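(* Let $T>0$, $\alpha > 0$ and let $S \subset L^2((0,2T) \times \partial M)$ be a closed subspace. Denote by $P : L^2((0,2T) \times \partial M) \to S$ the orthogonal projection. Then the regularized minimization problem $$\operatorname*{arg\,min}_{f \in S} \left( (f, K f) - 2 (I f, 1) + \alpha \|f\|^2 \right)$$ has a unique minimizer $f_\alpha \in S$, and $f_\alpha$ is the unique $f \in S$ solving $$(PKP + \alpha) f = P I^+ 1,$$ where $I^+$ is the adjoint of $I$ in $L^2((0,2T) \times \partial M)$. Moreover, $PKP + \alpha$ is positive definite on $S$.
   Context: $(M,g)$ is a $C^\infty$-smooth, compact and connected Riemannian manifold of dimension $n \ge 2$ with nonempty boundary $\partial M$, and $\mu$ is a $C^\infty$-smooth strictly positive function on $M$. For a source $f$ on $(0,\infty)\times\partial M$, $u^f$ denotes the solution of $$\partial_t^2 u + a(x,D_x) u = 0 \text{ in } (0,\infty)\times M,\quad u|_{t=0} = \partial_t u|_{t=0} = 0,\quad b(x,D_x) u = f \text{ on } (0,\infty) \times \partial M,$$ where in local coordinates $$a(x,D_x) u = -\sum_{j,k=1}^n \mu^{-1}|g|^{-1/2} \frac{\partial}{\partial x^j}\left( \mu |g|^{1/2} g^{jk} \frac{\partial u}{\partial x^k}\right),\qquad b(x,D_x)u = \sum_{j,k=1}^n \mu g^{jk}\nu_k \frac{\partial u}{\partial x^j},$$ with $(g^{jk})$ the inverse of $g$, $|g|$ its determinant, and $\nu$ the exterior co-normal of $\partial M$ normalized by $\sum g^{jk}\nu_j\nu_k = 1$. Functions are real valued. The solution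 is extended to $f \in L^2((0,2T)\times\partial M)$ (for times in $(0,2T)$) by continuity. The Neumann-to-Dirichlet operator is $\Lambda_{2T} : f \mapsto u^f|_{(0,2T)\times\partial M}$. Here $(\cdot,\cdot)$ and $\|\cdot\|$ are the inner product and norm of $L^2((0,2T)\times\partial M; dt\otimes dS_g)$, with $dS_g$ the Riemannian volume measure of $(\partial M, g|_{\partial M})$; $1$ is the constant function. Let $L = \{(t,s)\in\mathbb R^2 : t+s\le 2T,\ s>t>0\}$ and, acting in the time variable, $$Jf(t) = \tfrac12\int_0^{2T} 1_L(t,s) f(s)\,ds,\quad Rf(t) = f(2T-t),\quad K = J\Lambda_{2T} - R\Lambda_{2T}RJ,\quad If(t) = 1_{(0,T)}(t)\int_0^t f(s)\,ds,$$ where $1_A$ is the indicator function of a set $A$. *)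

(* Defs.v *)
From HB Require Import structures.
From mathcomp Require Import all_boot all_order all_algebra.
From mathcomp Require Import all_classical all_reals all_analysis.

Set Implicit Arguments.
Unset Strict Implicit.
Unset Printing Implicit Defensive.

Import Order.TTheory GRing.Theory Num.Theory.
Import numFieldNormedType.Exports.

Local Open Scope classical_set_scope.
Local Open Scope ring_scope.

Section Smooth.
Context {R : realType} {V : normedModType R}.
Implicit Types (U A : set V) (F f : V -> R).

Fixpoint Ck (k : nat) U F : Prop :=
  match k with
  | 0 => forall x, U x -> {for x, continuous F}
  | k'.+1 => (forall x, U x -> {for x, continuous F}) /\
      (forall v : V, (forall x, U x -> derivable F x v) /\ Ck k' U ('D_v F))
  end.

(* C^infinity on an arbitrary set [A], in the sense used for manifolds with
   boundary: locally the restriction of a C^infinity function of an open set. *)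
Definition smooth_on A f : Prop :=
  forall x, A x -> exists (U : set V) (F : V -> R),
    [/\ open U, U x, (forall k, Ck k U F) &
        forall y, U y -> A y -> F y = f y].

(* Right-hand directional derivative: the difference quotients only use the
   points [x + h *: v] with [h > 0].  For a function which is smooth on a
   relatively open subset of a half space and [v] a coordinate vector, it is the
   usual partial derivative, including at the points of the boundary
   hyperplane (where [x + h *: v] remains in the half space). *)
Definition rderive f (x v : V) : R :=
  lim ((h^-1 * (f (x + h *: v) - f x)) @[h --> 0^'+]).

End Smooth.

Definition partial {R : realType} {n : nat} (j : 'I_n) (f : 'rV[R]_n -> R)
    (x : 'rV[R]_n) : R := rderive f x (delta_mx ord0 j).

(* Manifolds have dimension n.+1 and are modelled on the half space
   {x | 0 <= x_0}; the boundary has dimension n. *)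
Section Manifold.
Context {R : realType} {n : nat} {M : topologicalType}.

Record chart := Chart {
  dom : set M;
  chart_map : M -> 'rV[R]_n.+1;
  param : 'rV[R]_n.+1 -> M }.

Definition half_space : set 'rV[R]_n.+1 := [set x | 0 <= x ord0 ord0].

Definition chart_image (c : chart) : set 'rV[R]_n.+1 := chart_map c @` dom c.

Record is_chart (c : chart) : Prop := {
  chart_open : open (dom c);
  chart_image_open :
    exists2 W : set 'rV[R]_n.+1, open W & chart_image c = W `&` half_space;
  chartK : forall p, dom c p -> param c (chart_map c p) = p;
  chart_coord_cont : forall p, dom c p -> {for p, continuous (chart_map c)};
  chart_param_cont : {within chart_image c, continuous (param c)} }.

Variables (I : Type) (A : I -> chart).

Definition overlap (i j : I) : set 'rV[R]_n.+1 :=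
  chart_map (A i) @` (dom (A i) `&` dom (A j)).

Definition transition (i j : I) (k : 'I_n.+1) (x : 'rV[R]_n.+1) : R :=
  chart_map (A j) (param (A i) x) ord0 k.

Record is_manifold : Prop := {
  manifold_hausdorff : hausdorff_space M;
  manifold_countable : @second_countable M;
  manifold_chart : forall i, is_chart (A i);
  manifold_cover : forall p, exists i, dom (A i) p;
  manifold_transition :
    forall i j k, smooth_on (overlap i j) (transition i j k) }.

Definition boundary : set M :=
  [set p | exists i, dom (A i) p /\ chart_map (A i) p ord0 ord0 = 0].

Definition smooth_function (w : M -> R) : Prop :=
  forall i, smooth_on (chart_image (A i)) (w \o param (A i)).

(* [g i x] is the matrix (g_jk) in the chart [A i] at the point of coordinates
   [x]; [riemannian_change] is the transformation law of a covariant 2-tensor. *)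
Variable g : I -> 'rV[R]_n.+1 -> 'M[R]_n.+1.

Record is_riemannian_metric : Prop := {
  riemannian_smooth : forall i j k,
    smooth_on (chart_image (A i)) (fun x => g i x j k);
  riemannian_sym : forall i x, chart_image (A i) x -> (g i x)^T = g i x;
  riemannian_pos : forall i x, chart_image (A i) x ->
    forall v : 'rV[R]_n.+1, v != 0 -> 0 < (v *m g i x *m v^T) ord0 ord0;
  riemannian_change : forall i j x, overlap i j x ->
    let J := \matrix_(a, b) partial b (transition i j a) x in
    g i x = J^T *m g j (chart_map (A j) (param (A i) x)) *m J }.

End Manifold.
Arguments chart R n M : clear implicits.

Notation borel M := (g_sigma_algebraType (@open M)).

Section BoundaryMeasure.
Context {R : realType} {n : nat} {M : ptopologicalType}.
Variables (I : Type) (A : I -> chart R n M).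
Variable g : I -> 'rV[R]_n.+1 -> 'M[R]_n.+1.

Local Notation leb := (@lebesgue_measure R).

(* Lebesgue integral over R^m of a nonnegative Borel function, as an iterated
   integral. *)
Fixpoint iint (m : nat) : ('rV[R]_m -> \bar R) -> \bar R :=
  match m with
  | 0 => fun F => F 0
  | m'.+1 => fun F =>
      (\int[leb]_t iint (fun y : 'rV[R]_m' => F (row_mx t%:M y)))%E
  end.

Definition bd_point (y : 'rV[R]_n) : 'rV[R]_n.+1 := row_mx (0 : 'rV_1) y.

Definition bd_metric (G : 'M[R]_n.+1) : 'M[R]_n := drsubmx (G : 'M[R]_(1 + n)).

(* The Riemannian volume measure of the boundary for the induced metric, seen as
   the Borel measure E |-> vol (E `&` boundary) of M. *)
Definition is_boundary_measure (dS : set (borel M) -> \bar R) : Prop :=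
  forall (i : I) (E : set (borel M)), measurable E -> E `<=` dom (A i) ->
    dS E = iint (fun y : 'rV[R]_n =>
      (\1_(chart_map (A i) @` E) (bd_point y)
         * Num.sqrt (\det (bd_metric (g i (bd_point y)))))%:E).

End BoundaryMeasure.

Section WaveEquation.
Context {R : realType} {n : nat} {M : ptopologicalType}.
Variables (I : Type) (A : I -> chart R n M).
Variable g : I -> 'rV[R]_n.+1 -> 'M[R]_n.+1.
Variable w : M -> R.

(* a(x, D_x) u in the chart [A i], at the point of coordinates [x]. *)
Definition a_op (i : I) (u : M -> R) (x : 'rV[R]_n.+1) : R :=
  let m := w \o param (A i) in
  let v := u \o param (A i) in
  let s y := Num.sqrt (\det (g i y)) in
  - \sum_(j < n.+1) \sum_(k < n.+1)
      (m x)^-1 * (s x)^-1 *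
      partial j (fun y => m y * s y * invmx (g i y) j k * partial k v y) x.

(* A covector at a boundary point of a chart: it annihilates the tangent vectors
   of the boundary, is negative on the inward vector e_0, and has length 1. *)
Definition exterior_conormal (i : I) (x : 'rV[R]_n.+1) (nu : 'rV[R]_n.+1) :=
  [/\ forall k, k != ord0 -> nu ord0 k = 0,
      nu ord0 ord0 < 0 &
      \sum_(j < n.+1) \sum_(k < n.+1)
        invmx (g i x) j k * nu ord0 j * nu ord0 k = 1].

Definition b_op (i : I) (nu : 'rV[R]_n.+1) (u : M -> R) (x : 'rV[R]_n.+1) : R :=
  \sum_(j < n.+1) \sum_(k < n.+1)
    w (param (A i) x) * invmx (g i x) j k * nu ord0 k *
    partial j (u \o param (A i)) x.

(* Elements of C_c^infinity((0, oo) x boundary), extended by zero to R x M. *)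
Definition smooth_source (f : R * M -> R) : Prop :=
  (exists a b : R, 0 < a /\
     forall t p, f (t, p) != 0 -> a <= t <= b /\ boundary A p) /\
  (forall i, smooth_on
     [set z : R * 'rV[R]_n | chart_image (A i) (bd_point z.2)]
     (fun z => f (z.1, param (A i) (bd_point z.2)))).

(* Classical solutions; only the values of [u] for t >= 0 matter. *)
Record is_solution (f u : R * M -> R) : Prop := {
  sol_smooth : forall i, smooth_on
    [set z : R * 'rV[R]_n.+1 | 0 <= z.1 /\ chart_image (A i) z.2]
    (fun z => u (z.1, param (A i) z.2));
  sol_wave : forall i t x, 0 < t -> chart_image (A i) x ->
    derive1n 2 (fun s => u (s, param (A i) x)) t
      + a_op i (fun p => u (t, p)) x = 0;
  sol_init0 : forall p, u (0, p) = 0;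
  sol_init1 : forall p, rderive (fun t : R => u (t, p)) 0 1 = 0;
  sol_neumann : forall i t x nu, 0 < t -> chart_image (A i) x ->
    x ord0 ord0 = 0 -> exterior_conormal i x nu ->
    b_op i nu (fun p => u (t, p)) x = f (t, param (A i) x) }.

End WaveEquation.

(* Elements of L^2 are handled through representatives: [f \in Lfun mu 2%:E],
   with equality almost everywhere. *)
Section L2.
Context d (X : measurableType d) (R : realType).
Variable mu : {measure set X -> \bar R}.
Implicit Types (f h : X -> R) (B : (X -> R) -> (X -> R)).

Definition L2 : set (X -> R) := [set f | f \in Lfun mu 2%:E].

Definition ip f h : R := (\int[mu]_z (f z * h z))%R.

Definition L2norm f : R := fine ('N[mu]_2%:E[EFin \o f]).

(* Closed under a.e. equality by [subspace_closed]. *)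
Record closed_subspace (S : set (X -> R)) : Prop := {
  subspace_sub : S `<=` L2;
  subspace0 : S (cst 0);
  subspace_lin : forall (a : R) f h, S f -> S h -> S (a *: f + h);
  subspace_closed : forall (F : nat -> X -> R) f,
    (forall k, S (F k)) -> L2 f ->
    L2norm (F k - f) @[k --> \oo] --> (0 : R) -> S f }.

(* Bounded linear operators of L^2; they respect a.e. equality by [op_lin] and
   [op_bounded]. *)
Record bounded_operator B : Prop := {
  op_L2 : forall f, L2 f -> L2 (B f);
  op_lin : forall (a : R) f h, L2 f -> L2 h ->
    B (a *: f + h) = a *: B f + B h %[ae mu];
  op_bounded : exists C : R, forall f, L2 f -> L2norm (B f) <= C * L2norm f }.

Definition orthogonal_projection (S : set (X -> R)) B : Prop :=
  forall f, L2 f -> S (B f) /\ forall h, S h -> ip (f - B f) h = 0.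

Definition adjoint_operator B B' : Prop :=
  forall h, L2 h -> L2 (B' h) /\ forall f, L2 f -> ip (B f) h = ip f (B' h).

Definition positive_definite_on (S : set (X -> R)) B : Prop :=
  (forall f h, S f -> S h -> ip (B f) h = ip f (B h)) /\
  (forall f, S f -> ~ (f = cst 0 %[ae mu]) -> 0 < ip f (B f)).

End L2.

Section Control.
Context {R : realType} {M : ptopologicalType}.
Variable T : R.
Local Notation X := (measurableTypeR R * borel M)%type.
Implicit Types f : X -> R.
Local Notation leb := (@lebesgue_measure R).

(* dt (x) dS on (0, 2T) x boundary, as a measure on R x M. *)
Definition lateral_measure (dS : {finite_measure set (borel M) -> \bar R}) :
    {measure set X -> \bar R} :=
  (mrestr leb (measurable_itv `]0%R, (2 * T)%R[) \x dS)%E.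

Definition triangle : set (R * R) :=
  [set z | z.1 + z.2 <= 2 * T /\ 0 < z.1 < z.2].

Definition J_op f : X -> R := fun z =>
  2^-1 * (\int[leb]_(s in `]0%R, 2 * T[) (\1_triangle (z.1, s) * f (s, z.2)))%R.

Definition R_op f : X -> R := fun z => f (2 * T - z.1, z.2).

Definition I_op f : X -> R := fun z =>
  \1_(`]0, T[%classic : set R) z.1 * (\int[leb]_(s in `]0%R, z.1[) f (s, z.2))%R.

Definition K_op (Lam : (X -> R) -> (X -> R)) f : X -> R :=
  J_op (Lam f) - R_op (Lam (R_op (J_op f))).

End Control.

(* Lambda_{2T}: the extension by continuity to L^2((0, 2T) x boundary) of the map
   f |-> u^f restricted to (0, 2T) x boundary.  The existence of u^f for smooth
   sources is part of the definition. *)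
Definition is_ND_operator {R : realType} {n : nat} {M : ptopologicalType}
    (I : Type) (A : I -> chart R n M) (g : I -> 'rV[R]_n.+1 -> 'M[R]_n.+1)
    (w : M -> R) (mu : {measure set (measurableTypeR R * borel M) -> \bar R})
    (Lam : (measurableTypeR R * borel M -> R) ->
           (measurableTypeR R * borel M -> R)) : Prop :=
  bounded_operator mu Lam /\
  forall f, smooth_source A f ->
    exists2 u, is_solution A g w f u & Lam f = u %[ae mu].

(* Main.v *)
(* The energy is [f |-> (f, K f) - 2 (f, I^+ 1) + alpha |f|^2], so everything
   follows, by completing the square and a contraction argument in [S], once
   [K] is known to be bounded, symmetric and nonnegative.  For smooth sources
   [f], [h] with waves [u], [v], Green's formula on [M] turns
   [(u(s), h(t)) - (f(s), v(t))] on the boundary into the integral over [M] of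
   [u(s) v''(t) - u''(s) v(t)].  With [s = 2T - t], this is an exact time
   derivative with vanishing endpoint values, and integrating over [(0, 2T)]
   shows that [R Lambda] is symmetric.  Integrating instead over the triangle
   [L] gives Blagovestchenskii's identity: [(K f, h)] is the integral over [M]
   of [u(T) v(T)] for the weighted volume, which is visibly symmetric and
   nonnegative for [h = f].  Boundedness of [Lambda] and the density of the
   smooth sources in L^2 extend both facts to all of L^2. *)
Require Import Defs.
From HB Require Import structures.
From mathcomp Require Import all_boot all_order all_algebra.
From mathcomp Require Import all_classical all_reals all_analysis.
From mathcomp Require finmap.
From mathcomp Require Import perm measurable_realfun ring lra.

Set Implicit Arguments.
Unset Strict Implicit.
Unset Printing Implicit Defensive.

Import Order.TTheory GRing.Theory Num.Theory.
Import numFieldNormedType.Exports.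

Local Open Scope classical_set_scope.
Local Open Scope ring_scope.

(** * Regularized minimization in L^2 *)

(** Cutting the vector field [u grad v - v grad u] by a partition of unity gives, in each chart,
    Green's formula with an error that contains the differential of the cut-off. These errors cancel
    only after summation, and each lives in its own chart, so integrals have to be independent of
    the chart: this is what the change of variables formula is for. It is first an inequality
    between integrals of nonnegative functions, obtained by averaging over small cubes whose images
    are controlled by strict differentiability, uniformly up to the boundary; exchanging the two
    charts gives equality. The boundary measure is known only on Borel subsets of chart domains,
    hence the detour through simple functions. Elements of L^2 are representatives, operators are
    linear almost everywhere, and [P] is known by orthogonality only, so identities in [S] are
    proved by testing against [S]. In the identity over the triangle, the integrand becomes a time
    derivative only after a primitive in time of one of the waves is introduced. *)

Section L2_theory.
Context d (X : measurableType d) (R : realType).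
Variable mu : {measure set X -> \bar R}.
Implicit Types f g h : X -> R.
Local Notation L2 := (L2 mu).
Local Notation ip := (ip mu).
Local Notation L2norm := (L2norm mu).

Let le1_2 : (1 <= 2%:E :> \bar R)%E. Proof. by rewrite lee_fin ler1n. Qed.

Lemma L2_measurable f : L2 f -> measurable_fun setT f.
Proof. by rewrite /Defs.L2/= inE => /andP[/[!inE]]. Qed.

Lemma L2_lin (a : R) f h : L2 f -> L2 h -> L2 (a *: f + h).
Proof.
rewrite /Defs.L2/= => f2 h2.
by have := @Lfun_submod_closed _ _ _ mu 2%:E le1_2 => -[_]; apply.
Qed.

Lemma L2_0 : L2 (cst 0).
Proof.
rewrite /Defs.L2/=.
by have := @Lfun_submod_closed _ _ _ mu 2%:E le1_2 => -[].
Qed.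

Lemma L2Z (a : R) f : L2 f -> L2 (a *: f).
Proof. by move=> f2; rewrite -[_ *: _]addr0; apply: L2_lin => //; exact: L2_0. Qed.

Lemma L2D f h : L2 f -> L2 h -> L2 (f + h).
Proof. by move=> f2 h2; rewrite -[f]scale1r; apply: L2_lin. Qed.

Lemma L2N f : L2 f -> L2 (- f).
Proof. by move=> f2; rewrite -scaleN1r; apply: L2Z. Qed.

Lemma L2B f h : L2 f -> L2 h -> L2 (f - h).
Proof. by move=> f2 h2; apply: L2D => //; apply: L2N. Qed.

Lemma L2_integrableM f h : L2 f -> L2 h ->
  mu.-integrable setT (EFin \o (fun x => f x * h x)).
Proof. by move=> f2 h2; apply/Lfun1_integrable/Lfun2_mul_Lfun1. Qed.

Lemma L2P f : L2 f <->
  measurable_fun setT f /\ mu.-integrable setT (EFin \o (fun x => f x ^+ 2)).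
Proof.
split=> [f2|[mf if2]].
  by split; [exact: L2_measurable | exact: Lfun2_integrable_sqr].
rewrite /Defs.L2/= inE; apply/andP; split; rewrite inE//=.
rewrite /finite_norm unlock poweR_lty//.
move/integrableP: if2 => [_]; apply: le_lt_trans.
rewrite le_eqVlt; apply/orP; left; apply/eqP.
apply: eq_integral => x _ /=.
by rewrite ?poweR_EFin powR_mulrn// normrX.
Qed.

Lemma ipC f h : ip f h = ip h f.
Proof. by rewrite /Defs.ip; apply: eq_Rintegral => x _; rewrite mulrC. Qed.

Lemma ip_linl (a : R) f g h : L2 f -> L2 g -> L2 h ->
  ip (a *: f + g) h = a * ip f h + ip g h.
Proof.
move=> f2 g2 h2; rewrite /Defs.ip -RintegralZl//; last exact: L2_integrableM.
rewrite -RintegralD//; last 2 first.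
- have := L2_integrableM (L2Z a f2) h2.
  by apply: eq_integrable => // x _ /=; rewrite mulrA.
- exact: L2_integrableM.
by apply: eq_Rintegral => x _; rewrite mulrDl mulrA.
Qed.

Lemma ip_linr (a : R) f g h : L2 f -> L2 g -> L2 h ->
  ip h (a *: f + g) = a * ip h f + ip h g.
Proof. by move=> *; rewrite ipC ip_linl// ipC (ipC g). Qed.

Lemma ip0l h : ip (cst 0) h = 0.
Proof.
rewrite /Defs.ip (_ : (fun z => _) = cst 0); last first.
  by apply/funext => x /=; rewrite mul0r.
by rewrite Rintegral_cst// mul0r.
Qed.

Lemma ip0r h : ip h (cst 0) = 0. Proof. by rewrite ipC ip0l. Qed.

Lemma ipZl (a : R) f h : L2 f -> L2 h -> ip (a *: f) h = a * ip f h.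
Proof.
move=> f2 h2; rewrite -[_ *: _]addr0 (ip_linl a f2 L2_0 h2).
by rewrite (ip0l h : ip 0 h = 0) addr0.
Qed.

Lemma ipZr (a : R) f h : L2 f -> L2 h -> ip h (a *: f) = a * ip h f.
Proof. by move=> *; rewrite ipC ipZl// ipC. Qed.

Lemma ipDl f g h : L2 f -> L2 g -> L2 h -> ip (f + g) h = ip f h + ip g h.
Proof. by move=> *; rewrite -[f in LHS]scale1r ip_linl// mul1r. Qed.

Lemma ipNl f h : L2 f -> L2 h -> ip (- f) h = - ip f h.
Proof. by move=> *; rewrite -scaleN1r ipZl// mulN1r. Qed.

Lemma ipBl f g h : L2 f -> L2 g -> L2 h -> ip (f - g) h = ip f h - ip g h.
Proof. by move=> f2 g2 h2; rewrite ipDl ?ipNl//; exact: L2N. Qed.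

Lemma ipBr f g h : L2 f -> L2 g -> L2 h -> ip h (f - g) = ip h f - ip h g.
Proof. by move=> *; rewrite ipC ipBl// ipC (ipC g). Qed.

Lemma ip_ge0 f : 0 <= ip f f.
Proof. by apply: Rintegral_ge0 => x _; rewrite -expr2 sqr_ge0. Qed.

Lemma eq_ip f f' h h' : measurable_fun setT f -> measurable_fun setT f' ->
  measurable_fun setT h -> measurable_fun setT h' ->
  f = f' %[ae mu] -> h = h' %[ae mu] -> ip f h = ip f' h'.
Proof.
move=> mf mf' mh mh' ff' hh'; congr fine; apply: ae_eq_integral => //.
- by apply/measurable_EFinP; exact: measurable_funM.
- by apply/measurable_EFinP; exact: measurable_funM.
by move: ff' hh'; apply: filterS2 => x /= /(_ I) -> /(_ I) ->.
Qed.

Lemma eq_ip2 f f' h h' : L2 f -> L2 f' -> L2 h -> L2 h' ->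
  f = f' %[ae mu] -> h = h' %[ae mu] -> ip f h = ip f' h'.
Proof. by move=> *; apply: eq_ip => //; exact: L2_measurable. Qed.

Lemma L2norm_ge0 f : 0 <= L2norm f.
Proof. by rewrite fine_ge0// Lnorm_ge0. Qed.

Lemma L2norm_sqr f : L2 f -> L2norm f ^+ 2 = ip f f.
Proof.
move=> f2; rewrite /Defs.L2norm /Defs.ip /Rintegral.
have E : (\int[mu]_x (`|(EFin \o f) x| `^ 2) = \int[mu]_x (f x * f x)%:E)%E.
  apply: eq_integral => x _ /=.
  by rewrite ?poweR_EFin powR_mulrn// real_normK ?num_real// expr2.
have fin : (\int[mu]_x (f x * f x)%:E \is a fin_num)%E.
  exact: integrable_fin_num (L2_integrableM f2 f2).
rewrite unlock /Lnorm E -[X in (X `^ _)%E](fineK fin) poweR_EFin/=.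
rewrite -powR_mulrn ?powR_ge0// -powRrM mulVf// powRr1//.
by rewrite fine_ge0// integral_ge0// => x _; rewrite lee_fin -expr2 sqr_ge0.
Qed.

Lemma L2norm_le f (c : R) : L2 f -> 0 <= c -> ip f f <= c ^+ 2 -> L2norm f <= c.
Proof.
move=> f2 c0; rewrite -L2norm_sqr// ler_sqr ?nnegrE//; exact: L2norm_ge0.
Qed.

Lemma L2normZ (a : R) f : L2 f -> L2norm (a *: f) = `|a| * L2norm f.
Proof.
move=> f2; apply/eqP.
rewrite -(@eqrXn2 _ 2)//; last 2 first.
- exact: L2norm_ge0.
- by rewrite mulr_ge0//; exact: L2norm_ge0.
rewrite exprMn !L2norm_sqr//; last exact: L2Z.
by rewrite ipZl ?ipZr//; [rewrite mulrA -expr2 real_normK ?num_real|exact: L2Z].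
Qed.

Lemma L2normN f : L2 f -> L2norm (- f) = L2norm f.
Proof. by move=> f2; rewrite -scaleN1r L2normZ// normrN1 mul1r. Qed.

Lemma L2normD f h : L2 f -> L2 h -> L2norm (f + h) <= L2norm f + L2norm h.
Proof.
move=> f2 h2.
rewrite /Defs.L2 /= in f2 h2.
exact: (@ler_LnormD _ _ _ mu 2%:E le1_2
  (Lfun_Sub le1_2 f2) (Lfun_Sub le1_2 h2)).
Qed.

Lemma L2normB f h : L2 f -> L2 h -> L2norm (f - h) <= L2norm f + L2norm h.
Proof. by move=> f2 h2; rewrite -(L2normN h2); apply: L2normD => //; apply: L2N. Qed.

Lemma L2norm0 : L2norm (cst 0) = 0.
Proof.
by apply/eqP; rewrite -sqrf_eq0 L2norm_sqr ?ip0l//; exact: L2_0.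
Qed.

Lemma L2norm_eq0 f : L2 f -> L2norm f = 0 -> f = cst 0 %[ae mu].
Proof.
rewrite /Defs.L2 /= => f2 f0.
exact: (@fine_Lnormr_eq0 _ _ _ mu 2%:E le1_2 (Lfun_Sub le1_2 f2)).
Qed.

Lemma eq_L2norm f h : L2 f -> L2 h -> f = h %[ae mu] -> L2norm f = L2norm h.
Proof.
move=> f2 h2 fh; apply/eqP; rewrite -(@eqrXn2 _ 2)//; try exact: L2norm_ge0.
by rewrite !L2norm_sqr//; apply/eqP/eq_ip2.
Qed.

Lemma ip_eq0 f : L2 f -> ip f f = 0 -> f = cst 0 %[ae mu].
Proof.
move=> f2; rewrite -L2norm_sqr// => /eqP; rewrite sqrf_eq0 => /eqP.
exact: L2norm_eq0.
Qed.

Lemma aeq_refl f : f = f %[ae mu].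
Proof. by near=> x. Unshelve. all: by end_near. Qed.

Lemma ae_subr_eq0 f h : f - h = cst 0 %[ae mu] -> f = h %[ae mu].
Proof.
by apply: filterS => x /= /(_ I) /eqP; rewrite subr_eq0 => /eqP.
Qed.

Lemma L2norm_eq f h : L2 f -> L2 h -> L2norm (f - h) = 0 -> f = h %[ae mu].
Proof. by move=> f2 h2 /L2norm_eq0 => /(_ (L2B f2 h2)) /ae_subr_eq0. Qed.

(* Nonnegativity of [|b f - a h|^2] for [a = |f|], [b = |h|]. *)
Lemma cauchy_schwarz f h : L2 f -> L2 h -> `|ip f h| <= L2norm f * L2norm h.
Proof.
move=> f2 h2.
wlog : f f2 / 0 <= ip f h.
  move=> H; have [/H->//|] := leP 0 (ip f h).
  move=> /ltW; rewrite -oppr_ge0 -ipNl// => /(H _ (L2N f2)).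
  by rewrite L2normN// ipNl// normrN.
move=> fh0; rewrite ger0_norm//.
set a := L2norm f; set b := L2norm h.
have a0 : 0 <= a by exact: L2norm_ge0.
have b0 : 0 <= b by exact: L2norm_ge0.
have [a00|an0] := eqVneq a 0.
  suff -> : ip f h = 0 by rewrite mulr_ge0.
  by rewrite (eq_ip2 f2 L2_0 h2 h2 (L2norm_eq0 f2 a00) (aeq_refl _)) ip0l.
have [b00|bn0] := eqVneq b 0.
  suff -> : ip f h = 0 by rewrite mulr_ge0.
  by rewrite (eq_ip2 f2 f2 h2 L2_0 (aeq_refl _) (L2norm_eq0 h2 b00)) ip0r.
have : 0 <= ip (b *: f - a *: h) (b *: f - a *: h) by exact: ip_ge0.
have bf2 := L2Z b f2; have ah2 := L2Z a h2.
rewrite ipBl ?ipBr ?ipZl ?ipZr//; last exact: L2B.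
rewrite -!L2norm_sqr// (ipC h f) -/a -/b => H.
have {}H : 0 <= 2 * (a * b) * (a * b - ip f h) by apply: (le_trans H); lra.
have ab0 : 0 < 2 * (a * b) by rewrite !mulr_gt0// lt_neqAle eq_sym ?an0 ?bn0.
by move: H; rewrite pmulr_rge0// subr_ge0.
Qed.

End L2_theory.

(** * Bounded operators up to null sets *)

Section operators.
Context d (X : measurableType d) (R : realType).
Variable mu : {measure set X -> \bar R}.
Implicit Types f g h : X -> R.
Local Notation L2 := (L2 mu).
Local Notation ip := (ip mu).
Local Notation L2norm := (L2norm mu).

(** The null function [-1 *: h + f] is mapped to a function of norm at most [C * 0], and linearity,
    valid almost everywhere, splits its image. *)
Lemma bounded_operator_ae B f h : bounded_operator mu B -> L2 f -> L2 h ->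
  f = h %[ae mu] -> B f = B h %[ae mu].
Proof.
move=> [B2 Blin [C BC]] f2 h2 fh.
have e2 : L2 (-1 *: h + f) by exact: L2_lin.
have e0 : L2norm (-1 *: h + f) = 0.
  rewrite -(L2norm0 mu); apply: eq_L2norm => //; first exact: L2_0.
  by move: fh; apply: filterS => x /= /(_ I) fhx _; rewrite fctE/= fhx scaleN1r addNr.
have : L2norm (B (-1 *: h + f)) = 0.
  apply/eqP; rewrite eq_le L2norm_ge0 andbT (le_trans (BC _ e2))//.
  by rewrite e0 mulr0.
move/(L2norm_eq0 (B2 _ e2)) => z0.
have := Blin (-1) h f h2 f2.
move: z0; apply: filterS2 => x /= /(_ I) -> /(_ I) + _.
by rewrite fctE/= scaleN1r addrC => /esym/eqP; rewrite subr_eq0 => /eqP.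
Qed.

Lemma bounded_operator_bound B : bounded_operator mu B ->
  exists2 C : R, 0 <= C & forall f, L2 f -> L2norm (B f) <= C * L2norm f.
Proof.
move=> [_ _ [C BC]]; exists `|C| => // f f2.
by rewrite (le_trans (BC _ f2))// ler_wpM2r ?L2norm_ge0 ?ler_norm.
Qed.

Lemma bounded_operator_comp B B' : bounded_operator mu B ->
  bounded_operator mu B' -> bounded_operator mu (B \o B').
Proof.
move=> bB bB'; have [C C0 BC] := bounded_operator_bound bB.
have [C' C'0 BC'] := bounded_operator_bound bB'; split.
- by move=> f f2; apply: (op_L2 bB); apply: (op_L2 bB').
- move=> a f h f2 h2 /=.
  have B'f2 := op_L2 bB' f2; have B'h2 := op_L2 bB' h2.
  apply: ae_eq_trans (op_lin bB a B'f2 B'h2).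
  apply: bounded_operator_ae => //; last exact: (op_lin bB').
    by apply: (op_L2 bB'); exact: L2_lin.
  exact: L2_lin.
- exists (C * C') => f f2 /=; rewrite (le_trans (BC _ (op_L2 bB' f2)))//.
  by rewrite -mulrA ler_wpM2l// BC'.
Qed.

Lemma bounded_operatorB B B' : bounded_operator mu B ->
  bounded_operator mu B' -> bounded_operator mu (fun f => B f - B' f).
Proof.
move=> bB bB'; have [C C0 BC] := bounded_operator_bound bB.
have [C' C'0 BC'] := bounded_operator_bound bB'; split.
- by move=> f f2; apply: L2B; [apply: (op_L2 bB)|apply: (op_L2 bB')].
- move=> a f h f2 h2.
  have := op_lin bB a f2 h2; have := op_lin bB' a f2 h2.
  apply: filterS2 => x /= /(_ I) + /(_ I) + _.
  rewrite !fctE/= => -> ->.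
  by rewrite scalerBr opprD !addrA; congr (_ + _); rewrite addrAC.
- exists (C + C') => f f2 /=.
  rewrite (le_trans (L2normB (op_L2 bB f2) (op_L2 bB' f2)))// mulrDl lerD//.
    exact: BC.
  exact: BC'.
Qed.

End operators.

(** * Lower limits in the extended reals *)

Section limn_einf.
Context {R : realType}.
Local Open Scope ereal_scope.

Lemma limn_einf_ub (u : (\bar R)^nat) (c : \bar R) :
  (\forall k \near \oo, u k <= c) -> limn_einf u <= c.
Proof.
move=> [k0 _ uc]; rewrite limn_einf_lim; apply: lime_le; first exact: is_cvg_einfs.
apply: nearW => n; apply: (@le_trans _ _ (u (maxn n k0))).
  by apply: ereal_inf_lbound; exists (maxn n k0) => //=; exact: leq_maxl.
by apply: uc => /=; exact: leq_maxr.
Qed.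

Lemma limn_einf_lb (u : (\bar R)^nat) (c : \bar R) :
  (\forall k \near \oo, c <= u k) -> c <= limn_einf u.
Proof.
move=> [k0 _ uc]; rewrite limn_einf_lim; apply: lime_ge; first exact: is_cvg_einfs.
exists k0 => // n /= k0n; apply: le_ereal_inf_tmp => _ [m /= nm <-].
by apply: uc => /=; exact: leq_trans nm.
Qed.

Lemma measurable_fun_limn_einf d (T : measurableType d) (D : set T)
    (f : (T -> \bar R)^nat) : (forall n, measurable_fun D (f n)) ->
  measurable_fun D (fun x => limn_einf (f ^~ x)).
Proof.
move=> mf; apply: measurableT_comp => //.
by apply: measurable_fun_limn_esup => n; exact: measurableT_comp.
Qed.

End limn_einf.

(** * Completeness of L^2 for sequences with geometric increments *)

Section completeness.
Context d (X : measurableType d) (R : realType).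
Variable mu : {measure set X -> \bar R}.
Hypothesis mu_fin : (mu setT < +oo)%E.
Implicit Types f g h : X -> R.
Local Notation L2 := (L2 mu).
Local Notation ip := (ip mu).
Local Notation L2norm := (L2norm mu).

Lemma L2_cst (c : R) : L2 (cst c).
Proof.
apply/L2P; split; first exact: measurable_cst.
rewrite (_ : EFin \o _ = cst (c ^+ 2)%:E)//.
apply/integrableP; split => //=; rewrite (integral_cst mu measurableT `|(c ^+ 2)%:E|%E).
by apply: lte_mul_pinfty.
Qed.

(** Cauchy-Schwarz for [|f|] and the constant 1, which is in L^2 because the measure is finite. *)
Lemma L2_int_le f : L2 f ->
  (\int[mu]_x `|f x|%:E <= (L2norm f * L2norm (cst 1))%:E)%E.
Proof.
move=> f2; have nf2 : L2 (fun x => `|f x|).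
  apply/L2P; split; first by exact: (measurableT_comp (@normr_measurable _ _) (L2_measurable f2)).
  have /L2P[_] := f2; apply: eq_integrable => // x _ /=.
  by rewrite real_normK ?num_real.
have := cauchy_schwarz nf2 (L2_cst 1).
rewrite (_ : L2norm (fun x => `|f x|) = L2norm f); last first.
  apply/eqP; rewrite -(@eqrXn2 _ 2)// ?L2norm_ge0// !L2norm_sqr//.
  apply/eqP; apply: eq_Rintegral => x _.
  by rewrite -!expr2 real_normK ?num_real.
move=> /(le_trans (ler_norm _)); rewrite -lee_fin; apply: le_trans.
rewrite /Defs.ip /Rintegral fineK; last first.
  exact: integrable_fin_num (L2_integrableM nf2 (L2_cst 1)).
by under [leRHS]eq_integral do rewrite mulr1.
Qed.

(** Fatou's lemma for the squares. The bound is required only for large [k], so that the distance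
    from a limit to a fixed term of a Cauchy sequence can be estimated from the tail alone; this is
    the reason for the shift by [k0]. *)
Lemma L2_fatou (F : nat -> X -> R) f (c : R) : 0 <= c ->
  measurable_fun setT f -> (forall k, L2 (F k)) ->
  {ae mu, forall x, F k x @[k --> \oo] --> f x} ->
  (\forall k \near \oo, L2norm (F k) <= c) -> L2 f /\ L2norm f <= c.
Proof.
move=> c0 mf F2 Ff [k0 _ Fc].
have mF k : measurable_fun setT (F k) by exact: L2_measurable.
have H : (\int[mu]_x (f x ^+ 2)%:E <= (c ^+ 2)%:E)%E.
  have -> : (\int[mu]_x (f x ^+ 2)%:E =
      \int[mu]_x limn_einf (fun k => (F (k0 + k)%N x ^+ 2)%:E))%E.
    apply: ae_eq_integral => //.
    - by apply/measurable_EFinP; exact: measurable_funX.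
    - apply: measurable_fun_limn_einf => k.
      by apply/measurable_EFinP; exact: measurable_funX.
    move: Ff; apply: filterS => x Fx _.
    apply/esym; apply: (cvg_limn_einf_sup _).1.
    have {}Fx : F (k0 + k)%N x @[k --> \oo] --> f x.
      under eq_fun do rewrite addnC.
      by have := Fx; rewrite -(cvg_shiftn k0 (fun k => F k x)).
    apply: cvg_EFin; first by near=> k.
    rewrite /comp/= expr2; under eq_fun do rewrite expr2.
    by apply: cvgM.
  apply: (le_trans (fatou _ _ _ _)) => //.
  - by move=> k; apply/measurable_EFinP; exact: measurable_funX.
  - by move=> k x _; rewrite lee_fin sqr_ge0.
  apply: limn_einf_ub; apply: nearW => k /=.
  have Fk := F2 (k0 + k)%N.
  have -> : (\int[mu]_x (F (k0 + k)%N x ^+ 2)%:E)%E = (L2norm (F (k0 + k)%N) ^+ 2)%:E.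
    rewrite L2norm_sqr// fineK//.
    exact: integrable_fin_num (L2_integrableM Fk Fk).
  rewrite lee_fin ler_sqr ?nnegrE ?L2norm_ge0//.
  by apply: Fc => /=; exact: leq_addr.
have f2 : L2 f.
  apply/L2P; split => //; apply/integrableP; split.
    by apply/measurable_EFinP; exact: measurable_funX.
  apply: le_lt_trans (ltry (c ^+ 2)); apply: le_trans H.
  by under eq_integral do rewrite /= ger0_norm ?sqr_ge0//.
split => //; apply: L2norm_le => //.
rewrite -lee_fin fineK//; exact: integrable_fin_num (L2_integrableM f2 f2).
Unshelve. all: by end_near. Qed.

Lemma geometric_sum_le (C q : R) n m : 0 <= C -> 0 <= q < 1 -> (n <= m)%N ->
  \sum_(n <= k < m) C * q ^+ k <= C * q ^+ n / (1 - q).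
Proof.
move=> C0 /andP[q0 q1] nm.
have q1' : 0 < 1 - q by rewrite subr_gt0.
rewrite (@telescope_sumr_eq _ _ _ (fun k => - (C * q ^+ k / (1 - q))))//; last first.
  by move=> k _; rewrite exprS; field; rewrite gt_eqF.
by rewrite opprK gerDr oppr_le0 mulr_ge0 ?(mulr_ge0 C0) ?exprn_ge0 ?invr_ge0 ?(ltW q1').
Qed.

Lemma L2norm_telescope_le (F : nat -> X -> R) (b : nat -> R) n m :
  (forall k, L2 (F k)) -> (forall k, L2norm (F k.+1 - F k) <= b k) -> (n <= m)%N ->
  L2norm (F m - F n) <= \sum_(n <= k < m) b k.
Proof.
move=> F2 Fb /subnKC <-; elim: (m - n)%N => [|p IH].
  by rewrite addn0 subrr big_geq// L2norm0.
rewrite addnS big_nat_recr ?leq_addr//= addrC.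
rewrite -[F (n + p).+1](subrK (F (n + p)%N)) -addrA.
by rewrite (le_trans (L2normD _ _))// ?lerD//; exact: L2B.
Qed.

(** The increments have summable norms, so the sum of their absolute values is integrable, hence
    finite almost everywhere, and [F] converges at almost every point. Fatou's lemma then bounds the
    distance from the limit to each term. The geometric rate is that of a fixed point iteration. *)
Lemma L2_complete (F : nat -> X -> R) (C q : R) : 0 <= C -> 0 <= q < 1 ->
  (forall k, L2 (F k)) ->
  (forall k, L2norm (F k.+1 - F k) <= C * q ^+ k) ->
  exists2 f, L2 f & L2norm (F k - f) @[k --> \oo] --> (0 : R).
Proof.
move=> C0 q01 F2 Fq.
have mF k : measurable_fun setT (F k) by exact: L2_measurable.
pose G k x := (`|F k.+1 x - F k x|%:E)%E.
have mG k : measurable_fun setT (G k).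
  by apply/measurable_EFinP; apply: measurableT_comp => //; exact: measurable_funB.
have G0 k x : (0 <= G k x)%E by rewrite lee_fin.
have q1' : 0 < 1 - q by rewrite subr_gt0; case/andP: q01.
set D := C * q ^+ 0 / (1 - q) * L2norm (cst 1).
have sumG : (\int[mu]_x \sum_(0 <= k <oo) G k x <= D%:E)%E.
  rewrite integral_nneseries//; apply: lime_le.
    by apply: is_cvg_nneseries => k _ _; exact: integral_ge0.
  apply: nearW => n; apply: (@le_trans _ _ (\sum_(0 <= k < n) (C * q ^+ k * L2norm (cst 1))%:E)%E).
    apply: lee_sum => k _; apply: (le_trans (L2_int_le (L2B (F2 k.+1) (F2 k)))).
    by rewrite lee_fin ler_wpM2r ?L2norm_ge0.
  rewrite sumEFin lee_fin -mulr_suml ler_wpM2r ?L2norm_ge0//.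
  exact: geometric_sum_le.
have aeG : {ae mu, forall x, (\sum_(0 <= k <oo) G k x \is a fin_num)%E}.
  have : mu.-integrable setT (fun x => \sum_(0 <= k <oo) G k x)%E.
    apply/integrableP; split; first exact: ge0_emeasurable_sum.
    under eq_integral do rewrite gee0_abs ?nneseries_ge0//.
    exact: le_lt_trans sumG (ltry _).
  by move=> /(integrable_ae measurableT); apply: filterS => x /(_ I).
have aecvg : {ae mu, forall x, cvgn (fun k => F k x)}.
  move: aeG; apply: filterS => x Gx.
  have -> : (fun k => F k x) = (fun n => F 0%N x + series (telescope (fun k => F k x)) n).
    by apply/funext => n; rewrite -eq_sum_telescope.
  apply: is_cvgD; first exact: is_cvg_cst.
  apply: normed_cvg; apply: nondecreasing_is_cvgn.
    by apply: nondecreasing_series => k _ _ /=.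
  exists (fine (\sum_(0 <= k <oo) G k x)) => _ [n _ <-].
  rewrite -lee_fin fineK// -sumEFin.
  by apply: nneseries_lim_ge => k _ _; exact: G0.
(* An upper limit is defined and measurable everywhere; it is the limit at almost every point. *)
pose f x := fine (limn_esup (fun k => (F k x)%:E)).
have mf : measurable_fun setT f.
  apply: measurableT_comp => //; apply: measurable_fun_limn_esup => k.
  exact/measurable_EFinP.
have Ff : {ae mu, forall x, F k x @[k --> \oo] --> f x}.
  move: aecvg; apply: filterS => x /cvg_ex[l Fl].
  have Fl' : (F k x)%:E @[k --> \oo] --> l%:E by apply: cvg_EFin Fl; near=> k.
  rewrite /f (cvg_limn_einf_sup Fl').2.
  exact: Fl.
have key k : L2 (f - F k) /\ L2norm (f - F k) <= C * q ^+ k / (1 - q).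
  apply: (L2_fatou (F := fun m => F m - F k)).
  - by case/andP: q01 => q0 q1; rewrite mulr_ge0 ?(mulr_ge0 C0) ?exprn_ge0 ?invr_ge0 ?(ltW q1').
  - exact: measurable_funB.
  - by move=> m; exact: L2B.
  - move: Ff; apply: filterS => x Fx.
    by apply: cvgB; [exact: Fx|exact: cvg_cst].
  near=> m; apply: (le_trans (L2norm_telescope_le F2 Fq _)).
    by near: m; exact: nbhs_infty_ge.
  by apply: geometric_sum_le => //; near: m; exact: nbhs_infty_ge.
have f2 : L2 f by rewrite -[f](subrK (F 0%N)); apply: L2D => //; case: (key 0%N).
exists f => //.
apply: (@squeeze_cvgr _ _ _ _ (cst 0) (fun k => C * q ^+ k / (1 - q))).
- near=> k; rewrite L2norm_ge0/=.
  by rewrite -opprB L2normN; [case: (key k)|exact: L2B].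
- exact: cvg_cst.
have -> : (0 : R) = 0 / (1 - q) by rewrite mul0r.
apply: cvgM; last exact: cvg_cst.
by apply: cvg_geometric; case/andP: q01 => q0 q1; rewrite ger0_norm.
Unshelve. all: by end_near. Qed.

End completeness.

(** * The coercive equation and its variational form *)

Section regularized_minimization.
Context d (X : measurableType d) (R : realType).
Variable mu : {measure set X -> \bar R}.
Hypothesis mu_fin : (mu setT < +oo)%E.
Implicit Types f g h : X -> R.
Local Notation L2 := (L2 mu).
Local Notation ip := (ip mu).
Local Notation L2norm := (L2norm mu).
Variables (S : set (X -> R)) (P K : (X -> R) -> (X -> R)) (c : X -> R) (alpha : R).
Hypothesis S_closed : closed_subspace mu S.
Hypothesis P_proj : orthogonal_projection mu S P.
Hypothesis K_bounded : bounded_operator mu K.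
Hypothesis K_sym : forall f h, L2 f -> L2 h -> ip (K f) h = ip f (K h).
Hypothesis K_ge0 : forall f, L2 f -> 0 <= ip f (K f).
Hypothesis c2 : L2 c.
Hypothesis alpha_gt0 : 0 < alpha.

Local Notation B f := (P (K (P f)) + alpha *: f).

Let S2 f : S f -> L2 f. Proof. exact: (subspace_sub S_closed). Qed.
Let K2 f : L2 f -> L2 (K f). Proof. exact: op_L2. Qed.
Let PS f : L2 f -> S (P f). Proof. by move=> /P_proj[]. Qed.
Let P2 f : L2 f -> L2 (P f). Proof. by move/PS/S2. Qed.

Lemma ip_affine (s : R) f h : L2 f -> L2 h ->
  ip (s *: f + h) (s *: f + h) = s ^+ 2 * ip f f + 2 * s * ip f h + ip h h.
Proof.
move=> f2 h2; have fh2 := L2_lin s f2 h2.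
by rewrite ip_linl// !ip_linr// (ipC mu h f); ring.
Qed.

Lemma subspaceB f h : S f -> S h -> S (f - h).
Proof.
by move=> Sf Sh; rewrite addrC -scaleN1r; apply: (subspace_lin S_closed).
Qed.

Lemma ip_proj f h : L2 f -> S h -> ip (P f) h = ip f h.
Proof.
move=> f2 Sh; have [_ /(_ h Sh)] := P_proj f2.
by rewrite ipBl//; [move/eqP; rewrite subr_eq0 => /eqP|exact: P2|exact: S2].
Qed.

(** [P f - f] lies in [S] and is orthogonal to [S], hence to itself. *)
Lemma proj_id f : S f -> P f = f %[ae mu].
Proof.
move=> Sf; apply: ae_subr_eq0; apply: ip_eq0.
  by apply: L2B; [apply: P2|]; exact: S2.
have Se : S (P f - f) by apply: subspaceB => //; apply: PS; exact: S2.
by rewrite (ipBl (P2 (S2 Sf)) (S2 Sf) (S2 Se)) ip_proj ?subrr//; exact: S2.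
Qed.

Lemma S_reg f : S f -> S (B f).
Proof.
move=> Sf; rewrite /= addrC; apply: (subspace_lin S_closed) => //.
exact/PS/K2/P2/S2.
Qed.

(** Tested against [S], both projections disappear: the outer one by orthogonality, the inner one
    because [P f] and [f] agree almost everywhere. *)
Lemma ip_reg f h : S f -> S h -> ip (B f) h = ip (K f) h + alpha * ip f h.
Proof.
move=> Sf Sh; have f2 := S2 Sf; have h2 := S2 Sh.
have KP2 := K2 (P2 f2).
rewrite ipDl//; [|exact: P2|exact: L2Z].
rewrite ipZl// ip_proj//; congr (_ + _).
apply: (eq_ip2 KP2 (K2 f2) h2 h2 _ (aeq_refl _ _)).
by apply: bounded_operator_ae => //; [exact: P2|exact: proj_id].
Qed.

Lemma ip_reg_ge f : S f -> alpha * L2norm f ^+ 2 <= ip f (B f).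
Proof.
move=> Sf; rewrite ipC ip_reg// -L2norm_sqr; last exact: S2.
by rewrite lerDr K_sym ?K_ge0//; exact: S2.
Qed.

(** [P] is known only through orthogonality, so linearity is proved weakly: both sides have the same
    inner product with their difference, which lies in [S]. *)
Lemma reg_lin (a : R) f h : S f -> S h -> B (a *: f + h) = a *: B f + B h %[ae mu].
Proof.
move=> Sf Sh; have f2 := S2 Sf; have h2 := S2 Sh.
have Sl := subspace_lin S_closed a Sf Sh.
have SB := S_reg Sl; have SBf := S_reg Sf; have SBh := S_reg Sh.
have SR := subspace_lin S_closed a SBf SBh.
apply: ae_subr_eq0; apply: ip_eq0; first exact/S2/subspaceB.
have Se := subspaceB SB SR.
rewrite ipBl ?(ip_linl a); try exact: S2.
rewrite !ip_reg//.
have K2' : ip (K (a *: f + h)) (B (a *: f + h) - (a *: B f + B h)) =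
   ip (a *: K f + K h) (B (a *: f + h) - (a *: B f + B h)).
  apply: eq_ip2; try exact: aeq_refl.
  - exact/K2/S2.
  - by apply: L2_lin; apply: K2.
  - exact: S2.
  - exact: S2.
  - exact: op_lin.
rewrite K2' !(ip_linl a)//; try exact: K2; try exact: (S2 Se).
lra.
Qed.

(** [P] comes with no norm bound, so [B f] is tested against itself. The inequality [alpha <= C] is
    recorded because it makes [1 - alpha^2 / C^2], the square of the contraction factor below,
    nonnegative. *)
Lemma reg_bounded : exists2 C : R, alpha <= C &
  forall f, S f -> L2norm (B f) <= C * L2norm f.
Proof.
have [C C0 KC] := bounded_operator_bound K_bounded.
exists (C + alpha); first by rewrite lerDr.
move=> f Sf; have f2 := S2 Sf; have SB := S_reg Sf.
have [->|n0] := eqVneq (L2norm (B f)) 0.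
  by rewrite mulr_ge0 ?L2norm_ge0// addr_ge0// ltW.
have nB : 0 < L2norm (B f) by rewrite lt_neqAle eq_sym n0 L2norm_ge0.
rewrite -(ler_pM2r nB) -expr2 L2norm_sqr; last exact: S2.
rewrite ip_reg//.
have H1 := cauchy_schwarz (K2 f2) (S2 SB).
have H2 := cauchy_schwarz f2 (S2 SB).
rewrite mulrDl mulrDl lerD//.
  apply: (le_trans (ler_norm _)); apply: (le_trans H1).
  by rewrite ler_wpM2r ?L2norm_ge0// KC.
by rewrite -mulrA ler_pM2l// (le_trans (ler_norm _)).
Qed.

Lemma reg_solution : exists2 f, S f & B f = P c %[ae mu].
Proof.
have [C aC BC] := reg_bounded.
have C0 : 0 < C by exact: lt_le_trans aC.
(* This step length minimizes [1 - 2 th alpha + th^2 C^2], which bounds the squared contraction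
   factor of [Phi]; the minimum is [q2]. *)
pose th := alpha / C ^+ 2.
have th0 : 0 < th by rewrite divr_gt0// exprn_gt0.
pose q2 := 1 - alpha ^+ 2 / C ^+ 2.
have q2_lt1 : q2 < 1 by rewrite gtrBl divr_gt0// exprn_gt0.
have q2_ge0 : 0 <= q2.
  by rewrite subr_ge0 ler_pdivrMr ?exprn_gt0// mul1r ler_sqr ?nnegrE ?(ltW alpha_gt0)// ltW.
pose q := Num.sqrt q2.
have q0 : 0 <= q by exact: sqrtr_ge0.
have q1 : q < 1 by rewrite -(sqrtr1 R) ltr_sqrt.
pose Phi f := (- th) *: (B f - P c) + f.
have SPc := PS c2.
have SPhi f : S f -> S (Phi f).
  by move=> Sf; apply: (subspace_lin S_closed) => //; apply: subspaceB => //; exact: S_reg.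
have Phi_contr f h : S f -> S h -> L2norm (Phi f - Phi h) <= q * L2norm (f - h).
  move=> Sf Sh; have Se := subspaceB Sf Sh; have e2 := S2 Se.
  have SBe := S_reg Se; have Be2 := S2 SBe.
  have SBe' := subspaceB (S_reg Sf) (S_reg Sh).
  (* [B] is linear only almost everywhere, so the norms are compared and not the functions. *)
  have -> : L2norm (Phi f - Phi h) = L2norm ((- th) *: B (f - h) + (f - h)).
    apply: eq_L2norm; [exact/S2/subspaceB/SPhi/Sh/SPhi/Sf|exact: L2_lin|].
    have := reg_lin (-1) Sh Sf; apply: filterS => x /= /(_ I) + _.
    rewrite (_ : -1 *: h + f = f - h); last by rewrite scaleN1r addrC.
    rewrite /Phi !fctE /= => ->; rewrite /GRing.scale/=; ring.
  apply: L2norm_le; first exact: L2_lin.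
    by rewrite mulr_ge0// L2norm_ge0.
  rewrite exprMn sqr_sqrtr// L2norm_sqr//.
  rewrite (ip_affine (- th) Be2 e2).
  have H1 := ip_reg_ge Se.
  have H2 : ip (B (f - h)) (B (f - h)) <= C ^+ 2 * ip (f - h) (f - h).
    rewrite -!L2norm_sqr// -exprMn ler_sqr ?nnegrE ?L2norm_ge0 ?BC//.
    by rewrite mulr_ge0 ?L2norm_ge0// ltW.
  rewrite L2norm_sqr// in H1.
  have E : th * C ^+ 2 = alpha by rewrite /th divfK// gt_eqF// exprn_gt0.
  have E2 : q2 = 1 - th * alpha by rewrite /q2 /th; congr (_ - _); rewrite expr2; ring.
  rewrite (ipC mu (B _) (f - h)).
  move: (ip (B _) (B _)) (ip (f - h) (f - h)) (ip (f - h) (B _)) H1 H2 => u v z H1 H2.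
  have H3 : th * (th * u) <= th * (alpha * v).
    by rewrite ler_pM2l// -E -mulrA ler_pM2l.
  have H4 : th * (alpha * v) <= th * z by rewrite ler_pM2l.
  by rewrite E2; lra.
pose F k := iter k Phi (cst 0).
have FE k : F k.+1 = Phi (F k) by [].
have SF k : S (F k).
  by elim: k => [|k IH] /=; [exact: (subspace0 S_closed)|exact: SPhi].
have FC k : L2norm (F k.+1 - F k) <= L2norm (F 1%N - F 0%N) * q ^+ k.
  elim: k => [|k IH]; first by rewrite expr0 mulr1.
  have := Phi_contr _ _ (SF k.+1) (SF k); rewrite -!FE => /le_trans; apply.
  by rewrite exprS mulrCA ler_wpM2l.
have [f f2 Ff] : exists2 f, L2 f & L2norm (F k - f) @[k --> \oo] --> (0 : R).
  apply: (L2_complete mu_fin _ _ _ FC); first exact: L2norm_ge0.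
    by rewrite q0.
  by move=> k; exact: S2.
have Sf : S f by exact: (subspace_closed S_closed SF).
exists f => //.
(* The iterate [F k.+1 = Phi (F k)] is inserted between [Phi f] and [f]; both distances tend to
   0. *)
have fix_f : L2norm (Phi f - f) = 0.
  apply/eqP; rewrite eq_le L2norm_ge0 andbT.
  have H : L2norm (F k.+1 - f) + L2norm (F k - f) @[k --> \oo] --> (0 : R).
    rewrite -[0 in X in _ --> X]addr0; apply: cvgD => //.
    by have := Ff; rewrite -(cvg_shiftS (fun k => L2norm (F k - f))).
  have <- := cvg_lim (@Rhausdorff R) H.
  apply: limr_ge; first by apply/cvg_ex; exists 0.
  apply: nearW => k.
  have -> : Phi f - f = - (Phi (F k) - Phi f) + (F k.+1 - f).
    by rewrite opprB addrA FE subrK.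
  have SPf := subspaceB (SPhi _ (SF k)) (SPhi _ Sf).
  have d2 := S2 (subspaceB (SF k.+1) Sf).
  apply: (le_trans (L2normD (L2N (S2 SPf)) d2)); rewrite addrC lerD2l.
  rewrite L2normN; last exact: S2.
  apply: (le_trans (Phi_contr _ _ (SF k) Sf)).
  by rewrite ler_piMl ?L2norm_ge0// ltW.
have := L2norm_eq0 (S2 (subspaceB (SPhi _ Sf) Sf)) fix_f.
apply: filterS => x /= /(_ I) + _; rewrite /Phi !fctE/= addrK => /eqP.
by rewrite scaler_eq0 oppr_eq0 gt_eqF//= subr_eq0 => /eqP.
Qed.

Lemma reg_unique f h : S f -> S h -> B f = B h %[ae mu] -> f = h %[ae mu].
Proof.
move=> Sf Sh fh; have Se := subspaceB Sf Sh; have e2 := S2 Se.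
apply: L2norm_eq; try exact: S2.
have B0 : B (f - h) = cst 0 %[ae mu].
  have := reg_lin (-1) Sh Sf; move: fh; apply: filterS2 => x /= /(_ I) + /(_ I) + _.
  rewrite (_ : -1 *: h + f = f - h); last by rewrite scaleN1r addrC.
  by rewrite !fctE /= => -> ->; rewrite scaleN1r addNr.
have := ip_reg_ge Se.
rewrite (eq_ip2 e2 e2 (S2 (S_reg Se)) (L2_0 mu) (aeq_refl _ _) B0) ip0r.
rewrite pmulr_rle0// => H; apply/eqP; rewrite -sqrf_eq0.
by rewrite eq_le H sqr_ge0.
Qed.

Variable ell : (X -> R) -> R.
Hypothesis ellE : forall f, L2 f -> ell f = ip f c.

(** The linear term is a separate function [ell] because the energy is written with (I f, 1), which
    is known to be (f, I^+ 1) for [f] in L^2 only. *)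
Lemma regularized_minimizer :
  let energy f := ip f (K f) - 2 * ell f + alpha * L2norm f ^+ 2 in
  let minimizer f := S f /\ forall h, S h -> energy f <= energy h in
  [/\ exists f_alpha,
        [/\ minimizer f_alpha,
            forall f, minimizer f -> f = f_alpha %[ae mu],
            B f_alpha = P c %[ae mu] &
            forall f, S f -> B f = P c %[ae mu] -> f = f_alpha %[ae mu]] &
      positive_definite_on mu S (fun f => B f)].
Proof.
move=> energy minimizer; split; last first.
  split=> [f h Sf Sh|f Sf f0].
    have f2 := S2 Sf; have h2 := S2 Sh.
    rewrite (ipC mu f (B h)) !ip_reg// K_sym// (ipC mu f (K h)).
    by rewrite (ipC mu f h).
  apply: lt_le_trans (ip_reg_ge Sf).
  rewrite pmulr_rgt0// exprn_gt0// lt_neqAle L2norm_ge0 andbT.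
  by apply/eqP => /esym/(L2norm_eq0 (S2 Sf)).
have [f0 Sf0 Bf0] := reg_solution.
have f02 := S2 Sf0.
(* Completing the square. *)
have energyE f : S f -> energy f = energy f0 + ip (f - f0) (B (f - f0)).
  move=> Sf; have f2 := S2 Sf; have Se := subspaceB Sf Sf0; have e2 := S2 Se.
  have Eenergy h : S h -> energy h = ip h (B h) - 2 * ip h (B f0).
    move=> Sh; have h2 := S2 Sh.
    have -> : ip h (B f0) = ell h.
      rewrite ellE// (eq_ip2 h2 h2 (S2 (S_reg Sf0)) (P2 c2) (aeq_refl _ _) Bf0).
      by rewrite ipC ip_proj// ipC.
    rewrite (ipC mu h (B h)) ip_reg// /energy L2norm_sqr// (ipC mu (K h)); lra.
  have BE : B (f - f0) = B f - B f0 %[ae mu].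
    have := reg_lin (-1) Sf0 Sf; apply: filterS => x /= /(_ I) + _.
    rewrite (_ : -1 *: f0 + f = f - f0); last by rewrite scaleN1r addrC.
    by rewrite !fctE /= => ->; rewrite scaleN1r addrC.
  have BB2 := S2 (subspaceB (S_reg Sf) (S_reg Sf0)).
  rewrite (eq_ip2 e2 e2 (S2 (S_reg Se)) BB2 (aeq_refl _ _) BE).
  have Bf2 := S2 (S_reg Sf); have Bf02 := S2 (S_reg Sf0).
  rewrite !Eenergy// ipBl// !ipBr//.
  have -> : ip f0 (B f) = ip f (B f0).
    rewrite (ipC mu f0 (B f)) (ipC mu f (B f0)) !ip_reg// K_sym//.
    by rewrite (ipC mu f (K f0)) (ipC mu f f0).
  lra.
exists f0; split.
- split => // h Sh; rewrite (energyE h)// lerDl.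
  apply: le_trans (ip_reg_ge (subspaceB Sh Sf0)).
  by rewrite mulr_ge0 ?sqr_ge0// ltW.
- move=> f [Sf /(_ _ Sf0)]; rewrite (energyE f)// gerDl.
  move=> /(le_trans (ip_reg_ge (subspaceB Sf Sf0))).
  rewrite pmulr_rle0// => H; apply: L2norm_eq; try exact: S2.
  by apply/eqP; rewrite -sqrf_eq0 eq_le H sqr_ge0.
- exact: Bf0.
- move=> f Sf Bf; apply: reg_unique => //.
  by apply: ae_eq_trans Bf _; apply: ae_eq_sym.
Qed.

End regularized_minimization.

(** * Borel sets, Lebesgue measure and change of variables *)

(** Balls of a pseudometric space need not be open, so the base consists of the interiors of balls
    with centres in [D] and radii 1/(k+1). *)
Lemma separable_second_countable (R : realType) (T : pseudoMetricType R)
    (D : set T) : countable D -> (forall x (e : R), 0 < e -> exists2 y, D y & ball x e y) ->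
  @second_countable T.
Proof.
move=> cD dD.
exists ((fun z : T * nat => (ball z.1 z.2.+1%:R^-1)°) @` (D `*` setT)); last split.
- apply: (card_le_trans (card_image_le _ _)); apply: countableX => //; exact: countableP.
- by move=> _ [[y k] _ <-]; exact: open_interior.
move=> x V /nbhs_ballP[_/posnumP[e] xV].
have [N] := @ltr_add_invr R 0%R (e%:num / 2) ltac:(by []); rewrite add0r => Ne.
have [y Dy xy] := dD x (N.+1%:R^-1 / 2) ltac:(by []).
exists (ball y N.+1%:R^-1)°.
  split; first by exists (y, N).
  apply/nbhs_ballP; exists (N.+1%:R^-1 / 2) => //= z xz.
  by apply: (ball_split (z := x)) => //; exact: ball_sym.
move=> z /interior_subset yz; apply: xV.
apply: (ball_split (z := y)).
  by apply: (le_ball _ xy); rewrite (le_trans _ (ltW Ne))// ler_pdivrMr// ler_peMr// ler1n.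
by apply: (le_ball _ yz); exact: ltW.
Qed.

Lemma second_countable_R (R : realType) : @second_countable R.
Proof.
apply: (@separable_second_countable _ _ (@ratr R @` setT)).
  by apply: (card_le_trans (card_image_le _ _)); exact: countableP.
move=> x e e0.
have [y [xy [q _ qy]]] := @dense_rat R (ball x e) (ex_intro _ x (ballxx x e0)) (ball_open x e).
by exists y => //; exists q.
Qed.

Lemma second_countable_rV (R : realType) n : @second_countable 'rV[R]_n.
Proof.
apply: (@separable_second_countable _ _ ((map_mx (@ratr R) : 'rV[rat]_n -> _) @` setT)).
  by apply: (card_le_trans (card_image_le _ _)); exact: countableP.
move=> x e e0.
have H (j : 'I_n) : {q : rat | ball (x ord0 j) e (ratr q)}.
  apply: cid.
  have [y [xy [q _ qy]]] := @dense_rat R (ball (x ord0 j) e)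
    (ex_intro _ _ (ballxx _ e0)) (ball_open _ e).
  by exists q; rewrite qy.
exists (\row_j ratr (projT1 (H j))).
  by exists (\row_j projT1 (H j)) => //; apply/rowP => j; rewrite !mxE.
split=> // i j; rewrite (ord1 i) mxE; exact: projT2 (H j).
Qed.

(** Two countable bases turn an open set of the product into a countable union of open rectangles;
    this puts it in the product sigma-algebra. *)
Lemma open_prod_bigcup (T1 T2 : topologicalType) (A : set (T1 * T2)) :
  @second_countable T1 -> @second_countable T2 -> open A ->
  exists U V, [/\ forall k : nat, open (U k : set T1), forall k, open (V k : set T2) &
    A = \bigcup_k (U k `*` V k)].
Proof.
move=> [B1 cB1 [oB1 bB1]] [B2 cB2 [oB2 bB2]] oA.
pose B := [set z : set T1 * set T2 | [/\ B1 z.1, B2 z.2 & z.1 `*` z.2 `<=` A]].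
have cB : countable B.
  apply: (@sub_countable _ _ _ (B1 `*` B2)); last exact: countableX.
  by apply: subset_card_le => z [].
have /pfcard_geP[B0|[f]] := cB.
  exists (fun=> set0), (fun=> set0); split; [by move=> _; exact: open0..|].
  rewrite bigcup_const//; apply/seteqP; split=> [[x y] Axy|[x y] [] //].
  have [[U V] [/= nU nV] UVA] := oA _ Axy.
  have [U' [BU' U'x] U'U] := bB1 _ _ nU; have [V' [BV' V'y] V'V] := bB2 _ _ nV.
  suff : B (U', V') by rewrite B0.
  by split => //= -[a b] [/= /U'U Ua /V'V Vb]; apply: UVA.
have Bf k : B (f k) by exact: (@funS _ _ setT B f k I).
exists (fun k => (f k).1), (fun k => (f k).2); split.
- by move=> k; apply: oB1; have [] := Bf k.
- by move=> k; apply: oB2; have [] := Bf k.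
apply/seteqP; split=> [[x y] Axy|[x y] [k _]]; last first.
  by move=> ?; have [_ _] := Bf k; apply.
have [[U V] [/= nU nV] UVA] := oA _ Axy.
have [U' [BU' U'x] U'U] := bB1 _ _ nU; have [V' [BV' V'y] V'V] := bB2 _ _ nV.
have BUV : B (U', V').
  by split => //= -[a b] [/= /U'U Ua /V'V Vb]; apply: UVA.
by have [k _ fk] := @surj _ _ setT B f _ BUV; exists k => //; rewrite fk.
Qed.

Lemma borel_open (M : ptopologicalType) (U : set M) :
  open U -> measurable (U : set (borel M)).
Proof. exact: sub_sigma_algebra. Qed.

Lemma measurable_fun_borel d (T : measurableType d) (M : ptopologicalType)
    (D : set T) (f : T -> borel M) :
  (forall U : set M, open U -> measurable (D `&` f @^-1` U)) -> measurable_fun D f.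
Proof.
move=> H; apply: (@measurability _ _ _ _ D f (@open M)) => //.
by move=> _ [U oU <-]; exact: H.
Qed.

Lemma measurable_fun_open_preimage d (T : measurableType d) (R : realType)
    (D : set T) (f : T -> R) :
  (forall U : set R, open U -> measurable (D `&` f @^-1` U)) -> measurable_fun D f.
Proof.
move=> H; apply: (measurability _ (RGenOpens.measurableE R)).
by move=> _ [_ [a [b ->] <-]]; apply: H; exact: interval_open.
Qed.

(** The maps [i1] and [i2] lead from the measurable carriers to the topological ones. They need not
    be continuous: [cv_le] uses a map that is only measurable. *)
Lemma open_measurable_prod d1 d2 (T1 : measurableType d1) (T2 : measurableType d2)
    (X1 : topologicalType) (X2 : topologicalType) (i1 : T1 -> X1) (i2 : T2 -> X2) :
  @second_countable X1 -> @second_countable X2 ->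
  (forall U, open U -> measurable (i1 @^-1` U)) ->
  (forall U, open U -> measurable (i2 @^-1` U)) ->
  forall A : set (X1 * X2), open A ->
  measurable [set z : T1 * T2 | A (i1 z.1, i2 z.2)].
Proof.
move=> c1 c2 m1 m2 A /(open_prod_bigcup c1 c2)[U [V [oU oV ->]]].
rewrite (_ : [set _ | _] = \bigcup_k ((i1 @^-1` U k) `*` (i2 @^-1` V k))).
  apply: bigcup_measurable => k _; apply: measurableX; [exact: m1|exact: m2].
by apply/seteqP; split=> -[x y] [k _ [/= ? ?]]; exists k.
Qed.

Lemma sigma_finite_product d1 d2 (T1 : measurableType d1) (T2 : measurableType d2)
    (R : realType) (m1 : {sigma_finite_measure set T1 -> \bar R})
    (m2 : {sigma_finite_measure set T2 -> \bar R}) : sigma_finite setT (m1 \x m2)%E.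
Proof.
have /sigma_finiteP[F [TF ndF Foo]] := sigma_finiteT m1.
have /sigma_finiteP[G [TG ndG Goo]] := sigma_finiteT m2.
exists (fun n => F n `*` G n).
 rewrite -setXTT TF TG predeqE => -[x y]; split.
    move=> [/= [n _ Fnx] [k _ Gky]]; exists (maxn n k) => //; split.
    - by move: x Fnx; exact/subsetPset/ndF/leq_maxl.
    - by move: y Gky; exact/subsetPset/ndG/leq_maxr.
  by move=> [n _ []/= ? ?]; split; exists n.
move=> k; have [? ?] := Foo k; have [? ?] := Goo k.
split; first exact: measurableX.
by rewrite product_measure1E// lte_mul_pinfty// ge0_fin_numE.
Qed.

(** * Lebesgue measure on row vectors *)

Section lebesgue_rV.
Context {R : realType}.
Local Notation leb := (@lebesgue_measure R).
Local Notation VT m := (borel 'rV[R]_m).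

Lemma row_mx_continuous m :
  continuous (fun z : R * 'rV[R]_m => row_mx z.1%:M z.2 : 'rV[R]_m.+1).
Proof.
move=> [t y] A /= /nbhs_ballP[e e0 eA]; apply/nbhs_ballP; exists e => // -[s z] [/= ts yz].
apply: eA; split => // i j; rewrite (ord1 i).
rewrite !mxE; case: splitP => k _; last exact: yz.2.
by rewrite !mxE (ord1 k) eqxx !mulr1n.
Qed.

Lemma row_mx_measurable m : measurable_fun setT
  (fun z : measurableTypeR R * VT m => row_mx z.1%:M z.2 : VT m.+1).
Proof.
apply: measurable_fun_borel => U oU; rewrite setTI.
have H := @open_measurable_prod _ _ (measurableTypeR R) (VT m) R 'rV[R]_m id id
  (second_countable_R R) (second_countable_rV R m) _ _
  ((fun z : R * 'rV[R]_m => row_mx z.1%:M z.2 : 'rV[R]_m.+1) @^-1` U).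
apply: H; [exact: open_measurable|exact: borel_open|].
by move: (U) oU; apply/continuousP/row_mx_continuous.
Qed.

Definition unrow m (x : VT m.+1) : measurableTypeR R * VT m :=
  ((x : 'rV[R]_m.+1) ord0 ord0, rsubmx (x : 'rV[R]_(1 + m))).

Lemma unrowK m (x : 'rV[R]_m.+1) :
  row_mx ((unrow x).1)%:M (unrow x).2 = x :> 'rV[R]_(1 + m).
Proof.
rewrite -[RHS](@hsubmxK _ 1 1 m); congr row_mx.
apply/rowP => i; rewrite !mxE !(ord1 i) eqxx mulr1n; congr (x _ _).
exact/val_inj.
Qed.

Lemma row_mxK m (t : R) (y : 'rV[R]_m) : unrow (row_mx t%:M y) = (t, y).
Proof.
rewrite /unrow row_mxKr; congr pair.
rewrite (_ : ord0 = lshift m (ord0 : 'I_1)); last exact/val_inj.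
by rewrite (row_mxEl t%:M y) mxE eqxx.
Qed.

Lemma rsubmx_continuous m : continuous (fun x : 'rV[R]_m.+1 => rsubmx (x : 'rV[R]_(1 + m))).
Proof.
move=> x A /nbhs_ballP[e e0 eA]; apply/nbhs_ballP; exists e => // y xy.
by apply: eA; split => // i j; rewrite !mxE; exact: xy.2.
Qed.

Lemma unrow_measurable m : measurable_fun setT (@unrow m).
Proof.
apply: measurable_fun_pair => /=.
- apply: measurable_fun_open_preimage => U oU; rewrite setTI; apply: borel_open.
  by move: (U) oU; apply/continuousP => x; exact: coord_continuous.
- apply: measurable_fun_borel => U oU; rewrite setTI; apply: borel_open.
  by move: (U) oU; apply/continuousP; exact: rsubmx_continuous.
Qed.

Definition rowf m (z : measurableTypeR R * VT m) : VT m.+1 := row_mx z.1%:M z.2.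

Lemma unrowfK m x : rowf (@unrow m x) = x.
Proof. exact: unrowK. Qed.

Section extend.
Context m (mu : {sigma_finite_measure set (VT m) -> \bar R}).

(** An image of the product measure, because row vectors carry the Borel sigma-algebra of their own
    topology and not a product one. *)
Definition lebesgue_extend : set (VT m.+1) -> \bar R :=
  pushforward (leb \x mu)%E (@rowf m).

Let M : {measure set (VT m.+1) -> \bar R} :=
  measure_function_pushforward__canonical__measure_function_Measure (leb \x mu)%E
    (@row_mx_measurable m).

Let lebesgue_extend0 : lebesgue_extend set0 = 0%E. Proof. exact: (measure0 M). Qed.

Let lebesgue_extend_ge0 A : (0 <= lebesgue_extend A)%E. Proof. exact: (measure_ge0 M). Qed.

Let lebesgue_extend_sigma_additive : semi_sigma_additive lebesgue_extend.
Proof. exact: (@measure_semi_sigma_additive _ _ _ M). Qed.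

HB.instance Definition _ := isMeasure.Build _ _ _ lebesgue_extend
  lebesgue_extend0 lebesgue_extend_ge0 lebesgue_extend_sigma_additive.

Lemma sigma_finite_lebesgue_extend : sigma_finite setT lebesgue_extend.
Proof.
have [F TF Ffin] : sigma_finite setT (leb \x mu)%E by exact: sigma_finite_product.
exists (fun k => @unrow m @^-1` F k).
  by rewrite -preimage_bigcup -TF preimage_setT.
move=> k; split.
  by rewrite -[X in measurable X]setTI; apply: unrow_measurable => //; case: (Ffin k).
rewrite /lebesgue_extend /pushforward.
rewrite (_ : _ @^-1` _ = F k); first by case: (Ffin k).
by apply/seteqP; split=> -[t y]; rewrite /preimage/= row_mxK.
Qed.

HB.instance Definition _ := Measure_isSigmaFinite.Build _ _ _ lebesgue_extend
  sigma_finite_lebesgue_extend.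

Lemma lebesgue_extendE (F : VT m.+1 -> \bar R) : measurable_fun setT F ->
  (forall x, 0 <= F x)%E ->
  (\int[lebesgue_extend]_x F x = \int[leb]_t \int[mu]_y F (rowf (t, y)))%E.
Proof.
move=> mF F0.
have rowm : measurable_fun setT (@rowf m) by exact: row_mx_measurable.
transitivity (\int[leb \x mu]_(z in @rowf m @^-1` setT) (F \o @rowf m) z)%E.
  by rewrite -ge0_integral_pushforward.
rewrite preimage_setT fubini_tonelli1//; first exact: (measurableT_comp mF rowm).
by move=> x; exact: F0.
Qed.

End extend.

(** Lebesgue measure on R^m, built with the recursion of [iint] so that Tonelli's theorem identifies
    the two ([iintE]). In dimension 0 it is the unit mass at the only point. *)
Fixpoint lam m : {sigma_finite_measure set (VT m) -> \bar R} :=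
  match m return {sigma_finite_measure set (VT m) -> \bar R} with
  | 0 => [the {sigma_finite_measure set (VT 0) -> \bar R} of \d_((0 : 'rV[R]_0) : VT 0)]
  | m'.+1 => [the {sigma_finite_measure set (VT m'.+1) -> \bar R} of lebesgue_extend (lam m')]
  end.

Lemma integral_lamS m (F : VT m.+1 -> \bar R) : measurable_fun setT F ->
  (forall x, 0 <= F x)%E ->
  (\int[lam m.+1]_x F x = \int[leb]_t \int[lam m]_y F (rowf (t, y)))%E.
Proof. exact: lebesgue_extendE. Qed.

Lemma iintE m (F : VT m -> \bar R) : measurable_fun setT F ->
  (forall x, 0 <= F x)%E -> (iint (F : 'rV[R]_m -> \bar R) = \int[lam m]_x F x)%E.
Proof.
elim: m F => [|m IH] F mF F0.
  by rewrite [RHS]integral_dirac// diracE in_setT mul1e.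
rewrite integral_lamS//=; apply: eq_integral => t _; rewrite -IH//.
apply: (measurableT_comp mF).
by apply: (measurableT_comp (@row_mx_measurable m)); exact: measurable_pair1.
Qed.

End lebesgue_rV.

Global Opaque lam.

Lemma continuous_rV (T : topologicalType) (R : realType) m (f : T -> 'rV[R]_m) (x : T) :
  (forall j, {for x, continuous (fun y => f y ord0 j)}) -> {for x, continuous f}.
Proof.
move=> cf A /nbhs_ballP[e e0 eA].
have : \forall y \near x, forall j, ball (f x ord0 j) e (f y ord0 j).
  by apply: filter_forall => j; apply: (cf j); exact: nbhsx_ballx.
by apply: filterS => y fy; apply: eA; split => // i j; rewrite (ord1 i).
Qed.

Lemma continuous_sum (T : topologicalType) (R : realType) (I : Type) (r : seq I)
    (F : I -> T -> R) (x : T) :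
  (forall i, {for x, continuous (F i)}) ->
  {for x, continuous (fun y => \sum_(i <- r) F i y)}.
Proof.
move=> cF; elim: r => [|i r IH].
  rewrite (_ : (fun y => _) = cst 0); last by apply/funext => y; rewrite big_nil.
  exact: cst_continuous.
rewrite (_ : (fun y => _) = fun y => F i y + \sum_(j <- r) F j y); last first.
  by apply/funext => y; rewrite big_cons.
by apply: continuousD; [exact: cF|exact: IH].
Qed.

(** * Affine changes of variables *)

Section scaling.
Context {R : realType}.
Local Notation leb := (@lebesgue_measure R).
Local Notation VT m := (borel 'rV[R]_m).

Lemma measurable_fun_continuous (M N : ptopologicalType) (f : M -> N) :
  continuous f -> measurable_fun setT (f : borel M -> borel N).
Proof.
move=> /continuousP cf; apply: measurable_fun_borel => U oU.
by rewrite setTI; apply: borel_open; exact: cf.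
Qed.

(** The rescaled image measure [nu] agrees with Lebesgue measure on half-open intervals, hence on
    all Borel sets. A negative [a] exchanges the closed and the open end of an interval, which is
    why its sign is distinguished. *)
Lemma lebesgue_affine (a c : R) (F : R -> \bar R) : a != 0 ->
  measurable_fun setT F -> (forall x, 0 <= F x)%E ->
  (\int[leb]_t F (a * t + c)%R = (`|a|^-1)%:E * \int[leb]_t F t)%E.
Proof.
move=> a0 mF F0.
pose phi (t : measurableTypeR R) : measurableTypeR R := a * t + c.
have mphi : measurable_fun setT phi.
  by apply: measurable_funD => //; exact: measurable_funM.
have na0 : 0 < `|a| by rewrite normr_gt0.
pose nu : {measure set (measurableTypeR R) -> \bar R} :=
  mscale (NngNum (normr_ge0 a)) (measure_function_pushforward__canonical__measure_function_Measure leb mphi).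
have E A : measurable A -> leb A = nu A.
  apply: lebesgue_measure_unique => _ [[x y] _ <-].
  rewrite -[nu _]/(`|a|%:E * leb (phi @^-1` `]x, y]))%E.
  rewrite lebesgue_measure_itv/= lte_fin.
  have [a_gt0|a_lt0|] := ltgtP 0 a; last by move=> /eqP; rewrite eq_sym (negbTE a0).
    rewrite (_ : phi @^-1` _ = `](x - c) / a, (y - c) / a]%classic); last first.
      apply/seteqP; split=> t; rewrite /phi/= !in_itv/= ltr_pdivrMr// ler_pdivlMr// ltrBlDr lerBrDr (mulrC t).
        by [].
      by [].
    rewrite lebesgue_measure_itv/= lte_fin ltr_pM2r ?invr_gt0// ltrD2r.
    case: ifPn => xy; last by rewrite mule0.
    rewrite -EFinB -EFinD -EFinM gtr0_norm//; congr (_%:E); field.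
    by rewrite gt_eqF.
  rewrite (_ : phi @^-1` _ = `[(y - c) / a, (x - c) / a[%classic); last first.
    apply/seteqP; split=> t; rewrite /phi/= !in_itv/= ltr_ndivlMr// ler_ndivrMr// ltrBlDr lerBrDr (mulrC t).
      by rewrite andbC.
    by rewrite andbC.
  rewrite lebesgue_measure_itv/= lte_fin ltr_nM2r ?invr_lt0// ltrD2r.
  case: ifPn => xy; last by rewrite mule0.
  rewrite -EFinB -EFinD -EFinM ltr0_norm//; congr (_%:E); field.
  by rewrite lt_eqF.
have -> : (\int[leb]_t F t = \int[nu]_t F t)%E.
  by apply: eq_measure_integral => A mA _; exact: E.
rewrite ge0_integral_mscale//= ge0_integral_pushforward//= preimage_setT.
by rewrite muleA -EFinM mulVf ?gt_eqF// mul1e.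
Qed.

Lemma integral_lamS2 m (F : VT m.+1 -> \bar R) : measurable_fun setT F ->
  (forall x, 0 <= F x)%E ->
  (\int[lam m.+1]_x F x = \int[lam m]_y \int[leb]_t F (rowf (t, y)))%E.
Proof.
move=> mF F0; rewrite integral_lamS//.
apply: (@fubini_tonelli _ _ _ _ _ leb (lam m) (F \o @rowf R m)).
  exact: measurableT_comp mF (@row_mx_measurable R m).
by move=> x; exact: F0.
Qed.

Lemma mulmx_continuous m k (B : 'M[R]_(m, k)) : continuous (fun x : 'rV[R]_m => x *m B).
Proof.
move=> x; apply: continuous_rV => j.
rewrite (_ : (fun y : 'rV[R]_m => (y *m B) ord0 j) = fun y => \sum_i y ord0 i * B i j); last first.
  by apply/funext => y; rewrite mxE.
apply: continuous_sum => i.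
apply: continuousM; last exact: cst_continuous.
exact: (@coord_continuous R _ _ ord0 i).
Qed.

Lemma shift_measurable m (v : 'rV[R]_m) :
  measurable_fun setT (fun x : VT m => (x + v) : VT m).
Proof.
apply: (@measurable_fun_continuous 'rV[R]_m 'rV[R]_m (fun x => x + v)) => x.
exact: (cvgD (@cvg_id _ (nbhs x)) (@cvg_cst _ v _ _ _)).
Qed.

Lemma row_measurable1 m (F : VT m.+1 -> \bar R) t : measurable_fun setT F ->
  measurable_fun setT (fun y => F (rowf (t, y))).
Proof.
move=> mF; apply: (measurableT_comp mF).
by apply: (measurableT_comp (@row_mx_measurable R m)); exact: measurable_pair1.
Qed.

Lemma row_measurable2 m (F : VT m.+1 -> \bar R) y : measurable_fun setT F ->
  measurable_fun setT (fun t : measurableTypeR R => F (rowf (t, y))).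
Proof.
move=> mF; apply: (measurableT_comp mF).
by apply: (measurableT_comp (@row_mx_measurable R m)); exact: measurable_pair2.
Qed.

Lemma rowfD m (t s : R) (y z : 'rV[R]_m) :
  rowf (t, y) + rowf (s, z) = rowf (t + s, y + z) :> 'rV[R]_m.+1.
Proof. by rewrite /rowf/= (add_row_mx t%:M y s%:M z) -raddfD. Qed.

Lemma lam_shift m (v : 'rV[R]_m) (F : VT m -> \bar R) : measurable_fun setT F ->
  (forall x, 0 <= F x)%E ->
  (\int[lam m]_x F ((x : 'rV[R]_m) + v)%R = \int[lam m]_x F x)%E.
Proof.
elim: m v F => [|m IH] v F mF F0.
  by apply: eq_integral => x _; congr F; apply/rowP => -[].
have mFv : measurable_fun setT (fun x : VT m.+1 => F ((x : 'rV[R]_m.+1) + v)).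
  exact: measurableT_comp mF (shift_measurable v).
rewrite (integral_lamS mFv (fun x => F0 _)) (integral_lamS mF F0).
pose v1 : R := (unrow v).1; pose v2 : 'rV[R]_m := (unrow v).2.
transitivity (\int[leb]_t \int[lam m]_y F (rowf ((t : R) + v1, y)%R))%E.
  apply: eq_integral => t _.
  transitivity (\int[lam m]_y (fun y => F (rowf ((t : R) + v1, y)%R)) ((y : 'rV[R]_m) + v2)%R)%E.
    by apply: eq_integral => y _; rewrite -rowfD -surjective_pairing unrowfK.
  by apply: IH => //; exact: row_measurable1.
transitivity (\int[leb]_t (fun s => \int[lam m]_y F (rowf (s, y))) (1 * (t : R) + v1)%R)%E.
  by apply: eq_integral => t _; rewrite mul1r.
rewrite (@lebesgue_affine 1 v1 (fun t => \int[lam m]_y F (rowf (t, y))))%E ?oner_neq0//.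
- by rewrite normr1 invr1 mul1e.
- apply: (@measurable_fun_fubini_tonelli_F _ _ _ _ _ (lam m) (F \o @rowf R m)).
    exact: measurableT_comp mF (@row_mx_measurable R m).
  by move=> x; exact: F0.
- by move=> t; exact: integral_ge0.
Qed.

(** The linear change of variables formula as a property of the matrix. It is stable under products,
    which reduces invertible matrices to elementary blocks. *)
Definition scales m (B : 'M[R]_m) := forall F : VT m -> \bar R,
  measurable_fun setT F -> (forall x, 0 <= F x)%E ->
  (\int[lam m]_x F ((x : 'rV[R]_m) *m B)%R = (`|\det B|^-1)%:E * \int[lam m]_x F x)%E.

Lemma mulmx_measurable m (B : 'M[R]_m) :
  measurable_fun setT (fun x : VT m => (x *m B) : VT m).
Proof. by apply: measurable_fun_continuous; exact: mulmx_continuous. Qed.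

Lemma scalesM m (B C : 'M[R]_m) : scales B -> scales C -> scales (B *m C).
Proof.
move=> sB sC F mF F0.
transitivity (\int[lam m]_x (fun y => F ((y : 'rV[R]_m) *m C)) ((x : 'rV[R]_m) *m B)%R)%E.
  by apply: eq_integral => x _; rewrite mulmxA.
rewrite (sB _ (measurableT_comp mF (mulmx_measurable C)) (fun x => F0 _))/=.
by rewrite sC// muleA -EFinM det_mulmx normrM invfM.
Qed.

Lemma rowf_mulmx m t y (a : R) (b : 'rV[R]_m) (c : 'cV[R]_m) (D : 'M[R]_m) :
  (rowf (t, y) : 'rV[R]_(1 + m)) *m block_mx a%:M b c D =
  rowf (t * a + (y *m c) ord0 ord0, t *: b + y *m D).
Proof.
rewrite /rowf/= mul_row_block; congr row_mx; last by rewrite mul_scalar_mx.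
by rewrite [LHS]mx11_scalar !mxE big_ord1 !mxE/= !mulr1n.
Qed.

(** With the first coordinate [t] frozen, the inner integral sees [D] and the translation by
    [t *: b]; the outer one then sees a dilation by [a]. *)
Lemma scales_upper m (a : R) (b : 'rV[R]_m) (D : 'M[R]_m) : a != 0 ->
  scales D -> scales (block_mx a%:M b 0 D : 'M[R]_m.+1).
Proof.
move=> a0 sD F mF F0.
have mFB := measurableT_comp mF (mulmx_measurable (block_mx a%:M b 0 D : 'M[R]_m.+1)).
rewrite (integral_lamS mFB (fun x => F0 _)) (integral_lamS mF F0).
have mG : measurable_fun setT (fun t : measurableTypeR R => \int[lam m]_y F (rowf (t, y)))%E.
  apply: (@measurable_fun_fubini_tonelli_F _ _ _ _ _ (lam m) (F \o @rowf R m)).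
    exact: measurableT_comp mF (@row_mx_measurable R m).
  by move=> x; exact: F0.
have G0 (t : R) : (0 <= \int[lam m]_y F (rowf (t, y)))%E by exact: integral_ge0.
transitivity (\int[leb]_t ((`|\det D|^-1)%:E *
    (fun s => \int[lam m]_y F (rowf (s, y))) (a * (t : R) + 0)%R))%E.
  apply: eq_integral => t _; rewrite /= addr0 mulrC.
  have mFt := row_measurable1 ((t : R) * a) mF.
  have mFt' := measurableT_comp mFt (shift_measurable (t *: b)).
  transitivity (\int[lam m]_y
      (fun z : VT m => F (rowf ((t : R) * a, z + t *: b)%R)) ((y : 'rV[R]_m) *m D)%R)%E.
    apply: eq_integral => y _; rewrite (rowf_mulmx t y a b 0 D).
    by rewrite mulmx0 mxE addr0 addrC.
  rewrite (sD _ mFt' (fun x => F0 _)); congr (_ * _)%E.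
  exact: (lam_shift _ mFt (fun x => F0 _)).
have mGa : measurable_fun setT
    (fun t => \int[lam m]_y F (rowf ((a * (t : R) + 0)%R, y)))%E.
  apply: (measurableT_comp mG).
  by apply: measurable_funD => //; exact: measurable_funM.
rewrite (ge0_integralZl leb measurableT mGa (fun t _ => G0 _)); last by rewrite lee_fin.
rewrite (lebesgue_affine 0 a0 mG G0).
by rewrite muleA -EFinM (@det_ublock _ 1 m a%:M b D) det_scalar1 normrM invfM mulrC.
Qed.

(** With the other coordinates frozen the map translates the first one, so the first coordinate is
    integrated inside ([integral_lamS2]). *)
Lemma scales_shear m (c : 'cV[R]_m) : scales (block_mx 1%:M 0 c 1%:M : 'M[R]_m.+1).
Proof.
move=> F mF F0.
have mFB := measurableT_comp mF (mulmx_measurable (block_mx 1%:M 0 c 1%:M : 'M[R]_m.+1)).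
rewrite (integral_lamS2 mFB (fun x => F0 _)) (integral_lamS2 mF F0).
rewrite (@det_lblock _ 1 m 1%:M c 1%:M) !det1 mulr1 normr1 invr1 mul1e.
apply: eq_integral => y _.
transitivity (\int[leb]_t (fun s => F (rowf (s, y))) (1 * (t : R) + ((y : 'rV[R]_m) *m c) ord0 ord0)%R)%E.
  apply: eq_integral => t _.
  by rewrite /= (rowf_mulmx t y 1 0 c 1%:M) mul1r mulr1 scaler0 add0r mulmx1.
rewrite (lebesgue_affine _ (oner_neq0 R) (row_measurable2 y mF))//.
by rewrite normr1 invr1 mul1e.
Qed.

(** Induction by elimination: with a nonzero pivot, the matrix is a shear times a block triangular
    matrix whose lower block has size one less. *)
Lemma scales_unit m (B : 'M[R]_m) : B \in unitmx -> scales B.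
Proof.
elim: m B => [|m IH] B uB.
  move=> F mF F0; rewrite [B]flatmx0 det_mx00 normr1 invr1 mul1e.
  by apply: eq_integral => x _; congr F; apply/rowP => -[].
have case1 (B' : 'M[R]_m.+1) : B' \in unitmx -> B' ord0 ord0 != 0 -> scales B'.
  move=> uB' a0.
  pose B'' : 'M[R]_(1 + m) := B'.
  set a := B' ord0 ord0 in a0.
  have aE : ulsubmx B'' = a%:M.
    rewrite [LHS]mx11_scalar !mxE /a; congr (B' _ _)%:M; exact/val_inj.
  (* The Schur complement of the pivot. *)
  pose D := drsubmx B'' - a^-1 *: (dlsubmx B'' *m ursubmx B'').
  have BE : B'' = block_mx 1%:M 0 (a^-1 *: dlsubmx B'') 1%:M *m block_mx a%:M (ursubmx B'') 0 D.
    rewrite mulmx_block !mul1mx !mul0mx !addr0 -[LHS]submxK aE.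
    congr block_mx.
      by rewrite mul_mx_scalar scalerA mulfV// scale1r.
    by rewrite -scalemxAl /D addrC subrK.
  have uD : D \in unitmx.
    move: uB'; rewrite -[B']/B'' BE unitmx_mul => /andP[_].
    by rewrite !unitmxE (@det_ublock _ 1 m a%:M (ursubmx B'') D) unitrM => /andP[].
  rewrite -[B']/B'' BE.
  by apply: scalesM; [exact: scales_shear|apply: scales_upper => //; exact: IH].
have [a0|a0] := eqVneq (B ord0 ord0) 0; last exact: case1.
pose B'' : 'M[R]_(1 + m) := B.
(* A zero first column would make the determinant vanish. *)
have [k ck] : exists k, B (lift ord0 k) ord0 != 0.
  apply/existsP; apply: contraT; rewrite negb_exists => /forallP c0.
  move: uB; rewrite unitmxE -[B]/B'' -[B'']submxK.
  have -> : dlsubmx B'' = 0.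
    apply/colP => i; rewrite !mxE.
    transitivity (B (lift ord0 i) ord0); first by congr (B _ _); exact/val_inj.
    exact/eqP/negbNE/c0.
  rewrite (@det_ublock _ 1 m (ulsubmx B'') (ursubmx B'') (drsubmx B'')) [ulsubmx _]mx11_scalar !mxE.
  rewrite (_ : B'' _ _ = 0) ?det_scalar1 ?mul0r ?unitr0// -[RHS]a0.
  by congr (B _ _); exact/val_inj.
pose e : 'rV[R]_m := delta_mx ord0 k.
(* Left multiplication by [U 1] adds row [lift ord0 k] to row 0, which creates a pivot; [U (-1)]
   undoes it. *)
pose U (s : R) : 'M[R]_(1 + m) := block_mx 1%:M (s *: e) 0 1%:M.
have sU s : scales (U s : 'M[R]_m.+1).
  apply: (@scales_upper m 1 (s *: e) 1%:M); first exact: oner_neq0.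
  by apply: IH; exact: unitmx1.
have UU : U (-1) *m U 1 = 1%:M.
  rewrite mulmx_block !mul1mx !mulmx1 !mul0mx !mulmx0 !addr0 add0r.
  by rewrite -scalerDl subrr scale0r -scalar_mx_block.
have BE : B = (U (-1) : 'M[R]_m.+1) *m ((U 1 : 'M[R]_m.+1) *m B).
  by rewrite mulmxA UU mul1mx.
rewrite BE; apply: scalesM => //; apply: case1.
  by rewrite unitmx_mul uB andbT unitmxE (@det_ublock _ 1 m) !det1 mulr1 unitr1.
rewrite (_ : (_ *m B) ord0 ord0 = B (lift ord0 k) ord0)//.
have U1E i : (U 1 : 'M[R]_m.+1) ord0 (lift ord0 i) = (i == k)%:R.
  transitivity (U 1 (lshift m (ord0 : 'I_1)) (rshift 1 i)).
    by congr (U 1 _ _); exact/val_inj.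
  by rewrite /U block_mxEur !mxE eqxx mul1r.
rewrite mxE (@big_ord_recl _ _ _ m) a0 mulr0 add0r (bigD1 k)//= big1 ?addr0.
  by rewrite U1E eqxx mul1r.
by move=> i ik; rewrite U1E (negbTE ik) mul0r.
Qed.

End scaling.

(** * Change of variables by averaging over cubes *)

Section cubes.
Context {R : realType}.
Local Notation leb := (@lebesgue_measure R).
Local Notation VT m := (borel 'rV[R]_m).

Lemma ball_rowf m (t s r : R) (y z : 'rV[R]_m) :
  ball (rowf (t, y) : 'rV[R]_m.+1) r (rowf (s, z)) <-> ball t r s /\ ball y r z.
Proof.
split=> [[r0 H]|[ts [r0 yz]]].
  split; last split => // i j.
    have := H ord0 (lshift m (ord0 : 'I_1)).
    by rewrite !(row_mxEl _%:M) !mxE eqxx !mulr1n.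
  have := H ord0 (rshift 1 j).
  by rewrite !(row_mxEr _%:M) (ord1 i).
split => // i j; rewrite (ord1 i) !mxE; case: splitP => k _.
  by rewrite !mxE (ord1 k) eqxx !mulr1n.
exact: yz.
Qed.

Lemma measurable_ball_rV m (x : 'rV[R]_m) r : measurable (ball x r : set (VT m)).
Proof. by apply: borel_open; exact: ball_open. Qed.

(** Balls of the sup norm are cubes; the induction splits off one coordinate. *)
Lemma lam_ball m (c : 'rV[R]_m) (r : R) : 0 < r ->
  lam m (ball c r : set (VT m)) = (((2 * r) ^+ m)%:E)%E.
Proof.
move=> r0; rewrite -[X in lam m X]setIT -integral_indic//; last exact: measurable_ball_rV.
have mI k (x : 'rV[R]_k) : measurable_fun setT (fun y : VT k => (\1_(ball x r) y : R)%:E).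
  by apply/measurable_EFinP; apply: measurable_indic; exact: measurable_ball_rV.
elim: m c => [|m IH] c.
  rewrite -(iintE (mI _ c))//= indicE mem_set//; split => // i [].
  by [].

rewrite (integral_lamS (mI _ c))//.
transitivity (\int[leb]_t ((\1_(ball ((unrow c).1 : R) r) t)%:E * ((2 * r) ^+ m)%:E))%E.
  apply: eq_integral => t _; rewrite -(IH (unrow c).2) -ge0_integralZl//.
  apply: eq_integral => y _; rewrite -EFinM -{1}(unrowfK c); congr (_%:E).
  rewrite (surjective_pairing (unrow c)) !indicE -natrM mulnb; congr (_%:R); congr nat_of_bool.
  apply/idP/idP; rewrite ?in_setE.
    by move/ball_rowf => [H1 H2]; apply/andP; rewrite !in_setE.
  by move=> /andP[]; rewrite !in_setE => H1 H2; apply/ball_rowf.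
rewrite ge0_integralZr//; last by rewrite lee_fin exprn_ge0// mulr_ge0// ltW.
  rewrite integral_indic//; last exact: measurable_ball.
  rewrite setIT; transitivity ((r *+ 2)%:E * ((2 * r) ^+ m)%:E)%E.
    by congr (_ * _)%E; exact: lebesgue_measure_ball (ltW r0).
  by rewrite -EFinM exprS mulr_natl.
by apply/measurable_EFinP; apply: measurable_indic; exact: measurable_ball.
Qed.

(** By continuity, [F (sigma y)] is recovered from averages of [F] over small cubes around
    [sigma y]. Fatou's lemma and Tonelli's theorem turn the integral of these averages into an
    integral over the centre [x] of a cube, weighted by the [G]-mass of the preimage of that cube,
    and the last hypothesis compares this mass with [rho x] times the volume. No injectivity or
    inverse of [sigma] enters; the reverse inequality will come from exchanging two charts. *)
Lemma cv_le m (F G rho : VT m -> R) (sigma : VT m -> VT m) :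
  measurable_fun setT F -> measurable_fun setT G -> measurable_fun setT rho ->
  measurable_fun setT sigma ->
  (forall x, 0 <= F x) -> (forall y, 0 <= G y) -> (forall x, 0 <= rho x) ->
  (\int[lam m]_x (F x)%:E < +oo)%E ->
  (forall y, G y != 0 ->
    {for (sigma y : 'rV[R]_m), continuous (F : 'rV[R]_m -> R)}) ->
  (forall e, 0 < e -> \forall k \near \oo, forall x, F x != 0 ->
     (\int[lam m]_y (G y * \1_(ball (x : 'rV[R]_m) k.+1%:R^-1) (sigma y))%:E <=
     ((rho x + e) * (2 * k.+1%:R^-1) ^+ m)%:E)%E) ->
  (\int[lam m]_y (F (sigma y) * G y)%:E <= \int[lam m]_x (F x * rho x)%:E)%E.
Proof.
move=> mF mG mrho msigma F0 G0 rho0 Ffin cF H.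
pose r (k : nat) : R := k.+1%:R^-1.
have r0 k : 0 < r k by rewrite invr_gt0.
pose V k := (2 * r k) ^+ m.
have V0 k : 0 < V k by rewrite exprn_gt0// mulr_gt0.
(* [G y] times the average of [F] over the cube of radius [r k] around [sigma y]. The indicator is
   written with centre [x] so that, once the integrals are exchanged, it cuts out the preimage of a
   cube. *)
pose a k y := (\int[lam m]_x
  (G y * ((V k)^-1 * F x * \1_(ball (x : 'rV[R]_m) (r k)) (sigma y)))%:E)%E.
have mball k : measurable_fun setT
    (fun z : VT m * VT m => \1_(ball (z.1 : 'rV[R]_m) (r k)) (sigma z.2) : R).
  apply: measurable_indic.
  apply: (@open_measurable_prod _ _ (VT m) (VT m) 'rV[R]_m 'rV[R]_m id sigma _ _ _ _
    [set z | ball z.1 (r k) z.2]).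
  - exact: second_countable_rV.
  - exact: second_countable_rV.
  - by move=> U oU; exact: borel_open.
  - move=> U oU; rewrite -[X in measurable X]setTI; apply: msigma => //.
    exact: borel_open.
  rewrite -ball_normE.
  rewrite (_ : [set z | _] = (fun z : 'rV[R]_m * 'rV[R]_m => `|z.1 - z.2|) @^-1` [set t | t < r k])//.
  apply: open_comp; last exact: open_lt.
  move=> z _; apply: cvg_norm; apply: cvgB; [exact: cvg_fst|exact: cvg_snd].
have mker k : measurable_fun setT (fun z : VT m * VT m =>
    (G z.2 * ((V k)^-1 * F z.1 * \1_(ball (z.1 : 'rV[R]_m) (r k)) (sigma z.2)))%:E).
  apply/measurable_EFinP; apply: measurable_funM.
    exact: (measurableT_comp mG measurable_snd).
  apply: measurable_funM; last exact: mball.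
  by apply: measurable_funM => //; exact: (measurableT_comp mF measurable_fst).
have ker0 k (z : VT m * VT m) : (0 <= (G z.2 * ((V k)^-1 * F z.1 *
    \1_(ball (z.1 : 'rV[R]_m) (r k)) (sigma z.2)))%:E)%E.
  by rewrite lee_fin !mulr_ge0// invr_ge0 ltW.
have ma k : measurable_fun setT (a k).
  exact: (@measurable_fun_fubini_tonelli_G _ _ _ _ _ (lam m) _ (mker k) (ker0 k)).
have a0 k y : (0 <= a k y)%E by apply: integral_ge0 => x _; exact: (ker0 k (x, y)).
have avg y : ((F (sigma y) * G y)%:E <= limn_einf (a ^~ y))%E.
  have [Gy0|Gy] := eqVneq (G y) 0.
    by rewrite Gy0 mulr0; apply: limn_einf_lb; exact: nearW.
  have Gy_gt0 : 0 < G y by rewrite lt_neqAle eq_sym Gy G0.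
  apply/lee_subgt0Pr => e' e'0; pose e := e' / G y.
  have e0 : 0 < e by exact: divr_gt0.
  (* The maximum with 0 keeps the constant of the lower bound nonnegative, as integration of
     nonnegative functions demands. *)
  pose b := Num.max (F (sigma y) - e) 0.
  have b0 : 0 <= b by rewrite le_max lexx orbT.
  have [k0 _ Fe] : \forall k \near \oo, forall x, ball (sigma y : 'rV[R]_m) (r k) x ->
      b <= F x.
    have /nbhs_ballP[d /= d0 dF] : \forall x \near (sigma y : 'rV[R]_m), b <= F x.
      have /cvgrPdist_lt/(_ e e0) := cF y Gy; apply: filterS => x.
      by move=> /ltr_distlBl/ltW Fx; rewrite ge_max Fx F0.
    have [k0 k0d] := @ltr_add_invr R 0%R d d0.
    exists k0 => // k /= k0k x skx; apply: dF; apply: le_ball skx.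
    rewrite (le_trans _ (ltW k0d))// add0r lef_pV2 ?posrE// ler_nat ltnS.
    exact: k0k.
  apply: limn_einf_lb; exists k0 => // k /= k0k; rewrite /a -EFinB.
  have cst0 : 0 <= G y * ((V k)^-1 * b) by rewrite !mulr_ge0// invr_ge0 ltW.
  have mI : measurable_fun setT (fun x : VT m =>
      (\1_(ball (sigma y : 'rV[R]_m) (r k)) x : R)%:E).
    by apply/measurable_EFinP; apply: measurable_indic; exact: measurable_ball_rV.
  apply: (@le_trans _ _ (\int[lam m]_x ((G y * ((V k)^-1 * b))%:E *
      (\1_(ball (sigma y : 'rV[R]_m) (r k)) x)%:E)%E)%E).
    rewrite (ge0_integralZl (lam m) measurableT mI)//.
    rewrite (integral_indic _ measurableT (measurable_ball_rV _ _)) setIT.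
    rewrite [X in (_ * X)%E](_ : _ = (V k)%:E); last exact: lam_ball (r0 k).
    rewrite -EFinM lee_fin -mulrA mulrAC mulVf ?gt_eqF// mul1r.
    apply: (@le_trans _ _ (G y * (F (sigma y) - e))).
      by rewrite mulrBr /e mulrCA divff ?gt_eqF// mulr1 mulrC.
    by rewrite ler_pM2l// le_max lexx.
  apply: ge0_le_integral => //.
  - by move=> x _; rewrite mule_ge0// lee_fin.
  - by apply: emeasurable_funM => //; exact: measurable_cst.
  - exact: (measurableT_comp (mker k) (pair2_measurable y)).
  move=> x _; rewrite -EFinM lee_fin !indicE.
  have [xs|xs] := pselect (ball (sigma y : 'rV[R]_m) (r k) x); last first.
    by rewrite memNset// mulr0 !mulr_ge0// invr_ge0 ltW.
  rewrite (mem_set xs) (mem_set (ball_sym xs)) !mulr1 ler_pM2l// ler_pM2l ?invr_gt0//.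
  by apply: Fe xs.
apply: (@le_trans _ _ (\int[lam m]_y limn_einf (a ^~ y))%E).
  apply: ge0_le_integral => //.
  - by move=> y _; rewrite lee_fin mulr_ge0.
  - apply/measurable_EFinP; apply: measurable_funM => //.
    exact: (measurableT_comp mF msigma).
  - exact: measurable_fun_limn_einf.
apply: (le_trans (fatou _ measurableT ma (fun k y _ => a0 k y))).
apply/lee_addgt0Pr => e e0.
have intF : (lam m).-integrable setT (EFin \o F).
  apply/integrableP; split; first exact/measurable_EFinP.
  by under eq_integral do rewrite gee0_abs ?lee_fin//.
have [I IE] : exists I, (\int[lam m]_x (F x)%:E = I%:E)%E.
  by exists (fine (\int[lam m]_x (F x)%:E)); rewrite fineK// integrable_fin_num.
have I0 : 0 <= I by rewrite -lee_fin -IE; apply: integral_ge0 => x _; rewrite lee_fin.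
(* The error [e'] gets multiplied by the integral [I] of [F]; the summand 1 avoids a division by
   0. *)
pose e' := e / (1 + I).
have I1 : 0 < 1 + I by rewrite ltr_pwDl.
have e'0 : 0 < e' by exact: divr_gt0.
apply: (@le_trans _ _ (\int[lam m]_x (F x * (rho x + e'))%:E)%E); last first.
  under eq_integral do rewrite mulrDr EFinD.
  rewrite ge0_integralD//; last 4 first.
  - by move=> x _; rewrite lee_fin mulr_ge0.
  - by apply/measurable_EFinP; exact: measurable_funM.
  - by move=> x _; rewrite lee_fin mulr_ge0// ltW.
  - by apply/measurable_EFinP; exact: measurable_funM.
  rewrite leeD2l//; under eq_integral do rewrite EFinM.
  rewrite ge0_integralZr//; last 3 first.
  - exact/measurable_EFinP.
  - by move=> x _; rewrite lee_fin.
  - by rewrite lee_fin ltW.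
  rewrite IE -EFinM lee_fin /e' mulrCA ler_piMr ?(ltW e0)//.
  by rewrite ler_pdivrMr// mul1r lerDr.
apply: limn_einf_ub; have := H _ e'0; apply: filterS => k Hk.
have swap := @fubini_tonelli _ _ _ _ _ (lam m) (lam m) _ (mker k) (ker0 k).
rewrite /a; apply: (@le_trans _ _ (\int[lam m]_x \int[lam m]_y
  (G y * ((V k)^-1 * F x * \1_(ball (x : 'rV[R]_m) (r k)) (sigma y)))%:E)%E).
  by rewrite le_eqVlt; apply/orP; left; apply/eqP; exact: esym swap.
clear swap.
apply: ge0_le_integral; first exact: measurableT.
- by move=> x _; apply: integral_ge0 => y _; exact: (ker0 k (x, y)).
- exact: (@measurable_fun_fubini_tonelli_F _ _ _ _ _ (lam m) _ (mker k) (ker0 k)).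
- apply/measurable_EFinP; apply: measurable_funM; first exact: mF.
  by apply: measurable_funD; [exact: mrho|exact: measurable_cst].
move=> x _; have [Fx0|Fx] := eqVneq (F x) 0.
  rewrite Fx0 mul0r; under eq_integral do rewrite mulr0 mul0r mulr0.
  by rewrite integral0.
have VF0 : 0 <= (V k)^-1 * F x by rewrite mulr_ge0// invr_ge0 ltW.
apply: (@le_trans _ _ (((V k)^-1 * F x)%:E * \int[lam m]_y
    (G y * \1_(ball (x : 'rV[R]_m) (r k)) (sigma y))%:E)%E).
  have mGI : measurable_fun setT (fun y : VT m =>
      (G y * \1_(ball (x : 'rV[R]_m) (r k)) (sigma y))%:E).
    apply/measurable_EFinP; apply: measurable_funM; first exact: mG.
    exact: (measurableT_comp (mball k) (pair1_measurable x)).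
  rewrite -(ge0_integralZl (lam m) measurableT mGI); last 2 first.
  - by move=> y _; rewrite lee_fin mulr_ge0.
  - by rewrite lee_fin.
  rewrite le_eqVlt; apply/orP; left; apply/eqP; apply: eq_integral => y _.
  by rewrite -EFinM mulrCA.
apply: (@le_trans _ _ (((V k)^-1 * F x)%:E * ((rho x + e') * V k)%:E)%E).
  apply: lee_wpmul2l; [by rewrite lee_fin|exact: Hk].
rewrite -EFinM lee_fin (_ : _ * _ * _ = F x * (rho x + e'))//.
by field; rewrite gt_eqF.
Qed.

End cubes.

(** * Smooth functions and bump functions *)

Section line.
Context {R : realType} {V : normedModType R}.
Implicit Types (F G : V -> R).

(** A directional derivative is the derivative at 0 of a function of one real variable, which gives
    access to the one-variable chain rule in any normed module. *)
Lemma is_derive_line F (x v : V) (d : R) :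
  is_derive x v F d <-> is_derive (0 : R) (1 : R) (fun h : R => F (h *: v + x)) d.
Proof.
have E : (fun h : R => h^-1 *: ((F \o shift x) (h *: v) - F x)) =
    (fun h : R => h^-1 *: (((fun h : R => F (h *: v + x)) \o shift 0) (h *: 1) - F (0 *: v + x))).
  by apply/funext => h /=; rewrite addr0 scale0r add0r [_%:A]mulr1.
by split=> -[]; rewrite /derivable /derive => D1 D2; split;
  rewrite /derivable /derive ?E // -?E.
Qed.

Lemma is_derive_comp F (h : R -> R) (x v : V) (d e : R) :
  is_derive x v F d -> is_derive (F x) 1 h e -> is_derive x v (h \o F) (e * d).
Proof.
move=> /is_derive_line dF dh; apply: (iffRL (is_derive_line (h \o F) x v (e * d))).
apply: (@is_derive1_comp R h (fun t : R => F (t *: v + x))) => //.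
by rewrite scale0r add0r.
Qed.

End line.

Lemma is_derive_affine (R : realType) (V V' : normedModType R) (l : V' -> V) (x v : V') (w : V) (F : V -> R) (d : R) :
  (forall h : R, l (h *: v + x) = h *: w + l x) ->
  is_derive (l x) w F d -> is_derive x v (F \o l) d.
Proof.
move=> lE /is_derive_line dF; apply: (iffRL (is_derive_line (F \o l) x v d)).
have -> : (fun h : R => (F \o l) (h *: v + x)) = (fun h : R => F (h *: w + l x)).
  by apply/funext => h /=; rewrite lE.
exact: dF.
Qed.

Lemma near_eq_continuous (T U : topologicalType) (F G : T -> U) (x : T) :
  (\near x, F x = G x) -> {for x, continuous F} -> {for x, continuous G}.
Proof.
move=> FG cF; have GxE := nbhs_singleton FG.
suff : F @ x --> G x by apply: cvg_trans; apply: near_eq_cvg.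
by rewrite -GxE; exact: cF.
Qed.

(** * Stability of the classes C^k *)

Section Ck.
Context {R : realType} {V : normedModType R}.
Implicit Types (U A : set V) (F G : V -> R).

Lemma Ck_continuous k U F x : Ck k U F -> U x -> {for x, continuous F}.
Proof. by case: k => [|k]; [apply|move=> [+ _]; apply]. Qed.

Lemma Ck_derivable k U F v x : Ck k.+1 U F -> U x -> is_derive x v F ('D_v F x).
Proof. by move=> [_ /(_ v)[+ _]] Ux => /(_ x Ux); exact: derivableP. Qed.

Lemma Ck_derive k U F v : Ck k.+1 U F -> Ck k U ('D_v F).
Proof. by move=> [_ /(_ v)[]]. Qed.

Lemma CkW k U F : Ck k.+1 U F -> Ck k U F.
Proof.
elim: k F => [F []//|k IH F [cF dF]]; split => // v.
by have [dvF CdF] := dF v; split => //; exact: IH.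
Qed.

Lemma Ck_sub k U U' F : U' `<=` U -> Ck k U F -> Ck k U' F.
Proof.
move=> UU'; elim: k F => [F cF x /UU'|k IH F [cF dF]]; first exact: cF.
split=> [x /UU'|v]; first exact: cF.
by have [dvF CdF] := dF v; split => [x /UU'|]; [exact: dvF|exact: IH].
Qed.

Lemma open_near_eq U F G x : open U -> (forall y, U y -> F y = G y) -> U x ->
  \near x, F x = G x.
Proof. by move=> oU FG Ux; apply: filterS (open_nbhs_nbhs (conj oU Ux)). Qed.

Lemma Ck_eq k U F G : open U -> (forall x, U x -> F x = G x) -> Ck k U F -> Ck k U G.
Proof.
move=> oU; elim: k F G => [F G FG cF x Ux|k IH F G FG [cF dF]].
  exact: near_eq_continuous (open_near_eq oU FG Ux) (cF x Ux).
split=> [x Ux|v].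
  exact: near_eq_continuous (open_near_eq oU FG Ux) (cF x Ux).
have [dvF CdF] := dF v; split=> [x Ux|].
  exact: near_eq_derivable (open_near_eq oU FG Ux) (dvF x Ux).
apply: IH CdF => x Ux; exact: near_eq_derive (open_near_eq oU FG Ux).
Qed.

Lemma Ck_cst k U (c : R) : Ck k U (cst c).
Proof.
elim: k c => [c x _|k IH c]; first exact: cst_continuous.
split=> [x _|v]; first exact: cst_continuous.
split=> [x _|]; first exact: derivable_cst.
by rewrite (_ : 'D_v (cst c) = cst 0)//; apply/funext => x; rewrite derive_cst.
Qed.

Lemma Ck_add k U F G : open U -> Ck k U F -> Ck k U G -> Ck k U (F + G).
Proof.
move=> oU; elim: k F G => [F G cF cG x Ux|k IH F G CF CG].
  by apply: continuousD; [exact: cF|exact: cG].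
split=> [x Ux|v].
  by apply: continuousD; [exact: Ck_continuous CF Ux|exact: Ck_continuous CG Ux].
have dF x := Ck_derivable v (x := x) CF; have dG x := Ck_derivable v (x := x) CG.
split=> [x Ux|].
  by have [H1 _] := dF x Ux; have [H2 _] := dG x Ux; exact: (derivableD H1 H2).
apply: (@Ck_eq _ _ ('D_v F + 'D_v G)) => // [x Ux|].
  by have [H1 _] := dF x Ux; have [H2 _] := dG x Ux; exact: esym (deriveD H1 H2).
by apply: IH; exact: Ck_derive.
Qed.

Lemma Ck_mul k U F G : open U -> Ck k U F -> Ck k U G -> Ck k U (F * G).
Proof.
move=> oU; elim: k F G => [F G cF cG x Ux|k IH F G CF CG].
  by apply: continuousM; [exact: cF|exact: cG].
split=> [x Ux|v].
  by apply: continuousM; [exact: Ck_continuous CF Ux|exact: Ck_continuous CG Ux].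
have dF x := Ck_derivable v (x := x) CF; have dG x := Ck_derivable v (x := x) CG.
split=> [x Ux|].
  by have [H1 _] := dF x Ux; have [H2 _] := dG x Ux; exact: (derivableM H1 H2).
apply: (@Ck_eq _ _ (F * 'D_v G + G * 'D_v F)) => // [x Ux|].
  by have [H1 _] := dF x Ux; have [H2 _] := dG x Ux; exact: esym (deriveM H1 H2).
by apply: Ck_add => //; apply: IH; by [exact: CkW|exact: Ck_derive].
Qed.

(** The outer function comes with the whole sequence [hs] of its derivatives on [O], so that the
    induction can pass from [hs j] to [hs j.+1]. *)
Lemma Ck_comp (O : set R) (hs : nat -> R -> R) k U F j : open U ->
  (forall i t, O t -> is_derive t 1 (hs i) (hs i.+1 t)) ->
  (forall x, U x -> O (F x)) -> Ck k U F -> Ck k U (hs j \o F).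
Proof.
move=> oU dhs FO.
have chs i t : O t -> {for t, continuous (hs i)}.
  by move=> /(dhs i)[+ _] => /derivable1_diffP/differentiable_continuous.
elim: k j => [j cF x Ux|k IH j CF].
  by apply: continuous_comp; [exact: cF|exact/chs/FO].
have cF x (Ux : U x) := Ck_continuous CF Ux.
have dF x v (Ux : U x) := Ck_derivable v CF Ux.
split=> [x Ux|v]; first by apply: continuous_comp; [exact: cF|exact/chs/FO].
have dhF x (Ux : U x) := is_derive_comp (dF x v Ux) (dhs j _ (FO x Ux)).
split=> [x Ux|]; first by case: (dhF x Ux).
apply: (@Ck_eq _ _ ((hs j.+1 \o F) * 'D_v F)) => // [x Ux|].
  by case: (dhF x Ux).
by apply: Ck_mul => //; [apply: IH; exact: CkW|exact: Ck_derive].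
Qed.

End Ck.

Lemma Ck_affine (R : realType) (V V' : normedModType R) (l : V' -> V) (L : V' -> V) k
    (U : set V) (F : V -> R) :
  open U -> continuous l -> (forall x v (h : R), l (h *: v + x) = h *: L v + l x) ->
  Ck k U F -> Ck k (l @^-1` U) (F \o l).
Proof.
move=> oU cl lE.
have olU : open (l @^-1` U) by apply: open_comp => // x _; exact: cl.
elim: k F => [F cF x Ux|k IH F CF].
  by apply: continuous_comp; [exact: cl|exact: cF].
have dF x v (Ux : U (l x)) : is_derive x v (F \o l) ('D_(L v) F (l x)).
  by apply: (is_derive_affine (w := L v)); [move=> h; exact: lE|exact: Ck_derivable CF Ux].
split=> [x Ux|v].
  by apply: continuous_comp; [exact: cl|exact: Ck_continuous CF Ux].
split=> [x Ux|]; first by case: (dF x v Ux).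
apply: (@Ck_eq _ _ _ _ ('D_(L v) F \o l)) => // [x Ux|].
  by case: (dF x v Ux).
by apply: IH; exact: Ck_derive.
Qed.

(** * The flat function and the derivatives of powers *)

Section bump.
Context {R : realType}.

Lemma horner_bound (Q : {poly R}) : exists2 C, 0 <= C &
  forall s, 1 <= s -> `|Q.[s]| <= C * s ^+ size Q.
Proof.
exists (\sum_(i < size Q) `|Q`_i|); first by apply: sumr_ge0.
move=> s s1; rewrite horner_coef mulr_suml (le_trans (ler_norm_sum _ _ _))//.
apply: ler_sum => i _; rewrite normrM ler_wpM2l// normrX ger0_norm ?(le_trans ler01)//.
by rewrite ler_weXn2l// ltnW.
Qed.

(** With [s = 1/t], differentiating [P(s) exp(-s)] with respect to [t] gives
    [s^2 (P - P')(s) exp(-s)]. *)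
Fixpoint flat_poly (k : nat) : {poly R} :=
  if k is k'.+1 then 'X^2 * (flat_poly k' - (flat_poly k')^`()) else 1.

(* The derivatives of the flat function [exp(-1/t)] extended by 0. *)
Definition flat k (t : R) : R :=
  if 0 < t then (flat_poly k).[t^-1] * expR (- t^-1) else 0.

(** With [s = 1/t >= 1], the polynomial is at most a constant times [s^n] while [exp(s)] is at least
    [s^(n+2) / (n+2)!]; the two spare powers give [t^2]. *)
Lemma flat_bound k : exists2 C, 0 <= C & forall t, 0 < t <= 1 -> `|flat k t| <= C * t ^+ 2.
Proof.
have [C C0 HC] := horner_bound (flat_poly k); set n := size _ in HC.
exists (C * n.+2`!%:R); first by rewrite mulr_ge0.
move=> t /andP[t0 t1]; rewrite /flat t0 normrM (ger0_norm (expR_ge0 _)).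
have s1 : 1 <= t^-1 by rewrite invf_ge1.
have s0 : 0 < t^-1 by rewrite invr_gt0.
rewrite expRN ler_pdivrMr ?expR_gt0//.
apply: (le_trans (HC _ s1)); rewrite -!mulrA ler_wpM2l//.
have := @expR_ge1Dxn R t^-1 n.+1 (ltW s0).
move=> H; have {}H : t^-1 ^+ n.+2 / n.+2`!%:R <= expR t^-1.
  by apply: le_trans H; rewrite lerDr.
apply: (@le_trans _ _ (n.+2`!%:R * (t ^+ 2 * (t^-1 ^+ n.+2 / n.+2`!%:R)))).
  have -> : t^-1 ^+ n.+2 = t^-1 ^+ n * t^-1 ^+ 2 by rewrite -exprD addn2.
  have : (n.+2`!%:R : R) != 0 by rewrite pnatr_eq0 -lt0n fact_gt0.
  move: (n.+2`!%:R) (t^-1 ^+ n) => a b a0.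
  rewrite le_eqVlt; apply/orP; left; apply/eqP; field.
  by rewrite a0 gt_eqF.
rewrite [leRHS](_ : _ = n.+2`!%:R * (t ^+ 2 * expR t^-1)); last by rewrite expr2 !mulrA.
apply: ler_wpM2l => //; apply: ler_wpM2l; first by rewrite exprn_ge0// ltW.
exact: H.
Qed.

Lemma is_derive_flat k (t : R) : is_derive t (1 : R) (flat k) (flat k.+1 t).
Proof.
have [t0|t0|->] := ltgtP t 0.
- have -> : flat k.+1 t = 0 by rewrite /flat ltNge (ltW t0).
  apply: (@near_eq_is_derive _ _ _ (cst 0)).
    near=> s; rewrite /flat ltNge/= (_ : s <= 0)//.
    by apply: ltW; near: s; exact: lt_nbhsl.
- have -> : flat k.+1 t = (flat_poly k).[t^-1] * (t ^- 2 * expR (- t^-1)) +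
      (- t ^- 2 * (flat_poly k)^`().[t^-1]) * expR (- t^-1).
    rewrite /flat t0 /= hornerM hornerXn hornerD hornerN exprVn; ring.
  apply: (@near_eq_is_derive R R R (fun s : R => (flat_poly k).[s^-1] * expR (- s^-1) : R)).
    near=> s; rewrite /flat ifT//.
    by near: s; exact: lt_nbhsr.
  have tn0 : t != 0 by rewrite gt_eqF.
  have dV : is_derive t 1 (fun s : R => s^-1) (- t ^- 2).
    have := @is_deriveV R id t 1 1 tn0 (is_derive_id _ _).
    by rewrite [_ *: _]mulr1.
  have dN : is_derive t 1 (fun s : R => - s^-1) (t ^- 2).
    by have := @is_deriveN _ _ _ _ _ _ _ dV; rewrite opprK.
  have dE : is_derive t 1 (fun s => expR (- s^-1)) (t ^- 2 * expR (- t^-1)).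
    have dX : is_derive (- t^-1) (1 : R) expR (expR (- t^-1)).
      by split; [exact: derivable_expR|rewrite -[LHS]/(('D_1 (@expR R)) (- t^-1)) derive_expR].
    by have := @is_derive1_comp R expR (fun s => - s^-1) t _ _ dX dN; rewrite mulrC.
  have dP : is_derive t 1 (fun s => (flat_poly k).[s^-1]) (- t ^- 2 * (flat_poly k)^`().[t^-1]).
    have := @is_derive1_comp R (horner (flat_poly k)) (fun s => s^-1) t _ _
      (is_derive_poly _ _) dV.
    by rewrite mulrC.
  apply: (is_derive_eq (is_deriveM dP dE)).
  by rewrite /GRing.scale/=; ring.
have -> : flat k.+1 0 = 0 by rewrite /flat ltxx.
have [C C0 HC] := flat_bound k.
(* The quadratic bound leaves a factor [h] in the difference quotient at 0. *)
have H : (fun h => h^-1 *: ((flat k \o shift 0) (h *: (1 : R)) - flat k 0)) @ 0^' --> (0 : R).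
  apply/cvgrPdist_lt => e e0; near=> h.
  rewrite sub0r normrN /= addr0 [flat k 0]/flat ltxx subr0 [_%:A]mulr1.
  have [h0|h0] := leP h 0; first by rewrite /flat (le_gtF h0) scaler0 normr0.
  have h1 : h <= 1.
    by rewrite (le_trans (ler_norm _))//; near: h; apply: dnbhs0_le.
  have hb : 0 < h <= 1 by rewrite h0.
  rewrite normrZ normfV (ger0_norm (ltW h0)) ltr_pdivrMl//.
  apply: (le_lt_trans (HC _ hb)); rewrite mulrC expr2 -mulrA ltr_pM2l//.
  apply: (@le_lt_trans _ _ (h * (C + 1))); first by rewrite ler_pM2l// lerDl.
  rewrite -ltr_pdivlMr ?ltr_wpDl//.
  rewrite (le_lt_trans (ler_norm _))//; near: h; apply: dnbhs0_lt.
  by rewrite divr_gt0// ltr_wpDl.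
by split; [apply/cvg_ex; exists 0|exact: cvg_lim H].
Unshelve. all: by end_near. Qed.

Lemma flat_gt0 t : (0 < flat 0 t) = (0 < t).
Proof. by rewrite /flat; case: ifP; rewrite ?ltxx// /= hornerE mul1r expR_gt0. Qed.

Lemma flat_ge0 t : 0 <= flat 0 t.
Proof. by rewrite /flat; case: ifP => // _; rewrite /= hornerE mul1r expR_ge0. Qed.

Lemma flat_le1 t : flat 0 t <= 1.
Proof.
rewrite /flat; case: ifP => // t0; rewrite /= hornerE mul1r expR_le1.
by rewrite oppr_le0 invr_ge0 ltW.
Qed.

(** The falling factorial [a (a - 1) ... (a - k + 1)]. *)
Definition powR_coef (a : R) k := \prod_(i < k) (a - i%:R).

Lemma is_derive_powR_iter a k (t : R) : 0 < t ->
  is_derive t (1 : R) (fun t => powR_coef a k * t `^ (a - k%:R)) (powR_coef a k.+1 * t `^ (a - k.+1%:R)).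
Proof.
move=> t0.
have := @is_derive1_powR R (a - k%:R) t t0.
move=> /(@is_deriveZ _ _ _ _ (powR_coef a k) _ _).
rewrite /powR_coef big_ord_recr/= -mulrA -addn1 natrD opprD addrA.
exact.
Qed.

End bump.

(** * Smooth functions on arbitrary sets *)

Section smooth_on.
Context {R : realType} {V : normedModType R}.
Implicit Types (U A : set V) (F G f h : V -> R).

Lemma smooth_on_eq A f h : (forall x, A x -> f x = h x) -> smooth_on A f -> smooth_on A h.
Proof.
move=> fh sf x Ax; have [U [F [oU Ux CF Ff]]] := sf x Ax.
by exists U, F; split => // y Uy Ay; rewrite Ff// fh.
Qed.

Lemma smooth_onS A B f : A `<=` B -> smooth_on B f -> smooth_on A f.
Proof.
move=> AB sf x /AB Bx; have [U [F [oU Ux CF Ff]]] := sf x Bx.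
by exists U, F; split => // y Uy /AB By; exact: Ff.
Qed.

Lemma smooth_on_local A f : (forall x, A x -> exists U, [/\ open U, U x & smooth_on (A `&` U) f]) ->
  smooth_on A f.
Proof.
move=> H x Ax; have [U [oU Ux /(_ x (conj Ax Ux))[U' [F [oU' U'x CF Ff]]]]] := H x Ax.
exists (U `&` U'), F; split => //; first exact: openI.
  by move=> k; apply: Ck_sub (CF k) => y [].
by move=> y [Uy U'y] Ay; apply: Ff.
Qed.

Lemma smooth_on_Ck A f : open A -> (forall k, Ck k A f) -> smooth_on A f.
Proof. by move=> oA Cf x Ax; exists A, f; split. Qed.

Lemma smooth_on_cst A (c : R) : smooth_on A (cst c).
Proof. by move=> x Ax; exists setT, (cst c); split => //; [exact: openT|move=> k; exact: Ck_cst]. Qed.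

Lemma smooth_onD A f h : smooth_on A f -> smooth_on A h -> smooth_on A (fun x => f x + h x).
Proof.
move=> sf sh x Ax; have [U [F [oU Ux CF Ff]]] := sf x Ax.
have [U' [G [oU' U'x CG Gh]]] := sh x Ax.
exists (U `&` U'), (F + G); split => //; first exact: openI.
  move=> k; apply: Ck_add; first exact: openI.
    by apply: Ck_sub (CF k) => y [].
  by apply: Ck_sub (CG k) => y [].
by move=> y [Uy U'y] Ay; rewrite -Ff// -Gh.
Qed.

Lemma smooth_onM A f h : smooth_on A f -> smooth_on A h -> smooth_on A (fun x => f x * h x).
Proof.
move=> sf sh x Ax; have [U [F [oU Ux CF Ff]]] := sf x Ax.
have [U' [G [oU' U'x CG Gh]]] := sh x Ax.
exists (U `&` U'), (F * G); split => //; first exact: openI.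
  move=> k; apply: Ck_mul; first exact: openI.
    by apply: Ck_sub (CF k) => y [].
  by apply: Ck_sub (CG k) => y [].
by move=> y [Uy U'y] Ay; rewrite -Ff// -Gh.
Qed.

Lemma smooth_onN A f : smooth_on A f -> smooth_on A (fun x => - f x).
Proof.
move=> sf; apply: (@smooth_on_eq _ (fun x => cst (-1) x * f x)).
  by move=> x _; rewrite mulN1r.
by apply: smooth_onM => //; exact: smooth_on_cst.
Qed.

Lemma smooth_onB A f h : smooth_on A f -> smooth_on A h -> smooth_on A (fun x => f x - h x).
Proof. by move=> sf sh; apply: smooth_onD => //; exact: smooth_onN. Qed.

Lemma smooth_on_sum A (J : Type) (r : seq J) (P : pred J) (f : J -> V -> R) :
  (forall i, smooth_on A (f i)) -> smooth_on A (fun x => \sum_(i <- r | P i) f i x).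
Proof.
move=> sf; elim: r => [|i r IH].
  apply: smooth_on_eq; last exact: (@smooth_on_cst A 0).
  move=> x _.
  by rewrite big_nil.
apply: (@smooth_on_eq _ (fun x => (if P i then f i x else 0) + \sum_(i <- r | P i) f i x)).
  by move=> x _; rewrite big_cons; case: (P i) => //; rewrite add0r.
apply: smooth_onD => //.
by case: (P i); [exact: sf|exact: smooth_on_cst].
Qed.

Lemma smooth_on_prod A (J : Type) (r : seq J) (P : pred J) (f : J -> V -> R) :
  (forall i, smooth_on A (f i)) -> smooth_on A (fun x => \prod_(i <- r | P i) f i x).
Proof.
move=> sf; elim: r => [|i r IH].
  apply: smooth_on_eq; last exact: (@smooth_on_cst A 1).
  move=> x _.
  by rewrite big_nil.
apply: (@smooth_on_eq _ (fun x => (if P i then f i x else 1) * \prod_(i <- r | P i) f i x)).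
  by move=> x _; rewrite big_cons; case: (P i) => //; rewrite mul1r.
apply: smooth_onM => //.
by case: (P i); [exact: sf|exact: smooth_on_cst].
Qed.

Lemma smooth_onX A f n : smooth_on A f -> smooth_on A (fun x => f x ^+ n).
Proof.
move=> sf; elim: n => [|n IH]; first exact: smooth_on_cst.
apply: (@smooth_on_eq _ (fun x => f x * f x ^+ n)); first by move=> x _; rewrite exprS.
exact: smooth_onM.
Qed.

Lemma smooth_on_continuous A f x : smooth_on A f -> A x ->
  exists F, {for x, continuous F} /\ \forall y \near x, A y -> F y = f y.
Proof.
move=> sf Ax; have [U [F [oU Ux CF Ff]]] := sf x Ax.
exists F; split; first exact: (CF 0%N).
by apply: filterS (open_nbhs_nbhs (conj oU Ux)) => y Uy; exact: Ff.
Qed.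

Lemma smooth_on_comp A (O : set R) (hs : nat -> R -> R) f : open O ->
  (forall i t, O t -> is_derive t (1 : R) (hs i) (hs i.+1 t)) ->
  (forall x, A x -> O (f x)) -> smooth_on A f -> smooth_on A (hs 0%N \o f).
Proof.
move=> oO dhs fO sf x Ax; have [U [F [oU Ux CF Ff]]] := sf x Ax.
have cF : {in U, continuous F}.
  by move=> y; rewrite inE => Uy; exact: (CF 0%N).
have oUO : open (U `&` F @^-1` O).
  rewrite openE => y [Uy Oy]; apply: filterI; first exact: open_nbhs_nbhs.
  by apply: cF; [rewrite inE|exact: open_nbhs_nbhs].
exists (U `&` F @^-1` O), (hs 0%N \o F); split => //.
- by split => //=; rewrite Ff//; exact: fO.
- move=> k; apply: (Ck_comp 0 oUO dhs) => [y []//|].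
  by apply: Ck_sub (CF k) => y [].
- by move=> y [Uy _] Ay /=; rewrite Ff.
Qed.

(** The exponents -1 and 1/2 will give inverses and square roots, as needed for the inverse metric
    and the volume density. *)
Lemma smooth_on_powR A f (a : R) : (forall x, A x -> 0 < f x) ->
  smooth_on A f -> smooth_on A (fun x => f x `^ a).
Proof.
move=> f0 sf.
have := @smooth_on_comp A [set t | 0 < t]
  (fun k t => powR_coef a k * t `^ (a - k%:R)) f (@open_gt _ 0)
  (fun k t t0 => is_derive_powR_iter a k t0) f0 sf.
by apply: smooth_on_eq => x _ /=; rewrite /powR_coef big_ord0 mul1r subr0.
Qed.

Lemma smooth_onV A f : (forall x, A x -> 0 < f x) ->
  smooth_on A f -> smooth_on A (fun x => (f x)^-1).
Proof.
move=> f0 sf; apply: smooth_on_eq; last exact: (smooth_on_powR (- 1) f0 sf).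
move=> x Ax.
by rewrite /= powR_inv1// ltW// f0.
Qed.

Lemma smooth_on_sqrt A f : (forall x, A x -> 0 < f x) ->
  smooth_on A f -> smooth_on A (fun x => Num.sqrt (f x)).
Proof.
move=> f0 sf; apply: smooth_on_eq; last exact: (smooth_on_powR 2^-1 f0 sf).
move=> x Ax.
by rewrite /= powR12_sqrt// ltW// f0.
Qed.

Lemma smooth_on_flat A f : smooth_on A f -> smooth_on A (fun x => flat 0 (f x)).
Proof.
move=> sf.
exact: (smooth_on_comp (O := setT) openT (fun k t _ => is_derive_flat k t)).
Qed.

End smooth_on.

Lemma smooth_on_affine (R : realType) (V V' : normedModType R) (l L : V' -> V)
    (A : set V) (f : V -> R) :
  continuous l -> (forall x v (h : R), l (h *: v + x) = h *: L v + l x) ->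
  smooth_on A f -> smooth_on (l @^-1` A) (f \o l).
Proof.
move=> cl lE sf x Ax; have [U [F [oU Ux CF Ff]]] := sf (l x) Ax.
exists (l @^-1` U), (F \o l); split => //.
- by apply: open_comp => // y _; exact: cl.
- by move=> k; exact: (Ck_affine oU cl lE).
- by move=> y Uy Ay; apply: Ff.
Qed.

Section segment.
Context {R : realType} {V : normedModType R}.
Implicit Types (U : set V) (F : V -> R).

Lemma is_derive_segment F (p v : V) (t d : R) :
  is_derive (t *: v + p) v F d -> is_derive t (1 : R) (fun t : R => F (t *: v + p)) d.
Proof.
apply: (is_derive_affine (l := fun t : R => t *: v + p)) => h.
by rewrite scalerDl addrA [_ *: 1]mulr1.
Qed.

Lemma is_derive_scale F (x v : V) (c d : R) :
  is_derive x v F d -> is_derive x (c *: v) F (c * d).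
Proof.
move=> /is_derive_line dF; apply/is_derive_line.
have -> : (fun h : R => F (h *: (c *: v) + x)) = (fun h => F (h *: v + x)) \o (fun h => h * c).
  by apply/funext => h /=; rewrite scalerA.
rewrite mulrC; apply: is_derive1_comp; first by rewrite mul0r.
have H := @is_deriveM R R id (cst c) 0 1 1 0 (is_derive_id _ _) (is_derive_cst _ _ _).
apply: (@is_derive_eq _ _ _ _ _ _ _ _ H).
by rewrite scaler0 add0r [_ *: _]mulr1.
Qed.

Lemma MVT_line F U (p v : V) : (forall t : R, 0 <= t <= 1 -> U (t *: v + p)) ->
  Ck 1 U F -> exists2 t : R, 0 <= t <= 1 & F (v + p) - F p = 'D_v F (t *: v + p).
Proof.
move=> pU CF.
have dF (t : R) : 0 <= t <= 1 ->
    is_derive t (1 : R) (fun t : R => F (t *: v + p)) ('D_v F (t *: v + p)).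
  by move=> /pU Ut; apply: is_derive_segment; exact: Ck_derivable CF Ut.
have cont : {within `[0 : R, 1], continuous (fun t : R => F (t *: v + p))}.
  apply: continuous_in_subspaceT => t; rewrite inE/= in_itv/= => t01.
  by have [+ _] := dF t t01 => /derivable1_diffP/differentiable_continuous.
have dF' (t : R) : t \in `]0, 1[ ->
    is_derive t (1 : R) (fun t : R => F (t *: v + p)) ('D_v F (t *: v + p)).
  by rewrite in_itv/= => /andP[t0 t1]; apply: dF; rewrite !ltW.
have [t t01] := MVT_segment ler01 dF' cont.
rewrite scale1r scale0r add0r subr0 mulr1 => E; exists t => //.
Qed.

End segment.

Lemma coord_le_norm {R : realType} m n (x : 'M[R]_(m, n)) i j : `|x i j| <= `|x|.
Proof.
rewrite [leRHS]mx_normrE.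
exact: (le_bigmax _ (fun k : 'I_m * 'I_n => `|x k.1 k.2|) (i, j)).
Qed.

(** * Strict differentiability and the chain rule *)

Section strict.
Context {R : realType} {n : nat}.
Implicit Types (U : set 'rV[R]_n) (F : 'rV[R]_n -> R).
Local Notation e_ k := (delta_mx (ord0 : 'I_1) k : 'rV[R]_n).

(** The point [z] is reached from [y] by changing one coordinate at a time, with the mean value
    theorem on each edge. Both points vary: this controls the images of small cubes whose centres
    are close to [x0], and not only at [x0]. *)
Lemma C1_strict U F (x0 : 'rV[R]_n) (e : R) : open U -> Ck 1 U F -> U x0 -> 0 < e ->
  exists2 d : R, 0 < d & ball x0 d `<=` U /\ forall y z, ball x0 d y -> ball x0 d z ->
    `|F z - F y - \sum_k (z - y) ord0 k * 'D_(e_ k) F x0| <= e * `|z - y|.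
Proof.
(* Each of the [n] edges contributes an error [e']; dividing by [n.+1] also covers [n = 0]. *)
move=> oU CF Ux0 e0; pose e' := e / n.+1%:R.
have e'0 : 0 < e' by rewrite divr_gt0.
have [d /= d0 dU] : exists2 d : R, 0 < d & forall x, ball x0 d x ->
    U x /\ forall k, `|'D_(e_ k) F x0 - 'D_(e_ k) F x| < e'.
  have : \forall x \near x0, U x /\ forall k, `|'D_(e_ k) F x0 - 'D_(e_ k) F x| < e'.
    apply: filterI; first exact: open_nbhs_nbhs.
    have H : \forall x \near x0, forall k, `|'D_(e_ k) F x0 - 'D_(e_ k) F x| < e'.
      apply: (@filter_forall _ 'I_n (fun k x => `|'D_(e_ k) F x0 - 'D_(e_ k) F x| < e') _ (nbhs_filter x0)) => k.
      have /cvgrPdist_lt/(_ _ e'0)// : {for x0, continuous ('D_(e_ k) F)}.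
      exact: (Ck_continuous (Ck_derive (e_ k) CF)).
    exact: H.
  by move=> /nbhs_ballP[d /= d0 dP]; exists d.
exists d => //; split; first by move=> x /dU[].
move=> y z yd zd.
(* [p i] has the first [i] coordinates of [z] and the remaining ones of [y]. The edges stay in the
   ball, which is a cube, because every coordinate stays between those of [y] and [z]. *)
pose p (i : nat) : 'rV[R]_n := \row_k (if (k < i)%N then z ord0 k else y ord0 k).
have pd i (t : R) : 0 <= t <= 1 -> forall k : 'I_n, i = k :> nat ->
    ball x0 d (t *: (((z - y) ord0 k) *: e_ k) + p i).
  move=> /andP[t0 t1] k ik; split=> // a b; rewrite (ord1 a) !mxE eqxx/= ik.
  have [->|bk] := eqVneq b k.
    rewrite ltnn mulr1 (_ : _ + _ = (1 - t) * y ord0 k + t * z ord0 k); last by ring.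
    have := yd.2 ord0 k; have := zd.2 ord0 k; rewrite /ball/= => zk yk.
    rewrite (_ : _ - _ = (1 - t) * (x0 ord0 k - y ord0 k) + t * (x0 ord0 k - z ord0 k)); last by ring.
    rewrite (le_lt_trans (ler_normD _ _))// !normrM (ger0_norm t0) ger0_norm ?subr_ge0//.
    have [t10|t1'] := eqVneq t 1; first by rewrite t10 subrr mul0r add0r mul1r.
    rewrite (_ : d = (1 - t) * d + t * d); last by ring.
    rewrite ltr_leD// ?ler_wpM2l// ?(ltW zk)// ltr_pM2l// subr_gt0 lt_neqAle t1' t1//.
  rewrite mulr0 mulr0 add0r; case: ifP => _; [exact: zd.2|exact: yd.2].
have pS i : exists c : R, `|c| <= e' /\ ((i < n)%N -> forall k : 'I_n, i = k :> nat ->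
    F (p i.+1) - F (p i) = (z - y) ord0 k * ('D_(e_ k) F x0 + c)).
  have [ni|i_lt] := leqP n i.
    by exists 0; split; rewrite ?normr0 ?(ltW e'0)// => /(leq_trans _)/(_ ni); rewrite ltnn.
  pose k := Ordinal i_lt; set v := ((z - y) ord0 k) *: e_ k.
  have [t t01 E] := MVT_line (fun t t01 => (dU _ (pd i t t01 k erefl)).1) CF.
  exists ('D_(e_ k) F (t *: v + p i) - 'D_(e_ k) F x0); split.
    by rewrite distrC ltW//; apply: (dU _ (pd i t t01 k erefl)).2.
  move=> _ k' ik'; have -> : k' = k by apply/val_inj; exact: esym ik'.
  have -> : p i.+1 = v + p i.
    apply/rowP => b; rewrite !mxE eqxx/= ltnS leq_eqVlt.
    have [->|bk] := eqVneq b k; first by rewrite eqxx ltnn mulr1 subrK.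
    rewrite mulr0 add0r (_ : (b == i :> nat) = false)//.
    by apply/negbTE; apply: contra bk => /eqP bi; apply/eqP/val_inj.
  rewrite E [X in _ * X]addrC subrK.
  have := Ck_derivable (e_ k) CF (dU _ (pd i t t01 k erefl)).1.
  by move=> /is_derive_scale-/(_ ((z - y) ord0 k))[_ ->].
have p0 : p 0%N = y by apply/rowP => k; rewrite mxE ltn0.
have pn : p n = z by apply/rowP => k; rewrite mxE ltn_ord.
pose c i := projT1 (cid (pS i)).
have cP i := projT2 (cid (pS i)).
have -> : F z - F y = \sum_k (z - y) ord0 k * ('D_(e_ k) F x0 + c k).
  transitivity (F (p n) - F (p 0%N)); first by rewrite pn p0.
  rewrite -(telescope_sumr (fun i => F (p i)) (leq0n n)) big_mkord.
  by apply: eq_bigr => k _; rewrite ((cP k).2 (ltn_ord k) k erefl).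
rewrite -sumrB (eq_bigr (fun k => (z - y) ord0 k * c k)); last first.
  by move=> k _; ring.
rewrite (le_trans (ler_norm_sum _ _ _))//.
apply: (@le_trans _ _ (\sum_(k < n) `|z - y| * e')).
  apply: ler_sum => k _; rewrite normrM ler_pM//; [exact: coord_le_norm|exact: (cP k).1].
rewrite sumr_const card_ord -mulr_natr -mulrA (mulrC e); apply: ler_wpM2l => //.
by rewrite /e' mulrAC ler_pdivrMr// ler_pM2l// ler_nat.
Qed.

End strict.

Lemma mx_norm_le {R : realType} m n (x : 'M[R]_(m, n)) (M : R) : 0 <= M ->
  (forall i j, `|x i j| <= M) -> `|x| <= M.
Proof.
move=> M0 xM; rewrite [leLHS]mx_normrE.
by apply/bigmax_leP; split => // -[i j] _; exact: xM.
Qed.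

Section chain.
Context {R : realType}.

(** Of the curve [c], only the derivative at 0 is assumed. Strict differentiability of [F] makes the
    remainder small compared with the distance from [c 0] to [c h], which is of the order of [h]. *)
Lemma is_derive_chain1 m (U : set 'rV[R]_m) (F : 'rV[R]_m -> R) (c : R -> 'rV[R]_m)
    (dc : 'I_m -> R) : open U -> Ck 1 U F -> U (c 0) ->
  (forall l, is_derive (0 : R) (1 : R) (fun h => c h ord0 l) (dc l)) ->
  is_derive (0 : R) (1 : R) (F \o c)
    (\sum_l 'D_(delta_mx ord0 l) F (c 0) * dc l).
Proof.
move=> oU CF Uc dcl.
pose q l (h : R) := h^-1 * (c h ord0 l - c 0 ord0 l).
have ql l : q l @ 0^' --> dc l.
  have [d1 d2] := dcl l.
  have <- : (fun h : R => h^-1 *: (((fun h => c h ord0 l) \o shift 0) (h *: (1 : R)) - c 0 ord0 l)) = q l.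
    by apply/funext => h; rewrite /q/= addr0 [h *: _]mulr1.
  by rewrite -d2; exact: d1.
have cc : {for 0, continuous c}.
  apply: continuous_rV => l; have [d _] := dcl l.
  by move: d => /derivable1_diffP/differentiable_continuous.
have H : (fun h : R => h^-1 * (F (c h) - F (c 0))) @ 0^' -->
    \sum_l 'D_(delta_mx ord0 l) F (c 0) * dc l.
  have -> : (fun h : R => h^-1 * (F (c h) - F (c 0))) =
      (fun h => (\sum_l 'D_(delta_mx ord0 l) F (c 0) * q l h) +
        h^-1 * (F (c h) - F (c 0) - \sum_l (c h - c 0) ord0 l * 'D_(delta_mx ord0 l) F (c 0))).
    apply/funext => h.
    have -> : \sum_l 'D_(delta_mx ord0 l) F (c 0) * q l h =
        h^-1 * \sum_l (c h - c 0) ord0 l * 'D_(delta_mx ord0 l) F (c 0).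
      by rewrite mulr_sumr; apply: eq_bigr => l _; rewrite /q !mxE; ring.
    by rewrite -mulrDr; congr (_ * _); ring.
  rewrite -[X in _ --> X]addr0; apply: cvgD.
    have cs (r : seq 'I_m) : (fun h => \sum_(l <- r) 'D_(delta_mx ord0 l) F (c 0) * q l h) @ 0^' -->
       \sum_(l <- r) 'D_(delta_mx ord0 l) F (c 0) * dc l.
      elim: r => [|l r IH].
        rewrite big_nil (_ : (fun h => _) = cst 0); first exact: cvg_cst.
        by apply/funext => h; rewrite big_nil.
      rewrite big_cons (_ : (fun h => _) = fun h => 'D_(delta_mx ord0 l) F (c 0) * q l h +
        \sum_(l <- r) 'D_(delta_mx ord0 l) F (c 0) * q l h); last first.
        by apply/funext => h; rewrite big_cons.
      by apply: cvgD => //; apply: cvgM; [exact: cvg_cst|exact: ql].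
    exact: cs.
  (* A common bound, near 0, for the difference quotients of all the coordinates. *)
  pose M := 1 + \sum_l `|dc l|.
  have M0 : 0 < M by rewrite ltr_pwDl// sumr_ge0.
  apply/cvgrPdist_lt => e e0.
  have e'0 : 0 < e / (2 * M) by rewrite divr_gt0// mulr_gt0.
  have [d d0 [_ Hd]] := C1_strict oU CF Uc e'0.
  near=> h.
  have h0 : 0 < `|h| by rewrite normr_gt0; near: h; exact: nbhs_dnbhs_neq.
  have qM : forall l, `|q l h| <= M.
    near: h; apply: filter_forall => l.
    have := ql l => /cvgrPdist_le/(_ 1 ltr01); apply: filterS => h H1.
    rewrite -[q l h](subrK (dc l)) (le_trans (ler_normD _ _))// lerD//.
      by rewrite distrC.
    by rewrite (bigD1 l)//= lerDl sumr_ge0.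
  have chM : `|c h - c 0| <= M * `|h|.
    apply: mx_norm_le; first by rewrite mulr_ge0// ltW.
    move=> i l; rewrite (ord1 i) !mxE.
    have := qM l; rewrite normrM normfV ler_pdivrMl// mulrC; exact.
  rewrite sub0r normrN normrM normfV ltr_pdivrMl//.
  have chd : ball (c 0) d (c h).
    near: h; apply: nbhs_dnbhs; exact: (cc _ (nbhsx_ballx (c 0) d d0)).
  apply: (le_lt_trans (Hd _ _ (ballxx _ d0) chd)).
  apply: (@le_lt_trans _ _ (e / (2 * M) * (M * `|h|))); first by rewrite ler_wpM2l// ltW.
  have -> : e / (2 * M) * (M * `|h|) = `|h| * (e / 2) by field; rewrite gt_eqF.
  by rewrite ltr_pM2l// gtr_pMr// invf_lt1// ltr1n.
have E : (fun h : R => h^-1 *: (((F \o c) \o shift 0) (h *: 1) - (F \o c) 0)) =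
    (fun h : R => h^-1 * (F (c h) - F (c 0))).
  by apply/funext => h /=; rewrite addr0 [h *: 1]mulr1.
split; first by rewrite /derivable E; apply/cvg_ex; eexists; exact: H.
by rewrite /derive E; exact: (cvg_lim (@Rhausdorff R)).
Unshelve. all: by end_near. Qed.

Lemma is_derive_chain (V : normedModType R) m (U : set 'rV[R]_m) (F : 'rV[R]_m -> R)
    (T : V -> 'rV[R]_m) (x v : V) (dT : 'I_m -> R) : open U -> Ck 1 U F -> U (T x) ->
  (forall l, is_derive x v (fun y => T y ord0 l) (dT l)) ->
  is_derive x v (F \o T) (\sum_l 'D_(delta_mx ord0 l) F (T x) * dT l).
Proof.
move=> oU CF UT dTl; apply/is_derive_line.
have := @is_derive_chain1 _ U F (fun h : R => T (h *: v + x)) dT oU CF.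
rewrite scale0r add0r; apply => // l; exact: (iffLR (is_derive_line _ _ _ _) (dTl l)).
Qed.

End chain.

(** * Partial derivatives up to the boundary hyperplane *)

Section partial.
Context {R : realType}.

Lemma rderiveE (V : normedModType R) (f F : V -> R) (x v : V) (d : R) :
  (\forall h \near (0 : R)^'+, f (x + h *: v) = F (x + h *: v)) -> f x = F x ->
  is_derive x v F d -> rderive f x v = d.
Proof.
move=> fF fx [dF <-].
rewrite /rderive; apply: (cvg_lim (@Rhausdorff R)).
have : (fun h : R => h^-1 *: ((F \o shift x) (h *: v) - F x)) @ 0^' --> 'D_v F x by exact: dF.
move=> dF'; have {}dF' : (fun h : R => h^-1 *: ((F \o shift x) (h *: v) - F x)) @ 0^'+ --> 'D_v F x.
  exact: cvg_dnbhs_at_right.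
apply: cvg_trans dF'; apply: near_eq_cvg.
by apply: filterS fF => h /=; rewrite fx addrC => ->.
Qed.

(** From a point of the half space, right-hand difference quotients stay in the half space, so any
    local extension [F] computes the partial derivative, boundary points included. *)
Lemma partialE n (W : set 'rV[R]_n.+1) (f F : 'rV[R]_n.+1 -> R) (x : 'rV[R]_n.+1) j (d : R) :
  open W -> W x -> half_space x ->
  (forall y, W y -> half_space y -> f y = F y) ->
  is_derive x (delta_mx ord0 j) F d -> partial j f x = d.
Proof.
move=> oW Wx Hx fF; apply: rderiveE; last exact: fF.
near=> h; apply: fF.
  near: h; apply: cvg_within.
  have : {for 0, continuous (fun h : R => x + h *: (delta_mx ord0 j : 'rV[R]_n.+1))}.
    apply: cvgD; first exact: cvg_cst.
    by apply: cvgZr_tmp; exact: cvg_id.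
  by apply; rewrite scale0r addr0; exact: open_nbhs_nbhs.
rewrite /half_space/= !mxE/= addr_ge0// mulr_ge0//.
Unshelve. all: by end_near. Qed.

End partial.

(** * Smooth functions and integration on the manifold *)

Section posdef.
Context {R : realType}.

Lemma posdef_det_neq0 n (G : 'M[R]_n) :
  (forall v : 'rV[R]_n, v != 0 -> 0 < (v *m G *m v^T) ord0 ord0) -> \det G != 0.
Proof.
move=> Gpos; rewrite -unitfE -unitmxE -row_free_unit -kermx_eq0.
apply/negP => /negP/rowV0Pn[v]; rewrite sub_kermx => /eqP vG /Gpos.
by rewrite vG mul0mx mxE ltxx.
Qed.

(* Deform [G] linearly to the identity: the determinant does not vanish on the way. *)
Lemma posdef_det_gt0 n (G : 'M[R]_n) :
  (forall v : 'rV[R]_n, v != 0 -> 0 < (v *m G *m v^T) ord0 ord0) -> 0 < \det G.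
Proof.
move=> Gpos.
have vv (v : 'rV[R]_n) : (v *m v^T) ord0 ord0 = \sum_i v ord0 i ^+ 2.
  by rewrite mxE; apply: eq_bigr => i _; rewrite mxE expr2.
have vv0 (v : 'rV[R]_n) : 0 <= (v *m v^T) ord0 ord0.
  by rewrite vv sumr_ge0// => i _; rewrite sqr_ge0.
pose Mt (t : R) := (1 - t) *: G + t%:M.
have Mneq0 t : 0 <= t <= 1 -> \det (Mt t) != 0.
  move=> /andP[t0 t1]; apply: posdef_det_neq0 => v v0.
  have -> : (v *m Mt t *m v^T) ord0 ord0 =
      (1 - t) * (v *m G *m v^T) ord0 ord0 + t * (v *m v^T) ord0 ord0.
    rewrite /Mt mulmxDr mulmxDl -scalemxAr -scalemxAl mul_mx_scalar -scalemxAl.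
    by rewrite [LHS]mxE; congr (_ + _); rewrite [LHS]mxE.
  have [t1'|t1'] := eqVneq t 1.
    rewrite t1' subrr mul0r add0r mul1r lt_neqAle vv0 andbT eq_sym.
    apply: contra v0; rewrite vv psumr_eq0 => [/allP v0|i _]; last exact: sqr_ge0.
    apply/eqP/rowP => i; have := v0 i; rewrite mem_index_enum => /(_ isT).
    by rewrite sqrf_eq0 => /eqP ->; rewrite mxE.
  by rewrite ltr_pwDl ?mulr_ge0// mulr_gt0 ?Gpos// subr_gt0 lt_neqAle t1'.
(* Along the deformation the determinant is a polynomial in the parameter, so the intermediate value
   theorem for polynomials applies. *)
pose P : {poly R} := \det ((1 - 'X) *: map_mx polyC G + 'X%:M).
have PE t : P.[t] = \det (Mt t).
  rewrite /P -horner_evalE -det_map_mx; congr (\det _); apply/matrixP => i j.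
  by rewrite !mxE /= /horner_eval !hornerE !hornerMn hornerX.
rewrite ltNge; apply/negP => G0.
have P0 : P.[0] <= 0 by rewrite PE /Mt subr0 scale1r raddf0 addr0.
have P1 : 0 <= P.[1] by rewrite PE /Mt subrr scale0r add0r det1 ler01.
have [t t01 /rootP Pt] := @poly_ivt R P 0 1 ler01 ltac:(by rewrite P0 P1).
by have := Mneq0 t t01; rewrite -PE Pt eqxx.
Qed.

(** Cramer's rule. It relates the volume density of the boundary to the normal entry of the inverse
    metric, and thereby the flux through the boundary to the Riemannian boundary measure. *)
Lemma invmx00 n (G : 'M[R]_n.+1) : \det G != 0 ->
  \det (bd_metric G) = \det G * invmx G ord0 ord0.
Proof.
move=> G0; rewrite /invmx unitmxE unitfE G0 !mxE mulrA mulfV// mul1r.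
rewrite /cofactor (_ : (-1) ^+ _ = 1 :> R) ?mul1r//; congr (\det _); apply/matrixP => i j.
by rewrite !mxE; congr (G _ _); exact/val_inj.
Qed.

End posdef.

(** * Charts and bump functions *)

Section charts.
Context {R : realType} {n : nat} {M : ptopologicalType} (I : Type).
Variable A : I -> chart R n M.
Hypothesis A_manifold : is_manifold A.
Implicit Types (i j : I) (x : 'rV[R]_n.+1) (p : M).
Local Notation im i := (chart_image (A i)).
Local Notation phi i := (chart_map (A i)).
Local Notation par i := (param (A i)).

Lemma chartP i : is_chart (A i). Proof. exact: (manifold_chart A_manifold). Qed.

Lemma chart_mapK i p : dom (A i) p -> par i (phi i p) = p.
Proof. exact: (chartK (chartP i)). Qed.

Lemma im_chart i p : dom (A i) p -> im i (phi i p).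
Proof. by move=> ip; exists p. Qed.

Lemma param_dom i x : im i x -> dom (A i) (par i x).
Proof. by move=> [p ip <-]; rewrite chart_mapK. Qed.

Lemma paramK i x : im i x -> phi i (par i x) = x.
Proof. by move=> [p ip <-]; rewrite chart_mapK. Qed.

Lemma im_half i x : im i x -> half_space x.
Proof. by have [W _ ->] := chart_image_open (chartP i) => -[]. Qed.

Lemma overlapP i j x : overlap A i j x <-> im i x /\ dom (A j) (par i x).
Proof.
split=> [[p [ip jp] <-]|[ix jx]].
  by split; [exact: im_chart|rewrite chart_mapK].
by exists (par i x); [split => //; exact: param_dom|rewrite paramK].
Qed.

Lemma overlap_im i j x : overlap A i j x -> im i x.
Proof. by case/overlapP. Qed.

Lemma overlap_sym i j x : overlap A i j x -> overlap A j i (phi j (par i x)).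
Proof.
move=> /overlapP[ix jx]; apply/overlapP; split; first exact: im_chart.
by rewrite chart_mapK//; exact: param_dom.
Qed.

Lemma transitionK i j x : overlap A i j x -> phi i (par j (phi j (par i x))) = x.
Proof. by move=> /overlapP[ix jx]; rewrite chart_mapK// paramK. Qed.

Lemma param_near i x (O : set M) : im i x -> open O -> O (par i x) ->
  exists V : set 'rV[R]_n.+1, [/\ open V, V x &
    forall y, V y -> half_space y -> im i y /\ O (par i y)].
Proof.
move=> ix oO Ox; have [W oW imW] := chart_image_open (chartP i).
have cpar := chart_param_cont (chartP i).
have /continuousP/(_ _ oO)/open_subspaceP[V oV VE] := cpar.
exists (V `&` W); split; first exact: openI.
  have Wx : W x by move: ix; rewrite imW => -[].
  split => //.
  by have [] : (V `&` im i) x by rewrite VE.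
move=> y [Vy Wy] Hy; have iy : im i y by rewrite imW.
by split => //; have [] : (par i @^-1` O `&` im i) y by rewrite -VE.
Qed.

Lemma half_spaceE : @half_space R n = [set x : 'rV[R]_n.+1 | 0 <= x ord0 ord0].
Proof. by []. Qed.

Lemma closed_half_space : closed (@half_space R n).
Proof.
rewrite half_spaceE (_ : [set _ | _] = (fun x : 'rV[R]_n.+1 => x ord0 ord0) @^-1` [set t | 0 <= t])//.
by apply: closed_comp => [x _|]; [exact: coord_continuous|exact: closed_ge].
Qed.

Local Notation smoothM := (smooth_function A).

Lemma smooth_function_continuous (f : M -> R) : smoothM f -> continuous f.
Proof.
move=> sf p; have [i ip] := manifold_cover A_manifold p.
have [F [cF FE]] := smooth_on_continuous (sf i) (im_chart ip).
have cphi := chart_coord_cont (chartP i) ip.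
have cFphi : {for p, continuous (F \o phi i)} by apply: continuous_comp.
apply: near_eq_continuous cFphi.
have H : \forall q \near p, dom (A i) q /\ (im i (phi i q) -> F (phi i q) = f (par i (phi i q))).
  apply: filterI; last exact: (cphi _ FE).
  exact: open_nbhs_nbhs (conj (chart_open (chartP i)) ip).
by apply: filterS H => q [iq]; rewrite chart_mapK// => <-//; exact: im_chart.
Qed.

Lemma smooth_functionM (f h : M -> R) : smoothM f -> smoothM h -> smoothM (fun p => f p * h p).
Proof. by move=> sf sh i; apply: smooth_onM; [exact: sf|exact: sh]. Qed.

Lemma smooth_function_sum (J : Type) (r : seq J) (f : J -> M -> R) :
  (forall k, smoothM (f k)) -> smoothM (fun p => \sum_(k <- r) f k p).
Proof. by move=> sf i; exact: (@smooth_on_sum _ _ (im i) J r xpredT (fun k => f k \o par i) (fun k => sf k i)). Qed.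

Lemma smooth_functionV (f : M -> R) : (forall p, 0 < f p) -> smoothM f -> smoothM (fun p => (f p)^-1).
Proof. by move=> f0 sf i; exact: (@smooth_onV _ _ (im i) (f \o par i) (fun x _ => f0 _) (sf i)). Qed.

Lemma smooth_bump i p (U : set M) : dom (A i) p -> open U -> U p ->
  exists (b : M -> R) (K : set M),
    [/\ smoothM b, forall q, 0 <= b q <= 1, 0 < b p, compact K &
      K `<=` U `&` dom (A i) /\ forall q, b q != 0 -> K q].
Proof.
move=> ip oU Up.
have par_p : par i (phi i p) = p by exact: chart_mapK.
have [|V [oV Vx HV]] := param_near (im_chart ip) oU; first by rewrite par_p.
have /nbhs_ballP[r /= r0 rV] : \forall y \near phi i p, V y by exact: open_nbhs_nbhs.
set x0 := phi i p in rV Vx *; pose s := r / 2.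
have s0 : 0 < s by rewrite divr_gt0.
pose C := [set y : 'rV[R]_n.+1 | half_space y /\ `|x0 - y| <= s].
have CV y : C y -> im i y /\ U (par i y).
  move=> [Hy ys]; apply: HV => //; apply: rV.
  by rewrite -ball_normE /=; apply: le_lt_trans ys _; rewrite /s gtr_pMr// invf_lt1// ltr1n.
have cC : compact C.
  apply: bounded_closed_compact.
    exists (`|x0| + s); split; first exact: num_real.
    move=> t ht y [_ ys]; rewrite /= (le_trans _ (ltW ht))//.
    by rewrite -[y](subKr x0) (le_trans (ler_normB _ _))// lerD2l.
  have cl : closed [set y : 'rV[R]_n.+1 | `|x0 - y| <= s].
    by have := @closed_ball_closed R _ x0 s; rewrite closed_ballE.
  exact: (closedI closed_half_space cl).
pose K := par i @` C.
have cK : compact K.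
  apply: continuous_compact => //.
  apply: continuous_subspaceW (chart_param_cont (chartP i)) => y /CV[].
  by [].
have KU : K `<=` U `&` dom (A i).
  by move=> _ [y /CV[iy Uy] <-]; split => //; exact: param_dom.
(* The squared Euclidean distance is smooth, unlike the sup norm; the Euclidean ball of radius [s]
   lies in the cube that defines [C]. *)
pose rad q := s ^+ 2 - \sum_k (phi i q ord0 k - x0 ord0 k) ^+ 2.
pose b q := if `[< dom (A i) q >] then flat 0 (rad q) else 0.
have bT q : dom (A i) q -> b q = flat 0 (rad q) by move=> iq; rewrite /b asboolT.
have bF q : ~ dom (A i) q -> b q = 0 by move=> iq; rewrite /b asboolF.
have bK q : b q != 0 -> K q.
  have [iq|/bF ->] := pselect (dom (A i) q); last by rewrite eqxx.
  rewrite bT// => b0; have : 0 < flat 0 (rad q) by rewrite lt_neqAle eq_sym b0 flat_ge0.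
  rewrite flat_gt0 subr_gt0 => qs; exists (phi i q); last exact: chart_mapK.
  split; first exact: im_half (im_chart iq).
  apply: mx_norm_le; first exact: ltW.
  move=> a k; rewrite (ord1 a) !mxE distrC -(@ler_sqr _ `|_|) ?nnegrE ?(ltW s0)//.
  rewrite real_normK ?num_real// (le_trans _ (ltW qs))// (bigD1 k)//= lerDl sumr_ge0//.
  by move=> l _; rewrite sqr_ge0.
exists b, K; split => //.
- move=> j; apply: smooth_on_local => y jy.
  have [iy|niy] := pselect (dom (A i) (par j y)).
    have [V' [oV' V'y HV']] := param_near jy (chart_open (chartP i)) iy.
    exists V'; split => //.
    apply: (@smooth_onS _ _ _ (overlap A j i)).
      by move=> z [jz V'z]; apply/overlapP; split => //; apply HV' => //; exact: im_half jz.
    apply: (@smooth_on_eq _ _ _ (fun z => flat 0 (s ^+ 2 - \sum_k (transition A j i k z - x0 ord0 k) ^+ 2))).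
      by move=> z /overlapP[jz iz]; rewrite /= bT.
    apply: smooth_on_flat; apply: smooth_onB; first exact: smooth_on_cst.
    apply: smooth_on_sum => k; apply: smooth_onX; apply: smooth_onB; last exact: smooth_on_cst.
    exact: (manifold_transition A_manifold).
  (* Outside the chart domain [b] vanishes locally, because the compact set [K] is closed in a
     Hausdorff space. *)
  have oK : open (~` K).
    by apply: closed_openC; apply: compact_closed => //; exact: (manifold_hausdorff A_manifold).
  have [|V' [oV' V'y HV']] := param_near jy oK; first by move=> /KU[].
  exists V'; split => //; apply: (@smooth_on_eq _ _ _ (cst 0)); last exact: smooth_on_cst.
  move=> z [jz V'z] /=; have [_ nK] := HV' z V'z (im_half jz).
  by apply/esym/eqP; apply: contraPT nK => /bK Kz; apply.
- move=> q; have [/bT ->|/bF ->] := pselect (dom (A i) q); last by rewrite lexx ler01.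
  by rewrite flat_ge0 flat_le1.
- rewrite bT// flat_gt0 /rad -/x0 big1 ?subr0 ?exprn_gt0//.
  by move=> k _; rewrite subrr expr0n.
Qed.

End charts.

(** * Partitions of unity, transition maps and the metric *)

Section atlas.
Context {R : realType} {n : nat} {M : ptopologicalType} (I : Type).
Variable A : I -> chart R n M.
Hypothesis A_manifold : is_manifold A.
Implicit Types (i j : I) (x : 'rV[R]_n.+1) (p : M).
Local Notation im i := (chart_image (A i)).
Local Notation phi i := (chart_map (A i)).
Local Notation par i := (param (A i)).
Local Notation smoothM := (smooth_function A).

(** Each cut-off vanishes outside a compact subset of a chart domain. This compactness later
    provides integrability in the chart and smooth extensions by 0 to the half space. *)
Lemma partition_of_unity : compact [set: M] ->
  exists (N : nat) (c : 'I_N -> I) (chi : 'I_N -> M -> R) (K : 'I_N -> set M),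
    [/\ forall k, smoothM (chi k), forall k p, 0 <= chi k p,
        forall p, \sum_k chi k p = 1,
        forall k, compact (K k) /\ K k `<=` dom (A (c k)) &
        forall k q, chi k q != 0 -> K k q].
Proof.
move=> Mc.
have /choice[c0 c0P] : forall p, exists i, dom (A i) p.
  by move=> p; exact: (manifold_cover A_manifold).
have /choice[bK bKP] : forall p, exists bK : (M -> R) * set M,
    [/\ smoothM bK.1, forall q, 0 <= bK.1 q <= 1, 0 < bK.1 p, compact bK.2 &
      bK.2 `<=` setT `&` dom (A (c0 p)) /\ forall q, bK.1 q != 0 -> bK.2 q].
  move=> p; have [b [K H]] := smooth_bump A_manifold (c0P p) openT Logic.I.
  by exists (b, K).
pose b p := (bK p).1.
have sb p : smoothM (b p) by case: (bKP p).
have b0 p q : 0 <= b p q by case: (bKP p) => _ /(_ q)/andP[].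
have : finite_subset_cover [set: M] (fun p => [set q | 0 < b p q]) [set: M].
  move: Mc; rewrite compact_cover; apply.
  - move=> p _; rewrite (_ : [set _ | _] = b p @^-1` [set t | 0 < t])//.
    apply: open_comp; last exact: open_gt.
    by move=> q _; apply: (smooth_function_continuous A_manifold (sb p)).
  - by move=> p _; exists p => //=; case: (bKP p).
move=> [D _ Dcov].
pose s : seq M := finmap.enum_fset D.
pose pt (k : 'I_(size s)) : M := tnth (in_tuple s) k.
pose B q := \sum_k b (pt k) q.
have sB : smoothM B by apply: smooth_function_sum => k; exact: sb.
have B_gt0 q : 0 < B q.
  have [p /= pD bpq] := Dcov q Logic.I.
  have ps : p \in s by [].
  have [k kp] : exists k, pt k = p.
    by have /seq_tnthP[k kE] := ps; exists k.
  rewrite /B (bigD1 k)//= kp ltr_pwDl// sumr_ge0//.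
exists (size s), (c0 \o pt), (fun k q => b (pt k) q * (B q)^-1), (fun k => (bK (pt k)).2).
split.
- by move=> k; apply: smooth_functionM => //; exact: smooth_functionV.
- by move=> k q; rewrite mulr_ge0// invr_ge0 ltW.
- by move=> q; rewrite -mulr_suml divff// gt_eqF//; exact: B_gt0.
- move=> k; have [_ _ _ cK [KD _]] := bKP (pt k); split => // q /KD[].
  by [].
- move=> k q bq; have [_ _ _ _ [_ ]] := bKP (pt k); apply.
  by apply: contra bq => /eqP; rewrite -/(b _) => ->; rewrite mul0r.
Qed.

Variable g : I -> 'rV[R]_n.+1 -> 'M[R]_n.+1.
Hypothesis g_metric : is_riemannian_metric A g.

Definition transition_jac i j x : 'M[R]_n.+1 :=
  \matrix_(a, b) partial b (transition A i j a) x.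

Lemma det_metric_gt0 i x : im i x -> 0 < \det (g i x).
Proof. by move=> ix; apply: posdef_det_gt0; exact: (riemannian_pos g_metric). Qed.

Lemma det_metric_change i j x : overlap A i j x ->
  \det (g i x) = \det (transition_jac i j x) ^+ 2 * \det (g j (phi j (par i x))).
Proof.
move=> ijx; rewrite (riemannian_change g_metric ijx) !det_mulmx det_tr.
by rewrite -/(transition_jac i j x); ring.
Qed.

(** By the transformation law of the metric, the squared Jacobian determinant is a factor of a
    positive determinant; no inverse transition has to be differentiated. *)
Lemma transition_jac_unit i j x : overlap A i j x -> transition_jac i j x \in unitmx.
Proof.
move=> ijx; rewrite unitmxE unitfE; apply/eqP => J0.
have := det_metric_gt0 (overlap_im A_manifold ijx).
by rewrite (det_metric_change ijx) J0 expr0n mul0r ltxx.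
Qed.

Lemma sqrt_det_change i j x : overlap A i j x ->
  Num.sqrt (\det (g i x)) =
    `|\det (transition_jac i j x)| * Num.sqrt (\det (g j (phi j (par i x)))).
Proof.
by move=> ijx; rewrite (det_metric_change ijx) sqrtrM ?sqr_ge0// sqrtr_sqr.
Qed.

(** One open set carries smooth extensions of all the components. They agree with the transition in
    the half space only, yet their derivatives at [x] are the entries of [transition_jac], which are
    right-hand derivatives. *)
Lemma transition_ext i j x : overlap A i j x ->
  exists (U : set 'rV[R]_n.+1) (T : 'I_n.+1 -> 'rV[R]_n.+1 -> R),
    [/\ open U, U x, forall a k, Ck k U (T a),
      forall y, U y -> half_space y -> overlap A i j y /\
        forall a, T a y = phi j (par i y) ord0 a &
      forall a b, 'D_(delta_mx ord0 b) (T a) x = transition_jac i j x a b].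
Proof.
move=> ijx; have [ix jx] := (iffLR (overlapP A_manifold _ _ _) ijx).
have [V [oV Vx HV]] := param_near A_manifold ix (chart_open (chartP A_manifold j)) jx.
have /choice[UF UFP] : forall a, exists UF : set 'rV[R]_n.+1 * ('rV[R]_n.+1 -> R),
    [/\ open UF.1, UF.1 x, (forall k, Ck k UF.1 UF.2) &
        forall y, UF.1 y -> overlap A i j y -> UF.2 y = transition A i j a y].
  move=> a; have [U [F [? ? ? ?]]] := manifold_transition A_manifold a ijx.
  by exists (U, F).
have Vov y : V y -> half_space y -> overlap A i j y.
  by move=> Vy Hy; apply/(overlapP A_manifold); exact: HV.
pose U := V `&` \bigcap_a (UF a).1.
have oU : open U.
  apply: openI => //; rewrite openE => y Uy; rewrite /interior.
  have : \forall z \near y, forall a, (UF a).1 z.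
    by apply: (@filter_forall _ 'I_n.+1 (fun a => (UF a).1) _ (nbhs_filter y)) => a; apply: open_nbhs_nbhs; split; [case: (UFP a)|exact: Uy].
  by apply: filterS => z Hz a _; exact: Hz.
have Ux : U x by split => // a _; case: (UFP a).
exists U, (fun a => (UF a).2); split => //.
- by move=> a k; have [_ _ CF _] := UFP a; apply: Ck_sub (CF k) => y [_ /(_ a Logic.I)].
- move=> y [Vy Uy] Hy; split; first exact: Vov.
  move=> a; have [_ _ _ ->//] := UFP a; last exact: Vov.
  exact: Uy.
- move=> a b; rewrite mxE; apply/esym; have [_ _ CF FE] := UFP a.
  have dF : is_derive x (delta_mx ord0 b) (UF a).2 ('D_(delta_mx ord0 b) (UF a).2 x).
    by apply: (Ck_derivable _ (CF 1%N)); exact: Ux.2.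
  apply: (partialE oU Ux (im_half A_manifold ix) _ dF) => y [Vy Uy] Hy.
  by rewrite FE//; [exact: Uy|exact: Vov].
Qed.

(** If an interior point went to the boundary, the coordinate 0 of the transition would have a
    minimum there; all its partial derivatives would vanish, and the Jacobian matrix would have a
    zero row. *)
Lemma interior_transition i j x : overlap A i j x -> 0 < x ord0 ord0 ->
  0 < phi j (par i x) ord0 ord0.
Proof.
move=> ijx x0; have [U [T [oU Ux CT TE DT]]] := transition_ext ijx.
have jy := overlap_sym A_manifold ijx.
have Hy := im_half A_manifold (overlap_im A_manifold jy).
rewrite lt_neqAle Hy andbT eq_sym; apply/eqP => y0.
suff J0 b : transition_jac i j x ord0 b = 0.
  have := transition_jac_unit ijx; rewrite unitmxE (expand_det_row _ ord0) big1 ?unitr0//.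
  by move=> b _; rewrite J0 mul0r.
rewrite -DT.
have /nbhs_ballP[d /= d0 dU] : \forall z \near x, U z /\ 0 < z ord0 ord0.
  apply: filterI; first exact: open_nbhs_nbhs.
  exact: (@coord_continuous R _ _ ord0 ord0 x _ (lt_nbhsr x0)).
have bd (t : R) : t \in `](- d), d[ -> ball x d (t *: delta_mx ord0 b + x).
  rewrite in_itv/= => /andP[t1 t2]; split => // k l; rewrite (ord1 k) !mxE eqxx/=.
  rewrite /ball/= opprD addrC subrK normrN; have [_|_] := eqVneq l b.
    by rewrite mulr1 ltr_norml t1.
  by rewrite mulr0 normr0.
have dT (t : R) : t \in `](- d), d[ ->
    is_derive t (1 : R) (fun t => T ord0 (t *: delta_mx ord0 b + x))
      ('D_(delta_mx ord0 b) (T ord0) (t *: delta_mx ord0 b + x)).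
  move=> /bd/dU[Ut _]; apply: is_derive_segment.
  exact: Ck_derivable (CT ord0 1%N) Ut.
have d00 : (0 : R) \in `](- d), d[ by rewrite in_itv/= oppr_lt0 d0.
have le_dd : - d <= d by rewrite (@le_trans _ _ 0)// ?oppr_le0 ltW.
have T0 z : U z -> 0 < z ord0 ord0 -> 0 <= T ord0 z.
  move=> Uz z0; have [ov ->] := TE z Uz (ltW z0).
  have := im_half A_manifold (overlap_im A_manifold (overlap_sym A_manifold ov)).
  exact.
have := derive1_at_min le_dd (fun t td => (@ex_derive _ _ _ _ _ _ _ (dT t td))) d00 _.
move=> /(_ _)[|_ E1].
  move=> t /bd/dU[Ut t0]; rewrite scale0r add0r.
  have [_ ->] := TE x Ux (ltW x0); rewrite y0; exact: T0.
have [_ E2] := dT 0 d00; rewrite scale0r add0r in E2.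
by rewrite -E2; exact: E1.
Qed.

End atlas.

Section measurable_on_open.
Context {R : realType} {M : ptopologicalType}.

Lemma measurable_indicM (D : set M) (f : M -> R) : open D ->
  (forall x, D x -> {for x, continuous f}) ->
  measurable_fun setT (fun x : borel M => \1_D x * f x).
Proof.
move=> oD cf; apply: measurable_fun_open_preimage => U oU; rewrite setTI.
rewrite (_ : _ @^-1` U = (D `&` f @^-1` U) `|` (~` D `&` [set x | U 0])).
  apply: measurableU.
    apply: borel_open; rewrite openE => x [Dx Ux]; apply: filterI.
      exact: open_nbhs_nbhs.
    by apply: cf => //; exact: open_nbhs_nbhs.
  apply: measurableI; first by apply: measurableC; exact: borel_open.
  have [U0|nU0] := pselect (U 0).
    by rewrite (_ : [set _ | _] = setT); [exact: measurableT|apply/seteqP; split].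
  by rewrite (_ : [set _ | _] = set0); [exact: measurable0|apply/seteqP; split].
apply/seteqP; split=> x /=; rewrite indicE.
  have [Dx|nDx] := pselect (D x); first by rewrite mem_set// mul1r; left.
  by rewrite memNset// mul0r; right.
by move=> [[Dx Ux]|[nDx U0]]; [rewrite mem_set// mul1r|rewrite memNset// mul0r].
Qed.

Lemma measurable_if_open (N : ptopologicalType) (D : set M) (f : M -> N) (c : N) : open D ->
  (forall x, D x -> {for x, continuous f}) ->
  measurable_fun setT (fun x : borel M => (if `[< D x >] then f x else c) : borel N).
Proof.
move=> oD cf; apply: measurable_fun_borel => U oU; rewrite setTI.
rewrite (_ : _ @^-1` U = (D `&` f @^-1` U) `|` (~` D `&` [set x | U c])).
  apply: measurableU.
    apply: borel_open; rewrite openE => x [Dx Ux]; apply: filterI.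
      exact: open_nbhs_nbhs.
    by apply: cf => //; exact: open_nbhs_nbhs.
  apply: measurableI; first by apply: measurableC; exact: borel_open.
  have [Uc|nUc] := pselect (U c).
    by rewrite (_ : [set _ | _] = setT); [exact: measurableT|apply/seteqP; split].
  by rewrite (_ : [set _ | _] = set0); [exact: measurable0|apply/seteqP; split].
apply/seteqP; split=> x /=.
  have [Dx|nDx] := pselect (D x); first by rewrite asboolT//; left.
  by rewrite asboolF//; right.
by move=> [[Dx Ux]|[nDx Uc]]; [rewrite asboolT|rewrite asboolF].
Qed.

End measurable_on_open.

(** * The mass of a small cube seen from another chart *)

Section change_of_charts.
Context {R : realType} {n : nat} {M : ptopologicalType} (I : Type).
Variable A : I -> chart R n M.
Hypothesis A_manifold : is_manifold A.
Variable g : I -> 'rV[R]_n.+1 -> 'M[R]_n.+1.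
Hypothesis g_metric : is_riemannian_metric A g.
Variable w : M -> R.
Hypothesis w_smooth : smooth_function A w.
Hypothesis w_pos : forall p, 0 < w p.
Implicit Types (i j : I) (x y : 'rV[R]_n.+1) (p : M).
Local Notation im i := (chart_image (A i)).
Local Notation phi i := (chart_map (A i)).
Local Notation par i := (param (A i)).
Local Notation VT m := (borel 'rV[R]_m).

Definition interior_image i : set 'rV[R]_n.+1 := [set x | im i x /\ 0 < x ord0 ord0].
Local Notation IM := interior_image.

Definition density i x : R := w (par i x) * Num.sqrt (\det (g i x)).

Lemma open_pos_half : open [set x : 'rV[R]_n.+1 | 0 < x ord0 ord0].
Proof.
rewrite (_ : [set _ | _] = (fun x : 'rV[R]_n.+1 => x ord0 ord0) @^-1` [set t | 0 < t])//.
by apply: open_comp; [move=> x _; exact: coord_continuous|exact: open_gt].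
Qed.

Lemma open_interior_image i : open (IM i).
Proof.
have [W oW imW] := chart_image_open (chartP A_manifold i).
rewrite (_ : IM i = W `&` [set x | 0 < x ord0 ord0]).
  exact: openI oW open_pos_half.
rewrite /interior_image imW; apply/seteqP; split=> x; first by move=> [[]].
by move=> [Wx x0]; split => //; split => //; exact: ltW.
Qed.

Lemma par_continuous i x : IM i x -> {for x, continuous (par i)}.
Proof.
move=> [ix x0] O; rewrite /= nbhsE => -[Q [oQ Qx] QO].
have [V [oV Vx HV]] := param_near A_manifold ix oQ Qx.
have : nbhs x (V `&` [set x | 0 < x ord0 ord0]).
  by apply: open_nbhs_nbhs; split => //; exact: openI oV open_pos_half.
by apply: filterS => y [Vy y0]; apply: QO; case: (HV y Vy (ltW y0)).
Qed.

Lemma density_gt0 i x : im i x -> 0 < density i x.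
Proof. by move=> ix; rewrite mulr_gt0// sqrtr_gt0; exact: (det_metric_gt0 g_metric). Qed.

Lemma smooth_det_metric i : smooth_on (im i) (fun x => \det (g i x)).
Proof.
rewrite /determinant.
apply: smooth_on_sum => s; apply: smooth_onM; first exact: smooth_on_cst.
by apply: smooth_on_prod => k; exact: (riemannian_smooth g_metric).
Qed.

Lemma smooth_sqrt_det i : smooth_on (im i) (fun x => Num.sqrt (\det (g i x))).
Proof.
apply: smooth_on_sqrt; last exact: smooth_det_metric.
by move=> x ix; exact: (det_metric_gt0 g_metric).
Qed.

Lemma smooth_density i : smooth_on (im i) (density i).
Proof. by apply: smooth_onM; [exact: w_smooth|exact: smooth_sqrt_det]. Qed.

Lemma smooth_on_near (B : set 'rV[R]_n.+1) f x (e : R) : smooth_on B f -> B x -> 0 < e ->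
  \forall y \near x, B y -> `|f x - f y| < e.
Proof.
move=> sf Bx e0; have [F [cF FE]] := smooth_on_continuous sf Bx.
have /cvgrPdist_lt/(_ _ e0) := cF.
have Fx : F x = f x by exact: (nbhs_singleton FE).
by move: FE; apply: filterS2 => y FE; rewrite Fx => + By; rewrite FE.
Qed.

Lemma cube_image (B : 'M[R]_n.+1) (c : 'rV[R]_n.+1) (r : R) : 0 < r -> B \in unitmx ->
  (\int[lam n.+1]_y (\1_(ball (0 : 'rV[R]_n.+1) r) (((y : 'rV[R]_n.+1) + (- c)%R)%R *m B))%:E
    = (`|\det B|^-1 * (2 * r) ^+ n.+1)%:E)%E.
Proof.
move=> r0 uB.
pose F (y : VT n.+1) := (\1_(ball (0 : 'rV[R]_n.+1) r) y : R)%:E.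
have mF : measurable_fun setT F.
  by apply/measurable_EFinP; apply: measurable_indic; exact: measurable_ball_rV.
have F0 y : (0 <= F y)%E by rewrite lee_fin.
have mFB := measurableT_comp mF (mulmx_measurable B).
have E := lam_shift (- c) mFB (fun x => F0 _).
have E2 := scales_unit uB mF F0.
have -> : (`|\det B|^-1 * (2 * r) ^+ n.+1)%:E = ((`|\det B|^-1)%:E * \int[lam n.+1]_x F x)%E.
  rewrite EFinM; congr (_ * _)%E.
  rewrite (integral_indic _ measurableT (measurable_ball_rV _ _)) setIT.
  by apply/esym; exact: lam_ball.
rewrite -E2; exact: E.
Qed.

Lemma mulmx_norm_le (m : nat) (v : 'rV[R]_m) (B : 'M[R]_m) :
  `|v *m B| <= `|v| * \sum_a \sum_b `|B a b|.
Proof.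
apply: mx_norm_le => [|k l]; first by rewrite mulr_ge0// sumr_ge0// => a _; exact: sumr_ge0.
rewrite mxE (le_trans (ler_norm_sum _ _ _))// mulr_sumr ler_sum// => a _.
rewrite normrM ler_pM// ?coord_le_norm//.
by rewrite (bigD1 l)//= lerDl sumr_ge0.
Qed.

Definition chart_overlap i j : set 'rV[R]_n.+1 := [set y | IM j y /\ dom (A i) (par j y)].

Lemma open_chart_overlap i j : open (chart_overlap i j).
Proof.
rewrite openE => y [jy iy]; rewrite /interior; apply: filterI.
  by apply: open_nbhs_nbhs; split => //; exact: open_interior_image.
apply: (par_continuous jy); apply: open_nbhs_nbhs; split => //.
exact: (chart_open (chartP A_manifold i)).
Qed.

(** The value 0 off the overlap is never seen: the integrands that contain [change] carry the
    indicator of the overlap. *)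
Definition change i j y : 'rV[R]_n.+1 :=
  if `[< chart_overlap i j y >] then phi i (par j y) else 0.

Lemma change_measurable i j : measurable_fun setT (change i j : VT n.+1 -> VT n.+1).
Proof.
have H := @measurable_if_open 'rV[R]_n.+1 'rV[R]_n.+1 _ (fun y => phi i (par j y)) 0 (@open_chart_overlap i j).
apply: H => y [jy iy]; apply: continuous_comp; first exact: par_continuous.
exact: (chart_coord_cont (chartP A_manifold i)).
Qed.

(** By strict differentiability at [x0], the points of chart [j] that are sent into the cube of
    radius [r] around [x] lie in the image of a slightly larger cube under the Jacobian [J] of the
    transition from [i] to [j]. The density of chart [j] is almost constant there, and [DE]
    identifies its product with [|det J|]. The estimate is uniform for [x] near [x0], boundary
    points included. *)
Lemma chart_mass_local i j x0 (e : R) : overlap A i j x0 -> 0 < e ->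
  exists2 d : R, 0 < d & forall x r, ball x0 d x -> half_space x -> 0 < r < d ->
   (\int[lam n.+1]_y (\1_(chart_overlap i j) y * density j y *
       \1_(ball (x : 'rV[R]_n.+1) r) (change i j y))%:E <=
     ((density i x + e) * (2 * r) ^+ n.+1)%:E)%E.
Proof.
move=> ijx0 e0; have [U [T [oU Ux0 CT TE DT]]] := transition_ext A_manifold ijx0.
have ix0 := overlap_im A_manifold ijx0.
set J := transition_jac A i j x0 in DT.
have uJ : J \in unitmx by exact: (transition_jac_unit A_manifold g_metric).
(* Vectors are rows: the linearized transition is [v *m J^T], and [B] inverts it. *)
pose B := invmx J^T.
have uB : B \in unitmx by rewrite unitmx_inv unitmx_tr.
pose c := \sum_a \sum_b `|B a b|.
have c0 : 0 <= c by rewrite sumr_ge0// => a _; exact: sumr_ge0.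
pose y0 := phi j (par i x0).
have jy0 : im j y0 by exact: (overlap_im A_manifold (overlap_sym A_manifold ijx0)).
have DE : density i x0 = density j y0 * `|\det J|.
  rewrite /density (sqrt_det_change g_metric ijx0) -/J -/y0.
  rewrite /y0 chart_mapK//; first by ring.
  by case: (iffLR (overlapP A_manifold _ _ _) ijx0).
(* The total error is a continuous function [h] of [eps] with value [density i x0] at 0. The last
   summand [eps] pays for the passage from [x0] to [x]. *)
have [eps eps0 epsP] : exists2 eps : R, 0 < eps &
    (density j y0 + eps) * `|\det J| * (1 + c * eps) ^+ n.+1 + eps < density i x0 + e.
  pose h (t : R) := (density j y0 + t) * `|\det J| * (1 + c * t) ^+ n.+1 + t.
  have ch : {for 0, continuous h}.
    apply: continuousD; last exact: cvg_id.
    apply: continuousM.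
      apply: continuousM; last exact: cvg_cst.
      by apply: continuousD; [exact: cvg_cst|exact: cvg_id].
    apply: (continuous_comp (f := fun t : R => 1 + c * t) (g := fun t : R => t ^+ n.+1)).
      apply: continuousD; first exact: cvg_cst.
      by apply: continuousM; [exact: cvg_cst|exact: cvg_id].
    exact: exprn_continuous.
  have h0 : h 0 < density i x0 + e.
    by rewrite /h !(mulr0, addr0, expr1n, mulr1) -DE ltrDl.
  have : \forall t \near (0:R), h t < density i x0 + e.
    have /cvgrPdist_lt/(_ (density i x0 + e - h 0)) := ch.
    rewrite subr_gt0 => /(_ h0); apply: filterS => t.
    by rewrite ltr_norml => /andP[+ _]; rewrite ltrBrDr; lra.
  move=> /nbhs_ballP[d /= d0 dh]; exists (d / 2); first by rewrite divr_gt0.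
  apply: dh; rewrite /ball/= sub0r normrN ger0_norm ?divr_ge0// 1?ltW//.
  by rewrite ltr_pdivrMr// mulr_natr mulr2n ltrDl.
have cT : {for x0, continuous (fun x : 'rV[R]_n.+1 => \row_a T a x)}.
  apply: continuous_rV => a.
  rewrite (_ : (fun y : 'rV[R]_n.+1 => _) = T a); last by apply/funext => y; rewrite mxE.
  exact: (Ck_continuous (CT a 0)).
have Ty0 : \row_a T a x0 = y0.
  apply/rowP => a; rewrite mxE.
  by have [_ ->] := TE x0 Ux0 (im_half A_manifold ix0).
have near1 : \forall x \near x0, im j (\row_a T a x) ->
    `|density j y0 - density j (\row_a T a x)| < eps.
  have cT' : (fun x : 'rV[R]_n.+1 => \row_a T a x) @ x0 --> y0 by rewrite -Ty0; exact: cT.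
  exact: (cT' _ (smooth_on_near (@smooth_density j) jy0 eps0)).
have near2 : \forall x \near x0, im i x -> `|density i x0 - density i x| < eps.
  exact: (smooth_on_near (@smooth_density i) ix0 eps0).
have strict (a : 'I_n.+1) : \forall d \near (0:R)^'+, ball x0 d `<=` U /\
    forall y z, ball x0 d y -> ball x0 d z ->
    `|T a z - T a y - \sum_b (z - y) ord0 b * J a b| <= eps * `|z - y|.
  have [d d0 [dU dT]] := C1_strict oU (CT a 1%N) Ux0 eps0.
  near=> d'.
  have sub : ball x0 d' `<=` ball x0 d by apply: le_ball; near: d'; exact: nbhs_right_le.
  split; first exact: subset_trans sub dU.
  move=> y z yd zd; have := dT y z (sub _ yd) (sub _ zd).
  by under eq_bigr do rewrite DT.
have [d0 d00 [dP [dT]]] : exists2 d : R, 0 < d & (forall x, ball x0 d x ->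
    (im j (\row_a T a x) -> `|density j y0 - density j (\row_a T a x)| < eps) /\
    (im i x -> `|density i x0 - density i x| < eps)) /\ ((forall a y z, ball x0 d y -> ball x0 d z ->
    `|T a z - T a y - \sum_b (z - y) ord0 b * J a b| <= eps * `|z - y|) /\ ball x0 d `<=` U).
  have [d1 /= d10 d1P] := iffLR (nbhs_ballP _ _) (filterI near1 near2).
  have allT := @filter_forall _ 'I_n.+1 (fun a d => _) _ _ strict.
  near (0:R)^'+ => d; exists d; first by near: d; exact: nbhs_right_gt.
  split.
    move=> x xd; apply: d1P; apply: le_ball xd; near: d; exact: nbhs_right_le.
  have H : forall a, ball x0 d `<=` U /\
    forall y z, ball x0 d y -> ball x0 d z ->
    `|T a z - T a y - \sum_b (z - y) ord0 b * J a b| <= eps * `|z - y| by near: d; exact: allT.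
  by split; [move=> a; case: (H a)|case: (H ord0)].
move=> dU.
exists (d0 / 2); first by rewrite divr_gt0.
move=> x r xd Hx /andP[r0 rd].
have xd0 : ball x0 d0 x by apply: le_ball xd; lra.
have [ijx _] := TE x (dU _ xd0) Hx.
have ix := overlap_im A_manifold ijx.
(* Multiplied by [B], the linearization error [eps * |x' - x|] becomes at most [c * eps * r]. *)
pose r' := (1 + c * eps) * r.
have r'0 : 0 < r' by rewrite mulr_gt0// ltr_pwDl// mulr_ge0// ltW.
pose k := density j y0 + eps.
have k0 : 0 < k by rewrite addr_gt0// density_gt0.
(* The indicator of the parallelepiped around the image of [x] that [B] maps to the cube of radius
   [r']. *)
pose Q (y : VT n.+1) : R := \1_(ball (0 : 'rV[R]_n.+1) r') (((y : 'rV[R]_n.+1) + - \row_a T a x) *m B).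
have mQ : measurable_fun setT Q.
  have mI : measurable_fun setT (\1_(ball (0 : 'rV[R]_n.+1) r') : VT n.+1 -> R).
    by apply: measurable_indic; exact: measurable_ball_rV.
  exact: (measurableT_comp mI (measurableT_comp (mulmx_measurable B) (shift_measurable _))).
have mL : measurable_fun setT (fun y : VT n.+1 => (\1_(chart_overlap i j) y * density j y *
       \1_(ball (x : 'rV[R]_n.+1) r) (change i j y))).
  apply: measurable_funM.
    apply: (measurable_indicM (@open_chart_overlap i j)) => y [[jy yp] _].
    have [F [cF FE]] := smooth_on_continuous (@smooth_density j) jy.
    have /near_eq_continuous : \forall z \near y, F z = density j z.
      have Ho : \forall z \near y, IM j z by apply: open_nbhs_nbhs; split => //; exact: open_interior_image.
      by move: FE Ho; apply: filterS2 => z FE [jz _]; exact: FE.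
    exact.
  have mI : measurable_fun setT (\1_(ball (x : 'rV[R]_n.+1) r) : VT n.+1 -> R).
    by apply: measurable_indic; exact: measurable_ball_rV.
  exact: (measurableT_comp mI (change_measurable i j)).
have le1 (y : VT n.+1) : \1_(chart_overlap i j) y * density j y *
    \1_(ball (x : 'rV[R]_n.+1) r) (change i j y) <= k * Q y.
  rewrite indicE; have [Oy|nOy] := pselect (chart_overlap i j y); last first.
    by rewrite memNset// !mul0r mulr_ge0// ltW.
  rewrite (mem_set Oy) mul1r /change asboolT// indicE.
  have [xy|nxy] := pselect (ball x r (phi i (par j y))); last first.
    by rewrite (memNset nxy) mulr0 mulr_ge0// ltW.
  rewrite (mem_set xy) mulr1.
  move: Oy => [[jy yp] iy]; set x' := phi i (par j y) in xy *.
  have jix : overlap A j i y by apply/(overlapP A_manifold).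
  have ijx' := overlap_sym A_manifold jix; rewrite -/x' in ijx'.
  have x'd : ball x0 d0 x'.
    by have := ball_triangle xd xy; apply: le_ball; lra.
  have Ty : \row_a T a x' = y.
    apply/rowP => a; rewrite mxE.
    have [_ ->] := TE x' (dU _ x'd) (im_half A_manifold (overlap_im A_manifold ijx')).
    by rewrite (transitionK A_manifold jix).
  have [H1 _] := dP x' x'd; rewrite Ty in H1.
  have {H1} : density j y <= k by move: (H1 jy); rewrite ltr_norml /k => /andP[]; lra.
  suff -> : Q y = 1 by rewrite mulr1.
  rewrite /Q indicE mem_set// -ball_normE/= sub0r normrN.
  have n0 : `|x' - x| < r by move: xy; rewrite -ball_normE/= distrC.
  have -> : (y + - \row_a T a x) *m B = (x' - x) + (y - \row_a T a x - (x' - x) *m J^T) *m B.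
    rewrite [in RHS]mulmxBl -mulmxA mulmxV ?unitmx_tr// mulmx1 [RHS]addrC subrK//.
  have n1 : `|y - \row_a T a x - (x' - x) *m J^T| <= eps * `|x' - x|.
    apply: mx_norm_le => [|k' a]; first by rewrite mulr_ge0// ltW.
    rewrite (ord1 k') -[in X in X - _ - _]Ty !mxE.
    have := dT a x x' xd0 x'd; congr (`| _ - _ | <= _).
    by apply: eq_bigr => b _; rewrite !mxE.
  rewrite (le_lt_trans (ler_normD _ _))// /r' mulrDl mul1r.
  apply: ltr_leD => //; apply: le_trans (mulmx_norm_le _ _) _; rewrite -/c mulrC -mulrA.
  apply: ler_wpM2l => //; apply: le_trans n1 _; rewrite ler_pM2l//; exact: ltW.
apply: (@le_trans _ _ (\int[lam n.+1]_y (k * Q y)%:E)%E).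
  apply: ge0_le_integral.
  - exact: measurableT.
  - move=> y _; rewrite lee_fin mulr_ge0// indicE.
    have [Oy|nOy] := pselect (chart_overlap i j y); last by rewrite memNset// mul0r.
    by rewrite mem_set// mul1r ltW// density_gt0//; case: Oy => -[].
  - by apply/measurable_EFinP.
  - by apply/measurable_EFinP; apply: measurable_funM => //; exact: measurable_cst.
  - by move=> y _; rewrite lee_fin.
under eq_integral do rewrite EFinM.
rewrite (@ge0_integralZl _ _ _ (lam n.+1) setT measurableT (fun y => (Q y)%:E)); last 3 first.
  by apply/measurable_EFinP.
  by move=> y _; rewrite lee_fin.
  by rewrite lee_fin ltW.
have -> := cube_image (\row_a T a x) r'0 uB.
rewrite -EFinM lee_fin /B det_inv det_tr normfV invrK mulrA /r' mulrCA [_ ^+ n.+1]exprMn mulrA.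
rewrite ler_pM2r ?exprn_gt0 ?mulr_gt0//.
have := (dP x xd0).2 ix; rewrite ltr_norml => /andP[_ H].
by apply: ltW; move: epsP; rewrite -/k; lra.
Unshelve. all: by end_near.
Qed.

End change_of_charts.

(** * Integrals in a chart and their independence of the chart *)

Section chart_integral.
Context {R : realType} {n : nat} {M : ptopologicalType} (I : Type).
Variable A : I -> chart R n M.
Hypothesis A_manifold : is_manifold A.
Variable g : I -> 'rV[R]_n.+1 -> 'M[R]_n.+1.
Hypothesis g_metric : is_riemannian_metric A g.
Variable w : M -> R.
Hypothesis w_smooth : smooth_function A w.
Hypothesis w_pos : forall p, 0 < w p.
Implicit Types (i j : I) (x y : 'rV[R]_n.+1) (p : M).
Local Notation im i := (chart_image (A i)).
Local Notation phi i := (chart_map (A i)).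
Local Notation par i := (param (A i)).
Local Notation VT m := (borel 'rV[R]_m).
Local Notation IM := (interior_image A).
Local Notation dens := (density A g w).

Lemma smooth_on_bounded (B C : set 'rV[R]_n.+1) (f : 'rV[R]_n.+1 -> R) :
  smooth_on B f -> compact C -> C `<=` B ->
  exists2 c : R, 0 < c & forall x, C x -> `|f x| <= c.
Proof.
move=> sf cC CB.
have H := @iffLR _ _ (compact_near_coveringP C) cC _ (pinfty_nbhs R)
  (fun c x => B x -> `|f x| <= c) _.
have : \forall c \near +oo, C `<=` (fun x => B x -> `|f x| <= c).
  apply: H => x Cx.
  have := smooth_on_near sf (CB _ Cx) ltr01.
  exists ([set y | B y -> `|f x - f y| < 1], [set c | `|f x| + 1 <= c]) => /=.
    by split => //; exact: nbhs_pinfty_ge.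
  move=> [y c] /= [yB xc] By; apply: le_trans xc.
  have := yB By; have := lerB_dist (f y) (f x); rewrite distrC; lra.
move=> Hc; near (pinfty_nbhs R) => c; exists c.
  by near: c; exact: nbhs_pinfty_gt.
move=> x Cx; suff : C `<=` (fun x => B x -> `|f x| <= c) by move=> /(_ x Cx); apply; exact: CB.
by near: c.
Unshelve. all: by end_near.
Qed.

Lemma compact_chart_map i (K : set M) : compact K -> K `<=` dom (A i) -> compact (phi i @` K).
Proof.
move=> cK KA; apply: continuous_compact => //.
apply: continuous_in_subspaceT => p /set_mem Kp.
exact: (chart_coord_cont (chartP A_manifold i) (KA _ Kp)).
Qed.

Lemma compact_rV_bounded (C : set 'rV[R]_n.+1) : compact C ->
  exists2 r : R, 0 < r & C `<=` ball (0 : 'rV[R]_n.+1) r.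
Proof.
move=> /compact_bounded[N [_ HN]]; exists (`|N| + 2); first by rewrite ltr_wpDl.
move=> x Cx; rewrite -ball_normE/= sub0r normrN.
have /(_ _ x Cx) := HN (`|N| + 1); move=> /(_ _)/le_lt_trans; apply.
  by rewrite (le_lt_trans (ler_norm N))// ltrDl.
by rewrite ltrD2l ltr1n.
Qed.

Lemma smooth_on_IM_continuous i f x : smooth_on (im i) f -> IM i x -> {for x, continuous f}.
Proof.
move=> sf [ix x0]; have [F [cF FE]] := smooth_on_continuous sf ix.
have Ho : \forall z \near x, IM i z.
  by apply: open_nbhs_nbhs; split => //; exact: open_interior_image.
have /near_eq_continuous : \forall z \near x, F z = f z.
  by move: FE Ho; apply: filterS2 => z FE [jz _]; exact: FE.
exact.
Qed.

Lemma chart_measurable i (f : 'rV[R]_n.+1 -> R) :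
  (forall x, IM i x -> {for x, continuous f}) ->
  measurable_fun setT (fun x : VT n.+1 => \1_(IM i) x * f x).
Proof. by move=> cf; apply: measurable_indicM => //; exact: open_interior_image. Qed.

Lemma comp_par_continuous i (F : M -> R) x : continuous F -> IM i x ->
  {for x, continuous (F \o par i)}.
Proof.
by move=> cF ix; apply: continuous_comp; [exact: par_continuous|exact: cF].
Qed.

Lemma chart_integrand_measurable i (F : M -> R) : continuous F ->
  measurable_fun setT (fun x : VT n.+1 => \1_(IM i) x * (F (par i x) * dens i x)).
Proof.
move=> cF; apply: (@chart_measurable i (fun x => F (par i x) * dens i x)) => x ix.
apply: continuousM; first exact: (comp_par_continuous cF ix).
by apply: (smooth_on_IM_continuous _ ix); apply: smooth_density.
Qed.

Lemma lam_bounded_integrable (f : 'rV[R]_n.+1 -> R) (c r : R) : 0 < r ->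
  measurable_fun setT (f : VT n.+1 -> R) -> (forall x, `|f x| <= c) ->
  (forall x, f x != 0 -> ball (0 : 'rV[R]_n.+1) r x) ->
  (lam n.+1).-integrable setT (EFin \o (f : VT n.+1 -> R)).
Proof.
move=> r0 mf fc fr.
have c0 : 0 <= c by apply: le_trans (fc 0).
have mb := @measurable_ball_rV R n.+1 0 r.
apply: (@le_integrable _ _ _ (lam n.+1) setT measurableT _ (fun x => (c * \1_(ball (0 : 'rV[R]_n.+1) r) x)%:E)).
- by apply/measurable_EFinP.
- move=> x _; rewrite /= lee_fin [leRHS]ger0_norm ?mulr_ge0// indicE.
  have [/fr rx|] := boolP (f x != 0); first by rewrite mem_set// mulr1.
  by rewrite negbK => /eqP ->; rewrite normr0 mulr_ge0.
- apply/integrableP; split.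
    apply/measurable_EFinP; apply: measurable_funM; first exact: measurable_cst.
    exact: measurable_indic.
  rewrite (eq_integral (fun x : VT n.+1 => c%:E * (\1_(ball (0 : 'rV[R]_n.+1) r) x)%:E)%E); last first.
    by move=> x _; rewrite /= ger0_norm ?EFinM// mulr_ge0.
  rewrite (@ge0_integralZl _ _ _ (lam n.+1) setT measurableT (fun x => (\1_(ball (0 : 'rV[R]_n.+1) r) x)%:E)); last 3 first.
    by apply/measurable_EFinP; exact: measurable_indic.
    by move=> x _; rewrite lee_fin.
    by rewrite lee_fin.
  rewrite (integral_indic _ measurableT mb) setIT.
  have E := lam_ball (0 : 'rV[R]_n.+1) r0.
  apply: lte_mul_pinfty; [by rewrite lee_fin|by []|].
  by apply: le_lt_trans (ltry ((2 * r) ^+ n.+1)); rewrite le_eqVlt; apply/orP; left; apply/eqP; exact: E.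
Qed.

Lemma continuous_support_bounded (F : M -> R) (K : set M) : continuous F -> compact K ->
  (forall q, F q != 0 -> K q) -> exists2 c : R, 0 < c & forall q, `|F q| <= c.
Proof.
move=> cF cK FK.
have : compact (F @` K).
  by apply: continuous_compact => //; exact: continuous_subspaceT.
move=> /compact_bounded[N [_ HN]]; exists (`|N| + 1); first by rewrite ltr_wpDl.
move=> q; have [/FK Kq|] := boolP (F q != 0).
  apply: HN; last by exists q.
  by rewrite (le_lt_trans (ler_norm N))// ltrDl.
by rewrite negbK => /eqP ->; rewrite normr0 addr_ge0.
Qed.

Lemma chart_integrable i (F : M -> R) (K : set M) : continuous F -> compact K ->
  K `<=` dom (A i) -> (forall q, F q != 0 -> K q) ->
  (lam n.+1).-integrable setT
    (fun x : VT n.+1 => (\1_(IM i) x * (F (par i x) * dens i x))%:E).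
Proof.
move=> cF cK KA FK.
have cC := compact_chart_map cK KA.
have [r r0 Cr] := compact_rV_bounded cC.
have CI : phi i @` K `<=` im i by move=> _ [q Kq <-]; apply: im_chart => //; exact: KA.
have sD : smooth_on (im i) (dens i) by apply: smooth_density.
have [c c0 cD] := smooth_on_bounded sD cC CI.
have [c' c'0 cF'] := continuous_support_bounded cF cK FK.
have suppC x : \1_(IM i) x * (F (par i x) * dens i x) != 0 -> (phi i @` K) x.
  rewrite indicE; have [ix|nix] := pselect (IM i x); last by rewrite memNset// mul0r eqxx.
  rewrite mem_set// mul1r mulf_eq0 negb_or => /andP[/FK Kx _].
  by exists (par i x) => //; rewrite paramK//; case: ix.
apply: (@lam_bounded_integrable (fun x => \1_(IM i) x * (F (par i x) * dens i x)) (c' * c) r r0).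
- exact: chart_integrand_measurable.
- move=> x; have [/suppC Cx|] := boolP (\1_(IM i) x * (F (par i x) * dens i x) != 0).
    rewrite normrM (normrM (F _)); have := cD _ Cx; have := cF' (par i x) => h1 h2.
    rewrite -[leRHS]mul1r; apply: ler_pM; rewrite ?mulr_ge0 ?normr_ge0//.
      by rewrite indicE; case: (_ \in _); rewrite ?normr1 ?normr0.
    by apply: ler_pM; rewrite ?normr_ge0.
  by rewrite negbK => /eqP ->; rewrite normr0 mulr_ge0// ltW.
- by move=> x /suppC; exact: Cr.
Qed.

(** This is [cv_le] for the transition map, the local mass estimate being made uniform by the
    compactness of the image of [K]. One inequality suffices, since the two charts can be
    exchanged. *)
Lemma chart_change_le i j (F : M -> R) (K : set M) : continuous F -> compact K ->
  K `<=` dom (A i) -> K `<=` dom (A j) -> (forall q, 0 <= F q) -> (forall q, F q != 0 -> K q) ->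
  (\int[lam n.+1]_y (\1_(IM j) y * (F (par j y) * dens j y))%:E <=
   \int[lam n.+1]_x (\1_(IM i) x * (F (par i x) * dens i x))%:E)%E.
Proof.
move=> cF cK Ki Kj F0 FK.
pose F_ x := \1_(IM i) x * F (par i x).
pose G y := \1_(chart_overlap A i j) y * dens j y.
pose rho x := \1_(IM i) x * dens i x.
have sD k : smooth_on (im k) (dens k) by apply: smooth_density.
have dens0 k x : im k x -> 0 <= dens k x by move=> kx; apply/ltW/density_gt0.
have indic0 (B : set 'rV[R]_n.+1) (f : 'rV[R]_n.+1 -> R) x : (B x -> 0 <= f x) -> 0 <= \1_B x * f x.
  move=> Bf; rewrite indicE; have [Bx|nBx] := pselect (B x).
    by rewrite mem_set// mul1r; exact: Bf.
  by rewrite memNset// mul0r.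
have G0 y : 0 <= G y by apply: indic0 => -[[jy _] _]; exact: dens0.
have rho0 x : 0 <= rho x by apply: indic0 => -[ix _]; exact: dens0.
have F_0 x : 0 <= F_ x by apply: (@indic0 (IM i) (F \o par i)) => _; exact: F0.
have cC := compact_chart_map cK Ki.
have [r r0 Cr] := compact_rV_bounded cC.
have [c' c'0 cF'] := continuous_support_bounded cF cK FK.
have mF_ : measurable_fun setT (F_ : VT n.+1 -> R).
  by apply: (@chart_measurable i (F \o par i)) => x ix; exact: comp_par_continuous.
have suppC x : F_ x != 0 -> IM i x /\ (phi i @` K) x.
  rewrite /F_ indicE; have [ix|nix] := pselect (IM i x); last by rewrite memNset// mul0r eqxx.
  rewrite mem_set// mul1r => /FK Kx; split => //.
  by exists (par i x) => //; rewrite paramK//; case: ix.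
have fin : (\int[lam n.+1]_x (F_ x)%:E < +oo)%E.
  have b1 x : `|F_ x| <= c'.
    rewrite /F_ indicE; case: (_ \in _); rewrite ?mul1r ?cF'//.
    by rewrite mul0r normr0 ltW.
  have b2 x : F_ x != 0 -> ball (0 : 'rV[R]_n.+1) r x by move=> /suppC[_]; exact: Cr.
  have /integrableP[mE] := lam_bounded_integrable r0 mF_ b1 b2.
  apply: le_lt_trans; apply: ge0_le_integral.
  - exact: measurableT.
  - by move=> x _; rewrite lee_fin.
  - exact: mE.
  - exact: (measurableT_comp (@abse_measurable _ _) mE).
  - by move=> x _; rewrite lee_fin ler_norm.
have chg y : chart_overlap A i j y -> IM i (phi i (par j y)) /\ par i (phi i (par j y)) = par j y.
  move=> [[jy y0] iy]; split; last exact: chart_mapK.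
  by split; [exact: im_chart|apply: (interior_transition A_manifold g_metric _ y0); exact/(overlapP A_manifold)].
have contF y : G y != 0 -> {for (change A i j y : 'rV[R]_n.+1), continuous (F_ : 'rV[R]_n.+1 -> R)}.
  rewrite /G indicE; have [Oy|nOy] := pselect (chart_overlap A i j y); last by rewrite memNset// mul0r eqxx.
  move=> _; rewrite /change asboolT//; have [ix _] := chg y Oy.
  have /near_eq_continuous : \forall z \near phi i (par j y), (F \o par i) z = F_ z.
    have : \forall z \near phi i (par j y), IM i z.
      by apply: open_nbhs_nbhs; split => //; exact: open_interior_image.
    by apply: filterS => z iz; rewrite /F_ indicE mem_set// mul1r.
  by apply; exact: comp_par_continuous.
have loc e : 0 < e -> \forall k \near \oo, forall x, F_ x != 0 ->
     (\int[lam n.+1]_y (G y * \1_(ball (x : 'rV[R]_n.+1) k.+1%:R^-1) (change A i j y))%:E <=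
     ((rho x + e) * (2 * k.+1%:R^-1) ^+ n.+1)%:E)%E.
  move=> e0.
  (* The neighbourhoods of a covering are taken in the whole vector space, whereas the estimate is
     available in the half space; hence the guard [half_space x]. *)
  have H := @iffLR _ _ (compact_near_coveringP _) cC _ \oo
   (fun k x => half_space x -> (\int[lam n.+1]_y (G y * \1_(ball (x : 'rV[R]_n.+1) k.+1%:R^-1) (change A i j y))%:E <=
     ((dens i x + e) * (2 * k.+1%:R^-1) ^+ n.+1)%:E)%E) _.
  have : \forall k \near \oo, phi i @` K `<=` (fun x => half_space x -> (\int[lam n.+1]_y (G y * \1_(ball (x : 'rV[R]_n.+1) k.+1%:R^-1) (change A i j y))%:E <=
     ((dens i x + e) * (2 * k.+1%:R^-1) ^+ n.+1)%:E)%E).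
    apply: H => x0 [q Kq qx0].
    have ijx0 : overlap A i j x0 by exists q => //; split; [exact: Ki|exact: Kj].
    have [d d0 dP] := chart_mass_local A_manifold g_metric w_smooth w_pos ijx0 e0.
    exists (ball x0 d, [set k : nat | k.+1%:R^-1 < d]) => /=.
      split; first exact: nbhsx_ballx.
      exact: near_infty_natSinv_lt (PosNum d0).
    move=> [x k] /= [xd kd] Hx; apply: dP => //.
    by rewrite kd invr_gt0 ltr0n.
  apply: filterS => k Hk x /suppC[ix Cx]; rewrite /rho indicE mem_set// mul1r.
  by apply: Hk => //; case: ix => _; exact: ltW.
have mG : measurable_fun setT (G : VT n.+1 -> R).
  apply: (measurable_indicM (@open_chart_overlap _ _ _ _ A A_manifold i j)) => y [jy _].
  exact: smooth_on_IM_continuous (sD j) jy.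
have mrho : measurable_fun setT (rho : VT n.+1 -> R).
  by apply: chart_measurable => x ix; exact: smooth_on_IM_continuous (sD i) ix.
have H := cv_le mF_ mG mrho (@change_measurable _ _ _ _ A A_manifold i j) F_0 G0 rho0 fin contF loc.
have E1 y : F_ (change A i j y) * G y = \1_(IM j) y * (F (par j y) * dens j y).
  rewrite /G indicE; have [Oy|nOy] := pselect (chart_overlap A i j y).
    have [ix xE] := chg y Oy; rewrite (mem_set Oy) /F_ /change asboolT// xE !indicE mem_set//.
    by rewrite (mem_set (A := IM j)) ?mul1r//; case: Oy.
  rewrite (memNset nOy) mul0r mulr0 indicE.
  have [jy|njy] := pselect (IM j y); last by rewrite memNset// mul0r.
  have [/FK /Ki iy|] := boolP (F (par j y) != 0); first by case: nOy; split.
  by rewrite negbK => /eqP ->; rewrite mul0r mulr0.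
have E2 x : F_ x * rho x = \1_(IM i) x * (F (par i x) * dens i x).
  by rewrite /F_ /rho indicE; case: (_ \in _); rewrite ?mul1r ?mul0r.
rewrite (eq_integral (fun y : VT n.+1 => (F_ (change A i j y) * G y)%:E)); last by move=> y _; rewrite E1.
by rewrite [leRHS](eq_integral (fun x : VT n.+1 => (F_ x * rho x)%:E)); last by move=> x _; rewrite E2.
Qed.

(** Only the interior part of the chart is integrated over: the parametrization is continuous there
    in the ordinary sense, and the hyperplane left out has measure 0. *)
Definition chart_integral i (F : M -> R) : R :=
  (\int[lam n.+1]_(x in (setT : set (VT n.+1))) (\1_(IM i) x * (F (par i x) * dens i x)))%R.

Lemma chart_integral_sum i (N : nat) (F : 'I_N -> M -> R) (K : set M) :
  (forall k, continuous (F k)) -> compact K -> K `<=` dom (A i) -> (forall k q, F k q != 0 -> K q) ->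
  chart_integral i (fun q => \sum_k F k q) = \sum_k chart_integral i (F k).
Proof.
move=> cF cK Ki FK.
rewrite /chart_integral /Rintegral sum_fine; last first.
  by move=> k _; apply: integrable_fin_num => //; exact: (chart_integrable (cF k) cK Ki (FK k)).
congr fine; rewrite -integral_sum//; last by move=> k; exact: (chart_integrable (cF k) cK Ki (FK k)).
apply: eq_integral => x _; rewrite sumEFin; congr EFin.
by rewrite mulr_suml mulr_sumr.
Qed.

Lemma chart_integral_change i j (F : M -> R) (K : set M) : continuous F -> compact K ->
  K `<=` dom (A i) -> K `<=` dom (A j) -> (forall q, F q != 0 -> K q) ->
  chart_integral i F = chart_integral j F.
Proof.
move=> cF cK Ki Kj FK.
(* For [s = 1] and [s = -1] this function is the positive and the negative part of [F]; both are
   continuous and vanish off [K]. *)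
have cpos (s : R) q : {for q, continuous (fun q => (`|s * F q| + s * F q) / 2)}.
  have cs : {for q, continuous (fun q => s * F q)} by apply: continuousM; [exact: cvg_cst|exact: cF].
  apply: continuousM; last exact: cvg_cst.
  by apply: continuousD => //; apply: continuous_comp; [exact: cs|exact: norm_continuous].
have pos (s : R) : (fun q => ((`|s * F q| + s * F q) / 2)) = (fun q => ((`|s * F q| + s * F q) / 2)) -> chart_integral i (fun q => ((`|s * F q| + s * F q) / 2)) = chart_integral j (fun q => ((`|s * F q| + s * F q) / 2)).
  move=> _; pose Fs q := ((`|s * F q| + s * F q) / 2).
  have cFs : continuous Fs.
    by move=> q; exact: cpos.
  have Fs0 q : 0 <= Fs q by rewrite divr_ge0// -lerBlDr sub0r -normrN ler_norm.
  have FsK q : Fs q != 0 -> K q.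
    move=> Fq; apply: FK; apply: contra Fq => /eqP Fq; rewrite /Fs Fq mulr0.
    by rewrite normr0 addr0 mul0r.
  rewrite /chart_integral /Rintegral; congr fine; apply/eqP; rewrite eq_le; apply/andP; split.
    exact: (chart_change_le cFs cK Kj Ki Fs0 FsK).
  exact: (chart_change_le cFs cK Ki Kj Fs0 FsK).
have dec k : K `<=` dom (A k) -> chart_integral k F =
    chart_integral k (fun q => ((`|1 * F q| + 1 * F q) / 2)) - chart_integral k (fun q => ((`|-1 * F q| + -1 * F q) / 2)).
  move=> Kk.
  have ik (s : R) : (lam n.+1).-integrable setT
    (fun x : VT n.+1 => (\1_(IM k) x * (((`|s * F (par k x)| + s * F (par k x)) / 2) * dens k x))%:E).
    apply: (@chart_integrable k (fun q => ((`|s * F q| + s * F q) / 2)) K) => //.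
      by move=> q; exact: cpos.
    move=> q Fq; apply: FK; apply: contra Fq => /eqP ->; rewrite mulr0.
    by rewrite normr0 addr0 mul0r.
  rewrite /chart_integral -RintegralB//; [|exact: (ik 1)|exact: (ik (-1))].
  apply: eq_Rintegral => x _; rewrite -mulrBr -mulrBl; congr (_ * (_ * _)).
  by rewrite mul1r mulN1r normrN; field.
by rewrite (dec i Ki) (dec j Kj) !pos.
Qed.

End chart_integral.

(** * Green's formula *)

Section half_space_parts.
Context {R : realType} {n : nat}.
Implicit Types x y : 'rV[R]_n.+1.
Local Notation VT m := (borel 'rV[R]_m).
Local Notation H := (@half_space R n).
Local Notation P := [set x : 'rV[R]_n.+1 | 0 < x ord0 ord0].
Local Notation e_ j := (delta_mx ord0 j : 'rV[R]_n.+1).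
Local Notation leb := (@lebesgue_measure R).

Lemma smooth_on_derive (f : 'rV[R]_n.+1 -> R) (B : set 'rV[R]_n.+1) x j : B `<=` H ->
  smooth_on B f -> nbhs x B -> P x -> is_derive x (e_ j) f (partial j f x).
Proof.
move=> BH sf Bx Px; have [U [F [oU Ux CF FE]]] := sf x (nbhs_singleton Bx).
have dF : is_derive x (e_ j) F ('D_(e_ j) F x) by apply: (Ck_derivable _ (CF 1%N)).
have Ff : \forall y \near x, F y = f y.
  have : nbhs x U by apply: open_nbhs_nbhs.
  by move: Bx; apply: filterS2 => y By Uy; exact: FE.
have df : is_derive x (e_ j) f ('D_(e_ j) F x).
  by apply: (near_eq_is_derive (f := F)) => //; apply: filterS Ff => y ->.
suff -> : partial j f x = 'D_(e_ j) F x by [].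
have [W [oW Wx WB]] : exists W, [/\ open W, W x & W `<=` B `&` U].
  have : nbhs x (B `&` U) by apply: filterI => //; exact: open_nbhs_nbhs.
  by rewrite nbhsE => -[W [oW Wx] WB]; exists W.
apply: (partialE oW Wx (BH _ (nbhs_singleton Bx)) _ dF) => y Wy _.
by have [By Uy] := WB _ Wy; apply/esym; exact: FE.
Qed.

Lemma smooth_on_partial (f : 'rV[R]_n.+1 -> R) (B W : set 'rV[R]_n.+1) j :
  open W -> B = W `&` H -> smooth_on B f -> smooth_on B (partial j f).
Proof.
move=> oW BE sf x Bx; have [U [F [oU Ux CF FE]]] := sf x Bx.
exists (U `&` W), ('D_(e_ j) F); split.
- exact: openI.
- by split => //; move: Bx; rewrite BE => -[].
- by move=> k; apply: Ck_sub (Ck_derive _ (CF k.+1)) => y [].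
- move=> y [Uy Wy] By; apply/esym.
  have dF : is_derive y (e_ j) F ('D_(e_ j) F y) by apply: (Ck_derivable _ (CF 1%N)).
  have oUW : open (U `&` W) by exact: openI.
  apply: (partialE oUW _ _ _ dF) => //; first by move: By; rewrite BE => -[].
  by move=> z [Uz Wz] Hz; apply/esym; apply: FE => //; rewrite BE.
Qed.

Variables (G : 'rV[R]_n.+1 -> R) (r : R).
Hypothesis r_gt0 : 0 < r.
Hypothesis smooth_G : smooth_on H G.
Hypothesis supp_G : forall x, H x -> G x != 0 -> ball (0 : 'rV[R]_n.+1) r x.

Let HE : H = setT `&` H. Proof. by rewrite setTI. Qed.

Let PH x : P x -> H x. Proof. by move=> ?; exact: ltW. Qed.

Let nbhsH x : P x -> nbhs x H.
Proof.
move=> Px; have : nbhs x P by apply: open_nbhs_nbhs; split => //; exact: open_pos_half.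
by apply: filterS => y; exact: PH.
Qed.

Let dG x j : P x -> is_derive x (e_ j) G (partial j G x).
Proof. by move=> Px; apply: (@smooth_on_derive G H) => //; exact: nbhsH. Qed.

Let G0_far x : H x -> r <= `|x| -> G x = 0.
Proof.
move=> Hx rx; apply/eqP; rewrite -[_ == _]negbK; apply/negP => /(supp_G Hx).
by rewrite -ball_normE/= sub0r normrN ltNge rx.
Qed.

Let partial_far x j : P x -> r < `|x| -> partial j G x = 0.
Proof.
move=> Px rx; have [_ <-] := dG j Px.
have d0 : is_derive x (e_ j) (cst 0 : 'rV[R]_n.+1 -> R) 0 by exact: is_derive_cst.
have : is_derive x (e_ j) G 0; last by case.
apply: (near_eq_is_derive (f := cst 0)) => //.
have c : {for x, continuous (fun y : 'rV[R]_n.+1 => `|y|)} by exact: norm_continuous.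
have h1 : \forall y \near x, r < `|y| by exact: (c _ (lt_nbhsr rx)).
have h2 := nbhsH Px.
by move: h1 h2; apply: filterS2 => y ry Hy; rewrite G0_far// ltW.
Qed.

Let compact_HB : compact (H `&` closed_ball (0 : 'rV[R]_n.+1) (r + 1)).
Proof.
apply: bounded_closed_compact.
  exists (r + 1); split; first exact: num_real.
  move=> M rM x [_]; rewrite closed_ballE ?addr_gt0// /closed_ball_/= sub0r normrN => /le_trans; apply.
  exact: ltW.
by apply: closedI; [exact: closed_half_space|exact: closed_ball_closed].
Qed.

Let partial_bounded j : exists2 c : R, 0 < c & forall x, P x -> `|partial j G x| <= c.
Proof.
have sp : smooth_on H (partial j G) := (smooth_on_partial j openT HE smooth_G).
have [c c0 cP] := smooth_on_bounded sp compact_HB (@subIsetl _ _ _).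
exists c => // x Px; have [xr|xr] := ltP r `|x|.
  by rewrite partial_far// normr0 ltW.
apply: cP; split; first exact: PH.
by rewrite closed_ballE ?addr_gt0// /closed_ball_/= sub0r normrN (le_trans xr)// lerDl.
Qed.

Let measurable_P (f : 'rV[R]_n.+1 -> R) : smooth_on H f ->
  measurable_fun setT (fun x : VT n.+1 => \1_P x * f x).
Proof.
move=> sf; apply: measurable_indicM; first exact: open_pos_half.
move=> x Px; have [F [cF FE]] := smooth_on_continuous sf (PH Px).
have /near_eq_continuous : \forall z \near x, F z = f z.
  by move: FE (nbhsH Px); apply: filterS2 => z FE Hz; exact: FE.
exact.
Qed.

Lemma integrable_partial j : (lam n.+1).-integrable setT
  (EFin \o (fun x : VT n.+1 => \1_P x * partial j G x)).
Proof.
have [c c0 cP] := partial_bounded j.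
apply: (@lam_bounded_integrable _ _ (fun x : 'rV[R]_n.+1 => \1_P x * partial j G x) c (r + 1)).
- by rewrite addr_gt0.
- by apply: measurable_P; exact: (smooth_on_partial j openT HE smooth_G).
- move=> x; rewrite indicE; have [Px|nPx] := pselect (P x).
    by rewrite mem_set// mul1r; exact: cP.
  by rewrite memNset// mul0r normr0 ltW.
- move=> x; rewrite indicE; have [Px|nPx] := pselect (P x); last by rewrite memNset// mul0r eqxx.
  rewrite mem_set// mul1r => G0; rewrite -ball_normE/= sub0r normrN.
  have [xr|xr] := ltP r `|x|; first by move: G0; rewrite partial_far// eqxx.
  by rewrite (le_lt_trans xr)// ltrDl.
Qed.

(** Translations along the boundary preserve the half space and the measure, so all difference
    quotients in direction [j] have integral 0; dominated convergence passes this to the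
    derivative. *)
Lemma integral_partial_tangent j : j != ord0 ->
  (\int[lam n.+1]_(x in (setT : set (VT n.+1))) (\1_P x * partial j G x))%R = 0.
Proof.
move=> j0; have [c c0 cP] := partial_bounded j.
pose F (x : VT n.+1) : R := \1_P x * G x.
have mF : measurable_fun setT F by exact: measurable_P smooth_G.
have [cG cG0 cGP] := smooth_on_bounded smooth_G compact_HB (@subIsetl _ _ _).
have F_far x : F x != 0 -> ball (0 : 'rV[R]_n.+1) r x.
  rewrite /F indicE; have [Px|nPx] := pselect (P x); last by rewrite memNset// mul0r eqxx.
  by rewrite mem_set// mul1r; apply: supp_G; exact: PH.
have iF : (lam n.+1).-integrable setT (EFin \o F).
  apply: (@lam_bounded_integrable _ _ F cG r) => // x.
  have [Fx|] := boolP (F x != 0); last by rewrite negbK => /eqP ->; rewrite normr0 ltW.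
  have rx := F_far _ Fx; move: Fx; rewrite /F indicE.
  have [Px|nPx] := pselect (P x); last by rewrite memNset// mul0r eqxx.
  rewrite mem_set// mul1r => _; apply: cGP; split; first exact: PH.
  move: rx; rewrite -ball_normE/= sub0r normrN => rx.
  by rewrite closed_ballE ?addr_gt0// /closed_ball_/= sub0r normrN ltW// (lt_trans rx)// ltrDl.
have Pshift (x : 'rV[R]_n.+1) (h : R) : P (x + h *: e_ j) = P x.
  by rewrite /= !mxE eqxx/= (eq_sym ord0 j) (negbTE j0) mulr0 addr0.
pose q (k : nat) (x : VT n.+1) : R := k.+1%:R * (F ((x : 'rV[R]_n.+1) + k.+1%:R^-1 *: e_ j) - F x).
have mS k : measurable_fun setT (fun x : VT n.+1 => F ((x : 'rV[R]_n.+1) + k.+1%:R^-1 *: e_ j)).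
  exact: (measurableT_comp mF (shift_measurable _)).
have iS k : (lam n.+1).-integrable setT (fun x : VT n.+1 => (F ((x : 'rV[R]_n.+1) + k.+1%:R^-1 *: e_ j))%:E).
  apply/integrableP; split; first by apply/measurable_EFinP; exact: mS.
  have mA : measurable_fun setT (fun x : VT n.+1 => `|F x|%:E).
    by apply/measurable_EFinP; exact: measurableT_comp.
  have := lam_shift (k.+1%:R^-1 *: e_ j) mA (fun x => normr_ge0 _) => E.
  have /integrableP[_ Ffin] := iF.
  by apply: le_lt_trans Ffin; rewrite le_eqVlt; apply/orP; left; apply/eqP; exact: E.
have shiftE k : (\int[lam n.+1]_x (F ((x : 'rV[R]_n.+1) + k.+1%:R^-1 *: e_ j)%R)%:E = \int[lam n.+1]_x (F x)%:E)%E.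
  have mE : measurable_fun setT (EFin \o F) by apply/measurable_EFinP.
  rewrite integralE [RHS]integralE; congr (_ - _)%E.
    have := lam_shift (k.+1%:R^-1 *: e_ j) (measurable_funepos mE) (fun x => funepos_ge0 _ x).
    by move=> <-; apply: eq_integral => x _; rewrite !funeposE.
  have := lam_shift (k.+1%:R^-1 *: e_ j) (measurable_funeneg mE) (fun x => funeneg_ge0 _ x).
  by move=> <-; apply: eq_integral => x _; rewrite !funenegE.
have iq k : (\int[lam n.+1]_x (q k x)%:E = 0)%E.
  have iD := integrableB measurableT (iS k) iF.
  rewrite (eq_integral (fun x : VT n.+1 => k.+1%:R%:E * ((F ((x : 'rV[R]_n.+1) + k.+1%:R^-1 *: e_ j)%R)%:E - (F x)%:E))%E); last first.
    by move=> x _; rewrite /q EFinM EFinB.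
  rewrite (integralZl measurableT iD) (integralB measurableT (iS k) iF).
  have finF := integrable_fin_num measurableT iF.
  by rewrite [X in (_ * (X - _))%E]shiftE subee ?mule0.
pose L (x : VT n.+1) : \bar R := (\1_P x * partial j G x)%:E.
have mL : measurable_fun setT L.
  by apply/measurable_EFinP; apply: measurable_P; exact: (smooth_on_partial j openT HE smooth_G).
(* The shifts have length at most 1, so the difference quotients vanish outside the ball of radius
   [r + 1]; the mean value theorem bounds them by [c]. *)
pose B (x : VT n.+1) : \bar R := (c * \1_(ball (0 : 'rV[R]_n.+1) (r + 1)) x)%:E.
have iB : (lam n.+1).-integrable setT B.
  apply: (@lam_bounded_integrable _ _ (fun x : 'rV[R]_n.+1 => c * \1_(ball (0 : 'rV[R]_n.+1) (r + 1)) x) c (r + 1)).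
  - by rewrite addr_gt0.
  - by apply: measurable_funM; [exact: measurable_cst|apply: measurable_indic; exact: measurable_ball_rV].
  - move=> x; rewrite indicE; case: (_ \in _); [rewrite mulr1 ger0_norm// ltW//|rewrite mulr0 normr0 ltW//].
  - move=> x; rewrite indicE; have [rx|nrx] := pselect (ball (0 : 'rV[R]_n.+1) (r + 1) x) => //.
    by rewrite memNset// mulr0 eqxx.
have qL (x : VT n.+1) : q ^~ x @ \oo --> (\1_P x * partial j G x : R).
  have [Px|nPx] := pselect (P x); last first.
    rewrite /q /F; rewrite (_ : (fun k => _) = cst 0).
      by rewrite indicE memNset// mul0r; exact: cvg_cst.
    apply/funext => k; rewrite !indicE (memNset nPx) memNset ?Pshift//.
    by rewrite !mul0r subrr mulr0.
  rewrite indicE mem_set// mul1r.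
  have [dGx <-] := dG j Px.
  have -> : q ^~ x = (fun k : nat => (k.+1%:R^-1)^-1 *: (G (k.+1%:R^-1 *: e_ j + x) - G x)).
    apply/funext => k.
    by rewrite /q /F invrK !indicE (mem_set Px) mem_set ?Pshift// !mul1r [_ *: e_ j + x]addrC.
  apply: (cvg_comp (fun k : nat => k.+1%:R^-1 : R) (fun h : R => h^-1 *: (G (h *: e_ j + x) - G x)) (G := 0^')) => //.
  move=> Z; rewrite /dnbhs /= => -[d /= d0 dZ].
  have := near_infty_natSinv_lt (PosNum d0); apply: filterS => k kd.
  apply: dZ => /=; last by rewrite invr_eq0 pnatr_eq0.
  by rewrite sub0r normrN ger0_norm.
have qB (x : VT n.+1) k : `|q k x| <= c * \1_(ball (0 : 'rV[R]_n.+1) (r + 1)) x.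
  have h0 : (0 : R) < k.+1%:R^-1 by rewrite invr_gt0.
  have h1 : (k.+1%:R^-1 : R) <= 1 by rewrite invf_le1// ler1n.
  have nh : `|(k.+1%:R^-1 : R) *: e_ j| <= 1.
    have ne : `|e_ j| <= 1.
      by apply: mx_norm_le => // a b; rewrite mxE; case: (_ && _); rewrite ?normr1 ?normr0.
    rewrite normrZ ger0_norm; last exact: ltW.
    by rewrite -[leRHS]mulr1; apply: ler_pM => //; exact: ltW.
  have [Px|nPx] := pselect (P x); last first.
    rewrite /q /F !indicE (memNset nPx) memNset ?Pshift//.
    by rewrite !mul0r subrr mulr0 normr0 mulr_ge0// ltW.
  rewrite /q /F !indicE (mem_set Px) mem_set ?Pshift// !mul1r.
  have [rx|nrx] := pselect (ball (0 : 'rV[R]_n.+1) (r + 1) x); last first.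
    have nx : r + 1 <= `|x| by move: nrx; rewrite -ball_normE/= sub0r normrN leNgt => /negP.
    have Gx0 : G x = 0 by apply: G0_far; [exact: PH|rewrite (le_trans _ nx)// lerDl].
    have Gx1 : G (x + k.+1%:R^-1 *: e_ j) = 0.
      apply: G0_far; first by apply: PH; rewrite Pshift.
      have := lerB_normD x (k.+1%:R^-1 *: e_ j); lra.
    by rewrite Gx0 Gx1 subrr mulr0 normr0 mulr_ge0// ltW.
  rewrite mem_set// mulr1.
  have der (t : R) : t \in `]0, (k.+1%:R^-1 : R)[ -> is_derive t (1 : R) (fun t => G (t *: e_ j + x)) (partial j G (t *: e_ j + x)).
    by move=> _; apply: is_derive_segment; apply: dG; rewrite addrC Pshift.
  have [t _ E] : exists2 t, t \in `]0, (k.+1%:R^-1 : R)[ & G (k.+1%:R^-1 *: e_ j + x) - G (0 *: e_ j + x) = partial j G (t *: e_ j + x) * (k.+1%:R^-1 - 0).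
    apply: (@MVT _ (fun t => G (t *: e_ j + x)) (fun t => partial j G (t *: e_ j + x)) 0 k.+1%:R^-1 h0 der).
    apply: derivable_within_continuous => t _.
    have := @is_derive_segment _ _ G x (e_ j) t (partial j G (t *: e_ j + x)).
    by move=> /(_ (dG j _))[]//; rewrite addrC Pshift.
  rewrite scale0r add0r subr0 in E; rewrite [x + _]addrC E normrM mulrC normrM.
  rewrite (ger0_norm (ltW h0)) -mulrA normr_nat mulVf ?mulr1; last by rewrite pnatr_eq0.
  by apply: cP; rewrite addrC Pshift.
have mq k : measurable_fun setT (fun x : VT n.+1 => (q k x)%:E).
  by apply/measurable_EFinP; apply: measurable_funM; [exact: measurable_cst|exact: measurable_funB (mS k) mF].
have aeL : {ae (lam n.+1), forall x : VT n.+1, setT x -> (fun k => (q k x)%:E) @ \oo --> L x}.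
  by apply: aeW => x _; apply: cvg_EFin; [exact: nearW|exact: qL].
have aeB : {ae (lam n.+1), forall (x : VT n.+1) (k : nat), setT x -> (`|(q k x)%:E| <= B x)%E}.
  by apply: aeW => x k _; exact: qB.
have [_ _ H3] := @dominated_convergence _ _ _ (lam n.+1) setT measurableT
  (fun k (x : VT n.+1) => (q k x)%:E) L B mq mL aeL iB aeB.
have {}H3 : (fun k => \int[lam n.+1]_x (q k x)%:E)%E @ \oo --> (\int[lam n.+1]_x L x)%E := H3.
have E0 : (fun k => \int[lam n.+1]_x (q k x)%:E)%E = cst 0%E by apply/funext => k; exact: iq.
rewrite E0 in H3.
have E := cvg_unique (@ereal_hausdorff R) (cvg_cst (0 : \bar R)%E) H3.
by rewrite /Rintegral -[X in fine X]E.
Qed.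

Let rowf0 (t : R) (y : 'rV[R]_n) : rowf (t, y) = t *: e_ ord0 + bd_point y :> 'rV[R]_n.+1.
Proof.
apply/rowP => k; rewrite !mxE eqxx/=.
case: (splitP (k : 'I_(1 + n))) => j kj.
  have -> : k = ord0 by apply: val_inj; rewrite /= kj (ord1 j).
  by rewrite (ord1 j) !mxE eqxx/= mulr1 addr0.
have -> : (k == ord0) = false by apply/negbTE; rewrite -val_eqE/= kj.
by rewrite mulr0 add0r.
Qed.

Let rowf00 (t : R) (y : 'rV[R]_n) : (rowf (t, y) : 'rV[R]_n.+1) ord0 ord0 = t.
Proof.
rewrite !mxE; case: (splitP (ord0 : 'I_(1 + n))) => j //= _.
by rewrite (ord1 j) !mxE eqxx.
Qed.

Let line_cvg (h : 'rV[R]_n.+1 -> R) (y : 'rV[R]_n) (t : R) : smooth_on H h -> 0 <= t ->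
  h (rowf (s, y)) @[s --> within [set s | 0 <= s] (nbhs t)] --> h (rowf (t, y)).
Proof.
move=> sh t0; have Ht : H (rowf (t, y) : 'rV[R]_n.+1) by rewrite /half_space/= rowf00.
have [F [cF FE]] := smooth_on_continuous sh Ht.
have cr : {for t, continuous (fun s : R => rowf (s, y) : 'rV[R]_n.+1)}.
  rewrite (_ : (fun s : R => _) = fun s => s *: e_ ord0 + bd_point y); last by apply/funext => s; exact: rowf0.
  by apply: cvgD; [apply: cvgZr_tmp; exact: cvg_id|exact: cvg_cst].
have cFr : F (rowf (s, y)) @[s --> t] --> F (rowf (t, y)) by exact: continuous_comp cr cF.
rewrite -(nbhs_singleton FE Ht).
apply: (@cvg_trans _ (F (rowf (s, y)) @[s --> within [set s | 0 <= s] (nbhs t)])).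
  apply: near_eq_cvg; rewrite /within/=.
  have crF : \forall s \near t, H (rowf (s, y)) -> F (rowf (s, y)) = h (rowf (s, y)) := cr _ FE.
  move: crF; apply: filterS => s Fs s0.
  by apply: Fs; rewrite /half_space/= rowf00.
by apply: cvg_trans cFr; apply: cvg_app; exact: cvg_within.
Qed.

(** The fundamental theorem of calculus on the normal line through [y], from the boundary to
    [r + 1]. This end is beyond the support of [G], so only the boundary value remains, with a minus
    sign. *)
Let line_FTC (y : 'rV[R]_n) :
  (\int[leb]_t (\1_P (rowf (t, y)) * partial ord0 G (rowf (t, y)))%:E = (- G (bd_point y))%:E)%E.
Proof.
pose b := r + 1; have b0 : 0 < b by rewrite addr_gt0.
pose f t := partial ord0 G (rowf (t, y)).
have sp : smooth_on H (partial ord0 G) := smooth_on_partial ord0 openT HE smooth_G.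
have lines h : smooth_on H h -> [/\ forall t : R, 0 < t -> h (rowf (s, y)) @[s --> t] --> h (rowf (t, y)),
    h (rowf (s, y)) @[s --> 0^'+] --> h (rowf (0, y)) & h (rowf (s, y)) @[s --> b^'-] --> h (rowf (b, y))].
  move=> sh; have int (t : R) : 0 < t -> h (rowf (s, y)) @[s --> t] --> h (rowf (t, y)).
    move=> t0; have := @line_cvg h y t sh (ltW t0); apply: cvg_trans; apply: cvg_app.
    move=> Q HQ; have HQ' : \forall s \near t, 0 <= s -> Q s := HQ.
    suff : \forall s \near t, Q s by [].
    by move: HQ' (lt_nbhsr t0); apply: filterS2 => s Qs s0; apply: Qs; exact: ltW.
  split => //.
    have := @line_cvg h y 0 sh (lexx 0); apply: cvg_trans; apply: cvg_app.
    move=> Q HQ; have HQ' : \forall s \near (0 : R), 0 <= s -> Q s := HQ.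
    suff : \forall s \near (0 : R), 0 < s -> Q s by [].
    by move: HQ'; apply: filterS => s Qs s0; apply: Qs; exact: ltW.
  by apply: cvg_at_left_filter; exact: int.
have cf : {within `[0, b], continuous f}.
  have [c1 c2 c3] := lines _ sp.
  apply/continuous_within_itvP; first by [].
  split; [by move=> t; rewrite in_itv/= => /andP[t0 _]; exact: c1|exact: c2|exact: c3].
have [g1 g2 g3] := lines _ smooth_G.
have dF (t : R) : 0 < t -> is_derive t (1 : R) (fun t => G (rowf (t, y))) (f t).
  move=> t0; rewrite (_ : (fun t : R => G (rowf (t, y))) = fun t => G (t *: e_ ord0 + bd_point y)).
    apply: is_derive_segment; rewrite /f -rowf0; apply: dG.
    by rewrite /= rowf00.
  by apply/funext => s; rewrite rowf0.
have E := @continuous_FTC2 R f (fun t => G (rowf (t, y))) 0 b b0 cf.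
have {}E : (\int[leb]_(x in `[0%R, b]) (f x)%:E = (G (rowf (b, y)))%:E - (G (rowf (0, y)))%:E)%E.
  apply: E; first split => //.
    by move=> t; rewrite in_itv/= => /andP[t0 _]; case: (dF t t0).
  move=> t; rewrite in_itv/= => /andP[t0 _]; rewrite derive1E.
  by have [_ ->] := dF t t0.
transitivity (\int[leb]_(x in `]0%R, b]) (f x)%:E)%E.
  rewrite [RHS]integral_mkcond; apply: eq_integral => t _; rewrite patchE.
  rewrite indicE; have [t0|t0] := ltP 0 t; last first.
    rewrite memNset ?mul0r; last by rewrite /= rowf00 => /lt_le_trans/(_ t0); rewrite ltxx.
    by rewrite memNset//= in_itv/= => /andP[/lt_le_trans/(_ t0)]; rewrite ltxx.
  rewrite (mem_set (A := P)) ?mul1r; last by rewrite /= rowf00.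
  have [tb|tb] := leP t b; first by rewrite mem_set//= in_itv/= t0.
  rewrite memNset; last by rewrite /= in_itv/= => /andP[_]; rewrite leNgt tb.
  rewrite partial_far//; first by rewrite /= rowf00.
  apply: (@lt_le_trans _ _ t); first by rewrite (lt_trans _ tb)// ltrDl.
  have := coord_le_norm (rowf (t, y) : 'rV[R]_n.+1) ord0 ord0.
  by rewrite rowf00 ger0_norm// ltW.
rewrite (integral_itv_obnd_cbnd (r := 0) (b := BRight b)); last first.
  have mP := measurable_P sp.
  have mPE : measurable_fun setT (fun x : VT n.+1 => (\1_P x * partial ord0 G x)%:E) by apply/measurable_EFinP.
  have mf := row_measurable2 y mPE.
  try apply/measurable_EFinP.
  apply: (@eq_measurable_fun _ _ _ _ _ (fun t : measurableTypeR R => \1_P (rowf (t, y)) * partial ord0 G (rowf (t, y)))).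
    move=> t; rewrite inE/= in_itv/= => /andP[t0 _].
    by rewrite indicE mem_set ?mul1r//= rowf00.
  by apply: measurable_funTS; apply/measurable_EFinP.
rewrite E; rewrite G0_far ?sub0e; last 2 first.
- by rewrite /half_space/= rowf00 ltW.
- apply: (@le_trans _ _ b); first by rewrite lerDl.
  have := coord_le_norm (rowf (b, y) : 'rV[R]_n.+1) ord0 ord0.
  by rewrite rowf00 ger0_norm// ltW.
by rewrite rowf0 scale0r add0r EFinN.
Qed.

(** The iterated integral with the normal variable inside is used for nonnegative functions, so the
    positive and negative parts are integrated separately and recombined on each normal line. *)
Lemma integral_partial_normal :
  (\int[lam n.+1]_(x in (setT : set (VT n.+1))) (\1_P x * partial ord0 G x))%R =
  - (\int[lam n]_(y in (setT : set (VT n))) G (bd_point y))%R.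
Proof.
have iF := integrable_partial ord0.
pose F (x : VT n.+1) : \bar R := (\1_P x * partial ord0 G x)%:E.
have mF : measurable_fun setT F by case/integrableP: iF.
have pos_fin : (\int[lam n.+1]_x F^\+ x < +oo)%E by have /integrableP[] := integrable_funepos measurableT iF; under eq_integral do rewrite gee0_abs//.
have neg_fin : (\int[lam n.+1]_x F^\- x < +oo)%E by have /integrableP[] := integrable_funeneg measurableT iF; under eq_integral do rewrite gee0_abs//.
have mFp := measurable_funepos mF; have mFn := measurable_funeneg mF.
pose Ap (y : VT n) := (\int[leb]_t F^\+ (rowf (t, y)))%E.
pose An (y : VT n) := (\int[leb]_t F^\- (rowf (t, y)))%E.
have row_m := @row_mx_measurable R n.
have mAp : measurable_fun setT Ap.
  have m1 : measurable_fun setT (fun z : measurableTypeR R * VT n => (F^\+)%E (rowf z)) := measurableT_comp mFp row_m.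
  have m2 := @measurable_fun_fubini_tonelli_G _ _ _ _ _ leb _ m1 (fun z => funepos_ge0 _ _).
  exact: m2.
have mAn : measurable_fun setT An.
  have m1 : measurable_fun setT (fun z : measurableTypeR R * VT n => (F^\-)%E (rowf z)) := measurableT_comp mFn row_m.
  have m2 := @measurable_fun_fubini_tonelli_G _ _ _ _ _ leb _ m1 (fun z => funeneg_ge0 _ _).
  exact: m2.
have Ap0 (y : VT n) : (0 <= Ap y)%E by apply: integral_ge0 => t _; exact: funepos_ge0.
have An0 (y : VT n) : (0 <= An y)%E by apply: integral_ge0 => t _; exact: funeneg_ge0.
have EAp : (\int[lam n.+1]_x F^\+ x = \int[lam n]_y Ap y)%E := integral_lamS2 mFp (fun x => funepos_ge0 _ x).
have EAn : (\int[lam n.+1]_x F^\- x = \int[lam n]_y An y)%E := integral_lamS2 mFn (fun x => funeneg_ge0 _ x).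
have iAp : (lam n).-integrable setT Ap.
  apply/integrableP; split => //; rewrite (eq_integral Ap); first by rewrite -EAp.
  by move=> y _; rewrite gee0_abs.
have iAn : (lam n).-integrable setT An.
  apply/integrableP; split => //; rewrite (eq_integral An); first by rewrite -EAn.
  by move=> y _; rewrite gee0_abs.
have EE (y : VT n) : (Ap y - An y = (- G (bd_point y))%:E)%E.
  rewrite -line_FTC [RHS]integralE.
  by congr (_ - _)%E; apply: eq_integral => t _; rewrite ?funeposE ?funenegE.
have E : (\int[lam n.+1]_x F x = \int[lam n]_y (- G (bd_point y))%:E)%E.
  rewrite integralE EAp EAn -integralB//.
  by apply: eq_integral => y _; rewrite EE.
rewrite /Rintegral -[LHS]/(fine (\int[lam n.+1]_x F x)%E) E -fineN; congr fine.
have -> : (fun y : VT n => (- G (bd_point y))%:E) = (fun y : VT n => (- (G (bd_point y))%:E)%E) by apply/funext.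
apply: integralN; apply: fin_num_adde_defl.
have -> : (\int[lam n]_y ((fun y0 : VT n => (G (bd_point y0))%:E)^\- y))%E = (\int[lam n]_y ((fun y0 : VT n => (- G (bd_point y0))%:E)^\+ y))%E.
  by apply: eq_integral => y _; rewrite funeposE funenegE EFinN.
have /integrable_funepos -/(_ measurableT) := integrableB measurableT iAp iAn.
move=> /integrable_fin_num -/(_ measurableT).
by rewrite fin_numN; congr (_ \is a fin_num); apply: eq_integral => y _; rewrite !funeposE EE.
Qed.

End half_space_parts.

(** * Differentials and their metric pairing *)

Section gradient.
Context {R : realType} {n : nat} {M : ptopologicalType} (I : Type).
Variable A : I -> chart R n M.
Hypothesis A_manifold : is_manifold A.
Variable g : I -> 'rV[R]_n.+1 -> 'M[R]_n.+1.
Hypothesis g_metric : is_riemannian_metric A g.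
Implicit Types (i j : I) (x y : 'rV[R]_n.+1) (p : M) (u v f h : M -> R).
Local Notation im i := (chart_image (A i)).
Local Notation phi i := (chart_map (A i)).
Local Notation par i := (param (A i)).
Local Notation smoothM := (smooth_function A).

Definition gradient i u x : 'rV[R]_n.+1 := \row_j partial j (u \o par i) x.

(* The metric pairing of the differentials of [u] and [v], in the chart [A i]. *)
Definition carre i u v x : R :=
  (gradient i u x *m invmx (g i x) *m (gradient i v x)^T) ord0 ord0.

(** The chain rule, applied to local extensions so that it also holds at boundary points. *)
Lemma gradient_change i j u x : smoothM u -> overlap A i j x ->
  gradient i u x = gradient j u (phi j (par i x)) *m transition_jac A i j x.
Proof.
move=> su ijx; have [U [T [oU Ux CT TE DT]]] := transition_ext A_manifold ijx.
have ix := overlap_im A_manifold ijx.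
have jy := overlap_im A_manifold (overlap_sym A_manifold ijx).
set y0 := phi j (par i x) in jy *.
have [V [F [oV Vy CF FE]]] := su j y0 jy.
pose Tv (x : 'rV[R]_n.+1) : 'rV[R]_n.+1 := \row_a T a x.
have Tx : Tv x = y0.
  by apply/rowP => a; rewrite mxE; have [_ ->] := TE x Ux (im_half A_manifold ix).
have cT : {for x, continuous Tv}.
  apply: continuous_rV => a.
  rewrite (_ : (fun y : 'rV[R]_n.+1 => _) = T a); last by apply/funext => y; rewrite mxE.
  exact: (Ck_continuous (CT a 0)).
have [W [oW Wx WP]] : exists W, [/\ open W, W x & forall y, W y -> U y /\ V (Tv y)].
  have : nbhs x (U `&` Tv @^-1` V).
    apply: filterI; first exact: open_nbhs_nbhs.
    by apply: cT; apply: open_nbhs_nbhs; rewrite Tx.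
  by rewrite nbhsE => -[W [oW Wx] WB]; exists W.
apply/rowP => b; rewrite !mxE.
have dT l : is_derive x (delta_mx ord0 b) (fun y => Tv y ord0 l) (transition_jac A i j x l b).
  rewrite (_ : (fun y => _) = T l); last by apply/funext => y; rewrite mxE.
  by rewrite -DT; apply: (Ck_derivable _ (CT l 1%N)).
have VT : V (Tv x) by rewrite Tx.
have dF := is_derive_chain oV (CF 1%N) VT dT.
transitivity (\sum_l 'D_(delta_mx ord0 l) F (Tv x) * transition_jac A i j x l b).
  apply: (partialE oW Wx (im_half A_manifold ix) _ dF) => y Wy Hy.
  have [Uy VTy] := WP y Wy; have [ov Ty] := TE y Uy Hy.
  have TyE : Tv y = phi j (par i y) by apply/rowP => a; rewrite mxE Ty.
  rewrite /= FE// TyE /=; last exact: (overlap_im A_manifold (overlap_sym A_manifold ov)).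
  rewrite chart_mapK//; by case: (iffLR (overlapP A_manifold _ _ _) ov).
apply: eq_bigr => l _; rewrite Tx.
have [W2 oW2 imW] := chart_image_open (chartP A_manifold j).
have jyW : (V `&` W2) y0 by split => //; move: jy; rewrite imW => -[].
have dF2 : is_derive y0 (delta_mx ord0 l) F ('D_(delta_mx ord0 l) F y0).
  by apply: (Ck_derivable _ (CF 1%N)).
have E : partial l (u \o par j) y0 = 'D_(delta_mx ord0 l) F y0.
  apply: (partialE (openI oV oW2) jyW (im_half A_manifold jy) _ dF2) => z [Vz Wz] Hz.
  by rewrite FE// imW.
by rewrite -E ?mxE.
Qed.

Lemma metric_unit i x : im i x -> g i x \in unitmx.
Proof. by move=> ix; rewrite unitmxE unitfE gt_eqF// (det_metric_gt0 g_metric). Qed.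

Lemma carre_change i j u v x : smoothM u -> smoothM v -> overlap A i j x ->
  carre i u v x = carre j u v (phi j (par i x)).
Proof.
move=> su sv ijx; rewrite /carre (gradient_change su ijx) (gradient_change sv ijx).
set J := transition_jac A i j x; set y0 := phi j (par i x).
have uJ : J \in unitmx by exact: (transition_jac_unit A_manifold g_metric).
have uGi := metric_unit (overlap_im A_manifold ijx).
have uGj := metric_unit (overlap_im A_manifold (overlap_sym A_manifold ijx)).
have GE : g i x = J^T *m g j y0 *m J := riemannian_change g_metric ijx.
have H : J *m invmx (g i x) *m J^T = invmx (g j y0).
  have E : (J *m invmx (g i x) *m J^T) *m g j y0 = 1%:M.
    apply: (can_inj (mulmxK uJ)); rewrite mul1mx -!mulmxA (mulmxA J^T) -GE.
    by rewrite mulVmx// mulmx1.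
  by rewrite -[LHS]mulmx1 -(mulmxV uGj) mulmxA E mul1mx.
by rewrite trmx_mul -H !mulmxA.
Qed.

Lemma smooth_invmx i a b : smooth_on (im i) (fun x => invmx (g i x) a b).
Proof.
apply: (@smooth_on_eq _ _ _ (fun x => cofactor (g i x) b a * (\det (g i x))^-1)).
  move=> x ix; rewrite /invmx (metric_unit ix) !mxE mulrC//.
apply: smooth_onM; last first.
  apply: smooth_onV; last exact: (smooth_det_metric g_metric).
  by move=> x ix; exact: (det_metric_gt0 g_metric).
rewrite /cofactor; apply: smooth_onM; first exact: smooth_on_cst.
rewrite /determinant; apply: smooth_on_sum => s; apply: smooth_onM; first exact: smooth_on_cst.
apply: smooth_on_prod => k; have H : smooth_on (im i) (fun x => g i x (lift b k) (lift a (s k))) by exact: (riemannian_smooth g_metric).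
by move: H; apply: smooth_on_eq => x _; rewrite !mxE.
Qed.

Lemma smooth_chart_partial i u (j : 'I_n.+1) : smoothM u -> smooth_on (im i) (partial j (u \o par i)).
Proof.
move=> su; have [W oW imW] := chart_image_open (chartP A_manifold i).
move=> x ix; have [U [F [oU Ux CF FE]]] := su i x ix.
exists (U `&` W), ('D_(delta_mx ord0 j) F); split.
- exact: openI.
- by split => //; move: ix; rewrite imW => -[].
- by move=> k; apply: Ck_sub (Ck_derive _ (CF k.+1)) => y [].
- move=> y [Uy Wy] iy; apply/esym.
  have dF : is_derive y (delta_mx ord0 j) F ('D_(delta_mx ord0 j) F y) by apply: (Ck_derivable _ (CF 1%N)).
  apply: (partialE (openI oU oW) _ (im_half A_manifold iy) _ dF) => // z [Uz Wz] Hz.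
  by apply/esym; apply: FE => //; rewrite imW.
Qed.

Lemma carreE i u v x : carre i u v x =
  \sum_j \sum_k invmx (g i x) j k * partial j (u \o par i) x * partial k (v \o par i) x.
Proof.
rewrite /carre !mxE exchange_big/=; apply: eq_bigr => k _.
rewrite !mxE mulr_suml; apply: eq_bigr => j _; rewrite !mxE; ring.
Qed.

Lemma smooth_carre i u v : smoothM u -> smoothM v -> smooth_on (im i) (carre i u v).
Proof.
move=> su sv; apply: (@smooth_on_eq _ _ _ (fun x => \sum_j \sum_k invmx (g i x) j k * partial j (u \o par i) x * partial k (v \o par i) x)).
  by move=> x _; rewrite carreE.
apply: smooth_on_sum => j; apply: smooth_on_sum => k; apply: smooth_onM; last exact: smooth_chart_partial.
by apply: smooth_onM; [exact: smooth_invmx|exact: smooth_chart_partial].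
Qed.

Definition chart_at p : I := projT1 (cid (manifold_cover A_manifold p)).

Lemma chart_atP p : dom (A (chart_at p)) p.
Proof. exact: (projT2 (cid (manifold_cover A_manifold p))). Qed.

(** Evaluated in a chosen chart; by [carre_change] the choice is immaterial for smooth arguments. *)
Definition carreM u v p : R := carre (chart_at p) u v (phi (chart_at p) p).

Lemma carreM_chart i u v x : smoothM u -> smoothM v -> im i x ->
  carreM u v (par i x) = carre i u v x.
Proof.
move=> su sv ix; rewrite /carreM; set j := chart_at _; apply/esym.
apply: carre_change => //; apply/(overlapP A_manifold); split => //; exact: chart_atP.
Qed.

Lemma smooth_carreM u v : smoothM u -> smoothM v -> smoothM (carreM u v).
Proof.
move=> su sv i; move: (@smooth_carre i u v su sv); apply: smooth_on_eq => x ix.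
by rewrite /= carreM_chart.
Qed.

Lemma carre_sym i u v x : im i x -> carre i u v x = carre i v u x.
Proof.
move=> ix; rewrite /carre.
transitivity (((gradient i u x *m invmx (g i x) *m (gradient i v x)^T)^T) ord0 ord0); first by rewrite [RHS]mxE.
by rewrite !trmx_mul trmxK trmx_inv (riemannian_sym g_metric ix) mulmxA.
Qed.

(** The entry is the squared length, for [g], of the nonzero row [e_0 g^-1]. *)
Lemma inv_metric00_gt0 i x : im i x -> 0 < invmx (g i x) ord0 ord0.
Proof.
move=> ix; have u := metric_unit ix.
pose v : 'rV[R]_n.+1 := delta_mx ord0 ord0 *m invmx (g i x).
have v0 : v != 0.
  apply/eqP => v0; have : v *m g i x = 0 by rewrite v0 mul0mx.
  rewrite /v -mulmxA mulVmx// mulmx1 => /matrixP/(_ ord0 ord0); rewrite !mxE !eqxx/=.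
  by move/eqP; rewrite oner_eq0.
have := riemannian_pos g_metric ix v0.
rewrite /v -mulmxA trmx_mul -!mulmxA (mulmxA (g i x)) trmx_inv (riemannian_sym g_metric ix) mulmxV// mul1mx.
rewrite mulmxA trmx_delta -rowE -colE !mxE//.
Qed.

End gradient.

(** * Green's formula in one chart *)

Section green.
Context {R : realType} {n : nat} {M : ptopologicalType} (I : Type).
Variable A : I -> chart R n M.
Hypothesis A_manifold : is_manifold A.
Variable g : I -> 'rV[R]_n.+1 -> 'M[R]_n.+1.
Hypothesis g_metric : is_riemannian_metric A g.
Variable w : M -> R.
Hypothesis w_smooth : smooth_function A w.
Hypothesis w_pos : forall p, 0 < w p.
Implicit Types (i : I) (x y : 'rV[R]_n.+1) (p : M) (u v f h : M -> R).
Local Notation im i := (chart_image (A i)).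
Local Notation phi i := (chart_map (A i)).
Local Notation par i := (param (A i)).
Local Notation smoothM := (smooth_function A).
Local Notation VT m := (borel 'rV[R]_m).
Local Notation IM := (interior_image A).
Local Notation H := (@half_space R n).
Local Notation P := [set x : 'rV[R]_n.+1 | 0 < x ord0 ord0].
Local Notation carre := (carre A g).
Local Notation carreM := (carreM A_manifold g).
Local Notation e_ j := (delta_mx ord0 j : 'rV[R]_n.+1).

(** The compact set [C] is closed, so the extension by 0 is locally constant off [C], in particular
    at the points of the half space outside the chart image. *)
Lemma extend_smooth i (f : 'rV[R]_n.+1 -> R) (C : set 'rV[R]_n.+1) : compact C -> C `<=` im i ->
  smooth_on (im i) f -> (forall x, im i x -> f x != 0 -> C x) ->
  smooth_on H (fun x => \1_(im i) x * f x).
Proof.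
move=> cC Ci sf fC x Hx; have [W oW imW] := chart_image_open (chartP A_manifold i).
have [ix|nix] := pselect (im i x).
  have [U [F [oU Ux CF FE]]] := sf x ix; exists (U `&` W), F; split.
  - exact: openI.
  - by split => //; move: ix; rewrite imW => -[].
  - by move=> k; apply: Ck_sub (CF k) => y [].
  - move=> y [Uy Wy] Hy; have iy : im i y by rewrite imW.
    by rewrite indicE mem_set// mul1r; exact: FE.
exists (~` C), (cst 0); split.
- by apply: closed_openC; apply: compact_closed => //; exact: norm_hausdorff.
- by move=> /Ci.
- by move=> k; exact: Ck_cst.
- move=> y nCy Hy; rewrite indicE; have [iy|niy] := pselect (im i y); last by rewrite memNset// mul0r.
  rewrite mem_set// mul1r; apply/esym/eqP; rewrite -[_ == _]negbK; apply/negP => /(fC _ iy).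
  exact: nCy.
Qed.

(** The expression that [a_op] differentiates, kept term by term so that [flux_div] matches its
    double sum directly. *)
Definition flux_term i v (j k : 'I_n.+1) y : R :=
  w (par i y) * Num.sqrt (\det (g i y)) * invmx (g i y) j k * partial k (v \o par i) y.

Definition flux i v (j : 'I_n.+1) y : R := \sum_k flux_term i v j k y.

Lemma smooth_flux_term i v j k : smoothM v -> smooth_on (im i) (flux_term i v j k).
Proof.
move=> sv; apply: smooth_onM; last exact: (smooth_chart_partial A_manifold).
apply: smooth_onM; last by apply: smooth_invmx.
by apply: smooth_onM; [exact: w_smooth|exact: (smooth_sqrt_det g_metric)].
Qed.

Lemma smooth_flux i v j : smoothM v -> smooth_on (im i) (flux i v j).
Proof. by move=> sv; apply: smooth_on_sum => k; exact: smooth_flux_term. Qed.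

(** A component of the vector field [chi (u grad v - v grad u)], times the density of the weighted
    volume. *)
Definition field i (chi u v : M -> R) (j : 'I_n.+1) x : R :=
  chi (par i x) * (u (par i x) * flux i v j x - v (par i x) * flux i u j x).

Lemma smooth_field i chi u v j : smoothM chi -> smoothM u -> smoothM v ->
  smooth_on (im i) (field i chi u v j).
Proof.
move=> sc su sv; apply: smooth_onM; first exact: sc.
by apply: smooth_onB; apply: smooth_onM; do ?[exact: su|exact: sv]; exact: smooth_flux.
Qed.

Lemma flux_carre i f h x : im i x ->
  \sum_j partial j (f \o par i) x * flux i h j x = density A g w i x * carre i f h x.
Proof.
move=> ix; rewrite carreE mulr_sumr; apply: eq_bigr => j _.
rewrite /flux !mulr_sumr; apply: eq_bigr => k _; rewrite /flux_term /density; ring.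
Qed.

Lemma flux_div i v x : im i x ->
  \sum_j \sum_k partial j (flux_term i v j k) x = - density A g w i x * a_op A g w i v x.
Proof.
move=> ix; rewrite /a_op mulNr mulrN opprK mulr_sumr; apply: eq_bigr => j _.
rewrite mulr_sumr; apply: eq_bigr => k _; rewrite /density /=.
have s0 : Num.sqrt (\det (g i x)) != 0.
  by rewrite gt_eqF// sqrtr_gt0; exact: (det_metric_gt0 g_metric).
have w0 : w (par i x) != 0 by rewrite gt_eqF.
by rewrite mulrA -invfM mulfV ?mul1r// mulf_neq0.
Qed.

Lemma IM_nbhs i x : IM i x -> nbhs x (im i).
Proof.
move=> ix; have : nbhs x (IM i) by apply: open_nbhs_nbhs; split => //; exact: open_interior_image.
by apply: filterS => y [].
Qed.

Lemma field_derive i chi u v (j : 'I_n.+1) x : smoothM chi -> smoothM u -> smoothM v -> IM i x ->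
  is_derive x (e_ j) (field i chi u v j)
   (partial j (chi \o par i) x * (u (par i x) * flux i v j x - v (par i x) * flux i u j x) +
    chi (par i x) * (partial j (u \o par i) x * flux i v j x + u (par i x) * \sum_k partial j (flux_term i v j k) x
      - partial j (v \o par i) x * flux i u j x - v (par i x) * \sum_k partial j (flux_term i u j k) x)).
Proof.
move=> sc su sv ix; have iH : im i `<=` H by move=> y; exact: im_half.
have nx := IM_nbhs ix; have Px : P x by case: ix.
have dM f : smoothM f -> is_derive x (e_ j) (f \o par i) (partial j (f \o par i) x).
  by move=> sf; exact: (smooth_on_derive j iH (sf i) nx Px).
have dflux f : smoothM f -> is_derive x (e_ j) (flux i f j) (\sum_k partial j (flux_term i f j k) x).
  move=> sf; rewrite (_ : flux i f j = \sum_k flux_term i f j k); last by apply/funext => y; rewrite /flux fct_sumE.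
  apply: is_derive_sum => k; apply: (smooth_on_derive j iH _ nx Px); exact: smooth_flux_term.
have D := is_deriveM (dM _ sc) (is_deriveB (is_deriveM (dM _ su) (dflux _ sv)) (is_deriveM (dM _ sv) (dflux _ su))).
apply: is_derive_eq D _; rewrite /=.
rewrite ?fctE /GRing.scale/= /comp/=. ring.
Qed.

(** The divergence theorem on the half space for [field] extended by 0. Tangential derivatives
    integrate to 0; in the divergence the pairings of [u] with [v] cancel by symmetry, and what
    remains is the differential of [chi] and the operator [a]. *)
Lemma chart_green i (chi u v qu qv : M -> R) (K : set M) :
  smoothM chi -> smoothM u -> smoothM v -> compact K -> K `<=` dom (A i) ->
  (forall q, chi q != 0 -> K q) ->
  (forall x, im i x -> a_op A g w i u x = qu (par i x)) ->
  (forall x, im i x -> a_op A g w i v x = qv (par i x)) ->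
  chart_integral A g w i (fun p => (u p * carreM v chi p - v p * carreM u chi p)
     - chi p * (u p * qv p - v p * qu p)) =
  - (\int[lam n]_(y in (setT : set (VT n))) (\1_(im i) (bd_point y) * field i chi u v ord0 (bd_point y)))%R.
Proof.
move=> sc su sv cK Ki chiK quE qvE.
pose C := phi i @` K; have cC : compact C := compact_chart_map A_manifold cK Ki.
have [r r0 Cr] := compact_rV_bounded cC.
have Ci : C `<=` im i by move=> _ [q Kq <-]; apply: im_chart => //; exact: Ki.
pose G j x := \1_(im i) x * field i chi u v j x.
have fieldC j x : im i x -> field i chi u v j x != 0 -> C x.
  move=> ix; rewrite /field mulf_eq0 negb_or => /andP[/chiK Kx _].
  by exists (par i x) => //; rewrite paramK.
have sG j : smooth_on H (G j).
  by apply: (extend_smooth cC Ci _ (fieldC j)); exact: smooth_field.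
have GC j x : H x -> G j x != 0 -> ball (0 : 'rV[R]_n.+1) r x.
  move=> _; rewrite /G indicE; have [ix|nix] := pselect (im i x); last by rewrite memNset// mul0r eqxx.
  by rewrite mem_set// mul1r => /(fieldC _ _ ix); exact: Cr.
rewrite -(integral_partial_normal r0 (sG ord0) (GC ord0)).
transitivity (\sum_j (\int[lam n.+1]_(x in (setT : set (VT n.+1))) (\1_P x * partial j (G j) x))%R).
  have ij j := integrable_partial r0 (sG j) (GC j) j.
  rewrite /Rintegral sum_fine; last first.
    by move=> j _; apply: integrable_fin_num => //; exact: ij.
  rewrite /chart_integral /Rintegral; congr fine; rewrite -integral_sum//.
  apply: eq_integral => x _; rewrite sumEFin; congr EFin.
  have [ix|nix] := pselect (IM i x); last first.
    rewrite indicE memNset// mul0r big1// => j _.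
    rewrite indicE; have [Px|nPx] := pselect (P x); last by rewrite memNset// mul0r.
    have nCx : (~` C) x by move=> /Ci ?; apply: nix.
    have oC : open (~` C) by apply: closed_openC; apply: compact_closed => //; exact: norm_hausdorff.
    rewrite (@partialE _ _ (~` C) (G j) (cst 0) x j 0 oC nCx (ltW Px)) ?mulr0//.
    move=> y nCy Hy; rewrite /G indicE; have [iy|niy] := pselect (im i y); last by rewrite memNset// mul0r.
    rewrite mem_set// mul1r; apply/eqP; rewrite -[_ == _]negbK; apply/negP => /(fieldC _ _ iy).
    exact: nCy.
  have [iix Px] := ix.
  rewrite indicE mem_set// mul1r.
  rewrite (carreM_chart A_manifold g_metric sv sc iix) (carreM_chart A_manifold g_metric su sc iix).
  pose dchi j := partial j (chi \o par i) x; pose du j := partial j (u \o par i) x; pose dv j := partial j (v \o par i) x.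
  pose fu j := flux i u j x; pose fv j := flux i v j x.
  pose dfu j := \sum_k partial j (flux_term i u j k) x; pose dfv j := \sum_k partial j (flux_term i v j k) x.
  set U := u (par i x); set V := v (par i x); set X := chi (par i x).
  transitivity (\sum_j (dchi j * (U * fv j - V * fu j) + X * (du j * fv j + U * dfv j - dv j * fu j - V * dfu j))); last first.
    apply: eq_bigr => j _; rewrite indicE mem_set// mul1r; apply/esym.
    have oIM : open (IM i) by exact: open_interior_image.
    apply: (partialE oIM ix (ltW Px) _ (field_derive j sc su sv ix)) => y [iy _] _.
    by rewrite /G indicE mem_set// mul1r.
  transitivity (U * (\sum_j dchi j * fv j) - V * (\sum_j dchi j * fu j) + X * ((\sum_j du j * fv j) + U * (\sum_j dfv j)
     - (\sum_j dv j * fu j) - V * (\sum_j dfu j))); last first.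
    rewrite !mulr_sumr -!sumrB -!big_split/= -!sumrB !mulr_sumr -big_split/=.
    by apply: eq_bigr => j _; ring.
  rewrite !flux_carre// !flux_div// quE// qvE//.
  rewrite (carre_sym g_metric chi v iix) (carre_sym g_metric chi u iix) (carre_sym g_metric v u iix).
  rewrite -/U -/V; ring.
rewrite (bigD1 ord0)//= big1 ?addr0//.
by move=> j j0; exact: (integral_partial_tangent r0 (sG j) (GC j)).
Qed.

(** The exterior conormal is [- e_0] divided by the square root of the entry [g^00] of the inverse
    metric, and [det g * g^00] is the determinant of the boundary metric ([invmx00]). The component
    0 of the flux is thus minus the Neumann datum times the boundary density. *)
Lemma field_boundary i (chi u v Fu Fv : M -> R) x : im i x -> x ord0 ord0 = 0 ->
  (forall nu, exterior_conormal g i x nu -> b_op A g w i nu u x = Fu (par i x)) ->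
  (forall nu, exterior_conormal g i x nu -> b_op A g w i nu v x = Fv (par i x)) ->
  field i chi u v ord0 x = chi (par i x) * (v (par i x) * Fu (par i x) - u (par i x) * Fv (par i x))
    * Num.sqrt (\det (bd_metric (g i x))).
Proof.
move=> ix x0 uF vF; have c0 := inv_metric00_gt0 g_metric ix; set c := invmx (g i x) ord0 ord0 in c0.
pose nu : 'rV[R]_n.+1 := - (Num.sqrt c)^-1 *: e_ ord0.
have sc0 : 0 < Num.sqrt c by rewrite sqrtr_gt0.
have nu0 : nu ord0 ord0 = - (Num.sqrt c)^-1 by rewrite !mxE !eqxx/= mulr1.
have nuk k : k != ord0 -> nu ord0 k = 0 by move=> k0; rewrite !mxE eqxx/= (negbTE k0) mulr0.
have cn : exterior_conormal g i x nu.
  split => //; first by rewrite nu0 oppr_lt0 invr_gt0.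
  rewrite (bigD1 ord0)//= (bigD1 ord0)//= !big1 ?addr0.
  - rewrite nu0 -/c -mulrA mulrNN -invfM -expr2 sqr_sqrtr ?mulfV ?gt_eqF// ltW//.
  - by move=> j j0; rewrite big1// => k _; rewrite (nuk j j0) mulr0 mul0r.
  - by move=> k k0; rewrite (nuk k k0) mulr0.
have fluxE f Ff : b_op A g w i nu f x = Ff -> flux i f ord0 x = - Ff * Num.sqrt (\det (bd_metric (g i x))).
  move=> <-; rewrite invmx00 ?gt_eqF ?(det_metric_gt0 g_metric)// sqrtrM ?ltW ?(det_metric_gt0 g_metric)// -/c.
  rewrite /b_op (eq_bigr (fun j => w (par i x) * invmx (g i x) j ord0 * nu ord0 ord0 * partial j (f \o par i) x)); last first.
    move=> j _; rewrite (bigD1 ord0)//= big1 ?addr0// => k k0.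
    by rewrite (nuk k k0) mulr0 mul0r.
  rewrite nu0 /flux -sumrN mulr_suml; apply: eq_bigr => j _; rewrite /flux_term.
  have -> : invmx (g i x) ord0 j = invmx (g i x) j ord0.
    by rewrite -[in LHS](riemannian_sym g_metric ix) -trmx_inv mxE.
  by field; rewrite gt_eqF.
rewrite /field (fluxE u _ (uF _ cn)) (fluxE v _ (vF _ cn)); ring.
Qed.

End green.

(** * The boundary measure in a chart *)

Section boundary_integral.
Import finmap HBNNSimple.
Context {R : realType} {n : nat} {M : ptopologicalType} (I : Type).
Variable A : I -> chart R n M.
Hypothesis A_manifold : is_manifold A.
Variable g : I -> 'rV[R]_n.+1 -> 'M[R]_n.+1.
Hypothesis g_metric : is_riemannian_metric A g.
Variable dS : {finite_measure set (borel M) -> \bar R}.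
Hypothesis dS_volume : is_boundary_measure A g dS.
Implicit Types (i : I) (p : M).
Local Notation im i := (chart_image (A i)).
Local Notation phi i := (chart_map (A i)).
Local Notation par i := (param (A i)).
Local Notation smoothM := (smooth_function A).
Local Notation VT m := (borel 'rV[R]_m).
Local Notation IM := (interior_image A).
Local Notation bd := (@bd_point R n).
Local Notation sbd i y := (Num.sqrt (\det (bd_metric (g i (bd y))))).

Definition bd_image i : set 'rV[R]_n := [set y | im i (bd y)].

Lemma bd_half (y : 'rV[R]_n) : half_space (bd y).
Proof.
rewrite /half_space/= !mxE; case: (splitP (ord0 : 'I_(1 + n))) => j //= _.
by rewrite (ord1 j) !mxE.
Qed.

Lemma bd00 (y : 'rV[R]_n) : bd y ord0 ord0 = 0.
Proof.
rewrite !mxE; case: (splitP (ord0 : 'I_(1 + n))) => j //= _.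
by rewrite (ord1 j) !mxE.
Qed.

Lemma bd_continuous : continuous bd.
Proof.
move=> y; apply: continuous_rV => j.
rewrite /bd_point; case: (splitP (j : 'I_(1 + n))) => k jk.
  rewrite (_ : (fun y => _) = cst 0); first exact: cst_continuous.
  apply/funext => z; rewrite mxE; case: splitP => l; first by rewrite mxE.
  by rewrite jk => E; move: (ltn_ord k); rewrite E.
rewrite (_ : (fun y => _) = fun z : 'rV[R]_n => z ord0 k); first exact: coord_continuous.
apply/funext => z; rewrite mxE; case: splitP => l; rewrite jk.
  by move=> E; move: (ltn_ord l); rewrite -E.
by move=> /addnI E; congr (z _ _); apply: val_inj.
Qed.

Lemma open_bd_image i : open (bd_image i).
Proof.
have [W oW imW] := chart_image_open (chartP A_manifold i).
rewrite (_ : bd_image i = bd @^-1` W); first by apply: open_comp => // y _; exact: bd_continuous.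
by apply/seteqP; split=> y; rewrite /bd_image imW/=; [move=> []|move=> ?; split => //; exact: bd_half].
Qed.

Lemma par_bd_continuous i y : bd_image i y -> {for y, continuous (par i \o bd)}.
Proof.
move=> iy O; rewrite /= nbhsE => -[Q [oQ Qx] QO].
have [V [oV Vx HV]] := param_near A_manifold iy oQ Qx.
have : nbhs y (bd @^-1` V) by apply: bd_continuous; exact: open_nbhs_nbhs.
by apply: filterS => z Vz; apply: QO; case: (HV _ Vz (bd_half z)).
Qed.

Lemma smooth_sbd i : smooth_on (im i) (fun x => Num.sqrt (\det (bd_metric (g i x)))).
Proof.
apply: smooth_on_sqrt.
  move=> x ix; rewrite invmx00 ?gt_eqF ?(det_metric_gt0 g_metric)//.
  by rewrite mulr_gt0 ?(det_metric_gt0 g_metric)// (inv_metric00_gt0 g_metric).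
rewrite /determinant; apply: smooth_on_sum => s; apply: smooth_onM; first exact: smooth_on_cst.
apply: smooth_on_prod => k.
have H : smooth_on (im i) (fun x => g i x (rshift 1 k) (rshift 1 (s k))) by exact: (riemannian_smooth g_metric).
by move: H; apply: smooth_on_eq => x _; rewrite /bd_metric !mxE.
Qed.

Lemma bd_comp_continuous i (f : 'rV[R]_n.+1 -> R) y : smooth_on (im i) f -> bd_image i y ->
  {for y, continuous (f \o bd)}.
Proof.
move=> sf iy; have [F [cF FE]] := smooth_on_continuous sf iy.
have cFb : {for y, continuous (F \o bd)} by apply: continuous_comp; [exact: bd_continuous|exact: cF].
have /near_eq_continuous : \forall z \near y, (F \o bd) z = (f \o bd) z.
  have Ho : \forall z \near y, bd_image i z by apply: open_nbhs_nbhs; split => //; exact: open_bd_image.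
  have FE' : \forall z \near y, im i (bd z) -> F (bd z) = f (bd z) := @bd_continuous y _ FE.
  by move: FE' Ho; apply: filterS2 => z FE' iz; exact: FE'.
exact.
Qed.

Let sigma i (y : VT n) : borel M := if `[< bd_image i y >] then par i (bd y) else point.

Let sigma_measurable i : measurable_fun setT (sigma i).
Proof.
have H := @measurable_if_open 'rV[R]_n M _ (fun y => par i (bd y)) point (@open_bd_image i).
by apply: H => y iy; exact: (par_bd_continuous iy).
Qed.

Let sb i (y : VT n) : R := \1_(bd_image i) y * sbd i y.

Let sb_measurable i : measurable_fun setT (sb i).
Proof.
apply: (measurable_indicM (@open_bd_image i)) => y iy.
exact: (bd_comp_continuous (@smooth_sbd i) iy).
Qed.

Let sb_ge0 i y : 0 <= sb i y.
Proof. by rewrite mulr_ge0// sqrtr_ge0. Qed.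

Let integrand_measurable i (Q : M -> R) : measurable_fun setT (Q : borel M -> R) ->
  measurable_fun setT (fun y : VT n => sb i y * Q (sigma i y)).
Proof.
by move=> mQ; apply: measurable_funM; [exact: sb_measurable|exact: measurableT_comp mQ (sigma_measurable i)].
Qed.

Let measure_chart i (E : set (borel M)) : measurable E -> E `<=` dom (A i) ->
  dS E = (\int[lam n]_y (sb i y * \1_E (sigma i y))%:E)%E.
Proof.
move=> mE EA; rewrite (dS_volume mE EA).
have eqF : (fun y : 'rV[R]_n => (\1_(phi i @` E) (bd y) * sbd i y)%:E) =
    (fun y : VT n => (sb i y * \1_E (sigma i y))%:E).
  apply/funext => y; congr EFin; rewrite /sb /sigma !indicE.
  have [iy|niy] := pselect (bd_image i y).
    rewrite asboolT// (mem_set iy) mul1r mulrC; congr (_ * (nat_of_bool _)%:R).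
    apply/idP/idP => [/set_mem[q Eq qy]|/set_mem Ey]; apply: mem_set.
      by rewrite -qy chart_mapK//; exact: EA.
    by exists (par i (bd y)) => //; rewrite paramK.
  rewrite memNset ?(memNset niy) ?mul0r//.
  by move=> [q Eq qy]; apply: niy; rewrite /bd_image/= -qy; apply: im_chart => //; exact: EA.
rewrite eqF; apply: iintE.
  by apply/measurable_EFinP; apply: integrand_measurable; exact: measurable_indic.
by move=> y; rewrite lee_fin mulr_ge0.
Qed.

Let nnsfun_chart i (h : {nnsfun (borel M) >-> R}) : (forall q, h q != 0 -> dom (A i) q) ->
  (\int[dS]_p (h p)%:E = \int[lam n]_y (sb i y * h (sigma i y))%:E)%E.
Proof.
move=> hA; set s := fset_set (h @` setT).
have s0 k : 0 <= s`_k.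
  have [ks|ks] := ltnP k (size s); last by rewrite nth_default.
  have : s`_k \in s by exact: mem_nth.
  by rewrite in_fset_set// => /set_mem[q _ <-].
transitivity (\int[dS]_p (\sum_(k < #|` s|) (s`_k * \1_(h @^-1` [set s`_k]) p)%:E))%E.
  by apply: eq_integral => p _; rewrite sumEFin; congr EFin; exact: fimfunEord.
transitivity (\int[lam n]_y (\sum_(k < #|` s|) (s`_k * (sb i y * \1_(h @^-1` [set s`_k]) (sigma i y)))%:E))%E; last first.
  apply: eq_integral => y _; rewrite sumEFin; congr EFin.
  rewrite [in RHS](fimfunEord h (sigma i y)) mulr_sumr; apply: eq_bigr => k _; ring.
rewrite ge0_integral_sum//; last 2 first.
- by move=> k; apply/measurable_EFinP; apply: measurable_funM => //; exact: measurable_indic.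
- by move=> k p _; rewrite lee_fin mulr_ge0.
rewrite ge0_integral_sum//; last 2 first.
- move=> k; apply/measurable_EFinP; apply: measurable_funM => //; apply: integrand_measurable.
  exact: measurable_indic.
- by move=> k p _; rewrite lee_fin mulr_ge0// mulr_ge0.
apply: eq_bigr => k _.
(* The level set of the value 0 is not contained in the chart domain, but it contributes nothing. *)
have [->|k0] := eqVneq s`_k 0.
  rewrite (eq_integral (cst 0%E)); last by move=> p _; rewrite mul0r.
  rewrite integral0 (eq_integral (cst 0%E)); last by move=> p _; rewrite mul0r.
  by rewrite integral0.
have mB : measurable (h @^-1` [set s`_k]) by exact: measurable_sfunP.
rewrite (eq_integral (fun p : borel M => (s`_k)%:E * (\1_(h @^-1` [set s`_k]) p)%:E)%E); last by move=> p _; rewrite EFinM.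
rewrite (@ge0_integralZl _ _ _ dS setT measurableT (fun p => (\1_(h @^-1` [set s`_k]) p)%:E)); last 3 first.
- by apply/measurable_EFinP; exact: measurable_indic.
- by move=> p _; rewrite lee_fin.
- by rewrite lee_fin.
rewrite [in RHS](eq_integral (fun y : VT n => (s`_k)%:E * (sb i y * \1_(h @^-1` [set s`_k]) (sigma i y))%:E)%E); last by move=> p _; rewrite EFinM.
rewrite (@ge0_integralZl _ _ _ (lam n) setT measurableT (fun y => (sb i y * \1_(h @^-1` [set s`_k]) (sigma i y))%:E)); last 3 first.
- by apply/measurable_EFinP; apply: integrand_measurable; exact: measurable_indic.
- by move=> p _; rewrite lee_fin mulr_ge0.
- by rewrite lee_fin.
rewrite -measure_chart//; last by move=> q /= hq; apply: hA; rewrite hq.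
by rewrite integral_indic// setIT.
Qed.

(** The hypothesis on [dS] concerns measurable subsets of a chart domain. It passes to simple
    functions supported there and, by monotone convergence, to nonnegative functions. *)
Lemma ge0_boundary_integral i (Q : M -> R) : measurable_fun setT (Q : borel M -> R) ->
  (forall q, 0 <= Q q) -> (forall q, Q q != 0 -> dom (A i) q) ->
  (\int[dS]_p (Q p)%:E = \int[lam n]_y (\1_(bd_image i) y * Q (par i (bd y)) * sbd i y)%:E)%E.
Proof.
move=> mQ Q0 QA.
have mE : measurable_fun setT (EFin \o (Q : borel M -> R)) by apply/measurable_EFinP.
pose h := nnsfun_approx measurableT mE.
have cvh p : (h k p)%:E @[k --> \oo] --> (Q p)%:E.
  exact: (@cvg_nnsfun_approx _ _ _ setT measurableT (EFin \o (Q : borel M -> R)) mE (fun x _ => Q0 x) p Logic.I).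
have ndh p : {homo (fun k => (h k p)%:E) : a b / (a <= b)%N >-> (a <= b)%E}.
  by move=> a b ab; rewrite lee_fin; have /lefP := @nd_nnsfun_approx _ _ _ setT measurableT (EFin \o (Q : borel M -> R)) mE _ _ ab; exact.
have hQ (k : nat) p : h k p <= Q p.
  by rewrite -lee_fin /h nnsfun_approxE; apply: le_approx => // *; rewrite ?lee_fin.
(* Simple functions below [Q] vanish where [Q] does, hence outside the chart. *)
have hA k q : h k q != 0 -> dom (A i) q.
  move=> hq; apply: QA; rewrite gt_eqF// (lt_le_trans _ (hQ k q))// lt_neqAle eq_sym hq/=.
  by [].
have E1 := @cvg_monotone_convergence _ _ _ dS setT measurableT (fun k p => (h k p)%:E) _ _ _.
have {}E1 : (fun k => \int[dS]_p (h k p)%:E)%E @ \oo --> (\int[dS]_p (Q p)%:E)%E.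
  have -> : (\int[dS]_p (Q p)%:E = \int[dS]_p (limn (fun k => (h k p)%:E)))%E.
    by apply: eq_integral => p _; apply/esym/cvg_lim => //; exact: cvh.
  apply: E1.
  - by move=> k; apply/measurable_EFinP.
  - by move=> k p _; rewrite lee_fin.
  - by move=> p _; exact: ndh.
have E2 := @cvg_monotone_convergence _ _ _ (lam n) setT measurableT (fun k y => (sb i y * h k (sigma i y))%:E) _ _ _.
have {}E2 : (fun k => \int[lam n]_y (sb i y * h k (sigma i y))%:E)%E @ \oo --> (\int[lam n]_y (sb i y * Q (sigma i y))%:E)%E.
  have -> : (\int[lam n]_y (sb i y * Q (sigma i y))%:E = \int[lam n]_y (limn (fun k => (sb i y * h k (sigma i y))%:E)))%E.
    apply: eq_integral => y _; apply/esym/cvg_lim => //.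
    rewrite EFinM (_ : (fun k => _) = (fun k => (sb i y)%:E * (h k (sigma i y))%:E)%E); last by apply/funext => k; rewrite EFinM.
    by apply: cvgeZl => //; exact: cvh.
  apply: E2.
  - by move=> k; apply/measurable_EFinP; exact: integrand_measurable.
  - by move=> k p _; rewrite lee_fin mulr_ge0.
  - move=> p _ a b ab; rewrite lee_fin ler_wpM2l//.
    by have := ndh (sigma i p) _ _ ab; rewrite lee_fin.
have E12 : (fun k => \int[dS]_p (h k p)%:E)%E = (fun k => \int[lam n]_y (sb i y * h k (sigma i y))%:E)%E.
  by apply/funext => k; apply: nnsfun_chart => q; exact: hA.
rewrite E12 in E1.
rewrite (cvg_unique (@ereal_hausdorff R) E1 E2); apply: eq_integral => y _; congr EFin.
rewrite /sb /sigma indicE; have [iy|niy] := pselect (bd_image i y).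
  by rewrite asboolT// mem_set// !mul1r mulrC.
by rewrite memNset// !mul0r.
Qed.

Lemma boundary_integral i (Q : M -> R) : measurable_fun setT (Q : borel M -> R) ->
  (forall q, Q q != 0 -> dom (A i) q) ->
  (\int[dS]_p (Q p)%:E = \int[lam n]_y (\1_(bd_image i) y * Q (par i (bd y)) * sbd i y)%:E)%E.
Proof.
move=> mQ QA; rewrite integralE [RHS]integralE.
have mE : measurable_fun setT (fun x : borel M => Num.max (Q x) 0) by exact: measurable_maxr.
have mE' : measurable_fun setT (fun x : borel M => Num.max (- Q x) 0).
  by apply: measurable_maxr => //; exact: measurableT_comp.
have sA (s : R) q : Num.max (s * Q q) 0 != 0 -> dom (A i) q.
  by move=> H; apply: QA; apply: contra H => /eqP ->; rewrite mulr0 maxxx.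
have pos (a b c : R) : 0 <= a -> 0 <= c -> Num.max (a * b * c) 0 = a * Num.max b 0 * c.
  move=> a0 c0; have [b0|b0] := leP b 0.
    by rewrite mulr0 mul0r; apply/max_idPr; rewrite mulr_le0_ge0// mulr_ge0_le0.
  by apply/max_idPl; rewrite !mulr_ge0// ltW.
congr (_ - _)%E.
  transitivity (\int[dS]_p (Num.max (Q p) 0)%:E)%E; first by apply: eq_integral => p _; rewrite funeposE EFin_max.
  rewrite (@ge0_boundary_integral i (fun p => Num.max (Q p) 0))//.
  - by apply: eq_integral => y _; rewrite funeposE -EFin_max pos// sqrtr_ge0.
  - by move=> q; rewrite le_max lexx orbT.
  - by move=> q; have := @sA 1 q; rewrite mul1r.
transitivity (\int[dS]_p (Num.max (- Q p) 0)%:E)%E; first by apply: eq_integral => p _; rewrite funenegE EFin_max.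
rewrite (@ge0_boundary_integral i (fun p => Num.max (- Q p) 0))//.
- by apply: eq_integral => y _; rewrite funenegE -EFinN -EFin_max -mulNr -mulrN pos// sqrtr_ge0.
- by move=> q; rewrite le_max lexx orbT.
- by move=> q; have := @sA (-1) q; rewrite mulN1r.
Qed.

End boundary_integral.

(** * Green's formula on the manifold *)

Section green_manifold.
Context {R : realType} {n : nat} {M : ptopologicalType} (I : Type).
Variable A : I -> chart R n M.
Hypothesis A_manifold : is_manifold A.
Hypothesis M_compact : compact [set: M].
Variable g : I -> 'rV[R]_n.+1 -> 'M[R]_n.+1.
Hypothesis g_metric : is_riemannian_metric A g.
Variable w : M -> R.
Hypothesis w_smooth : smooth_function A w.
Hypothesis w_pos : forall p, 0 < w p.
Variable dS : {finite_measure set (borel M) -> \bar R}.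
Hypothesis dS_volume : is_boundary_measure A g dS.
Implicit Types (i : I) (p : M).
Local Notation im i := (chart_image (A i)).
Local Notation phi i := (chart_map (A i)).
Local Notation par i := (param (A i)).
Local Notation smoothM := (smooth_function A).
Local Notation VT m := (borel 'rV[R]_m).
Local Notation IM := (interior_image A).
Local Notation carre := (carre A g).
Local Notation carreM := (carreM A_manifold g).
Local Notation CI := (chart_integral A g w).

Let continuous_sub (f h : M -> R) p : {for p, continuous f} -> {for p, continuous h} ->
  {for p, continuous (fun q => f q - h q)}.
Proof. by move=> cf ch; exact: (cvgB cf ch). Qed.

Let continuous_mul (f h : M -> R) p : {for p, continuous f} -> {for p, continuous h} ->
  {for p, continuous (fun q => f q * h q)}.
Proof. by move=> cf ch; exact: (cvgM cf ch). Qed.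

Lemma eq_chart_integral i (F F' : M -> R) :
  (forall x, IM i x -> F (par i x) = F' (par i x)) -> CI i F = CI i F'.
Proof.
move=> FF; apply: eq_Rintegral => x _; rewrite indicE.
have [ix|nix] := pselect (IM i x); first by rewrite FF.
by rewrite memNset// !mul0r.
Qed.

Lemma carreM_support (v chi : M -> R) (K : set M) : compact K -> (forall q, chi q != 0 -> K q) ->
  forall q, carreM v chi q != 0 -> K q.
Proof.
move=> cK chiK q; apply: contra_neqP => nKq.
have oK : open (~` K) by apply: closed_openC; apply: compact_closed => //; exact: (manifold_hausdorff A_manifold).
rewrite /carreM; set i := chart_at _ _; have iq : dom (A i) q := chart_atP A_manifold q.
have ix := im_chart iq.
have [V [oV Vx HV]] : exists V : set 'rV[R]_n.+1, [/\ open V, V (phi i q) &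
    forall y, V y -> half_space y -> im i y /\ (~` K) (par i y)].
  by apply: (param_near A_manifold ix oK); rewrite chart_mapK.
rewrite carreE big1// => j _; rewrite big1// => k _.
rewrite (@partialE _ _ V (chi \o par i) (cst 0) _ k 0 oV Vx (im_half A_manifold ix)) ?mulr0//.
move=> y Vy Hy; have [_ nK] := HV y Vy Hy; apply/eqP; rewrite -[_ == _]negbK; apply/negP => /chiK.
exact: nK.
Qed.

Variables (N : nat) (c : 'I_N -> I) (chi : 'I_N -> M -> R) (K : 'I_N -> set M).
Hypothesis chi_smooth : forall k, smoothM (chi k).
Hypothesis chi_sum : forall p, \sum_k chi k p = 1.
Hypothesis K_chart : forall k, compact (K k) /\ K k `<=` dom (A (c k)).
Hypothesis chi_supp : forall k q, chi k q != 0 -> K k q.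

Definition manifold_integral (F : M -> R) : R := \sum_k CI (c k) (fun p => chi k p * F p).

Let cchi k : continuous (chi k).
Proof. exact: (smooth_function_continuous A_manifold). Qed.

(** The error that the differential of the [k]-th cut-off brings into Green's formula. *)
Let X (u v : M -> R) k p := u p * carreM v (chi k) p - v p * carreM u (chi k) p.

Let cX u v k : smoothM u -> smoothM v -> continuous (X u v k).
Proof.
move=> su sv p; apply: continuous_sub; apply: continuous_mul.
- exact: (smooth_function_continuous A_manifold su).
- by apply: (smooth_function_continuous A_manifold); exact: smooth_carreM.
- exact: (smooth_function_continuous A_manifold sv).
- by apply: (smooth_function_continuous A_manifold); exact: smooth_carreM.
Qed.

Let X_supp u v k q : X u v k q != 0 -> K k q.
Proof.
apply: contra_neqP => nK; have [cK _] := K_chart k.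
have z f : carreM f (chi k) q = 0.
  apply/eqP; rewrite -[_ == _]negbK; apply/negP => /(carreM_support cK (@chi_supp k)).
  exact: nK.
by rewrite /X !z !mulr0 subrr.
Qed.

(** The cut-offs sum to 1, so their differentials sum to 0. *)
Let carre_sum0 i v x : smoothM v -> IM i x -> \sum_k carreM v (chi k) (par i x) = 0.
Proof.
move=> sv ix; have [iix x0] := ix; under eq_bigr do rewrite (carreM_chart A_manifold g_metric sv (chi_smooth _) iix) carreE.
rewrite exchange_big big1//= => j _; rewrite exchange_big big1//= => l _.
rewrite -mulr_sumr; suff -> : \sum_k partial l (chi k \o par i) x = 0 by rewrite mulr0.
have d k : is_derive x (delta_mx ord0 l : 'rV[R]_n.+1) (chi k \o par i) (partial l (chi k \o par i) x).
  have iH : im i `<=` @half_space R n by move=> y; exact: im_half.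
  have nx := IM_nbhs A_manifold ix.
  by apply: (smooth_on_derive l iH _ nx x0); exact: chi_smooth.
have D := is_derive_sum d.
have E : \sum_k (chi k \o par i) = cst 1 by apply/funext => y; rewrite fct_sumE/= -[RHS](chi_sum (par i y)).
rewrite E in D; have [_ <-] := D.
by have [_ ->] := is_derive_cst (1 : R) x (delta_mx ord0 l : 'rV[R]_n.+1).
Qed.

(** The [k]-th term is integrated in the chart [c k], so the terms cannot be added under one
    integral. Multiplication by a second copy [chi l] of the partition localizes them in the overlap
    of two charts, where chart independence moves the integral to [c l]; there the sum over [k]
    vanishes pointwise. *)
Let sum_X0 u v : smoothM u -> smoothM v -> \sum_k CI (c k) (X u v k) = 0.
Proof.
move=> su sv.
have cl k l : continuous (fun p => chi l p * X u v k p).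
  by move=> p; apply: continuous_mul; [exact: cchi|exact: cX].
have suppK k l q : chi l q * X u v k q != 0 -> K k q /\ K l q.
  by rewrite mulf_eq0 negb_or => /andP[/chi_supp Kl /X_supp Kk].
transitivity (\sum_k \sum_l CI (c l) (fun p => chi l p * X u v k p)).
  apply: eq_bigr => k _; have [cK KA] := K_chart k.
  transitivity (CI (c k) (fun p => \sum_l chi l p * X u v k p)).
    apply: eq_chart_integral => x _; rewrite -mulr_suml chi_sum mul1r//.
  rewrite (chart_integral_sum A_manifold g_metric w_smooth (cl k) cK KA); last by move=> l q /suppK[].
  apply: eq_bigr => l _; have [cKl KAl] := K_chart l.
  apply: (@chart_integral_change _ _ _ _ _ A_manifold _ g_metric _ w_smooth w_pos (c k) (c l) _ (K k `&` K l)).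
  - exact: cl.
  - apply: compact_closedI => //; apply: compact_closed => //; exact: (manifold_hausdorff A_manifold).
  - by move=> q [/KA].
  - by move=> q [_ /KAl].
  - by move=> q /suppK.
rewrite exchange_big/= big1// => l _; have [cKl KAl] := K_chart l.
rewrite -(chart_integral_sum A_manifold g_metric w_smooth (fun k => cl k l) cKl KAl); last by move=> k q /suppK[].
transitivity (CI (c l) (fun=> 0)).
  apply: eq_chart_integral => x ix; rewrite -mulr_sumr /X sumrB -!mulr_sumr.
  by rewrite !carre_sum0// !mulr0 subrr mulr0.
rewrite /chart_integral /Rintegral (eq_integral (cst 0%E)); last by move=> x _; rewrite mul0r mulr0.
by rewrite integral0.
Qed.

(** The Neumann data are asked to be bounded and measurable only: a source is smooth along the
    boundary, but extended by 0 it is in general not continuous on the manifold. *)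
Lemma green (u v qu qv Fu Fv : M -> R) (B : R) : smoothM u -> smoothM v ->
  continuous qu -> continuous qv ->
  (forall i x, im i x -> a_op A g w i u x = qu (par i x)) ->
  (forall i x, im i x -> a_op A g w i v x = qv (par i x)) ->
  (forall i x nu, im i x -> x ord0 ord0 = 0 -> exterior_conormal g i x nu -> b_op A g w i nu u x = Fu (par i x)) ->
  (forall i x nu, im i x -> x ord0 ord0 = 0 -> exterior_conormal g i x nu -> b_op A g w i nu v x = Fv (par i x)) ->
  measurable_fun setT (Fu : borel M -> R) -> measurable_fun setT (Fv : borel M -> R) ->
  (forall p, `|Fu p| <= B) -> (forall p, `|Fv p| <= B) ->
  manifold_integral (fun p => u p * qv p - v p * qu p) =
  (\int[dS]_(p in (setT : set (borel M))) (Fu p * v p - u p * Fv p))%R.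
Proof.
move=> su sv cqu cqv quE qvE uF vF mFu mFv FuB FvB.
have cu := smooth_function_continuous A_manifold su.
have cv := smooth_function_continuous A_manifold sv.
pose Z p := u p * qv p - v p * qu p; pose Y p := Fu p * v p - u p * Fv p.
have cZ : continuous Z by move=> p; apply: continuous_sub; apply: continuous_mul; do ?[exact: cu|exact: cv|exact: cqu|exact: cqv].
have ck k : CI (c k) (fun p => chi k p * Z p) = CI (c k) (X u v k) + (\int[dS]_(p in (setT : set (borel M))) (chi k p * Y p))%R.
  have [cK KA] := K_chart k.
  have G := chart_green A_manifold g_metric w_smooth w_pos (chi_smooth k) su sv cK KA (@chi_supp k) (quE (c k)) (qvE (c k)).
  have mY : measurable_fun setT ((fun p => chi k p * Y p) : borel M -> R).
    have mc f : continuous f -> measurable_fun setT (f : borel M -> measurableTypeR R).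
      by move=> cf; apply: measurable_fun_open_preimage => U oU; rewrite setTI; apply: borel_open; exact: (proj1 (continuousP _) cf).
    apply: measurable_funM; first exact: mc.
    by apply: measurable_funB; apply: measurable_funM => //; exact: mc.
  have suppY q : chi k q * Y q != 0 -> dom (A (c k)) q.
    by rewrite mulf_eq0 negb_or => /andP[/chi_supp /KA].
  have B1 : (\int[lam n]_(y in (setT : set (VT n))) (\1_(im (c k)) (bd_point y) * field A g w (c k) (chi k) u v ord0 (bd_point y)))%R =
      (\int[dS]_(p in (setT : set (borel M))) (chi k p * Y p))%R.
    rewrite /Rintegral (boundary_integral A_manifold g_metric dS_volume mY suppY); congr fine.
    apply: eq_integral => y _; congr EFin; rewrite !indicE.
    have [iy|niy] := pselect (bd_image A (c k) y); last by rewrite (memNset niy) memNset// !mul0r.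
    rewrite (mem_set iy) mem_set// !mul1r.
    rewrite (field_boundary g_metric (chi k) iy (bd00 y) (fun nu => uF (c k) _ nu iy (bd00 y)) (fun nu => vF (c k) _ nu iy (bd00 y))).
    by rewrite /Y; ring.
  rewrite B1 in G.
  have GE : CI (c k) (fun p => X u v k p - chi k p * Z p) = CI (c k) (X u v k) - CI (c k) (fun p => chi k p * Z p).
    rewrite /chart_integral -RintegralB//.
    - by apply: eq_Rintegral => x _; rewrite -mulrBr -mulrBl.
    - exact: (chart_integrable A_manifold g_metric w_smooth (cX su sv) cK KA (@X_supp u v k)).
    - apply: (chart_integrable A_manifold g_metric w_smooth (F := fun p => chi k p * Z p) _ cK KA).
        by move=> p; apply: continuous_mul; [exact: cchi|exact: cZ].
      by move=> q; rewrite mulf_eq0 negb_or => /andP[/chi_supp].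
  have : CI (c k) (X u v k) - CI (c k) (fun p => chi k p * Z p) = - (\int[dS]_(p in (setT : set (borel M))) (chi k p * Y p))%R.
    by rewrite -GE -G.
  lra.
rewrite /manifold_integral (eq_bigr _ (fun k _ => ck k)) big_split/= sum_X0// add0r.
have bd (f : M -> R) : continuous f -> exists2 b : R, 0 < b & forall q, `|f q| <= b.
  by move=> cf; exact: (continuous_support_bounded cf M_compact (fun q _ => Logic.I)).
have [bu bu0 ub] := bd u cu; have [bv bv0 vb] := bd v cv.
have mc f : continuous f -> measurable_fun setT (f : borel M -> measurableTypeR R).
  by move=> cf; apply: measurable_fun_open_preimage => U oU; rewrite setTI; apply: borel_open; exact: (proj1 (continuousP _) cf).
have iY k : dS.-integrable setT (fun p => (chi k p * Y p)%:E).
  have [bc bc0 cb] := bd _ (@cchi k).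
  apply: (@le_integrable _ _ _ dS setT measurableT _ (cst (bc * (B * bv + bu * B))%:E)).
  - apply/measurable_EFinP; apply: measurable_funM; first exact: mc.
    by apply: measurable_funB; apply: measurable_funM => //; exact: mc.
  - move=> p _; rewrite /= lee_fin normrM; apply: le_trans (ler_norm _).
    apply: ler_pM => //; apply: le_trans (ler_normB _ _) _.
    by rewrite !normrM; apply: lerD; apply: ler_pM.
  - by apply: finite_measure_integrable_cst.
rewrite /Rintegral sum_fine; last by move=> k _; apply: integrable_fin_num.
rewrite -integral_sum//; congr fine; apply: eq_integral => p _.
by rewrite sumEFin -mulr_suml chi_sum mul1r.
Qed.

End green_manifold.

(** * Operators on the lateral boundary *)

Section restriction.
Context d (X : measurableType d) (R : realType).
Local Open Scope ereal_scope.

Lemma ge0_integral_mrestr (m : {measure set X -> \bar R}) (D : set X) (mD : measurable D)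
    (F : X -> \bar R) : measurable_fun setT F -> (forall x, 0 <= F x) ->
  \int[mrestr m mD]_x F x = \int[m]_(x in D) F x.
Proof.
move=> mF F0; have mDc := measurableC mD.
have mFD : measurable_fun setT (F \_ D).
  by apply/(measurable_restrict _ mD measurableT); rewrite setTI; exact: measurable_funTS.
have FD0 x : 0 <= (F \_ D) x by rewrite patchE; case: ifP.
transitivity (\int[mrestr m mD]_x (F \_ D) x).
  apply: ae_eq_integral => //; exists (~` D); split => //.
    by rewrite /= /mrestr setICl measure0.
  by move=> x /=; apply: contra_not => Dx _; rewrite patchE mem_set.
rewrite [RHS]integral_mkcond.
(* [m] is the sum of its restrictions to [D] and to the complement of [D], and the integrand
   vanishes on the latter. *)
rewrite (_ : \int[m]_x _ = \int[measure_add (mrestr m mD) (mrestr m mDc)]_x (F \_ D) x); last first.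
  apply: eq_measure_integral => Y mY _; rewrite /= /measure_add/= /msum !big_ord_recl big_ord0/= adde0.
  rewrite /mrestr/= -measureU//; try exact: measurableI.
    by rewrite -setIUr setUCr setIT.
  by rewrite setIACA setICr setI0.
rewrite ge0_integral_measure_add//.
rewrite [X in _ = _ + X](_ : _ = 0) ?adde0//.
transitivity (\int[mrestr m mDc]_x (cst 0 x : \bar R)); last exact: integral0.
apply: ae_eq_integral => //; exists D; split => //.
  by rewrite /= /mrestr setIC setICl measure0.
by move=> x /=; apply: contra_notP => nDx _; rewrite patchE memNset.
Qed.

End restriction.

(** * Lateral integrals, time reversal and the operator J *)

Section lateral.
Context {R : realType} {M : ptopologicalType}.
Variable T : R.
Hypothesis T_gt0 : 0 < T.
Variable dS : {finite_measure set (borel M) -> \bar R}.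
Local Notation X := (measurableTypeR R * borel M)%type.
Local Notation leb := (@lebesgue_measure R).
Local Notation mu := (lateral_measure T dS).
Local Notation D := (`]0%R, (2 * T)%R[%classic : set (measurableTypeR R)).

Local Notation mD := (measurable_itv `]0%R, (2 * T)%R[).

Let leb_D : leb D = (2 * T)%:E.
Proof.
rewrite lebesgue_measure_itv/= lte_fin mulr_gt0// sube0//.
Qed.

Let leb_D_fin : (leb D < +oo)%E. Proof. by rewrite leb_D ltry. Qed.

(** The time factor of [lateral_measure], under a name that can carry the structure of a finite
    measure. *)
Definition restr_leb : set (measurableTypeR R) -> \bar R := mrestr leb mD.
HB.instance Definition _ := Measure.on restr_leb.
Lemma restr_leb_fin : fin_num_fun restr_leb.
Proof.
move=> U mU; rewrite ge0_fin_numE ?measure_ge0//.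
apply: le_lt_trans leb_D_fin; rewrite /restr_leb /mrestr.
by apply: le_measure; rewrite ?inE//; exact: measurableI.
Qed.
HB.instance Definition _ := Measure_isFinite.Build _ _ _ restr_leb restr_leb_fin.
Local Notation tau := restr_leb.

Let integral_tau (F : measurableTypeR R -> \bar R) :
  (\int[mrestr leb mD]_t F t = \int[tau]_t F t)%E.
Proof. by apply: eq_measure_integral => Y mY _. Qed.

Let integral_mu (F : X -> \bar R) : (\int[mu]_z F z = \int[tau \x dS]_z F z)%E.
Proof.
by apply: eq_measure_integral => Y mY _; exact: integral_tau.
Qed.

Lemma ge0_integral_lateral_time (F : X -> \bar R) : measurable_fun setT F -> (forall z, 0 <= F z)%E ->
  (\int[mu]_z F z = \int[leb]_(t in D) \int[dS]_p F (t, p))%E.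
Proof.
move=> mF F0; rewrite integral_mu.
etransitivity; first exact: (@fubini_tonelli1 _ _ _ _ _ tau dS F mF F0).
rewrite -integral_tau.
apply: ge0_integral_mrestr; first by apply: measurable_fun_fubini_tonelli_F.
by move=> t; apply: integral_ge0 => p _; exact: F0.
Qed.

Lemma ge0_integral_lateral (F : X -> \bar R) : measurable_fun setT F -> (forall z, 0 <= F z)%E ->
  (\int[mu]_z F z = \int[dS]_p \int[leb]_(t in D) F (t, p))%E.
Proof.
move=> mF F0; rewrite integral_mu.
etransitivity; first exact: (@fubini_tonelli2 _ _ _ _ _ tau dS F mF F0).
apply: eq_integral => p _; rewrite /fubini_G -integral_tau.
apply: ge0_integral_mrestr; first exact: measurableT_comp mF (pair2_measurable _).
by move=> t; exact: F0.
Qed.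

Lemma lateral_finite : (mu setT < +oo)%E.
Proof.
have E : (mu setT = \int[mu]_z 1)%E by rewrite (integral_cst mu measurableT 1%E) mul1e.
rewrite E (ge0_integral_lateral (F := fun=> 1%E)); last 2 first.
- exact: measurable_cst.
- by move=> z; exact: lee01.
have E2 (p : borel M) : (\int[leb]_(t in D) 1 = (2 * T)%:E)%E.
  by rewrite (integral_cst leb mD 1%E) mul1e; exact: leb_D.
rewrite (eq_integral (fun=> (2 * T)%:E)%E); last by move=> p _; exact: E2.
rewrite (integral_cst dS measurableT (2 * T)%:E%E).
apply: lte_mul_pinfty; [by rewrite lee_fin mulr_ge0// ltW|by []|].
by rewrite -ge0_fin_numE; [exact: fin_num_measure|exact: measure_ge0].
Qed.

Lemma integral_lateral (F : X -> R) : mu.-integrable setT (EFin \o F) ->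
  (\int[mu]_z (F z)%:E = \int[dS]_p \int[restr_leb]_t (F (t, p))%:E)%E.
Proof.
move=> iF; rewrite integral_mu.
have iF' : (tau \x dS)%E.-integrable setT (EFin \o F).
  have /integrableP[mF F_fin] := iF; apply/integrableP; split => //.
by etransitivity; first exact: (esym (@integral21_prod_meas1 _ _ _ _ _ tau dS (EFin \o F) iF')).
Qed.

Lemma restr_leb_integral (F : measurableTypeR R -> R) : measurable_fun setT F ->
  (\int[restr_leb]_t (F t)%:E = \int[leb]_(t in D) (F t)%:E)%E.
Proof.
move=> mF; have mE : measurable_fun setT (EFin \o F) by apply/measurable_EFinP.
rewrite -integral_tau integralE [RHS]integralE; congr (_ - _)%E.
  exact: (ge0_integral_mrestr leb mD (measurable_funepos mE) (fun z => funepos_ge0 _ z)).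
exact: (ge0_integral_mrestr leb mD (measurable_funeneg mE) (fun z => funeneg_ge0 _ z)).
Qed.

Lemma integrable_section (F : X -> R) : measurable_fun setT F ->
  mu.-integrable setT (EFin \o F) ->
  {ae dS, forall p, leb.-integrable D (fun t => (F (t, p))%:E)}.
Proof.
move=> mF /integrableP[_ F_fin].
have mE : measurable_fun setT (fun z : X => `|F z|%:E).
  by apply/measurable_EFinP; apply: measurableT_comp.
pose G (p : borel M) := (\int[leb]_(t in D) `|F (t, p)|%:E)%E.
have G0 p : (0 <= G p)%E by apply: integral_ge0 => t _; rewrite lee_fin.
have mG : measurable_fun setT G.
  have := @measurable_fun_fubini_tonelli_G _ _ _ _ _ tau (fun z : X => `|F z|%:E) mE (fun z => normr_ge0 _).
  congr measurable_fun; apply/funext => p; rewrite /G /fubini_G -integral_tau.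
  by apply: ge0_integral_mrestr => [|t]; [exact: measurableT_comp mE (pair2_measurable _)|rewrite lee_fin].
have iG : dS.-integrable setT G.
  apply/integrableP; split => //; apply: le_lt_trans F_fin.
  rewrite (ge0_integral_lateral mE)//; apply: ge0_le_integral => //.
  - by apply: measurableT_comp.
  - by move=> p _; rewrite gee0_abs.
have := integrable_ae measurableT iG.
apply: filterS => p /(_ Logic.I) Gp; apply/integrableP; split.
  by apply/measurable_EFinP; apply: measurable_funTS; exact: measurableT_comp mF (pair2_measurable _).
by rewrite -ge0_fin_numE// integral_ge0.
Qed.

Definition reflect (z : X) : X := (2 * T - z.1, z.2).

Lemma reflect_measurable : measurable_fun setT reflect.
Proof.
apply: measurable_fun_pair => //=.
apply: measurable_funB; first exact: measurable_cst.
exact: measurable_fst.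
Qed.

Lemma ge0_integral_reflect (F : X -> \bar R) : measurable_fun setT F -> (forall z, 0 <= F z)%E ->
  (\int[mu]_z F (reflect z) = \int[mu]_z F z)%E.
Proof.
move=> mF F0.
have mFr := measurableT_comp mF reflect_measurable.
rewrite (ge0_integral_lateral mFr (fun z => F0 _)) (ge0_integral_lateral mF F0).
apply: eq_integral => p _.
have mFp := measurableT_comp mF (pair2_measurable p).
rewrite [LHS]integral_mkcond [RHS]integral_mkcond.
have H := @lebesgue_affine R (-1) (2 * T) ((fun t => F (t, p)) \_ D).
rewrite normrN normr1 invr1 mul1e in H; rewrite -H.
- apply: eq_integral => t _; rewrite !patchE /reflect/= mulN1r (addrC (- t)).
  suff -> : ((2 * T - t)%R \in D) = (t \in D) by [].
  by apply/idP/idP; rewrite !inE/= !in_itv/=; lra.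
- by rewrite oppr_eq0 oner_eq0.
- by apply/(measurable_restrict _ mD measurableT); rewrite setTI; exact: measurable_funTS.
- by move=> t; rewrite patchE; case: ifP.
Qed.

Lemma integral_reflect (F : X -> R) : measurable_fun setT F ->
  (\int[mu]_z F (reflect z) = \int[mu]_z F z)%R.
Proof.
move=> mF; rewrite /Rintegral; congr fine.
have mE : measurable_fun setT (EFin \o F) by apply/measurable_EFinP.
rewrite integralE [in RHS]integralE; congr (_ - _)%E.
  transitivity (\int[mu]_z (EFin \o F)^\+ (reflect z))%E; first by apply: eq_integral => z _; rewrite ?funeposE ?funenegE.
  exact: (ge0_integral_reflect (measurable_funepos mE) (fun z => funepos_ge0 _ z)).
transitivity (\int[mu]_z (EFin \o F)^\- (reflect z))%E; first by apply: eq_integral => z _; rewrite ?funeposE ?funenegE.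
exact: (ge0_integral_reflect (measurable_funeneg mE) (fun z => funeneg_ge0 _ z)).
Qed.

Lemma R_op_adjoint (f h : X -> R) : measurable_fun setT f -> measurable_fun setT h ->
  ip mu (R_op T f) h = ip mu f (R_op T h).
Proof.
move=> mf mh; rewrite /ip -[RHS]integral_reflect.
  by apply: eq_Rintegral => -[t p] _; rewrite /R_op /reflect/= subKr.
by apply: measurable_funM => //; exact: (measurableT_comp mh reflect_measurable).
Qed.

Lemma R_op_L2 (f : X -> R) : L2 mu f -> L2 mu (R_op T f).
Proof.
move=> /L2P[mf f2]; have mrf : measurable_fun setT (R_op T f) := measurableT_comp mf reflect_measurable.
apply/L2P; split => //; apply/integrableP; split.
  by apply/measurable_EFinP; apply: measurable_funX.
have /integrableP[m2 f2'] := f2.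
have H := @ge0_integral_reflect (abse \o (EFin \o (fun x => (f x ^+ 2)%R)))
  (measurableT_comp (@abse_measurable _ _) m2) (fun z => abse_ge0 _).
by apply: le_lt_trans f2'; rewrite -H.
Qed.

Lemma bounded_R_op : bounded_operator mu (R_op T).
Proof.
split; first exact: R_op_L2.
- by move=> a f h _ _; exact: aeq_refl.
- exists 1 => f f2; rewrite mul1r; apply: L2norm_le; [exact: R_op_L2|exact: L2norm_ge0|].
  rewrite R_op_adjoint; [|exact: L2_measurable f2|exact: L2_measurable (R_op_L2 f2)].
  rewrite L2norm_sqr// (_ : R_op T (R_op T f) = f)//.
  by apply/funext => -[t p]; rewrite /R_op/= subKr.
Qed.

Lemma J_kernel_measurable (f : X -> R) : measurable_fun setT f ->
  measurable_fun setT (fun y : (measurableTypeR R * X) => (\1_(triangle T) (y.2.1, y.1) * f (y.1, y.2.2))%R).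
Proof.
move=> mf; apply: measurable_funM; last first.
  apply: measurableT_comp mf _; apply: measurable_fun_pair.
    exact: measurable_fst.
  exact: measurableT_comp measurable_snd measurable_snd.
rewrite (_ : (fun y : measurableTypeR R * X => _) = \1_((fun y : measurableTypeR R * X => (y.2.1, y.1)) @^-1` triangle T)); last first.
  by apply/funext => y; rewrite !indicE; congr (nat_of_bool _)%:R.
apply: measurable_indic.
have m1 : measurable_fun setT (fun y : measurableTypeR R * X => y.1) by exact: measurable_fst.
have m2 : measurable_fun setT (fun y : measurableTypeR R * X => y.2.1).
  exact: measurableT_comp measurable_fst measurable_snd.
rewrite (_ : _ @^-1` _ = [set y | y.2.1 + y.1 <= 2 * T] `&` ([set y | 0 < y.2.1] `&` [set y | y.2.1 < y.1])); last first.
  apply/seteqP; split=> y /=; rewrite /triangle/=; first by move=> [? /andP[? ?]].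
  by move=> [? [? ?]]; split => //; apply/andP.
have mle (a b : measurableTypeR R * X -> R) : measurable_fun setT a -> measurable_fun setT b -> measurable [set y | a y < b y].
  move=> ma mb; have := measurable_fun_ltr ma mb => /(_ measurableT [set true] I).
  by rewrite setTI; congr measurable; apply/seteqP; split.
apply: measurableI; last by apply: measurableI; apply: mle => //; exact: measurable_cst.
rewrite (_ : [set y | _] = ~` [set y : measurableTypeR R * X | 2 * T < y.2.1 + y.1]); last first.
  by apply/seteqP; split=> y /=; rewrite leNgt => /negP.
by apply: measurableC; apply: mle; [exact: measurable_cst|exact: measurable_funD].
Qed.

Lemma J_op_measurable (f : X -> R) : measurable_fun setT f -> measurable_fun setT (J_op T f : X -> R).
Proof.
move=> mf; apply: measurable_funM; first exact: measurable_cst.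
have mk := J_kernel_measurable mf.
have mE : measurable_fun setT (EFin \o (fun y : (measurableTypeR R * X) => (\1_(triangle T) (y.2.1, y.1) * f (y.1, y.2.2))%R)).
  by apply/measurable_EFinP.
rewrite /Rintegral; apply: measurableT_comp => //.
rewrite (_ : (fun z : X => _) = (fun z : X => (\int[tau]_s ((fun y : measurableTypeR R * X => (\1_(triangle T) (y.2.1, y.1) * f (y.1, y.2.2))%:E)^\+ (s, z)) -
   \int[tau]_s ((fun y : measurableTypeR R * X => (\1_(triangle T) (y.2.1, y.1) * f (y.1, y.2.2))%:E)^\- (s, z)))%E)); last first.
  apply/funext => z; rewrite -restr_leb_integral; last exact: (measurableT_comp mk (pair2_measurable z)).
  rewrite integralE; congr (_ - _)%E; apply: eq_integral => s _; by rewrite ?funeposE ?funenegE.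
apply: emeasurable_funB.
  exact: (@measurable_fun_fubini_tonelli_G _ _ _ _ _ tau _ (measurable_funepos mE) (fun z => funepos_ge0 _ z)).
exact: (@measurable_fun_fubini_tonelli_G _ _ _ _ _ tau _ (measurable_funeneg mE) (fun z => funeneg_ge0 _ z)).
Qed.

(** Cauchy-Schwarz in [s] against the indicator of the triangle, whose squared norm is at most
    [2 * T]; with the square of the factor 1/2 in [J] this gives [T / 2]. No integrability of the
    section is assumed, the bound being trivial when the right-hand side is infinite. *)
Lemma J_op_sqr_le (f : X -> R) (t : R) p : measurable_fun setT f ->
  (((J_op T f (t, p)) ^+ 2)%:E <= (T / 2)%:E * \int[restr_leb]_s ((f (s, p)) ^+ 2)%:E)%E.
Proof.
move=> mf; have mfp : measurable_fun setT (fun s : measurableTypeR R => f (s, p)) := measurableT_comp mf (pair2_measurable p).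
have m2 : measurable_fun setT (fun s : measurableTypeR R => (f (s, p)) ^+ 2) by exact: measurable_funX.
have [|] := ltP (\int[restr_leb]_s ((f (s, p)) ^+ 2)%:E)%E +oo%E; last first.
  rewrite leye_eq => /eqP ->; rewrite gt0_muley ?leey//.
  by rewrite lte_fin divr_gt0.
move=> fin.
have f2 : L2 restr_leb (fun s => f (s, p)).
  apply/L2P; split => //; apply/integrableP; split; first exact/measurable_EFinP.
  apply: le_lt_trans fin; apply: ge0_le_integral.
  - exact: measurableT.
  - by move=> s _; exact: abse_ge0.
  - by apply: (measurableT_comp (@abse_measurable _ _)); apply/measurable_EFinP.
  - by apply/measurable_EFinP.
  - by move=> s _; rewrite /= ger0_norm// sqr_ge0.
have fin_tau : (restr_leb setT < +oo)%E by rewrite /restr_leb /mrestr setTI.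
have k2 : L2 restr_leb (fun s => \1_(triangle T) (t, s)).
  have mk : measurable_fun setT (fun s : measurableTypeR R => \1_(triangle T) (t, s) : R).
    have := measurableT_comp (@J_kernel_measurable (cst 1) (measurable_cst _)) (pair2_measurable ((t, p) : X)).
    by congr measurable_fun; apply/funext => s; rewrite /= mulr1.
  apply/L2P; split => //; apply: (@le_integrable _ _ _ restr_leb setT measurableT _ (cst 1%E)).
  - by apply/measurable_EFinP; exact: measurable_funX.
  - by move=> s _; rewrite /= lee_fin normr1 indicE; case: (_ \in _); rewrite ?expr1n ?normr1// expr0n normr0.
  - by apply/integrableP; split => //; rewrite integral_cst//= normr1 mul1e.
have kle : ip restr_leb (fun s => \1_(triangle T) (t, s)) (fun s => \1_(triangle T) (t, s)) <= 2 * T.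
  rewrite -lee_fin /ip /Rintegral fineK; last first.
    by apply: integrable_fin_num => //; exact: L2_integrableM.
  rewrite -leb_D -[leRHS]/(leb D) -[leRHS]mul1e.
  apply: (@le_trans _ _ (\int[restr_leb]_s (cst 1%E s))%E).
    apply: ge0_le_integral => //.
    - by apply/measurable_EFinP; apply: measurable_funM; exact: L2_measurable k2.
    - by move=> s _; rewrite lee_fin indicE; case: (_ \in _); rewrite ?mulr1 ?mulr0.
  rewrite [X in (X <= _)%E](integral_cst restr_leb measurableT 1%E) !mul1e le_eqVlt; apply/orP; left; apply/eqP.
  by rewrite /restr_leb /mrestr; congr (leb _); exact: setTI.
have JE : J_op T f (t, p) = 2^-1 * ip restr_leb (fun s => \1_(triangle T) (t, s)) (fun s => f (s, p)).
  rewrite /J_op /ip /Rintegral restr_leb_integral//.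
  by apply: measurable_funM; [exact: L2_measurable k2|exact: mfp].
have E : (\int[restr_leb]_s ((f (s, p)) ^+ 2)%:E = (ip restr_leb (fun s => f (s, p)) (fun s => f (s, p)))%:E)%E.
  rewrite /ip /Rintegral fineK; last by apply: integrable_fin_num => //; exact: L2_integrableM.
  by apply: eq_integral => s _; rewrite expr2.
rewrite E -EFinM lee_fin JE exprMn.
have cs := cauchy_schwarz k2 f2.
have : `|ip restr_leb (fun s => \1_(triangle T) (t, s)) (fun s => f (s, p))| ^+ 2 <= 2 * T * ip restr_leb (fun s => f (s, p)) (fun s => f (s, p)).
  apply: (@le_trans _ _ ((L2norm restr_leb (fun s => \1_(triangle T) (t, s)) * L2norm restr_leb (fun s => f (s, p))) ^+ 2)).
    by rewrite ler_pXn2r// ?nnegrE// mulr_ge0// L2norm_ge0.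
  by rewrite exprMn !L2norm_sqr// ler_wpM2r// ip_ge0.
rewrite real_normK ?num_real//; set a := ip _ _ _; set b := ip _ _ _; lra.
Qed.

(** The pointwise bound does not depend on [t]; integrating it over a time interval of length
    [2 * T] gives the constant [(T / 2) * (2 * T) = T ^+ 2]. *)
Lemma J_op_L2 (f : X -> R) : L2 mu f -> L2 mu (J_op T f) /\ ip mu (J_op T f) (J_op T f) <= (T * L2norm mu f) ^+ 2.
Proof.
move=> f2; have mf := L2_measurable f2; have mJ := J_op_measurable mf.
have mJ2 : measurable_fun setT (fun z : X => ((J_op T f z) ^+ 2)%:E).
  by apply/measurable_EFinP; exact: measurable_funX.
have mf2 : measurable_fun setT (fun z : X => ((f z) ^+ 2)%:E).
  by apply/measurable_EFinP; exact: measurable_funX.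
have fE : (\int[mu]_z ((f z) ^+ 2)%:E = (L2norm mu f ^+ 2)%:E)%E.
  rewrite L2norm_sqr// /ip /Rintegral fineK; last by apply: integrable_fin_num => //; exact: L2_integrableM.
  by apply: eq_integral => s _; rewrite expr2.
have le : (\int[mu]_z ((J_op T f z) ^+ 2)%:E <= ((T * L2norm mu f) ^+ 2)%:E)%E.
  pose G (p : borel M) := (\int[restr_leb]_s ((f (s, p)) ^+ 2)%:E)%E.
  have G0 p : (0 <= G p)%E by apply: integral_ge0 => s _; rewrite lee_fin sqr_ge0.
  have mG : measurable_fun setT G.
    exact: (@measurable_fun_fubini_tonelli_G _ _ _ _ _ tau (fun z : X => ((f z) ^+ 2)%:E) mf2 (fun z => sqr_ge0 _)).
  have Gf : (\int[dS]_p G p = \int[mu]_z ((f z) ^+ 2)%:E)%E.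
    rewrite integral_mu; apply: esym.
    exact: (@fubini_tonelli2 _ _ _ _ _ tau dS (fun z : X => ((f z) ^+ 2)%:E) mf2 (fun z => sqr_ge0 _)).
  have mTG : measurable_fun setT (fun p => (T / 2)%:E * G p)%E by apply: emeasurable_funM => //; exact: measurable_cst.
  have TG0 p : (0 <= (T / 2)%:E * G p)%E by rewrite mule_ge0// lee_fin divr_ge0// ltW.
  rewrite (ge0_integral_lateral_time mJ2); last by move=> z; rewrite lee_fin sqr_ge0.
  apply: (@le_trans _ _ (\int[leb]_(t in D) ((T / 2)%:E * (L2norm mu f ^+ 2)%:E))%E).
    apply: ge0_le_integral; first exact: measurable_itv.
    - by move=> t _; apply: integral_ge0 => p _; rewrite lee_fin sqr_ge0.
    - apply: measurable_funTS.
      exact: (@measurable_fun_fubini_tonelli_F _ _ _ _ _ dS (fun z : X => ((J_op T f z) ^+ 2)%:E) mJ2 (fun z => sqr_ge0 _)).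
    - exact: measurable_cst.
    - move=> t _; rewrite -fE -Gf -ge0_integralZl//; last by rewrite lee_fin divr_ge0// ltW.
      apply: ge0_le_integral => //.
      + by move=> p _; rewrite lee_fin sqr_ge0.
      + exact: (measurableT_comp mJ2 (pair1_measurable t)).
      + by move=> p _; exact: J_op_sqr_le.
  have -> : (\int[leb]_(t in D) ((T / 2)%:E * (L2norm mu f ^+ 2)%:E) = ((T / 2)%:E * (L2norm mu f ^+ 2)%:E) * (2 * T)%:E)%E.
    by rewrite -leb_D; exact: (integral_cst leb mD ((T / 2)%:E * (L2norm mu f ^+ 2)%:E)%E).
  rewrite -!EFinM lee_fin exprMn; set b := _ ^+ 2; nra.
have JL : L2 mu (J_op T f).
  apply/L2P; split => //; apply/integrableP; split => //.
  apply: le_lt_trans (ltry ((T * L2norm mu f) ^+ 2)); apply: le_trans le.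
  apply: ge0_le_integral => //; first exact: measurableT_comp.
  by move=> z _; rewrite /= ger0_norm// sqr_ge0.
split => //; rewrite -lee_fin /ip /Rintegral fineK; last by apply: integrable_fin_num => //; exact: L2_integrableM.
apply: le_trans le; rewrite le_eqVlt; apply/orP; left; apply/eqP.
by apply: eq_integral => z _; rewrite expr2.
Qed.

(** Linearity may fail at the points [p] where a time section of [f] or [h] is not integrable. They
    form a null set [N], and the exceptional set consists of the whole time lines over [N]. *)
Lemma J_op_lin (a : R) (f h : X -> R) : L2 mu f -> L2 mu h ->
  J_op T (a *: f + h) = a *: J_op T f + J_op T h %[ae mu].
Proof.
move=> f2 h2; have mf := L2_measurable f2; have mh := L2_measurable h2.
have int_sec (u : X -> R) : L2 mu u -> {ae dS, forall p, leb.-integrable D (fun t => (u (t, p))%:E)}.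
  move=> l2; apply: integrable_section; first exact: L2_measurable l2.
  have := L2_integrableM l2 (L2_cst lateral_finite 1).
  by apply: eq_integrable => // z _; rewrite /= mulr1.
have /filterI/(_ (int_sec _ h2))[N [mN N0 NP]] := int_sec _ f2.
exists (setT `*` N); split; first exact: measurableX.
  transitivity ((tau \x dS)%E ([set: measurableTypeR R] `*` N)); first exact: integral_tau.
  by rewrite (@product_measure1E _ _ _ _ _ tau dS)//; transitivity (restr_leb setT * 0)%E; [congr (_ * _)%E; exact: N0|exact: mule0].
move=> [t p] /= nJ; split => //; apply: NP => /= -[ifp ihp]; apply: nJ => _.
have mk : measurable_fun setT (fun s : measurableTypeR R => \1_(triangle T) (t, s) : R).
  have := measurableT_comp (@J_kernel_measurable (cst 1) (measurable_cst _)) (pair2_measurable ((t, p) : X)).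
  by congr measurable_fun; apply/funext => s; rewrite /= mulr1.
have ik (u : X -> R) : measurable_fun setT u -> leb.-integrable D (fun t => (u (t, p))%:E) ->
    leb.-integrable D (fun s => (\1_(triangle T) (t, s) * u (s, p))%:E).
  move=> mu' iu; apply: le_integrable iu => //.
    apply/measurable_EFinP; apply: measurable_funTS; apply: measurable_funM => //.
    exact: (measurableT_comp mu' (pair2_measurable p)).
  move=> s _; rewrite /= lee_fin normrM ler_piMl// indicE; case: (_ \in _); rewrite ?normr1// normr0//.
rewrite /J_op/= -[RHS]/(a * (2^-1 * _) + 2^-1 * _) [in RHS]mulrCA -mulrDr; congr (_ * _).
rewrite -RintegralZl//; last exact: ik.
rewrite -RintegralD//; last 2 first.
- have mD' : measurable D by exact: measurable_itv.
  have := integrableZl mD' a (ik f mf ifp).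
  by apply: eq_integrable => //; exact: measurable_itv.
- exact: ik.
by apply: eq_Rintegral => s _; rewrite -[X in _ * X]/(a * f (s, p) + h (s, p)); ring.
Qed.

Lemma bounded_J_op : bounded_operator mu (J_op T).
Proof.
split; first by move=> f /J_op_L2[].
- exact: J_op_lin.
- exists T => f f2; have [JL Jle] := J_op_L2 f2; apply: L2norm_le => //.
  by rewrite mulr_ge0 ?L2norm_ge0// ltW.
Qed.

Lemma bounded_K_op Lam : bounded_operator mu Lam -> bounded_operator mu (K_op T Lam).
Proof.
move=> bL; apply: (@bounded_operatorB _ _ _ _ (fun f => J_op T (Lam f)) (fun f => R_op T (Lam (R_op T (J_op T f))))).
  exact: bounded_operator_comp bounded_J_op bL.
apply: (@bounded_operator_comp _ _ _ _ (R_op T) (fun f => Lam (R_op T (J_op T f)))).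
  exact: bounded_R_op.
apply: (@bounded_operator_comp _ _ _ _ Lam (fun f => R_op T (J_op T f)) bL).
exact: bounded_operator_comp bounded_R_op bounded_J_op.
Qed.

End lateral.

(** * Bounded functions on finite measure spaces *)

Section bounded_integrals.
Context {R : realType}.

(** Over finite measures this class is stable under the operations needed, and membership alone
    justifies finiteness of integrals and Fubini's theorem; the integrands of the wave identities
    are brought into it. *)
Definition bounded_measurable d (X : measurableType d) (F : X -> R) :=
  measurable_fun setT F /\ exists B : R, forall x, `|F x| <= B.

Section one_measure.
Context d (X : measurableType d).
Variable m : {finite_measure set X -> \bar R}.
Implicit Types F G : X -> R.

Lemma bounded_integrable F : bounded_measurable F -> m.-integrable setT (EFin \o F).
Proof.
move=> [mF [B FB]]; have B0 : 0 <= `|B| by [].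
apply: (@le_integrable _ _ _ m setT measurableT _ (cst (`|B|)%:E)).
- by apply/measurable_EFinP.
- by move=> x _; rewrite /= lee_fin normr_id (le_trans (FB x))// ler_norm.
- exact: finite_measure_integrable_cst.
Qed.

Lemma bounded_measurableM F G : bounded_measurable F -> bounded_measurable G ->
  bounded_measurable (fun x => F x * G x).
Proof.
move=> [mF [B FB]] [mG [C GC]]; split; first exact: measurable_funM.
by exists (B * C) => x; rewrite normrM ler_pM.
Qed.

Lemma bounded_measurableD F G : bounded_measurable F -> bounded_measurable G ->
  bounded_measurable (fun x => F x + G x).
Proof.
move=> [mF [B FB]] [mG [C GC]]; split; first exact: measurable_funD.
by exists (B + C) => x; rewrite (le_trans (ler_normD _ _))// lerD.
Qed.

Lemma bounded_measurableB F G : bounded_measurable F -> bounded_measurable G ->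
  bounded_measurable (fun x => F x - G x).
Proof.
move=> [mF [B FB]] [mG [C GC]]; split; first exact: measurable_funB.
by exists (B + C) => x; rewrite (le_trans (ler_normB _ _))// lerD.
Qed.

Lemma bounded_measurable_cst c : bounded_measurable (cst c : X -> R).
Proof. by split; [exact: measurable_cst|exists `|c|]. Qed.

Lemma bounded_Rintegral F : bounded_measurable F ->
  (\int[m]_x (F x)%:E = ((\int[m]_x F x)%R)%:E)%E.
Proof.
by move=> bF; rewrite /Rintegral fineK//; apply: integrable_fin_num => //; exact: bounded_integrable.
Qed.

Lemma Rintegral_norm_le F B : measurable_fun setT F -> (forall x, `|F x| <= B) ->
  `|(\int[m]_x F x)%R| <= B * fine (m setT).
Proof.
move=> mF FB; have bF : bounded_measurable F by split => //; exists B.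
apply: le_trans (le_normr_Rintegral measurableT (bounded_integrable bF)) _.
have bnF : bounded_measurable (fun x => `|F x|).
  by split; [exact: measurableT_comp|exists B => x; rewrite normr_id].
rewrite -(Rintegral_cst m measurableT B); apply: le_Rintegral => //.
- exact: bounded_integrable.
- exact: (bounded_integrable (bounded_measurable_cst B)).
Qed.

End one_measure.

Lemma bounded_measurable_comp d d' (X : measurableType d) (Y : measurableType d')
    (F : Y -> R) (h : X -> Y) : measurable_fun setT h -> bounded_measurable F ->
  bounded_measurable (F \o h).
Proof.
by move=> mh [mF [B FB]]; split; [exact: measurableT_comp|exists B => x; exact: FB].
Qed.

Section two_measures.
Context d1 d2 (X1 : measurableType d1) (X2 : measurableType d2).
Variables (m1 : {finite_measure set X1 -> \bar R}) (m2 : {finite_measure set X2 -> \bar R}).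
Variable F : X1 * X2 -> R.
Hypothesis bF : bounded_measurable F.

Lemma bounded_section1 x : bounded_measurable (fun y => F (x, y)).
Proof. exact: (bounded_measurable_comp (pair1_measurable x) bF). Qed.

Lemma bounded_section2 y : bounded_measurable (fun x => F (x, y)).
Proof. exact: (bounded_measurable_comp (pair2_measurable y) bF). Qed.

Let iF : (m1 \x m2)%E.-integrable setT (EFin \o F).
Proof.
have [mF [B FB]] := bF; have nB x : `|F x| <= `|B| by rewrite (le_trans (FB x))// ler_norm.
apply/integrableP; split; first by apply/measurable_EFinP.
have mN : measurable_fun setT (fun z => `|F z|%:E).
  by apply/measurable_EFinP; apply: measurableT_comp.
rewrite (@fubini_tonelli1 _ _ _ _ _ m1 m2 (fun z => `|F z|%:E) mN (fun z => normr_ge0 _)).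
apply: (@le_lt_trans _ _ (\int[m1]_x (cst (`|B|%:E * m2 setT)%E x))%E).
  apply: ge0_le_integral.
  - exact: measurableT.
  - by move=> x _; apply: integral_ge0 => y _; rewrite lee_fin.
  - exact: (@measurable_fun_fubini_tonelli_F _ _ _ _ _ m2 (fun z => `|F z|%:E) mN (fun z => normr_ge0 _)).
  - exact: measurable_cst.
  - move=> x _; rewrite -(integral_cst m2 measurableT `|B|%:E).
    apply: ge0_le_integral.
    + exact: measurableT.
    + by move=> y _; rewrite lee_fin.
    + exact: (measurableT_comp mN (pair1_measurable x)).
    + exact: measurable_cst.
    + by move=> y _; rewrite lee_fin.
rewrite (integral_cst m1 measurableT).
have f1 : m1 setT \is a fin_num by exact: fin_num_measure.
have f2 : m2 setT \is a fin_num by exact: fin_num_measure.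
by rewrite -ge0_fin_numE ?mule_ge0// !fin_numM.
Qed.

Lemma bounded_fubini_measurable : measurable_fun setT (fun x => (\int[m2]_y F (x, y))%R).
Proof.
have [mF _] := bF; have mE : measurable_fun setT (EFin \o F) by apply/measurable_EFinP.
rewrite /Rintegral; apply: measurableT_comp => //.
rewrite (_ : (fun x => _) = (fun x => \int[m2]_y (EFin \o F)^\+ (x, y) - \int[m2]_y (EFin \o F)^\- (x, y))%E); last first.
  by apply/funext => x; rewrite integralE; congr (_ - _)%E; apply: eq_integral => y _; rewrite ?funeposE ?funenegE.
apply: emeasurable_funB.
  exact: (@measurable_fun_fubini_tonelli_F _ _ _ _ _ m2 _ (measurable_funepos mE) (fun z => funepos_ge0 _ z)).
exact: (@measurable_fun_fubini_tonelli_F _ _ _ _ _ m2 _ (measurable_funeneg mE) (fun z => funeneg_ge0 _ z)).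
Qed.

Lemma bounded_fubini_bounded : bounded_measurable (fun x => (\int[m2]_y F (x, y))%R).
Proof.
split; first exact: bounded_fubini_measurable.
have [mF [B FB]] := bF; exists (B * fine (m2 setT)) => x.
by apply: Rintegral_norm_le => //; exact: measurableT_comp mF (pair1_measurable x).
Qed.

Lemma bounded_fubini : (\int[m1]_x (\int[m2]_y F (x, y)) = \int[m2]_y (\int[m1]_x F (x, y)))%R.
Proof.
have E := @Fubini _ _ _ _ _ m1 m2 (EFin \o F) iF.
rewrite [LHS]/Rintegral [RHS]/Rintegral; congr fine.
rewrite (eq_integral (fun x => \int[m2]_y (EFin \o F) (x, y))%E); last first.
  by move=> x _; rewrite (bounded_Rintegral _ (bounded_section1 x)).
rewrite E; apply: eq_integral => y _.
by rewrite -(bounded_Rintegral _ (bounded_section2 y)).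
Qed.

End two_measures.

End bounded_integrals.

(** * Density of the smooth sources *)

Section L2_closure.
Import finmap HBNNSimple.
Context d (X : measurableType d) (R : realType).
Variable mu : {measure set X -> \bar R}.
Hypothesis mu_fin : (mu setT < +oo)%E.
Implicit Types f h F : X -> R.
Local Notation L2 := (L2 mu).
Local Notation L2norm := (L2norm mu).

Lemma L2_of_le F G : measurable_fun setT F -> L2 G -> (forall x, `|F x| <= `|G x|) -> L2 F.
Proof.
move=> mF /L2P[mG iG] FG; apply/L2P; split => //.
apply: le_integrable iG => //; first by apply/measurable_EFinP; exact: measurable_funX.
move=> x _; rewrite /= lee_fin !normrX ler_pXn2r ?nnegrE//.
Qed.

Lemma L2_bounded F (B : R) : measurable_fun setT F -> (forall x, `|F x| <= B) -> L2 F.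
Proof.
move=> mF FB; apply: (@L2_of_le F (cst B)) => //; first exact: L2_cst.
by move=> x; rewrite (le_trans (FB x))// ler_norm.
Qed.

(** Dominated convergence for the squared differences, with the bound [4 * G ^+ 2], since [G] bounds
    both [F k] and the limit. *)
Lemma L2_dominated (F : nat -> X -> R) f G : (forall k, measurable_fun setT (F k)) ->
  measurable_fun setT f -> L2 G -> (forall k x, `|F k x| <= G x) ->
  (forall x, F k x @[k --> \oo] --> f x) ->
  L2norm (F k - f) @[k --> \oo] --> (0 : R).
Proof.
move=> mF mf G2 FG cF.
have fG x : `|f x| <= G x.
  have cN : `|F k x| @[k --> \oo] --> `|f x| by apply: cvg_norm; exact: cF.
  by apply: (ler_cvg_to cN (cvg_cst (G x))); apply: nearW => k; exact: FG.
have G0 x : 0 <= G x by apply: le_trans (FG 0 x).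
have F2 k : L2 (F k) by apply: (L2_of_le (mF k) G2) => x; rewrite (le_trans (FG k x))// ler_norm.
have f2 : L2 f by apply: (L2_of_le mf G2) => x; rewrite (le_trans (fG x))// ler_norm.
have D2 k : L2 (F k - f) by exact: L2B.
have /L2P[mG iG] := G2.
have iG4 : mu.-integrable setT (fun x => (4 * (G x ^+ 2))%:E).
  have := integrableZl measurableT 4 iG; apply: eq_integrable => // x _.
have H := @dominated_convergence _ _ _ mu setT measurableT (fun k x => (((F k - f) x) ^+ 2)%:E) (cst 0%E)
  (fun x => (4 * (G x ^+ 2))%:E) _ (measurable_cst _) _ iG4 _.
have {H}[_ _ H] : [/\ mu.-integrable setT (cst 0%E : X -> \bar R),
  [sequence \int[mu]_x `|(((F k - f) x) ^+ 2)%:E - cst 0%E x| ]_k @ \oo --> 0%E &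
  [sequence \int[mu]_x (((F k - f) x) ^+ 2)%:E ]_k @ \oo --> (\int[mu]_x (cst 0 x))%E]%E.
  apply: H.
  - by move=> k; apply/measurable_EFinP; apply: measurable_funX; exact: L2_measurable (D2 k).
  - apply: aeW => x _; apply: cvg_EFin; first exact: nearW.
    have : (F k x - f x) @[k --> \oo] --> f x - f x by apply: cvgB; [exact: cF|exact: cvg_cst].
    rewrite subrr => c0; have c1 : (fun t : R => t ^+ 2) @ (0 : R) --> (0 : R) ^+ 2 := @exprn_continuous R 2 0.
    by have := cvg_comp _ _ c0 c1; rewrite expr0n.
  - apply: aeW => x k _; rewrite /= lee_fin normrX -[4](_ : 2 ^+ 2 = 4 :> R); last by ring.
    rewrite -exprMn ler_pXn2r ?nnegrE// ?mulr_ge0//.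
    apply: le_trans (ler_normB _ _) _; rewrite mulr_natl mulr2n; exact: lerD.
rewrite integral0 in H.
have E k : (\int[mu]_x (((F k - f) x) ^+ 2)%:E = (L2norm (F k - f) ^+ 2)%:E)%E.
  rewrite L2norm_sqr// /ip /Rintegral fineK; last by apply: integrable_fin_num => //; exact: L2_integrableM.
  by apply: eq_integral => x _; rewrite expr2.
have {}H : (L2norm (F k - f) ^+ 2)%:E @[k --> \oo] --> (0 : R)%:E.
  move: H; rewrite (_ : [sequence _]_k = (fun k => (L2norm (F k - f) ^+ 2)%:E))//.
  by apply/funext => k; exact: E.
have /fine_cvgP[_ H2] := H.
have c2 : L2norm (F k - f) ^+ 2 @[k --> \oo] --> (0 : R) := H2.
have c3 := cvg_comp _ _ c2 (@sqrt_continuous R 0); rewrite sqrtr0 in c3.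
move: c3; rewrite (_ : _ \o _ = (fun k => L2norm (F k - f)))//.
by apply/funext => k; rewrite /= sqrtr_sqr ger0_norm// L2norm_ge0.
Qed.

Variable D : set (X -> R).
Hypothesis D_L2 : D `<=` L2.
Hypothesis D0 : D (cst 0).
Hypothesis D_lin : forall (a : R) f h, D f -> D h -> D (a *: f + h).

Definition L2_closure : set (X -> R) :=
  [set F | L2 F /\ forall e : R, 0 < e -> exists2 f, D f & L2norm (F - f) < e].
Local Notation C := L2_closure.

Lemma closure_sub f : D f -> C f.
Proof.
move=> Df; split; first exact: D_L2.
by move=> e e0; exists f => //; rewrite subrr L2norm0.
Qed.

Lemma closure_lin (a : R) f h : C f -> C h -> C (a *: f + h).
Proof.
move=> [f2 Cf] [h2 Ch]; split; first exact: L2_lin.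
move=> e e0.
have e1 : 0 < e / 2 / (`|a| + 1) by rewrite !divr_gt0// ltr_wpDl.
have [f' Df' ff'] := Cf _ e1.
have [h' Dh' hh'] := Ch (e / 2) ltac:(by rewrite divr_gt0).
exists (a *: f' + h'); first exact: D_lin.
have f'2 := D_L2 Df'; have h'2 := D_L2 Dh'.
have -> : a *: f + h - (a *: f' + h') = a *: (f - f') + (h - h').
  by rewrite scalerBr opprD addrACA.
apply: le_lt_trans (L2normD _ _) _; [by apply: L2Z; exact: L2B|exact: L2B|].
rewrite L2normZ; last exact: L2B.
rewrite [ltRHS](splitr e); apply: ler_ltD => //.
have : L2norm (f - f') * (`|a| + 1) < e / 2 by rewrite -ltr_pdivlMr// ltr_wpDl.
have := L2norm_ge0 mu (f - f'); have := normr_ge0 a; nra.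
Qed.

Lemma closure0 : C (cst 0). Proof. exact: closure_sub. Qed.

Lemma closure_lim (F : nat -> X -> R) f : (forall k, C (F k)) -> L2 f ->
  L2norm (F k - f) @[k --> \oo] --> (0 : R) -> C f.
Proof.
move=> CF f2 cF; split => // e e0.
have e2 : 0 < e / 2 by rewrite divr_gt0.
have /cvgrPdist_lt/(_ _ e2)[k0 _ Hk] := cF.
have := Hk k0 (leqnn _); rewrite sub0r normrN ger0_norm ?L2norm_ge0// => lt1.
have [F2 /(_ _ e2)[h Dh Fh]] := CF k0.
exists h => //; have h2 := D_L2 Dh.
have -> : f - h = (F k0 - h) - (F k0 - f).
  by apply/funext => x; change (f x - h x = (F k0 x - h x) - (F k0 x - f x)); ring.
apply: le_lt_trans (L2normB _ _) _; [exact: L2B|exact: L2B|].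
by rewrite [ltRHS](splitr e); apply: ltrD.
Qed.

Lemma closure_ae f h : C f -> L2 h -> f = h %[ae mu] -> C h.
Proof.
move=> [f2 Cf] h2 fh; split => // e e0; have [k Dk fk] := Cf e e0; exists k => //.
rewrite -(@eq_L2norm _ _ _ mu (f - k)) => //; try by apply: L2B => //; exact: D_L2.
by move: fh; apply: filterS => x E Tx; change (f x - k x = h x - k x); rewrite E.
Qed.

Lemma closure_dominated (F : nat -> X -> R) f G : (forall k, C (F k)) ->
  measurable_fun setT f -> L2 G -> (forall k x, `|F k x| <= G x) ->
  (forall x, F k x @[k --> \oo] --> f x) -> C f.
Proof.
move=> CF mf G2 FG cF.
have fG x : `|f x| <= G x.
  have cN : `|F k x| @[k --> \oo] --> `|f x| by apply: cvg_norm; exact: cF.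
  by apply: (ler_cvg_to cN (cvg_cst (G x))); apply: nearW => k; exact: FG.
apply: (closure_lim CF).
  by apply: (L2_of_le mf G2) => x; rewrite (le_trans (fG x))// ler_norm.
by apply: (L2_dominated _ mf G2 FG cF) => k; case: (CF k) => /L2_measurable.
Qed.

Lemma closure_sum (J : Type) (r : seq J) (P : pred J) (a : J -> R) (F : J -> X -> R) :
  (forall j, C (F j)) -> C (fun x => \sum_(j <- r | P j) a j * F j x).
Proof.
move=> CF; elim: r => [|j r IH].
  rewrite (_ : (fun x => _) = cst 0); first exact: closure0.
  by apply/funext => x; rewrite big_nil.
rewrite (_ : (fun x => _) = (if P j then a j else 0) *: F j + (fun x => \sum_(j <- r | P j) a j * F j x)).
  exact: closure_lin.
by apply/funext => x; rewrite big_cons; case: ifP => _ //; rewrite -[RHS]/(0 * F j x + _) mul0r add0r.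
Qed.

(* Monotone class argument: [W] is a weight, and the sets [E] whose weighted indicator
   lies in the closure form a Dynkin system. *)
Variable W : X -> R.
Hypothesis W_meas : measurable_fun setT W.
Hypothesis W_le1 : forall x, 0 <= W x <= 1.

(** [pi] and [Z] let the argument treat one factor of a product at a time: [pi] projects to the
    factor under study, and [Z] is a cylinder over the other one. *)
Lemma closure_dynkin d' (Y : measurableType d') (G : set_system Y) (pi : X -> Y) (Z : set X) :
  measurable_fun setT pi -> measurable Z ->
  @measurable _ Y = <<s G >> -> setI_closed G ->
  C (fun x => \1_Z x * W x) ->
  (forall E, G E -> C (fun x => \1_(pi @^-1` E `&` Z) x * W x)) ->
  forall E, measurable E -> C (fun x => \1_(pi @^-1` E `&` Z) x * W x).
Proof.
move=> mpi mZ mG GI CZ CG.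
have mI E : measurable E -> measurable (pi @^-1` E `&` Z).
  move=> mE; apply: measurableI => //; rewrite -[X in measurable X]setTI; exact: mpi.
have P0 : C (fun x => \1_(pi @^-1` setT `&` Z) x * W x) by rewrite preimage_setT setTI.
suff H : forall S, <<s G >> S -> C (fun x => \1_(pi @^-1` S `&` Z) x * W x).
  by move=> E mE; apply: H; rewrite -mG.
apply: (@dynkin_induction d' Y G (fun E => C (fun x => \1_(pi @^-1` E `&` Z) x * W x)) mG GI P0 CG).
- move=> E mE CE.
  rewrite (_ : (fun x => _) = (-1) *: (fun x => \1_(pi @^-1` E `&` Z) x * W x) + (fun x => \1_Z x * W x)).
    exact: closure_lin.
  apply/funext => x; rewrite -[RHS]/(-1 * (\1_(pi @^-1` E `&` Z) x * W x) + \1_Z x * W x) mulN1r !indicE.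
  have [Zx|nZx] := pselect (Z x); last by rewrite !memNset ?mul0r ?addr0 ?oppr0// => -[].
  have [Ex|nEx] := pselect (E (pi x)).
    rewrite (memNset (A := pi @^-1` (~` E) `&` Z)); last by move=> [/(_ Ex)].
    by rewrite !mem_set// !mul1r mul0r addNr.
  rewrite (memNset (A := pi @^-1` E `&` Z)); last by move=> [/nEx].
  by rewrite !mem_set// mul0r oppr0 add0r.
- move=> F mF tF CF.
  pose S k x := \sum_(j < k) 1 * (\1_(pi @^-1` (F j) `&` Z) x * W x).
  have W0 x : 0 <= W x by case/andP: (W_le1 x).
  have lim x : S k x @[k --> \oo] --> \1_(pi @^-1` (\bigcup_k F k) `&` Z) x * W x.
    have [[[j _ Fj] Zx]|nU] := pselect ((pi @^-1` (\bigcup_k F k) `&` Z) x); last first.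
      rewrite indicE memNset// mul0r (_ : S ^~ x = cst 0); first exact: cvg_cst.
      apply/funext => k; rewrite /S big1// => j _; rewrite indicE memNset ?mul0r ?mulr0//.
      by move=> [Fx Zx]; apply: nU; split => //; exists j.
    apply: cvg_near_cst; exists j.+1 => // k /= jk.
    rewrite /S (bigD1 (Ordinal jk))//= big1 ?addr0; last first.
      move=> l lj; rewrite indicE memNset ?mul0r ?mulr0// => -[Fl _].
      move/trivIsetP: tF => /(_ (nat_of_ord l) j Logic.I Logic.I) H.
      have : F l `&` F j = set0 by apply: H; apply: contra lj => /eqP lj; apply/eqP; exact: val_inj.
      by move=> /seteqP[/(_ (pi x)) + _]; apply; split.
    rewrite mul1r !indicE !mem_set//; by split => //; exists j.
  apply: (@closure_dominated S _ (cst 1)).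
  - by move=> k; apply: closure_sum => j; exact: CF.
  - apply: measurable_funM => //; apply: measurable_indic; apply: mI.
    exact: bigcupT_measurable.
  - exact: L2_cst.
  - move=> k x; have S0 : 0 <= S k x by apply: sumr_ge0 => j _; rewrite mul1r mulr_ge0.
    rewrite ger0_norm// /S.
    have [[j jk]|nj] := pselect (exists2 j : 'I_k, true & (pi @^-1` (F j) `&` Z) x).
      move=> Fx; rewrite (bigD1 j)//= big1 ?addr0.
        by rewrite mul1r indicE; case: (_ \in _); rewrite ?mul1r ?mul0r//; case/andP: (W_le1 x).
      move=> l lj; rewrite indicE memNset ?mul0r ?mulr0// => -[Fl _].
      move/trivIsetP: tF => /(_ (nat_of_ord l) (nat_of_ord j) Logic.I Logic.I) H.
      have : F l `&` F j = set0 by apply: H; apply: contra lj => /eqP lj; apply/eqP; exact: val_inj.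
      by move=> /seteqP[/(_ (pi x)) + _]; apply; split => //; case: Fx.
    rewrite big1// => j _; rewrite indicE memNset ?mul0r ?mulr0// => Fx; apply: nj.
    by exists j.
  - exact: lim.
Qed.

Hypothesis C_ind : forall E : set X, measurable E -> C (fun x => \1_E x * W x).
Hypothesis W_ae : forall f, L2 f -> (fun x => f x * W x) = f %[ae mu].

Let closure_nnsfun (h : {nnsfun X >-> R}) : C (fun x => h x * W x).
Proof.
rewrite (_ : (fun x => _) = (fun x => \sum_(k < #|` fset_set (h @` setT)|)
    (fset_set (h @` setT))`_k * (\1_(h @^-1` [set (fset_set (h @` setT))`_k]) x * W x))).
  by apply: closure_sum => k; apply: C_ind; exact: measurable_sfunP.
apply/funext => x; rewrite [in LHS](fimfunEord h x) mulr_suml.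
by apply: eq_bigr => k _; rewrite mulrA.
Qed.

Let closure_ge0 f : L2 f -> (forall x, 0 <= f x) -> C (fun x => f x * W x).
Proof.
move=> f2 f0; have mf := L2_measurable f2.
have mE : measurable_fun setT (EFin \o f) by apply/measurable_EFinP.
pose h := nnsfun_approx measurableT mE.
have hQ (k : nat) x : h k x <= f x.
  by rewrite -lee_fin /h nnsfun_approxE; apply: le_approx => // *; rewrite ?lee_fin.
have cvh x : h k x @[k --> \oo] --> f x.
  have := @cvg_nnsfun_approx _ _ _ setT measurableT (EFin \o f) mE (fun x _ => f0 x) x Logic.I.
  by move=> /fine_cvgP[].
apply: (@closure_dominated (fun k x => h k x * W x) _ f) => //.
- by apply: measurable_funM; [exact: mf|exact: W_meas].
- move=> k x; have /andP[W0 W1] := W_le1 x.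
  rewrite ger0_norm ?mulr_ge0//; apply: le_trans (hQ k x).
  by rewrite ler_piMr.
- by move=> x; apply: cvgM; [exact: cvh|exact: cvg_cst].
Qed.

Lemma closure_full f : L2 f -> C f.
Proof.
move=> f2; have mf := L2_measurable f2.
have mp : measurable_fun setT (fun x => Num.max (f x) 0) by exact: measurable_maxr.
have mn : measurable_fun setT (fun x => Num.max (- f x) 0).
  by apply: measurable_maxr => //; exact: measurableT_comp.
have p2 : L2 (fun x => Num.max (f x) 0).
  apply: (L2_of_le mp f2) => x; have [h|h] := leP (f x) 0; first by rewrite normr0.
  by [].
have n2 : L2 (fun x => Num.max (- f x) 0).
  apply: (L2_of_le mn f2) => x; have [h|h] := leP (- f x) 0; first by rewrite normr0.
  by rewrite normrN.
have := closure_lin (-1) (closure_ge0 n2 _) (closure_ge0 p2 _).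
move=> /(_ _ _)H; have {}H : C (fun x => f x * W x).
  have -> : (fun x => f x * W x) = -1 *: (fun x => Num.max (- f x) 0 * W x) + (fun x => Num.max (f x) 0 * W x).
    apply/funext => x; rewrite -[RHS]/(-1 * (Num.max (- f x) 0 * W x) + Num.max (f x) 0 * W x).
    have {1}-> : f x = Num.max (f x) 0 - Num.max (- f x) 0 by case: (leP (f x) 0) => h; case: (leP (- f x) 0) => h'; lra.
    by ring.
  by apply: H => x; rewrite le_max lexx orbT.
exact: (closure_ae H f2 (W_ae f2)).
Qed.

End L2_closure.

(** * Waves and the connecting operator *)

Lemma pair_continuous (T T1 T2 : topologicalType) (f : T -> T1) (h : T -> T2) (x : T) :
  {for x, continuous f} -> {for x, continuous h} -> {for x, continuous (fun y => (f y, h y))}.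
Proof. by move=> cf ch; exact: (cvg_pair cf ch). Qed.

(** * Functions smooth up to the initial time *)

Section time_smooth.
Context {R : realType} {n : nat} {M : ptopologicalType} (I : Type).
Variable A : I -> chart R n M.
Hypothesis A_manifold : is_manifold A.
Hypothesis M_compact : compact [set: M].
Implicit Types (i : I) (p : M) (u v : R * M -> R).
Local Notation im i := (chart_image (A i)).
Local Notation phi i := (chart_map (A i)).
Local Notation par i := (param (A i)).
Local Notation X := (measurableTypeR R * borel M)%type.
Local Notation V := (R * 'rV[R]_n.+1)%type.

Definition time_domain i : set V := [set z | 0 <= z.1 /\ im i z.2].

Definition smooth_time u := forall i, smooth_on (time_domain i) (fun z => u (z.1, par i z.2)).

(** A right-hand derivative in time, so that it is meaningful and smooth up to [t = 0]. *)
Definition dt u : R * M -> R := fun z => rderive (fun t : R => u (t, z.2)) z.1 1.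

Lemma smooth_time_point u (t : R) p : smooth_time u -> 0 <= t -> exists i (U : set V) (F : V -> R),
  [/\ dom (A i) p, open U, U (t, phi i p), (forall k, Ck k U F) &
    forall s q, U (s, phi i q) -> dom (A i) q -> 0 <= s -> F (s, phi i q) = u (s, q)].
Proof.
move=> su t0; have [i ip] := manifold_cover A_manifold p.
have D : time_domain i (t, phi i p) by split => //; exact: im_chart.
have [U [F [oU Up CF FE]]] := su i _ D.
exists i, U, F; split => // s q Uq iq s0; rewrite FE//=; first by rewrite chart_mapK.
by split => //; exact: im_chart.
Qed.

Let line_derive (U : set V) (F : V -> R) (t : R) x : (forall k, Ck k U F) -> U (t, x) ->
  is_derive t (1 : R) (fun s : R => F (s, x)) ('D_((1 : R), (0 : 'rV[R]_n.+1)) F (t, x)).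
Proof.
move=> CF Ut.
have E (s : R) : (s, x) = s *: ((1 : R), (0 : 'rV[R]_n.+1)) + (0, x) :> V.
  by rewrite [RHS]surjective_pairing/=; congr (_, _); rewrite ?addr0 ?scaler0 ?add0r// [_ *: _]mulr1.
rewrite (_ : (fun s : R => F (s, x)) = fun s => F (s *: ((1 : R), (0 : 'rV[R]_n.+1)) + (0, x))).
  rewrite (E t); apply: is_derive_segment; rewrite -E.
  by apply: (Ck_derivable _ (CF 1%N)).
by apply/funext => s; rewrite E.
Qed.

Let line_near (U : set V) (t : R) x : open U -> U (t, x) -> \forall s \near t, U (s, x).
Proof.
move=> oU Ut.
have c : {for t, continuous (fun s : R => (s, x) : V)}.
  by apply: pair_continuous; [exact: cvg_id|exact: cvg_cst].
exact: (c _ (open_nbhs_nbhs (conj oU Ut))).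
Qed.

Lemma dt_ext (U : set V) (F : V -> R) u (t : R) q x : open U -> (forall k, Ck k U F) -> U (t, x) ->
  (forall s, U (s, x) -> 0 <= s -> F (s, x) = u (s, q)) -> 0 <= t ->
  dt u (t, q) = 'D_((1 : R), (0 : 'rV[R]_n.+1)) F (t, x).
Proof.
move=> oU CF Ut FE t0; rewrite /dt /=.
apply: (@rderiveE R R (fun s : R => u (s, q)) (fun s => F (s, x))); last exact: line_derive.
- have := line_near oU Ut => Hn.
  have c : {for 0, continuous (fun h : R => t + h *: (1 : R))}.
    by apply: cvgD; [exact: cvg_cst|apply: cvgZr_tmp; exact: cvg_id].
  have H0 : \forall h \near (0 : R), U (t + h *: (1 : R), x).
    have Hn' : nbhs (t + 0 *: (1 : R)) (fun s => U (s, x)) by rewrite scale0r addr0.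
    exact: (c _ Hn').
  near=> h; apply/esym/FE; first by near: h; apply: cvg_within; exact: H0.
  rewrite addr_ge0// [_ *: _]mulr1 ltW//; near: h; exact: nbhs_right_gt.
- by apply/esym/FE.
Unshelve. all: by end_near.
Qed.

Lemma dt_derive u (t : R) p : smooth_time u -> 0 < t ->
  is_derive t (1 : R) (fun s : R => u (s, p)) (dt u (t, p)).
Proof.
move=> su t0; have [i [U [F [ip oU Up CF FE]]]] := smooth_time_point p su (ltW t0).
rewrite (dt_ext oU CF Up (fun s Us s0 => FE s p Us ip s0) (ltW t0)).
apply: (near_eq_is_derive (f := fun s : R => F (s, phi i p))); last exact: line_derive.
by have := line_near oU Up; have := lt_nbhsr t0; apply: filterS2 => s s0 Us; rewrite FE// ltW.
Qed.

Lemma smooth_dt u : smooth_time u -> smooth_time (dt u).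
Proof.
move=> su i [t x] [/= t0 ix]; have [U [F [oU Up CF FE]]] := su i (t, x) (conj t0 ix).
exists U, ('D_((1 : R), (0 : 'rV[R]_n.+1)) F); split => //.
  by move=> k; exact: (Ck_derive _ (CF k.+1)).
move=> [s y] Uy [/= s0 iy]; apply/esym; apply: (dt_ext oU CF Uy) => // s' Us s'0.
by rewrite FE.
Qed.

Lemma dt2_derive u (t : R) p : smooth_time u -> 0 < t ->
  derive1n 2 (fun s : R => u (s, p)) t = dt (dt u) (t, p).
Proof.
move=> su t0; rewrite /derive1n/= derive1E.
have d2 := dt_derive p (smooth_dt su) t0.
have [_ <-] := d2; apply: near_eq_derive.
have := lt_nbhsr t0; apply: filterS => s s0.
by rewrite derive1E; have [_ ->] := dt_derive p su s0.
Qed.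

Lemma smooth_time_fixed u (t : R) : smooth_time u -> 0 <= t -> smooth_function A (fun p => u (t, p)).
Proof.
move=> su t0 i.
have lE (y v : 'rV[R]_n.+1) (h : R) : (t, h *: v + y) = h *: ((0 : R), v) + (t, y) :> V.
  by rewrite [RHS]surjective_pairing/=; congr (_, _); rewrite ?scaler0 add0r.
have cl : continuous (fun y : 'rV[R]_n.+1 => (t, y) : V).
  by move=> y; apply: (@pair_continuous _ _ _ (fun=> t) id); [exact: cst_continuous|exact: cvg_id].
apply: (@smooth_onS _ _ _ ((fun y : 'rV[R]_n.+1 => (t, y) : V) @^-1` time_domain i)).
  by move=> x ix; split.
have H := smooth_on_affine cl lE (su i).
by move: H; apply: smooth_on_eq.
Qed.

Let chart_pair_continuous i (t : R) p : dom (A i) p ->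
  {for (t, p), continuous (fun z : R * M => (z.1, phi i z.2) : V)}.
Proof.
move=> ip; apply: pair_continuous; first exact: cvg_fst.
apply: continuous_comp; first exact: cvg_snd.
exact: (chart_coord_cont (chartP A_manifold i)).
Qed.

(** At [t = 0] the function is only the restriction of a continuous one; bounds, limits and
    measurability are all drawn from this local form. *)
Lemma smooth_time_near u (t : R) p : smooth_time u -> 0 <= t -> exists F : R * M -> R,
  {for (t, p), continuous F} /\ \forall z \near (t, p), 0 <= z.1 -> F z = u z.
Proof.
move=> su t0; have [i [U [F [ip oU Up CF FE]]]] := smooth_time_point p su t0.
have cp := @chart_pair_continuous i t p ip.
exists (fun z => F (z.1, phi i z.2)); split.
  by apply: (continuous_comp (f := fun z : R * M => (z.1, phi i z.2) : V)) => //; exact: (Ck_continuous (CF 0%N)).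
have h1 : \forall z \near (t, p), U (z.1, phi i z.2) by exact: (cp _ (open_nbhs_nbhs (conj oU Up))).
have h2 : \forall z \near (t, p), dom (A i) z.2.
  have c2 : {for (t, p), continuous (fun z : R * M => z.2)} by exact: cvg_snd.
  exact: (c2 _ (open_nbhs_nbhs (conj (chart_open (chartP A_manifold i)) ip))).
by move: h1 h2; apply: filterS2 => -[s q] /= Uq iq s0; exact: FE.
Qed.

Lemma smooth_time_within u (t : R) p : smooth_time u -> 0 <= t ->
  u (s, p) @[s --> within [set s | 0 <= s] (nbhs t)] --> u (t, p).
Proof.
move=> su t0; have [F [cF FE]] := smooth_time_near p su t0.
have cl : {for t, continuous (fun s : R => (s, p))}.
  by apply: pair_continuous; [exact: cvg_id|exact: cvg_cst].
rewrite -(nbhs_singleton FE t0).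
apply: (@cvg_trans _ (F (s, p) @[s --> within [set s | 0 <= s] (nbhs t)])).
  apply: near_eq_cvg; rewrite /within/=.
  have H : \forall s \near t, 0 <= s -> F (s, p) = u (s, p) := cl _ FE.
  by move: H; apply: filterS => s Fs s0; exact: Fs.
have cFl : F (s, p) @[s --> t] --> F (t, p) by exact: (continuous_comp cl cF).
by apply: cvg_trans cFl; apply: cvg_app; exact: cvg_within.
Qed.

(** Compactness is used twice: of the manifold, near a fixed time, which gives a bound uniform in
    nearby times, and then of the time interval. *)
Lemma smooth_time_bounded u (b : R) : smooth_time u ->
  exists2 B : R, 0 <= B & forall t p, 0 <= t <= b -> `|u (t, p)| <= B.
Proof.
move=> su.
have loc (t : R) p : 0 <= t -> \forall z \near (t, p), 0 <= z.1 -> `|u z| <= `|u (t, p)| + 1.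
  move=> t0; have [F [cF FE]] := smooth_time_near p su t0.
  have /cvgrPdist_lt/(_ _ ltr01) := cF; rewrite (nbhs_singleton FE t0).
  move: FE; apply: filterS2 => z FE + z0; rewrite FE// => h.
  have := lerB_dist (u z) (u (t, p)); rewrite distrC; move: h; set a := `|_ - _|; lra.
have cT := @segment_compact R 0 b.
have H1 (t : R) : 0 <= t -> \forall B \near +oo & s \near t, 0 <= s -> forall p, `|u (s, p)| <= B.
  move=> t0.
  have := @iffLR _ _ (compact_near_coveringP [set: M]) M_compact (R * R)%type (filter_prod +oo (nbhs t))
    (fun Bs p => 0 <= Bs.2 -> `|u (Bs.2, p)| <= Bs.1) _.
  move=> H; have {}H : \forall Bs \near filter_prod +oo (nbhs t), [set: M] `<=` (fun p => 0 <= Bs.2 -> `|u (Bs.2, p)| <= Bs.1).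
    apply: H => p _; have [[P Q] /= [tP pQ] PQ] := loc t p t0.
    exists (Q, [set Bs | `|u (t, p)| + 1 <= Bs.1 /\ P Bs.2]) => /=.
      split => //; exists ([set B | `|u (t, p)| + 1 <= B], P) => /=; first by split => //; exact: nbhs_pinfty_ge.
      by move=> [B s] /= [].
    move=> [q [B s]] /= [Qq [uB Ps]] s0; apply: le_trans uB; exact: (PQ (s, q)).
  by move: H; apply: filterS => -[B s] /= H s0 p; exact: H.
have := @iffLR _ _ (compact_near_coveringP `[0, b]%classic) cT R +oo (fun B s => 0 <= s -> forall p, `|u (s, p)| <= B) _.
move=> H; have {}H : \forall B \near +oo, `[0, b]%classic `<=` (fun s : R => 0 <= s -> forall p, `|u (s, p)| <= B).
  apply: H => t /=; rewrite in_itv/= => /andP[t0 _].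
  by have [[P Q] /= [PB Qt] PQ] := H1 t t0; exists (Q, P) => //= -[s B] /= [Qs PB']; exact: (PQ (B, s)).
near (pinfty_nbhs R) => B; exists B; first by near: B; exact: nbhs_pinfty_ge.
move=> t p /andP[t0 tb].
suff HB : `[0, b]%classic `<=` (fun s : R => 0 <= s -> forall p, `|u (s, p)| <= B).
  by apply: HB => //=; rewrite in_itv/= t0.
by near: B.
Unshelve. all: by end_near.
Qed.

Lemma product_open_measurable (O : set (R * M)) : open O -> measurable (O : set X).
Proof.
move=> oO; have := @open_measurable_prod _ _ (measurableTypeR R) (borel M) R M idfun idfun
  (@second_countable_R R) (manifold_countable A_manifold) _ _ O oO.
move=> /(_ _ _)H; rewrite (_ : O = [set z : X | O (idfun z.1, idfun z.2)]).
  by apply: H => U oU; [exact: open_measurable|exact: borel_open].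
by apply/seteqP; split=> -[].
Qed.

Lemma product_measurable_indicM (O : set (R * M)) (F : R * M -> R) : open O ->
  (forall z, O z -> {for z, continuous F}) ->
  measurable_fun setT (fun z : X => \1_O (z : R * M) * F z).
Proof.
move=> oO cF; apply: measurable_fun_open_preimage => U oU; rewrite setTI.
rewrite (_ : _ @^-1` U = (O `&` F @^-1` U) `|` (~` O `&` [set z | U 0])).
  apply: measurableU.
    apply: product_open_measurable; rewrite openE => z [Oz Uz]; apply: filterI.
      exact: open_nbhs_nbhs.
    by apply: cF => //; exact: open_nbhs_nbhs.
  apply: measurableI; first by apply: measurableC; exact: product_open_measurable.
  have [U0|nU0] := pselect (U 0).
    by rewrite (_ : [set _ | _] = setT); [exact: measurableT|apply/seteqP; split].
  by rewrite (_ : [set _ | _] = set0); [exact: measurable0|apply/seteqP; split].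
apply/seteqP; split=> z /=; rewrite indicE.
  have [Dx|nDx] := pselect (O z); first by rewrite mem_set// mul1r; left.
  by rewrite memNset// mul0r; right.
by move=> [[Dx Ux]|[nDx U0]]; [rewrite mem_set// mul1r|rewrite memNset// mul0r].
Qed.

Lemma smooth_time_bounded_measurable u (b : R) : smooth_time u ->
  bounded_measurable (fun z : X => \1_(`]0, b[%classic : set R) z.1 * u z).
Proof.
move=> su; have [B B0 uB] := smooth_time_bounded b su; split; last first.
  exists B => -[t p] /=; rewrite indicE; have [tb|ntb] := pselect ((`]0, b[%classic : set R) t).
    by rewrite mem_set// mul1r; apply: uB; move: tb; rewrite /= in_itv/= => /andP[/ltW -> /ltW ->].
  by rewrite memNset// mul0r normr0.
pose O := [set z : R * M | (`]0, b[%classic : set R) z.1].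
have oO : open O.
  have oi : open (`]0, b[%classic : set R) by exact: interval_open.
  rewrite (_ : O = (fun z : R * M => z.1) @^-1` `]0, b[%classic)//.
  by apply: open_comp => // z _; exact: cvg_fst.
have := @product_measurable_indicM O u oO.
move=> H; have {}H := H _; rewrite (_ : (fun z : X => _) = (fun z : X => \1_O (z : R * M) * u z)); last first.
  by apply/funext => z; rewrite !indicE.
apply: H => -[t p] /= tb; have t0 : 0 < t.
  by have : (`]0, b[%classic : set R) t := tb; rewrite /= in_itv/= => /andP[].
have [F [cF FE]] := smooth_time_near p su (ltW t0).
have c1 : {for (t, p), continuous (fun z : R * M => z.1)} by exact: cvg_fst.
have H0 : \forall z \near (t, p), 0 < z.1 := c1 _ (lt_nbhsr t0).
have /near_eq_continuous : \forall z \near (t, p), F z = u z.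
  by move: FE H0; apply: filterS2 => z FE z0; apply: FE; exact: ltW.
exact.
Qed.

End time_smooth.

(** * Exchange of the integrals over time and over the manifold *)

Section manifold_fubini.
Context {R : realType} {n : nat} {M : ptopologicalType} (I : Type).
Variable A : I -> chart R n M.
Hypothesis A_manifold : is_manifold A.
Variable g : I -> 'rV[R]_n.+1 -> 'M[R]_n.+1.
Hypothesis g_metric : is_riemannian_metric A g.
Variable w : M -> R.
Hypothesis w_smooth : smooth_function A w.
Implicit Types (i : I) (p : M).
Local Notation im i := (chart_image (A i)).
Local Notation phi i := (chart_map (A i)).
Local Notation par i := (param (A i)).
Local Notation smoothM := (smooth_function A).
Local Notation VT m := (borel 'rV[R]_m).
Local Notation IM := (interior_image A).
Local Notation CI := (chart_integral A g w).

(* This presentation of chart integrals makes Fubini's theorem with the time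
   variable applicable. *)
Lemma chart_integral_finite i (chi : M -> R) (K : set M) : smoothM chi -> compact K ->
  K `<=` dom (A i) -> (forall q, chi q != 0 -> K q) ->
  exists (m : {finite_measure set (VT n.+1) -> \bar R}) (kap : VT n.+1 -> R) (sig : VT n.+1 -> borel M),
    [/\ bounded_measurable kap, measurable_fun setT sig &
      forall F : borel M -> R, bounded_measurable F ->
        CI i (fun p => chi p * F p) = (\int[m]_x (kap x * F (sig x)))%R].
Proof.
move=> sc cK KA chiK.
have cchi := smooth_function_continuous A_manifold sc.
have [r r0 Cr] := compact_rV_bounded (compact_chart_map A_manifold cK KA).
(* The support of [chi] has a bounded image in the chart, so Lebesgue measure may be replaced by its
   restriction to a ball, which is finite. *)
pose b : set (VT n.+1) := ball (0 : 'rV[R]_n.+1) r.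
have mb : measurable b by exact: measurable_ball_rV.
have b_fin : (lam n.+1 b < +oo)%E.
  have E := lam_ball (0 : 'rV[R]_n.+1) r0.
  by apply: le_lt_trans (ltry ((2 * r) ^+ n.+1)); rewrite le_eqVlt; apply/orP; left; apply/eqP; exact: E.
pose m : {finite_measure set (VT n.+1) -> \bar R} := [the {finite_measure set (VT n.+1) -> \bar R} of mfrestr mb b_fin].
pose kap (x : VT n.+1) : R := \1_(IM i) x * (chi (par i x) * density A g w i x).
pose sig (x : VT n.+1) : borel M := if `[< IM i x >] then par i x else point.
have sm : measurable_fun setT sig.
  have H := @measurable_if_open 'rV[R]_n.+1 M _ (fun x => par i x) point (open_interior_image A_manifold (i := i)).
  by apply: H => x ix; exact: (par_continuous A_manifold ix).
have CI_int := chart_integrable A_manifold g_metric w_smooth cchi cK KA chiK.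
have sD : smooth_on (im i) (density A g w i) by apply: smooth_density.
have Ci : phi i @` K `<=` im i by move=> _ [q Kq <-]; apply: im_chart => //; exact: KA.
have [c c0 cD] := smooth_on_bounded sD (compact_chart_map A_manifold cK KA) Ci.
have [c' c'0 cF'] := continuous_support_bounded cchi cK chiK.
have kapC x : kap x != 0 -> (phi i @` K) x.
  rewrite /kap indicE; have [ix|nix] := pselect (IM i x); last by rewrite memNset// mul0r eqxx.
  rewrite mem_set// mul1r mulf_eq0 negb_or => /andP[/chiK Kx _].
  by exists (par i x) => //; rewrite paramK//; case: ix.
have bk : bounded_measurable kap.
  split; first exact: (chart_integrand_measurable A_manifold g_metric w_smooth i cchi).
  exists (c' * c) => x; have [/kapC Cx|] := boolP (kap x != 0).
    rewrite /kap normrM (normrM (chi _)); have := cD _ Cx; have := cF' (par i x) => h1 h2.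
    rewrite -[leRHS]mul1r; apply: ler_pM; rewrite ?mulr_ge0 ?normr_ge0//.
      by rewrite indicE; case: (_ \in _); rewrite ?normr1 ?normr0.
    by apply: ler_pM; rewrite ?normr_ge0.
  by rewrite negbK => /eqP ->; rewrite normr0 mulr_ge0// ltW.
exists m, kap, sig; split; [exact: bk|exact: sm|move=> F bF].
have bkF := bounded_measurableM bk (bounded_measurable_comp sm bF).
pose H (x : VT n.+1) := kap x * F (sig x).
have mH : measurable_fun setT (EFin \o H) by apply/measurable_EFinP; case: bkF.
have H0 x : x \notin b -> H x = 0.
  move=> nb; apply/eqP; rewrite -[_ == _]negbK; apply/negP; rewrite mulf_eq0 negb_or => /andP[/kapC/Cr bx _].
  by move: nb; rewrite mem_set.
have restr (G : VT n.+1 -> \bar R) : measurable_fun setT G -> (forall x, 0 <= G x)%E -> (forall x, x \notin b -> G x = 0%E) ->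
    (\int[lam n.+1]_x G x = \int[m]_x G x)%E.
  move=> mG G0 Gb; rewrite [RHS](_ : _ = \int[mrestr (lam n.+1) mb]_x G x)%E; last by apply: eq_measure_integral.
  have mDc := measurableC mb.
  rewrite (_ : \int[lam n.+1]_x _ = \int[measure_add (mrestr (lam n.+1) mb) (mrestr (lam n.+1) mDc)]_x G x)%E; last first.
    apply: eq_measure_integral => Y mY _; rewrite /= /measure_add/= /msum !big_ord_recl big_ord0/= adde0.
    rewrite /mrestr/= -measureU//; try exact: measurableI.
      by rewrite -setIUr setUCr setIT.
    by rewrite setIACA setICr setI0.
  rewrite ge0_integral_measure_add//.
  rewrite [X in (_ + X)%E](_ : _ = 0%E) ?adde0//.
  transitivity (\int[mrestr (lam n.+1) mDc]_x (cst 0 x : \bar R))%E; last exact: integral0.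
  apply: ae_eq_integral => //; exists b; split => //.
    by rewrite /= /mrestr setICr measure0.
  move=> x /=; apply: contra_notP => nbx _; apply: Gb; by apply/negP => /set_mem /nbx.
rewrite [LHS]/Rintegral [RHS]/Rintegral; congr fine.
transitivity (\int[lam n.+1]_x (H x)%:E)%E.
  apply: eq_integral => x _; congr EFin; rewrite /H /kap /sig indicE.
  have [ix|nix] := pselect (IM i x); first by rewrite asboolT//; ring.
  by rewrite memNset// !mul0r.
have Ep : (\int[lam n.+1]_x (EFin \o H)^\+ x = \int[m]_x (EFin \o H)^\+ x)%E.
  apply: restr; [exact: measurable_funepos|by move=> x; exact: funepos_ge0|].
  by move=> x nb; rewrite funeposE /= H0// maxxx.
have En : (\int[lam n.+1]_x (EFin \o H)^\- x = \int[m]_x (EFin \o H)^\- x)%E.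
  apply: restr; [exact: measurable_funeneg|by move=> x; exact: funeneg_ge0|].
  by move=> x nb; rewrite funenegE /= H0// oppr0 maxxx.
etransitivity; first exact: (integralE (lam n.+1) setT (EFin \o H)).
etransitivity; last exact: (esym (integralE m setT (EFin \o H))).
by rewrite Ep En.
Qed.

Variables (N : nat) (c : 'I_N -> I) (chi : 'I_N -> M -> R) (K : 'I_N -> set M).
Hypothesis chi_smooth : forall k, smoothM (chi k).
Hypothesis K_chart : forall k, compact (K k) /\ K k `<=` dom (A (c k)).
Hypothesis chi_supp : forall k q, chi k q != 0 -> K k q.

Lemma manifold_integral_fubini (tau : {finite_measure set (measurableTypeR R) -> \bar R})
    (F : measurableTypeR R * borel M -> R) : bounded_measurable F ->
  (\int[tau]_t (\sum_k CI (c k) (fun p => chi k p * F (t, p))))%R =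
  \sum_k CI (c k) (fun p => chi k p * (\int[tau]_t F (t, p))%R).
Proof.
move=> bF.
have /choice[m /choice[kap /choice[sig mkP]]] k :=
  chart_integral_finite (chi_smooth k) (K_chart k).1 (K_chart k).2 (@chi_supp k).
have bt t : bounded_measurable (fun p : borel M => F (t, p)) by exact: bounded_section1.
have bF' : bounded_measurable (fun z : borel M * measurableTypeR R => F (z.2, z.1)).
  exact: (bounded_measurable_comp (measurable_fun_pair measurable_snd measurable_fst) bF).
have bp : bounded_measurable (fun p : borel M => (\int[tau]_t F (t, p))%R).
  exact: (bounded_fubini_bounded tau bF').
have bK k : bounded_measurable (fun z : measurableTypeR R * VT n.+1 => kap k z.2 * F (z.1, sig k z.2)).
  have [bk ms _] := mkP k; apply: bounded_measurableM.
    exact: (bounded_measurable_comp measurable_snd bk).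
  apply: (bounded_measurable_comp (h := fun z : measurableTypeR R * VT n.+1 => (z.1, sig k z.2)) _ bF).
  by apply: measurable_fun_pair => //; exact: measurableT_comp.
transitivity (\sum_k (\int[tau]_t (\int[m k]_x (kap k x * F (t, sig k x)))))%R.
  rewrite /Rintegral sum_fine; last first.
    move=> k _; apply: integrable_fin_num => //; apply: bounded_integrable.
    exact: (bounded_fubini_bounded (m k) (bK k)).
  congr fine; rewrite -integral_sum//; last first.
    by move=> k; apply: bounded_integrable; exact: (bounded_fubini_bounded (m k) (bK k)).
  apply: eq_integral => t _; rewrite sumEFin; congr EFin; apply: eq_bigr => k _.
  by have [_ _ ->] := mkP k.
apply: eq_bigr => k _; have [bk ms ->//] := mkP k.
rewrite (bounded_fubini tau (m k) (bK k)); apply: eq_Rintegral => x _ /=.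
rewrite RintegralZl//; apply: (@bounded_integrable _ _ _ tau (fun t => F (t, sig k x))).
exact: bounded_section2.
Qed.

Lemma manifold_integral_fubini_bounded (F : measurableTypeR R * borel M -> R) : bounded_measurable F ->
  bounded_measurable (fun t : measurableTypeR R => \sum_k CI (c k) (fun p => chi k p * F (t, p))).
Proof.
move=> bF.
have /choice[m /choice[kap /choice[sig mkP]]] k :=
  chart_integral_finite (chi_smooth k) (K_chart k).1 (K_chart k).2 (@chi_supp k).
have bK k : bounded_measurable (fun z : measurableTypeR R * VT n.+1 => kap k z.2 * F (z.1, sig k z.2)).
  have [bk ms _] := mkP k; apply: bounded_measurableM.
    exact: (bounded_measurable_comp measurable_snd bk).
  apply: (bounded_measurable_comp (h := fun z : measurableTypeR R * VT n.+1 => (z.1, sig k z.2)) _ bF).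
  by apply: measurable_fun_pair => //; exact: measurableT_comp.
rewrite (_ : (fun t => _) = fun t => \sum_k (\int[m k]_x (kap k x * F (t, sig k x)))%R); last first.
  apply/funext => t; apply: eq_bigr => k _; have [_ _ ->//] := mkP k.
  exact: bounded_section1.
suff H (r : seq 'I_N) : bounded_measurable (fun t : measurableTypeR R => \sum_(k <- r) (\int[m k]_x (kap k x * F (t, sig k x)))%R) by exact: H.
elim: r => [|k r IH].
  rewrite (_ : (fun t => _) = cst 0); first exact: bounded_measurable_cst.
  by apply/funext => t; rewrite big_nil.
rewrite (_ : (fun t => _) = (fun t => (\int[m k]_x (kap k x * F (t, sig k x)))%R + \sum_(k <- r) (\int[m k]_x (kap k x * F (t, sig k x)))%R)); last first.
  by apply/funext => t; rewrite big_cons.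
by apply: bounded_measurableD => //; exact: (bounded_fubini_bounded (m k) (bK k)).
Qed.

End manifold_fubini.

(** * Approximation by smooth sources *)

Section density.
Context {R : realType} {n : nat} {M : ptopologicalType} (I : Type).
Variable A : I -> chart R n M.
Hypothesis A_manifold : is_manifold A.
Hypothesis M_compact : compact [set: M].
Variable g : I -> 'rV[R]_n.+1 -> 'M[R]_n.+1.
Hypothesis g_metric : is_riemannian_metric A g.
Variable dS : {finite_measure set (borel M) -> \bar R}.
Hypothesis dS_volume : is_boundary_measure A g dS.
Variable T : R.
Hypothesis T_gt0 : 0 < T.
Implicit Types (i : I) (p q : M).
Local Notation im i := (chart_image (A i)).
Local Notation phi i := (chart_map (A i)).
Local Notation par i := (param (A i)).
Local Notation smoothM := (smooth_function A).
Local Notation X := (measurableTypeR R * borel M)%type.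
Local Notation mu := (lateral_measure T dS).
Local Notation dM := (boundary A).
Local Notation V := (R * 'rV[R]_n)%type.

Let mu_fin : (mu setT < +oo)%E := lateral_finite T_gt0 dS.

Definition sources : set (X -> R) := [set f : X -> R |
  [/\ smooth_source A f, bounded_measurable f &
    exists a b : R, [/\ 0 < a, b < 2 * T & forall z, f z != 0 -> a <= z.1 <= b]]].

Lemma sources_L2 : sources `<=` L2 mu.
Proof. by move=> f [_ [mf [B fB]] _]; exact: L2_bounded fB. Qed.

Lemma sources0 : sources (cst 0).
Proof.
split.
- split; first by exists 1, 1; split => // t p; rewrite eqxx.
  by move=> i; exact: smooth_on_cst.
- exact: bounded_measurable_cst.
- by exists T, T; split => //; [rewrite ltr_pMl// ltr1n|move=> z; rewrite eqxx].
Qed.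

Lemma sources_lin (c : R) f h : sources f -> sources h -> sources (c *: f + h).
Proof.
move=> [[[a1 [b1 [a10 f1]]] sf] bf [a [b [a0 bT fab]]]] [[[a2 [b2 [a20 h1]]] sh] bh [a' [b' [a'0 b'T hab]]]].
have E z : (c *: f + h) z = c * f z + h z by [].
have nz z : (c *: f + h) z != 0 -> f z != 0 \/ h z != 0.
  rewrite E; have [->|fz] := eqVneq (f z) 0; last by left.
  by rewrite mulr0 add0r; right.
split.
- split.
    exists (Num.min a1 a2), (Num.max b1 b2); split; first by rewrite lt_min a10.
    move=> t p /nz[/f1|/h1][/andP[h2 h3] bp]; split => //; rewrite ge_min le_max h2 h3 ?orbT//.
  move=> i; apply: (@smooth_on_eq _ _ _ (fun z => cst c z * f (z.1, par i (bd_point z.2)) + h (z.1, par i (bd_point z.2)))) => //.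
  by apply: smooth_onD => //; apply: smooth_onM => //; exact: smooth_on_cst.
- apply: (@bounded_measurableD _ _ _ (fun z => c * f z) h) => //.
  by apply: (@bounded_measurableM _ _ _ (cst c) f) => //; exact: bounded_measurable_cst.
- exists (Num.min a a'), (Num.max b b'); split; first by rewrite lt_min a0.
    by rewrite gt_max bT.
  by move=> z /nz[/fab|/hab]/andP[h2 h3]; rewrite ge_min le_max h2 h3 ?orbT.
Qed.

Local Notation C := (L2_closure mu sources).

(** A point belongs to the boundary as soon as one chart says so; [interior_transition] excludes
    that another chart sees it as interior. *)
Lemma open_interior_manifold : open (~` dM).
Proof.
rewrite openE => p nbp; have [i ip] := manifold_cover A_manifold p; rewrite /interior.
have x0 : 0 < phi i p ord0 ord0.
  have := im_half A_manifold (im_chart ip); rewrite /half_space/= le_eqVlt => /orP[/eqP E|//].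
  by exfalso; apply: nbp; exists i.
have h1 : \forall q \near p, dom (A i) q by apply: open_nbhs_nbhs; split => //; exact: (chart_open (chartP A_manifold i)).
have c : {for p, continuous (fun q => phi i q ord0 ord0)}.
  apply: (continuous_comp (f := phi i) (g := fun x : 'rV[R]_n.+1 => x ord0 ord0)).
    exact: (chart_coord_cont (chartP A_manifold i)).
  exact: coord_continuous.
have h2 : \forall q \near p, 0 < phi i q ord0 ord0 := c _ (lt_nbhsr x0).
move: h1 h2; apply: filterS2 => q iq q0 [j [jq j0]].
have ov : overlap A i j (phi i q) by exists q.
by have := interior_transition A_manifold g_metric ov q0; rewrite chart_mapK// j0 ltxx.
Qed.

Lemma measurable_boundary : measurable (dM : set (borel M)).
Proof. by rewrite -[dM]setCK; apply: measurableC; apply: borel_open; exact: open_interior_manifold. Qed.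

(** In a chart, the image of a set disjoint from the boundary misses the boundary hyperplane, so the
    integrand that defines its measure is 0; the finitely many charts of a partition of unity cover
    the manifold. *)
Lemma boundary_full : dS (~` dM) = 0%E.
Proof.
have [N [c [chi [K [_ _ chi1 KP chiK]]]]] := partition_of_unity A_manifold M_compact.
have mC : measurable (~` dM : set (borel M)) by apply: measurableC; exact: measurable_boundary.
pose E (k : 'I_N) : set (borel M) := ~` dM `&` dom (A (c k)).
have mE k : measurable (E k) by apply: measurableI => //; apply: borel_open; exact: (chart_open (chartP A_manifold (c k))).
have E0 k : dS (E k) = 0%E.
  rewrite (dS_volume (mE k) (@subIsetr _ _ _)).
  rewrite (_ : (fun y : 'rV[R]_n => _) = cst 0%E).
    by rewrite iintE; [exact: integral0|exact: measurable_cst|move=> y].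
  apply/funext => y; congr EFin; rewrite indicE memNset ?mul0r//.
  move=> [q [nq iq] qy]; apply: nq; exists (c k); split => //; rewrite qy.
  rewrite !mxE; case: (splitP (ord0 : 'I_(1 + n))) => j //= _.
  by rewrite (ord1 j) !mxE.
have sub : ~` dM `<=` \big[setU/set0]_(k < N) E k.
  move=> q nq; have [k kq] : exists k, chi k q != 0.
    apply: contrapT => /forallNP H; have := chi1 q; rewrite big1 ?(eq_sym 0)//.
      by move/eqP; rewrite eq_sym oner_eq0.
    by move=> k _; apply/eqP; rewrite -[_ == _]negbK; apply/negP; exact: H.
  by rewrite (bigD1 k)//=; left; split => //; apply: (KP k).2; exact: chiK.
apply/eqP; rewrite eq_le measure_ge0 andbT.
have mU : measurable (\big[setU/set0]_(k < N) E k : set (borel M)) by apply: bigsetU_measurable.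
apply: (@le_trans _ _ (dS (\big[setU/set0]_(k < N) E k))).
  by apply: le_measure => //; apply: mem_set.
suff [_ ->] : measurable (\big[setU/set0]_(k < N) E k : set (borel M)) /\ dS (\big[setU/set0]_(k < N) E k) = 0%E by [].
apply: (big_ind (fun V : set (borel M) => measurable V /\ dS V = 0%E)); first by split; [exact: measurable0|exact: measure0].
  by move=> V V' [mV V0] [mV' V0']; split; [exact: measurableU|rewrite measureU0].
by move=> k _; split; [exact: mE|exact: E0].
Qed.

(** Equal to 1 almost everywhere for the lateral measure. Sources vanish off the boundary and
    outside []0, 2 * T[], so only weighted indicators can be pointwise limits of sources. *)
Definition weight (z : X) : R := \1_(`]0, 2 * T[%classic : set R) z.1 * \1_dM z.2.

Lemma weight_measurable : measurable_fun setT weight.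
Proof.
apply: measurable_funM.
  have H : measurable_fun setT (\1_(`]0, 2 * T[%classic : set (measurableTypeR R)) : measurableTypeR R -> R).
    by apply: measurable_indic; exact: measurable_itv.
  exact: (measurableT_comp H measurable_fst).
have H : measurable_fun setT (\1_(dM : set (borel M)) : borel M -> R).
  by apply: measurable_indic; exact: measurable_boundary.
exact: (measurableT_comp H measurable_snd).
Qed.

Lemma weight_le1 z : 0 <= weight z <= 1.
Proof. by rewrite /weight !indicE; do 2 case: (_ \in _); rewrite ?mulr1 ?mulr0 ?mul1r ?mul0r ?lexx ?ler01. Qed.

Lemma weight_ae f : (fun z => f z * weight z) = f %[ae mu].
Proof.
pose Z : set X := [set z | weight z != 1].
have mZ : measurable Z.
  have := weight_measurable measurableT (measurable_set1 1) ; rewrite setTI => m1.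
  rewrite (_ : Z = ~` (weight @^-1` [set 1])); first exact: measurableC.
  by apply/seteqP; split=> z /=; [move=> /eqP|move=> H; apply/eqP].
exists Z; split => //; last first.
  move=> z /= nH; apply/eqP => W1; apply: nH => _; by rewrite W1 mulr1.
have mI : measurable_fun setT (fun z : X => (\1_Z z : R)%:E) by apply/measurable_EFinP; exact: measurable_indic.
have -> : mu Z = (\int[mu]_z (\1_Z z : R)%:E)%E by rewrite integral_indic// setIT.
rewrite (ge0_integral_lateral T_gt0 dS mI); last by move=> z; rewrite lee_fin.
transitivity (\int[dS]_p (cst 0 p : \bar R))%E; last exact: integral0.
apply: ae_eq_integral => //.
  apply: (eq_measurable_fun (fun p : borel M => (2 * T)%:E * (\1_(~` dM) p)%:E)%E).
    move=> p _; rewrite indicE; have [bp|nbp] := pselect (dM p).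
      rewrite memNset//= mule0; apply/esym/integral0_eq => t tD.
      rewrite indicE memNset// /Z/= /weight !indicE (mem_set bp) (mem_set tD) mulr1.
      by rewrite eqxx.
    rewrite mem_set// mule1; apply/esym.
    rewrite (eq_integral (cst 1%E)); last first.
      move=> t _; rewrite indicE mem_set// /Z/= /weight !indicE (memNset nbp) mulr0 eq_sym.
      exact: oner_neq0.
    have E1 : (\int[@lebesgue_measure R]_(t in (`]0%R, (2 * T)%R[%classic : set (measurableTypeR R))) 1 = (2 * T)%:E)%E.
      rewrite (integral_cst (@lebesgue_measure R) (measurable_itv `]0%R, (2 * T)%R[) 1%E) mul1e.
      have E2 : @lebesgue_measure R (`]0%R, (2 * T)%R[%classic : set R) = (2 * T)%:E.
        by rewrite lebesgue_measure_itv/= lte_fin mulr_gt0// sube0.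
      exact: E2.
    exact: E1.
  apply: emeasurable_funM; first exact: measurable_cst.
  apply/measurable_EFinP; apply: measurable_indic; apply: measurableC; exact: measurable_boundary.
exists (~` dM); split => //; [apply: measurableC; exact: measurable_boundary|exact: boundary_full|].
move=> p /= H bp; apply: H => _; apply: integral0_eq => t tD.
rewrite indicE memNset// /Z/= /weight !indicE (mem_set bp) (mem_set tD) mulr1.
by rewrite eqxx.
Qed.

(** Consequently, for a smooth [theta] with values in [[0, 1]], the functions [1 - (1 - theta) ^+ k]
    are smooth and tend to the indicator of the set where [theta] is positive. *)
Lemma cvg_expr_indic (t : R) : 0 <= t <= 1 -> (1 - t) ^+ k @[k --> \oo] --> ((t == 0)%:R : R).
Proof.
move=> /andP[t0 t1]; have [->|tn0] := eqVneq t 0.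
  by rewrite subr0 (_ : (fun k => _) = cst 1); [exact: cvg_cst|apply/funext => k; rewrite expr1n].
apply: cvg_expr; rewrite ger0_norm ?subr_ge0// ltrBlDr ltrDl lt_neqAle eq_sym tn0//.
Qed.

(** Second countability reduces the bumps around all the points of [U] to a sequence. *)
Lemma open_bumps (U : set M) : open U -> exists beta : nat -> M -> R,
  [/\ forall l, smoothM (beta l), forall l q, 0 <= beta l q <= 1,
      forall l q, beta l q != 0 -> U q & forall q, U q -> exists l, 0 < beta l q].
Proof.
move=> oU.
have /choice[b bP] : forall p, exists b : M -> R,
    [/\ smoothM b, forall q, 0 <= b q <= 1, forall q, b q != 0 -> U q & U p -> 0 < b p].
  move=> p; have [Up|nUp] := pselect (U p).
    have [i ip] := manifold_cover A_manifold p.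
    have [b [K [sb b01 bp cK [KU bK]]]] := smooth_bump A_manifold ip oU Up.
    by exists b; split => // q /bK/KU[].
  exists (cst 0); split => //; first by move=> i; exact: smooth_on_cst.
    by move=> q; rewrite lexx ler01.
  by move=> q; rewrite eqxx.
have [B cB [Bo Bb]] := manifold_countable A_manifold.
(* For each basic open set, one bump that is positive on the whole set is selected if there is any;
   basic sets without such a bump receive an arbitrary point. *)
have /choice[pt ptP] : forall O : set M, exists p : M, (exists p', O p' /\ O `<=` [set q | 0 < b p' q]) -> O `<=` [set q | 0 < b p q].
  move=> O; have [[p' [_ H]]|nH] := pselect (exists p', O p' /\ O `<=` [set q | 0 < b p' q]).
    by exists p'.
  by exists point.
have [f fB] : exists f : nat -> set M, forall O, B O -> exists l, f l = O.
  have /pfcard_geP[B0|[f]] := cB.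
    by exists (fun=> set0) => O; rewrite B0.
  exists f => O BO; have [l _ fl] := @surj _ _ setT B f _ BO.
  by exists l.
exists (fun l => b (pt (f l))); split.
- by move=> l; case: (bP (pt (f l))).
- by move=> l q; case: (bP (pt (f l))).
- by move=> l q; case: (bP (pt (f l))) => _ _ + _; exact.
- move=> q Uq; have [sb _ _ /(_ Uq) bq] := bP q.
  have cb := smooth_function_continuous A_manifold sb.
  have nb : nbhs q [set r | 0 < b q r] := cb q _ (lt_nbhsr bq).
  have [Q [BQ Qq] Qb] := Bb q _ nb.
  have [l fl] := fB Q BQ; exists l; rewrite fl; apply: (ptP Q) => //.
  by exists q.
Qed.

Let theta (a b t : R) := flat 0 (t - a) * flat 0 (b - t).

Let theta01 a b t : 0 <= theta a b t <= 1.
Proof.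
apply/andP; split; first by apply: mulr_ge0; exact: flat_ge0.
rewrite -[leRHS]mulr1; apply: ler_pM; [exact: flat_ge0|exact: flat_ge0|exact: flat_le1|exact: flat_le1].
Qed.

Let theta_pos a b t : (0 < theta a b t) = (a < t < b).
Proof.
rewrite -(subr_gt0 a) -(subr_gt0 t b) -(flat_gt0 (t - a)) -(flat_gt0 (b - t)) /theta.
have := flat_ge0 (t - a); have := flat_ge0 (b - t).
rewrite !le_eqVlt => /orP[/eqP <-|h1] /orP[/eqP <-|h2]; rewrite ?mulr0 ?mul0r ?ltxx ?andbF//.
by rewrite h1 h2 mulr_gt0.
Qed.

Lemma smooth_on_linear (V' : normedModType R) (l : V' -> R) : continuous l ->
  (forall x v (h : R), l (h *: v + x) = h * l v + l x) -> smooth_on setT l.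
Proof.
move=> cl lE.
have sid : smooth_on setT (fun t : R => t).
  have did (t v : R) : is_derive t v (fun t : R => t) v by exact: is_derive_id.
  apply: smooth_on_Ck; first exact: openT.
  case=> [|k] /=; first by move=> x _; exact: cvg_id.
  split => [x _|v]; first exact: cvg_id.
  split => [x _|]; first by case: (did x v).
  apply: (@Ck_eq _ _ _ _ (cst v)) => //; [exact: openT|by move=> x _; have [_ ->] := did x v|exact: Ck_cst].
have H := smooth_on_affine (L := l) cl lE sid.
by move: H; rewrite preimage_setT.
Qed.

Let smooth_theta a b : smooth_on setT (theta a b).
Proof.
have sid : smooth_on setT (fun t : R => t).
  by apply: smooth_on_linear => // t; exact: cvg_id.
apply: smooth_onM; apply: smooth_on_flat; apply: smooth_onB.
- exact: sid.
- exact: smooth_on_cst.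
- exact: smooth_on_cst.
- exact: sid.
Qed.

Let theta_measurable a b : measurable_fun setT (theta a b : measurableTypeR R -> R).
Proof.
apply: continuous_measurable_fun => t.
have [Ft [cFt FtE]] := smooth_on_continuous (@smooth_theta a b) (Logic.I : setT t).
have /near_eq_continuous : \forall s \near t, Ft s = theta a b s by apply: filterS FtE => s; exact.
exact.
Qed.

Let pow01 (t : R) k : 0 <= t <= 1 -> 0 <= (1 - t) ^+ k <= 1.
Proof.
move=> /andP[t0 t1]; apply/andP; split; first by apply: exprn_ge0; rewrite subr_ge0.
by apply: exprn_ile1; rewrite ?subr_ge0// lerBlDr lerDl.
Qed.

Let prod01 k (P : pred 'I_k) (F : 'I_k -> R) : (forall l, 0 <= F l <= 1) -> 0 <= \prod_(l < k | P l) F l <= 1.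
Proof.
move=> F01; apply: (big_ind (fun x => 0 <= x <= 1)) => [|x y /andP[x0 x1] /andP[y0 y1]|l _]; last exact: F01.
  by rewrite ler01 lexx.
by rewrite mulr_ge0//= -[leRHS]mulr1 ler_pM.
Qed.

(** * Products of an open time interval and an open set as limits of sources *)

Section base.
Variables (a b : R) (U : set M) (beta : nat -> M -> R).
Hypothesis a_gt0 : 0 < a.
Hypothesis b_lt : b < 2 * T.
Hypothesis sb : forall l, smoothM (beta l).
Hypothesis b01 : forall l q, 0 <= beta l q <= 1.
Hypothesis bU : forall l q, beta l q != 0 -> U q.
Hypothesis Ub : forall q, U q -> exists l, 0 < beta l q.

(** Both the number of bumps and the exponent grow with [k]: on [U] a single factor forces the
    product to 0, and off [U] all factors are 1. *)
Let gam k q := \prod_(l < k) (1 - beta l q) ^+ k.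

Let gam01 k q : 0 <= gam k q <= 1.
Proof.
by apply: prod01 => l; exact: pow01.
Qed.

Let smooth_gam k : smoothM (gam k).
Proof.
move=> i; apply: smooth_on_prod => l; apply: smooth_onX; apply: smooth_onB; first exact: smooth_on_cst.
exact: sb.
Qed.

(** The indicator of the boundary is not smooth on the manifold, but it is constant along the
    boundary, where the smoothness of a source is tested. *)
Let F k (z : X) : R := (1 - (1 - theta a b z.1) ^+ k) * (1 - gam k z.2) * \1_dM z.2.

Let F01 k z : 0 <= F k z <= 1.
Proof.
have /andP[h1 h2] := pow01 k (theta01 a b z.1); have /andP[h3 h4] := gam01 k z.2.
rewrite /F indicE; move: h1 h2 h3 h4; set x := (1 - theta _ _ _) ^+ _; set y := gam _ _ => h1 h2 h3 h4.
case: (_ \in _); rewrite ?mulr0 ?mulr1 ?lexx ?ler01//.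
apply/andP; split; first by apply: mulr_ge0; rewrite subr_ge0.
by rewrite -[leRHS]mulr1; apply: ler_pM; rewrite ?subr_ge0// lerBlDr lerDl.
Qed.

Let indic_snd (E : set (borel M)) : measurable E -> measurable_fun setT (fun z : X => \1_E z.2 : R).
Proof.
move=> mE; have H : measurable_fun setT (\1_E : borel M -> R) by apply: measurable_indic.
exact: (measurableT_comp H measurable_snd).
Qed.

Let mF k : measurable_fun setT (F k).
Proof.
apply: measurable_funM; last exact: (indic_snd measurable_boundary).
apply: measurable_funM; apply: measurable_funB; try exact: measurable_cst.
  apply: measurable_funX; apply: measurable_funB; first exact: measurable_cst.
  exact: (measurableT_comp (theta_measurable a b) measurable_fst).
have mg : measurable_fun setT (gam k : borel M -> measurableTypeR R).
  apply: measurable_fun_open_preimage => O oO; rewrite setTI; apply: borel_open.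
  exact: (proj1 (continuousP _) (smooth_function_continuous A_manifold (@smooth_gam k))).
exact: (measurableT_comp mg measurable_snd).
Qed.

Let Fz k z : F k z != 0 -> a <= z.1 <= b /\ dM z.2.
Proof.
rewrite /F !mulf_eq0 !negb_or => /andP[/andP[h1 _] h2]; split.
  have tn0 : theta a b z.1 != 0 by apply: contra h1 => /eqP ->; rewrite subr0 expr1n subrr.
  have : 0 < theta a b z.1 by rewrite lt_neqAle eq_sym tn0; case/andP: (theta01 a b z.1).
  by rewrite theta_pos => /andP[/ltW -> /ltW ->].
apply: contrapT => nb; move: h2; rewrite indicE memNset// eqxx//.
Qed.

Let F_smooth k i : smooth_on [set z : V | im i (bd_point z.2)] (fun z => F k (z.1, par i (bd_point z.2))).
Proof.
pose l1 (z : V) : R := z.1; pose l2 (z : V) : 'rV[R]_n.+1 := bd_point z.2.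
apply: (@smooth_on_eq _ _ _ (fun z : V => (1 - (1 - theta a b (l1 z)) ^+ k) * (1 - (gam k \o par i) (l2 z)))).
  move=> z iz; rewrite /F /= (_ : \1_dM _ = 1) ?mulr1//.
  rewrite indicE mem_set//; exists i; split; first exact: param_dom.
  by rewrite paramK// bd00.
have cl1 : continuous l1 by move=> z; exact: cvg_fst.
have sl : smooth_on [set z : V | im i (bd_point z.2)] l1.
  apply: (@smooth_onS _ _ _ setT) => //; apply: smooth_on_linear => // x v h.
have sth : smooth_on [set z : V | im i (bd_point z.2)] (fun z : V => theta a b (l1 z)).
  apply: smooth_onM; apply: smooth_on_flat; apply: smooth_onB.
  - exact: sl.
  - exact: smooth_on_cst.
  - exact: smooth_on_cst.
  - exact: sl.
have sg : smooth_on [set z : V | im i (bd_point z.2)] (fun z : V => (gam k \o par i) (l2 z)).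
  have cl2 : continuous l2.
    move=> z; apply: (continuous_comp (f := fun z : V => z.2) (g := @bd_point R n)); first exact: cvg_snd.
    exact: bd_continuous.
  have lE (x v : V) (h : R) : l2 (h *: v + x) = h *: l2 v + l2 x.
    apply/rowP => k'; rewrite /l2 /bd_point !mxE; case: splitP => j _.
      by rewrite !mxE mulr0 addr0.
    by rewrite /= !mxE.
  have H := smooth_on_affine cl2 lE (@smooth_gam k i).
  exact: H.
apply: smooth_onM; apply: smooth_onB; [exact: smooth_on_cst| |exact: smooth_on_cst|exact: sg].
by apply: smooth_onX; apply: smooth_onB; [exact: smooth_on_cst|exact: sth].
Qed.

Let F_source k : sources (F k).
Proof.
split.
- split; last by move=> i; exact: F_smooth.
  by exists a, b; split => // t p /Fz[].
- by split; [exact: mF|exists 1 => z; have /andP[h1 h2] := F01 k z; rewrite ger0_norm].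
- by exists a, b; split => // z /Fz[].
Qed.

Let indic_fst : measurable_fun setT (fun z : X => \1_(`]a, b[%classic : set R) z.1 : R).
Proof.
have H : measurable_fun setT (\1_(`]a, b[%classic : set (measurableTypeR R)) : measurableTypeR R -> R).
  by apply: measurable_indic; exact: measurable_itv.
exact: (measurableT_comp H measurable_fst).
Qed.

Let cvg1 (z : X) : (1 - (1 - theta a b z.1) ^+ k) @[k --> \oo] --> (\1_(`]a, b[%classic : set R) z.1 : R).
Proof.
have -> : (\1_(`]a, b[%classic : set R) z.1 : R) = 1 - (theta a b z.1 == 0)%:R.
  rewrite indicE; have [tz|tz] := eqVneq (theta a b z.1) 0.
    by rewrite subrr memNset//= in_itv/= -theta_pos tz ltxx.
  rewrite subr0 mem_set//= in_itv/= -theta_pos lt_neqAle eq_sym tz.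
  by case/andP: (theta01 a b z.1).
by apply: cvgB; [exact: cvg_cst|apply: cvg_expr_indic; exact: theta01].
Qed.

Let cvg2 (z : X) : (1 - gam k z.2) @[k --> \oo] --> (\1_U z.2 : R).
Proof.
have [Uz|nUz] := pselect (U z.2); last first.
  rewrite indicE memNset//= (_ : (fun k => _) = cst 0); first exact: cvg_cst.
  apply/funext => k; rewrite /gam big1 ?subrr// => l _.
  have -> : beta l z.2 = 0 by apply/eqP; rewrite -[_ == _]negbK; apply/negP => /bU.
  by rewrite subr0 expr1n.
rewrite indicE mem_set//= -[X in _ --> X]subr0; apply: cvgB; first exact: cvg_cst.
have [l bl] := Ub Uz.
apply: (@squeeze_cvgr _ _ _ _ (cst 0) (fun k => (1 - beta l z.2) ^+ k)).
- exists l.+1 => // k /= lk; have /andP[g0 _] := gam01 k z.2; rewrite g0/=.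
  rewrite /gam (bigD1 (Ordinal lk))//= -[leRHS]mulr1; apply: ler_wpM2l.
    by case/andP: (pow01 k (b01 l z.2)).
  by have /andP[] := prod01 (fun l' => l' != Ordinal lk) (fun l' : 'I_k => pow01 k (b01 l' z.2)).
- exact: cvg_cst.
- by have := cvg_expr_indic (b01 l z.2); rewrite gt_eqF.
Qed.

Lemma base_closure_bumps : open U ->
  C (fun z : X => \1_(`]a, b[%classic : set R) z.1 * \1_U z.2 * weight z).
Proof.
move=> oU; have sL2 := sources_L2; apply: (closure_dominated sL2 (F := F) (G := cst 1)).
- by move=> k; apply: closure_sub; [exact: sources_L2|exact: F_source].
- apply: measurable_funM; last exact: weight_measurable.
  by apply: measurable_funM; [exact: indic_fst|apply: indic_snd; exact: borel_open].
- exact: L2_cst.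
- by move=> k z; have /andP[h1 h2] := F01 k z; rewrite ger0_norm.
move=> z.
have -> : \1_(`]a, b[%classic : set R) z.1 * \1_U z.2 * weight z = \1_(`]a, b[%classic : set R) z.1 * \1_U z.2 * \1_dM z.2.
  rewrite /weight; have [tz|ntz] := pselect ((`]a, b[%classic : set R) z.1).
    rewrite [X in _ * (X * _)]indicE mem_set ?mul1r//.
    move: tz; rewrite /= !in_itv/= => /andP[h1 h2]; by rewrite (lt_trans a_gt0)//= (lt_trans h2).
  by rewrite indicE memNset// !mul0r.
by apply: cvgM; [apply: cvgM; [exact: cvg1|exact: cvg2]|exact: cvg_cst].
Qed.

End base.

Let mfst : measurable_fun setT (fst : X -> measurableTypeR R).
Proof. exact: measurable_fst. Qed.

Let msnd : measurable_fun setT (snd : X -> borel M).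
Proof. exact: measurable_snd. Qed.

Let Cdom (F : nat -> X -> R) (h : X -> R) : (forall k, C (F k)) -> measurable_fun setT h ->
  (forall k x, `|F k x| <= 1) -> (forall x, F k x @[k --> \oo] --> h x) -> C h.
Proof.
move=> CF mh F1 Fh; apply: (closure_dominated sources_L2 (F := F) (G := cst 1)) => //.
exact: L2_cst.
Qed.

Let le1 (E : set X) z : `|\1_E z * weight z| <= 1.
Proof.
have /andP[w0 w1] := weight_le1 z; rewrite indicE; case: (_ \in _); rewrite ?mul1r ?mul0r ?normr0//.
by rewrite ger0_norm.
Qed.

Let mind (E : set X) : measurable E -> measurable_fun setT (fun z => \1_E z * weight z).
Proof. by move=> mE; apply: measurable_funM; [exact: measurable_indic|exact: weight_measurable]. Qed.

Let mZ2 (U : set (borel M)) : measurable U -> measurable (setT `*` U : set X).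
Proof. by move=> mU; apply: measurableX. Qed.

Let small (e : R) : 0 < e -> \forall k \near \oo, (k.+1%:R^-1 : R) < e.
Proof. by move=> e0; exact: near_infty_natSinv_lt (PosNum e0). Qed.

(** Half-open intervals generate the Borel sets and are stable under intersection. On []0, 2 * T[]
    they are limits of open intervals that keep a positive distance from 0 and from [2 * T], as
    sources require. *)
Let cylinder_lim (a b t : R) : 0 < t < 2 * T ->
  (\1_(`](Num.max a 0 + k.+1%:R^-1), (Num.min (b + k.+1%:R^-1) (2 * T - k.+1%:R^-1))[%classic : set R) t : R)
    @[k --> \oo] --> (\1_(`]a, b]%classic : set R) t : R).
Proof.
move=> /andP[t0 tT]; apply: cvg_near_cst.
have k0 (k : nat) : (0 : R) < k.+1%:R^-1 by rewrite invr_gt0.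
have [/andP[ta tb]|ntab] := boolP (a < t <= b).
  have h1 : 0 < t - Num.max a 0 by rewrite subr_gt0 gt_max ta t0.
  have h2 : 0 < 2 * T - t by rewrite subr_gt0.
  have := small h1; have := small h2; apply: filterS2 => k k1 k2.
  rewrite !indicE !mem_set//=; first by rewrite in_itv/= ta tb.
  rewrite in_itv/=; apply/andP; split; first by rewrite -ltrBrDl.
  by rewrite lt_min (le_lt_trans tb) ?ltrDl//= ltrBrDl -ltrBrDr.
have [ta|ta] := leP t a.
  apply: nearW => k; rewrite !indicE !memNset//=; first by rewrite in_itv/= ltNge ta.
  rewrite in_itv/= => /andP[+ _]; apply/negP; rewrite -leNgt (le_trans ta)//.
  by rewrite (le_trans (_ : a <= Num.max a 0)) ?le_max ?lexx// lerDl ltW.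
have tb : 0 < t - b by rewrite subr_gt0 ltNge; move: ntab; rewrite ta.
have := small tb; apply: filterS => k k1.
rewrite !indicE !memNset//=; first by rewrite in_itv/= (negbTE ntab).
rewrite in_itv/= => /andP[_]; rewrite lt_min => /andP[h _].
by move: k1; rewrite ltrBrDl => /(lt_trans h); rewrite ltxx.
Qed.

(** From here to [S4] the class of sets grows: interval times open set, Borel set times open set,
    rectangle of Borel sets, arbitrary measurable set. Each of the last three stages is one
    application of [closure_dynkin]. *)
Let S1 a b (U : set M) : open U -> C (fun z => \1_(fst @^-1` (`]a, b]%classic : set R) `&` (setT `*` U)) z * weight z).
Proof.
move=> oU; have [beta [sb b01 bU Ub]] := open_bumps oU.
pose al (k : nat) : R := Num.max a 0 + k.+1%:R^-1.
pose bl (k : nat) : R := Num.min (b + k.+1%:R^-1) (2 * T - k.+1%:R^-1).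
have k0 (k : nat) : (0 : R) < k.+1%:R^-1 by rewrite invr_gt0.
apply: (Cdom (F := fun k z => \1_(`]al k, bl k[%classic : set R) z.1 * \1_U z.2 * weight z)).
- move=> k; apply: (base_closure_bumps _ _ sb b01 bU Ub oU).
    by rewrite ltr_wpDl// le_max lexx orbT.
  by rewrite gt_min ltrBlDr ltrDl k0 orbT.
- apply: mind; apply: measurableI; last by apply: mZ2; exact: borel_open.
  by rewrite -[X in measurable X]setTI; apply: mfst => //; exact: measurable_itv.
- move=> k z; have /andP[w0 w1] := weight_le1 z; rewrite !indicE.
  by do 2 case: (_ \in _); rewrite ?mul1r ?mul0r ?mulr0 ?mul0r ?normr0// ger0_norm.
move=> z; have [W0|Wn0] := eqVneq (weight z) 0.
  by rewrite W0 mulr0 (_ : (fun k => _) = cst 0); [exact: cvg_cst|apply/funext => k; rewrite mulr0].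
have tz : 0 < z.1 < 2 * T.
  apply: contraNT Wn0 => nt; rewrite /weight indicE memNset ?mul0r//= in_itv/=; exact/negP.
apply: cvgM; last exact: cvg_cst.
rewrite (_ : \1_(_ `&` _) z = \1_(`]a, b]%classic : set R) z.1 * \1_U z.2).
  by apply: cvgM; [exact: cylinder_lim|exact: cvg_cst].
rewrite !indicE; have [Uz|nUz] := pselect (U z.2); last first.
  by rewrite memNset ?(memNset nUz) ?mulr0// => -[_ []].
rewrite (mem_set Uz) mulr1; congr (nat_of_bool _)%:R.
by apply/idP/idP => /set_mem H; apply: mem_set; [case: H|split].
Qed.

Let S1T (U : set M) : open U -> C (fun z => \1_(setT `*` U) z * weight z).
Proof.
move=> oU; apply: (Cdom (F := fun k z => \1_(fst @^-1` (`](- 1), (2 * T)]%classic : set R) `&` (setT `*` U)) z * weight z)).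
- by move=> k; exact: S1.
- by apply: mind; apply: mZ2; exact: borel_open.
- by move=> k z; exact: le1.
move=> z; apply: cvg_near_cst; apply: nearW => k.
have [tz|ntz] := pselect ((`]0, 2 * T[%classic : set R) z.1); last first.
  by rewrite /weight [X in _ * (X * _) = _]indicE [X in _ = _ * (X * _)]indicE memNset// !mul0r !mulr0.
congr (_ * _); rewrite !indicE; congr (nat_of_bool _)%:R.
apply/idP/idP => /set_mem H; apply: mem_set; first by case: H.
split => //; move: tz; rewrite /= !in_itv/= => /andP[h1 h2]; apply/andP; split; [lra|exact: ltW].
Qed.

Let S2 (B : set (measurableTypeR R)) (U : set M) : measurable B -> open U ->
  C (fun z => \1_(fst @^-1` B `&` (setT `*` U)) z * weight z).
Proof.
move=> mB oU; have sL2 := sources_L2; have s0 := sources0; have sl := sources_lin.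
have Wm := weight_measurable; have Wle := weight_le1; have muf := mu_fin.
apply: (closure_dynkin muf sL2 s0 sl Wm Wle mfst _ (G := @ocitv R)) => //.
- by apply: mZ2; exact: borel_open.
- exact: ocitvI.
- exact: S1T.
- by move=> _ [[a b] _ <-]; exact: S1.
Qed.

Let CT : C (fun z => \1_setT z * weight z).
Proof. by have := S1T openT; rewrite setXTT. Qed.

Let S3 (B : set (measurableTypeR R)) (E : set (borel M)) : measurable B -> measurable E ->
  C (fun z => \1_(snd @^-1` E `&` (B `*` setT)) z * weight z).
Proof.
move=> mB mE; have sL2 := sources_L2; have s0 := sources0; have sl := sources_lin.
have Wm := weight_measurable; have Wle := weight_le1; have muf := mu_fin.
refine (@closure_dynkin _ X R mu muf _ sL2 s0 sl _ Wm Wle _ (borel M) (@open M) snd (B `*` setT) _ _ _ _ _ _ _ _) => //.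
- exact: measurableX.
- by move=> U V oU oV; exact: openI.
- have := S2 mB openT; congr (C _); apply/funext => z; congr (\1_ _ _ * _).
  by apply/seteqP; split=> -[t p] /= [].
- move=> U oU; have := S2 mB oU; congr (C _); apply/funext => z; congr (\1_ _ _ * _).
  by apply/seteqP; split=> -[t p] /= [h1 h2]; split => //; [case: h2|case: h2].
Qed.

Let S4 (E : set X) : measurable E -> C (fun z => \1_E z * weight z).
Proof.
move=> mE; have sL2 := sources_L2; have s0 := sources0; have sl := sources_lin.
have Wm := weight_measurable; have Wle := weight_le1; have muf := mu_fin.
have H : C (fun z => \1_(id @^-1` E `&` setT) z * weight z); last by move: H; rewrite setIT.
apply: (closure_dynkin muf sL2 s0 sl Wm Wle (@measurable_id _ X setT) measurableT (G := [set B `*` E | B in measurable & E in measurable])) => //.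
- exact: measurable_prod_measurableType.
- move=> _ _ [B mB [E' mE' <-]] [B' mB' [E'' mE'' <-]]; exists (B `&` B'); first exact: measurableI.
  by exists (E' `&` E''); [exact: measurableI|rewrite setXI].
- move=> _ [B mB [E' mE' <-]]; rewrite setIT; have := S3 mB mE'; congr (C _); apply/funext => z; congr (\1_ _ _ * _).
  by apply/seteqP; split=> -[t p] /= [h1 h2]; split => //; case: h2.
Qed.

Lemma sources_dense f : L2 mu f -> C f.
Proof.
have sL2 := sources_L2; have s0 := sources0; have sl := sources_lin.
have Wm := weight_measurable; have Wle := weight_le1.
have Wae h : L2 mu h -> (fun z => h z * weight z) = h %[ae mu] by move=> _; exact: weight_ae.
move=> f2; exact: (closure_full sL2 s0 sl Wm Wle S4 Wae f2).
Qed.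

End density.

(** * One-variable calculus *)

Section calculus.
Context {R : realType}.
Local Notation leb := (@lebesgue_measure R).

(** Both forms are used: the inner integral over the triangle runs over []t, 2T - t]], the outer
    time integrals over open intervals. *)
Lemma continuous_FTC (F f : R -> R) (a b : R) : a < b ->
  (forall x, a <= x <= b -> {for x, continuous F}) ->
  (forall x, a <= x <= b -> {for x, continuous f}) ->
  (forall x, a < x < b -> is_derive x (1 : R) F (f x)) ->
  [/\ (\int[leb]_(x in `]a, b]) (f x)%:E = (F b - F a)%:E)%E &
      (\int[leb]_(x in `]a, b[) (f x)%:E = (F b - F a)%:E)%E].
Proof.
move=> ab cF cf dF.
have cfw : {within `[a, b], continuous f}.
  apply: continuous_in_subspaceT => x; rewrite inE/= in_itv/= => xab; exact: cf.
have E : (\int[leb]_(x in `[a, b]) (f x)%:E = (F b - F a)%:E)%E.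
  rewrite (@continuous_FTC2 R f F a b ab cfw)//.
    split; first by move=> x; rewrite in_itv/= => xab; case: (dF x xab).
      by apply: cvg_at_right_filter; apply: cF; rewrite lexx ltW.
    by apply: cvg_at_left_filter; apply: cF; rewrite lexx ltW.
  by move=> x; rewrite in_itv/= => xab; rewrite derive1E; have [_ ->] := dF x xab.
have mf (i : interval R) : [set` i] `<=` `[a, b]%classic -> measurable_fun ([set` i] : set (measurableTypeR R)) f.
  move=> iab; have mab : measurable_fun (`[a, b]%classic : set (measurableTypeR R)) f.
    by apply: subspace_continuous_measurable_fun => //; exact: measurable_itv.
  by apply: (measurable_funS _ iab mab); exact: measurable_itv.
have s1 : `]a, b]%classic `<=` (`[a, b]%classic : set R).
  by move=> x /=; rewrite !in_itv/= => /andP[/ltW -> ->].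
have s2 : `]a, b[%classic `<=` (`[a, b]%classic : set R).
  by move=> x /=; rewrite !in_itv/= => /andP[/ltW -> /ltW ->].
have E1 : (\int[leb]_(x in `]a, b]) (f x)%:E = (F b - F a)%:E)%E.
  rewrite -E; apply: integral_itv_obnd_cbnd; try apply/measurable_EFinP; exact: (mf _ s1).
split => //; rewrite -E1.
apply: integral_itv_bndo_bndc; try apply/measurable_EFinP; exact: (mf _ s2).
Qed.

Lemma antiderivative (f : R -> R) (a b : R) : a < b -> continuous f ->
  exists U : R -> R, forall x, a < x < b -> is_derive x (1 : R) U (f x).
Proof.
move=> ab cf; pose U x := (\int[leb]_(t in [set` `[a, x]]) f t)%R.
exists U => x /andP[ax xb].
have iab : leb.-integrable `[a, b] (EFin \o f).
  apply: continuous_compact_integrable; first exact: segment_compact.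
  exact: continuous_subspaceT.
have [d e] := continuous_FTC1_closed xb iab ax (cf x).
by apply: DeriveDef; [exact: d|rewrite -derive1E e].
Qed.

End calculus.

(** * Exact time derivatives at a fixed point of the manifold *)

Section time_lines.
Context {R : realType} {n : nat} {M : ptopologicalType} (I : Type).
Variable A : I -> chart R n M.
Hypothesis A_manifold : is_manifold A.
Implicit Types (u v : R * M -> R) (p : M) (s t : R).

(* Continuous extension to negative times of a function of [t >= 0]. *)
Definition extend_time u p : R -> R := fun s => u (Num.max s 0, p).

Lemma extend_timeE u p s : 0 <= s -> extend_time u p s = u (s, p).
Proof. by move=> s0; rewrite /extend_time (max_idPl _). Qed.

Lemma extend_time_continuous u p : smooth_time A u -> continuous (extend_time u p).
Proof.
move=> su t.
have c1 : (fun s : R => Num.max s 0) @ t --> within [set s | 0 <= s] (nbhs (Num.max t 0)).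
  have c : (fun s : R => Num.max s 0) @ t --> Num.max t 0.
    have -> : (fun s : R => Num.max s 0) = (fun s => (`|s| + s) / 2).
      by apply/funext => s; case: (leP s 0) => h; [rewrite ler0_norm//|rewrite gtr0_norm//]; field.
    have -> : Num.max t 0 = (`|t| + t) / 2.
      by case: (leP t 0) => h; [rewrite ler0_norm//|rewrite gtr0_norm//]; field.
    apply: cvgM; last exact: cvg_cst.
    by apply: cvgD; [exact: norm_continuous|exact: cvg_id].
  move=> Q HQ; have HQ' : \forall s \near Num.max t 0, 0 <= s -> Q s := HQ.
  have H : \forall s \near t, 0 <= Num.max s 0 -> Q (Num.max s 0) := c _ HQ'.
  suff : \forall s \near t, Q (Num.max s 0) by [].
  by move: H; apply: filterS => s; apply; rewrite le_max lexx orbT.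
have t0 : 0 <= Num.max t 0 by rewrite le_max lexx orbT.
have c2 := @smooth_time_within _ _ _ _ _ A_manifold u _ p su t0.
exact: (cvg_comp _ _ c1 c2).
Qed.

Lemma extend_time_derive u p t : smooth_time A u -> 0 < t ->
  is_derive t (1 : R) (extend_time u p) (extend_time (dt u) p t).
Proof.
move=> su t0; have -> : extend_time (dt u) p t = dt u (t, p) by rewrite extend_timeE// ltW.
have d := @dt_derive _ _ _ _ _ A_manifold _ t p su t0.
apply: (near_eq_is_derive _ d).
have := lt_nbhsr t0; apply: filterS => s s0.
by rewrite extend_timeE// ltW.
Qed.

Let reflect_continuous (f : R -> R) (b t : R) : continuous f -> {for t, continuous (fun s => f (b - s))}.
Proof.
move=> cf; apply: (continuous_comp (f := fun s : R => b - s) (g := f)); last exact: cf.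
by apply: cvgB; [exact: cvg_cst|exact: cvg_id].
Qed.

Let reflect_derive (f : R -> R) (b t d : R) : is_derive (b - t) (1 : R) f d ->
  is_derive t (1 : R) (fun s => f (b - s)) (- d).
Proof.
move=> df; have dg : is_derive t (1 : R) (fun s : R => b - s) (0 - 1).
  by apply: is_deriveB.
have := @is_derive1_comp R f (fun s => b - s) t _ _ df dg.
by rewrite sub0r mulrN1.
Qed.

Variable T : R.
Hypothesis T_gt0 : 0 < T.
Variables (u v : R * M -> R) (p : M).
Hypothesis su : smooth_time A u.
Hypothesis sv : smooth_time A v.
Hypothesis u0 : u (0, p) = 0.
Hypothesis v0 : v (0, p) = 0.
Hypothesis u1 : dt u (0, p) = 0.
Hypothesis v1 : dt v (0, p) = 0.

Let cu := @extend_time_continuous _ p su.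
Let cv := @extend_time_continuous _ p sv.
Let cu' := @extend_time_continuous _ p (smooth_dt su).
Let cv' := @extend_time_continuous _ p (smooth_dt sv).
Let cu'' := @extend_time_continuous _ p (smooth_dt (smooth_dt su)).
Let cv'' := @extend_time_continuous _ p (smooth_dt (smooth_dt sv)).

Lemma reflected_wronskian :
  (\int[lebesgue_measure]_(t in `]0%R, (2 * T)%R[)
    (v (2 * T - t, p) * dt (dt u) (t, p) - u (t, p) * dt (dt v) (2 * T - t, p))%:E = 0)%E.
Proof.
pose U := extend_time u p; pose V := extend_time v p.
pose U' := extend_time (dt u) p; pose V' := extend_time (dt v) p.
pose U'' := extend_time (dt (dt u)) p; pose V'' := extend_time (dt (dt v)) p.
(* A primitive of [f]: since time reversal changes the sign of the derivative of [V], the products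
   of first derivatives cancel. Each summand has a factor at time 0 at either end point. *)
pose F t := V (2 * T - t) * U' t + U t * V' (2 * T - t).
pose f t := V (2 * T - t) * U'' t - U t * V'' (2 * T - t).
have b0 : 0 < 2 * T by rewrite mulr_gt0.
have [||| _ E] := @continuous_FTC R F f 0 (2 * T) b0.
- move=> x _; apply: cvgD; apply: cvgM.
  + exact: (@reflect_continuous V (2 * T) x cv).
  + exact: cu'.
  + exact: cu.
  + exact: (@reflect_continuous V' (2 * T) x cv').
- move=> x _; apply: cvgB; apply: cvgM.
  + exact: (@reflect_continuous V (2 * T) x cv).
  + exact: cu''.
  + exact: cu.
  + exact: (@reflect_continuous V'' (2 * T) x cv'').
- move=> x /andP[x0 xT]; have x0' : 0 < 2 * T - x by rewrite subr_gt0.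
  have d1 := reflect_derive (@extend_time_derive _ p _ sv x0').
  have d2 := @extend_time_derive _ p _ (smooth_dt su) x0.
  have d3 := @extend_time_derive _ p _ su x0.
  have d4 := reflect_derive (@extend_time_derive _ p _ (smooth_dt sv) x0').
  have D := is_deriveD (is_deriveM d1 d2) (is_deriveM d3 d4).
  apply: is_derive_eq D _; rewrite /f /GRing.scale/= -/U -/V -/U' -/V' -/U'' -/V''; ring.
transitivity (\int[lebesgue_measure]_(t in `]0%R, (2 * T)%R[) (f t)%:E)%E.
  apply: eq_integral => t; rewrite inE/= in_itv/= => /andP[t0 tT].
  by rewrite /f /V /U /U'' /V'' !extend_timeE// ?subr_ge0 ltW.
rewrite E /F subrr subr0 /U /V /U' /V' !extend_timeE ?lexx ?ltW//.
by rewrite u0 v0 u1 v1 !mul0r !mulr0 !addr0 subrr.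
Qed.

Lemma triangle_wronskian (H : R -> R) :
  (forall t, 0 < t < T -> (\int[lebesgue_measure]_(s in `]t, (2 * T - t)%R])
    (u (s, p) * dt (dt v) (t, p) - v (t, p) * dt (dt u) (s, p))%:E = (H t)%:E)%E) ->
  (\int[lebesgue_measure]_(t in `]0%R, T[) (H t)%:E = (2 * (u (T, p) * v (T, p)))%:E)%E.
Proof.
move=> HE.
pose U := extend_time u p; pose V := extend_time v p.
pose U' := extend_time (dt u) p; pose V' := extend_time (dt v) p.
pose U'' := extend_time (dt (dt u)) p; pose V'' := extend_time (dt (dt v)) p.
have b0 : 0 < 2 * T by rewrite mulr_gt0.
(* The primitive [Q] of [U] will carry the integral of [u] in [s]; the margin around [[0, 2 * T]]
   makes it differentiable at the end points. *)
have ab : (-1 : R) < 2 * T + 1 by lra.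
have [Q dQ] := antiderivative ab cu; rewrite -/U in dQ.
have cQ x : -1 < x < 2 * T + 1 -> {for x, continuous Q}.
  by move=> /dQ[+ _] => /derivable1_diffP/differentiable_continuous.
(* Its derivative is [f], the value of the inner integral in [s], because the two terms in
   [V' t * (U t + U (2 * T - t))] cancel. At [T] the first summand vanishes and the second is
   [2 u(T) v(T)]; at 0 both vanish by the initial conditions on [v]. *)
pose F t := V' t * (Q (2 * T - t) - Q t) + V t * (U t + U (2 * T - t)).
pose f t := V'' t * (Q (2 * T - t) - Q t) - V t * (U' (2 * T - t) - U' t).
have cQr x : 0 <= x <= T -> {for x, continuous (fun t => Q (2 * T - t) - Q t)}.
  move=> /andP[x0 xT]; apply: cvgB; last by apply: cQ; apply/andP; split; lra.
  apply: (continuous_comp (f := fun s : R => 2 * T - s) (g := Q)).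
    by apply: cvgB; [exact: cvg_cst|exact: cvg_id].
  by apply: cQ; apply/andP; split; lra.
have [||| _ E] := @continuous_FTC R F f 0 T T_gt0.
- move=> x xT; apply: cvgD; apply: cvgM.
  + exact: cv'.
  + exact: cQr.
  + exact: cv.
  + by apply: cvgD; [exact: cu|exact: (@reflect_continuous U (2 * T) x cu)].
- move=> x xT; apply: cvgB; apply: cvgM.
  + exact: cv''.
  + exact: cQr.
  + exact: cv.
  + by apply: cvgB; [exact: (@reflect_continuous U' (2 * T) x cu')|exact: cu'].
- move=> x /andP[x0 xT]; have x0' : 0 < 2 * T - x by lra.
  have dq1 : is_derive (2 * T - x) (1 : R) Q (U (2 * T - x)) by apply: dQ; apply/andP; split; lra.
  have dq2 : is_derive x (1 : R) Q (U x) by apply: dQ; apply/andP; split; lra.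
  have d1 := is_deriveB (reflect_derive dq1) dq2.
  have d2 := @extend_time_derive _ p _ (smooth_dt sv) x0.
  have d3 := @extend_time_derive _ p _ sv x0.
  have d4 := is_deriveD (@extend_time_derive _ p _ su x0) (reflect_derive (@extend_time_derive _ p _ su x0')).
  have D := is_deriveD (is_deriveM d2 d1) (is_deriveM d3 d4).
  apply: is_derive_eq D _; rewrite /f ?fctE /GRing.scale/= -/U -/V -/U' -/V' -/U'' -/V''; ring.
transitivity (\int[lebesgue_measure]_(t in `]0%R, T[) (f t)%:E)%E; last first.
  rewrite E /F (_ : 2 * T - T = T); last by ring.
  rewrite subrr mulr0 add0r /U /V /V' !extend_timeE ?lexx ?ltW//.
  - by rewrite v0 v1 !mul0r addr0 subr0; congr EFin; ring.
  - by rewrite subr0.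
apply: eq_integral => t; rewrite inE/= in_itv/= => /andP[t0 tT].
rewrite -HE ?t0//.
have tt : t < 2 * T - t by lra.
have [||| E2 _] := @continuous_FTC R (fun s => V'' t * Q s - V t * U' s) (fun s => V'' t * U s - V t * U'' s) t (2 * T - t) tt.
- move=> x /andP[x0 xT]; apply: cvgB; apply: cvgM; try exact: cvg_cst.
    by apply: cQ; apply/andP; split; lra.
  exact: cu'.
- move=> x _; apply: cvgB; apply: cvgM; try exact: cvg_cst.
    exact: cu.
  exact: cu''.
- move=> x /andP[tx xT]; have x0 : 0 < x by lra.
  have dq : is_derive x (1 : R) Q (U x) by apply: dQ; apply/andP; split; lra.
  have d2 := @extend_time_derive _ p _ (smooth_dt su) x0.
  have D := is_deriveB (is_deriveZ (V'' t) dq) (is_deriveZ (V t) d2).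
  exact: D.
transitivity (\int[lebesgue_measure]_(s in `]t, (2 * T - t)%R]) (V'' t * U s - V t * U'' s)%:E)%E.
  apply: eq_integral => s; rewrite inE/= in_itv/= => /andP[ts sT].
  have s0 : 0 <= s by rewrite ltW// (lt_trans t0).
  by rewrite /V'' /V /U /U'' !extend_timeE ?(ltW t0) ?s0// mulrC.
by etransitivity; [exact: E2|rewrite /f; congr EFin; ring].
Qed.

End time_lines.

(** * Extension by density *)

Section extension.
Context d (X : measurableType d) (R : realType).
Variable mu : {measure set X -> \bar R}.
Implicit Types f g h k : X -> R.
Local Notation L2 := (L2 mu).
Local Notation ip := (ip mu).
Local Notation nrm := (L2norm mu).

Lemma ip_operatorB B f g h : bounded_operator mu B -> L2 f -> L2 g -> L2 h ->
  ip (B (f - g)) h = ip (B f) h - ip (B g) h.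
Proof.
move=> bB f2 g2 h2.
have E : B (f - g) = B f - B g %[ae mu].
  by have := op_lin bB (-1) g2 f2; rewrite !scaleN1r addrC [X in _ = X %[ae _]]addrC.
have Bf2 := op_L2 bB f2; have Bg2 := op_L2 bB g2.
by rewrite (eq_ip2 (op_L2 bB (L2B f2 g2)) (L2B Bf2 Bg2) h2 h2 E (aeq_refl _ _)) ipBl.
Qed.

Variable D : set (X -> R).
Hypothesis D_L2 : D `<=` L2.
Hypothesis D_dense : forall f, L2 f -> L2_closure mu D f.

(** The limit passage shared by all the extensions. Restricting to [g] at distance at most 1 keeps
    the norm of [g] bounded, which the quadratic case [dense_ge0] needs. *)
Lemma dense_le0 f (C x : R) : L2 f ->
  (forall g, D g -> nrm (f - g) <= 1 -> x <= C * nrm (f - g)) -> x <= 0.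
Proof.
move=> f2 H; rewrite leNgt; apply/negP => x0.
have C1 : 0 < `|C| + 1 by rewrite ltr_wpDl.
have e0 : 0 < Num.min 1 (x / (`|C| + 1)) by rewrite lt_min ltr01 divr_gt0.
have [g Dg] := (D_dense f2).2 _ e0; rewrite lt_min => /andP[g1].
rewrite ltr_pdivlMr// => gx; have := H g Dg (ltW g1); apply/negP; rewrite -ltNge.
apply: le_lt_trans gx; rewrite mulrC ler_wpM2l ?L2norm_ge0//.
by rewrite (le_trans (ler_norm _))// lerDl.
Qed.

Lemma dense_functional B f h k : bounded_operator mu B -> L2 f -> L2 h -> L2 k ->
  (forall g, D g -> ip (B g) h = ip g k) -> ip (B f) h = ip f k.
Proof.
move=> bB f2 h2 k2 H; have [C C0 BC] := bounded_operator_bound bB.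
apply/eqP; rewrite -subr_eq0 -normr_le0.
apply: (@dense_le0 f (C * nrm h + nrm k)) => // g Dg _; have g2 := D_L2 Dg.
have -> : ip (B f) h - ip f k = ip (B (f - g)) h - ip (f - g) k.
  by rewrite ip_operatorB// ipBl// (H g Dg); ring.
apply: (le_trans (ler_normB _ _)); rewrite mulrDl.
have e2 := L2B f2 g2; apply: lerD.
  apply: (le_trans (cauchy_schwarz (op_L2 bB e2) h2)).
  by rewrite mulrAC ler_wpM2r ?L2norm_ge0// BC.
by apply: (le_trans (cauchy_schwarz e2 k2)); rewrite mulrC.
Qed.

(** Density is used in one argument at a time, the other one being a fixed function. *)
Lemma dense_adjoint B B' f h : bounded_operator mu B -> bounded_operator mu B' ->
  (forall g k, D g -> D k -> ip (B g) k = ip g (B' k)) ->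
  L2 f -> L2 h -> ip (B f) h = ip f (B' h).
Proof.
move=> bB bB' H f2 h2; rewrite ipC [RHS]ipC; symmetry.
apply: dense_functional => //; first exact: op_L2.
move=> g Dg; have g2 := D_L2 Dg; rewrite ipC [RHS]ipC; symmetry.
apply: dense_functional => //; first exact: op_L2.
by move=> k Dk; exact: H.
Qed.

Lemma dense_ge0 B f : bounded_operator mu B -> (forall g, D g -> 0 <= ip g (B g)) ->
  L2 f -> 0 <= ip f (B f).
Proof.
move=> bB H f2; have [C C0 BC] := bounded_operator_bound bB; rewrite -oppr_le0.
apply: (@dense_le0 f (nrm (B f) + (nrm f + 1) * C)) => // g Dg g1; have g2 := D_L2 Dg.
have e2 := L2B f2 g2; have Bf2 := op_L2 bB f2; have Be2 := op_L2 bB e2.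
have E : ip f (B f) - ip g (B g) = ip (f - g) (B f) + ip g (B (f - g)).
  by rewrite (ipC mu g (B (f - g))) ip_operatorB// ipBl// (ipC mu g (B g)) (ipC mu (B f) g); ring.
have n1 := cauchy_schwarz e2 Bf2; have n2 := cauchy_schwarz g2 Be2.
have n3 : nrm g <= nrm f + 1.
  have {1}-> : g = f - (f - g) by apply/funext => x; rewrite !fctE; ring.
  by apply: (le_trans (L2normB f2 e2)); rewrite lerD2l.
have n4 : nrm g * nrm (B (f - g)) <= (nrm f + 1) * (C * nrm (f - g)).
  by apply: ler_pM; rewrite ?L2norm_ge0// BC.
have n5 := ler_norm (- ip (f - g) (B f)); have n6 := ler_norm (- ip g (B (f - g))).
rewrite !normrN in n5 n6; have Hg := H g Dg; rewrite mulrDl -mulrA [nrm (B f) * _]mulrC.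
move: E n1 n2 n4 n5 n6 Hg; lra.
Qed.

End extension.

(** * Identities for smooth sources *)

Section identities.
Context {R : realType} {n : nat} {M : ptopologicalType} (I : Type).
Variable A : I -> chart R n M.
Hypothesis A_manifold : is_manifold A.
Hypothesis M_compact : compact [set: M].
Variable g : I -> 'rV[R]_n.+1 -> 'M[R]_n.+1.
Hypothesis g_metric : is_riemannian_metric A g.
Variable w : M -> R.
Hypothesis w_smooth : smooth_function A w.
Hypothesis w_pos : forall p, 0 < w p.
Variable dS : {finite_measure set (borel M) -> \bar R}.
Hypothesis dS_volume : is_boundary_measure A g dS.
Variable T : R.
Hypothesis T_gt0 : 0 < T.
Variables (N : nat) (c : 'I_N -> I) (chi : 'I_N -> M -> R) (K : 'I_N -> set M).
Hypothesis chi_smooth : forall k, smooth_function A (chi k).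
Hypothesis chi_ge0 : forall k p, 0 <= chi k p.
Hypothesis chi_sum : forall p, \sum_k chi k p = 1.
Hypothesis K_chart : forall k, compact (K k) /\ K k `<=` dom (A (c k)).
Hypothesis chi_supp : forall k q, chi k q != 0 -> K k q.
Implicit Types (i : I) (p q : M) (s t : R).
Local Notation im i := (chart_image (A i)).
Local Notation par i := (param (A i)).
Local Notation X := (measurableTypeR R * borel M)%type.
Local Notation mu := (lateral_measure T dS).
Local Notation leb := (@lebesgue_measure R).
Local Notation tau := (restr_leb T).
Local Notation MI := (manifold_integral A g w c chi).
Local Notation D := (`]0, 2 * T[%classic : set R).
Local Notation sol := (is_solution A g w).

Let mu_fin : (mu setT < +oo)%E := lateral_finite T_gt0 dS.

(** Solutions are controlled on compact sets of times [t >= 0] only. The cut-off makes them bounded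
    and measurable on the whole product without changing their class for the lateral measure. *)
Definition clip (u : R * M -> R) : X -> R := fun z => \1_D z.1 * u z.

Lemma clip_bounded u : smooth_time A u -> bounded_measurable (clip u).
Proof. exact: (smooth_time_bounded_measurable A_manifold M_compact (2 * T)). Qed.

Lemma clipE u t p : 0 < t < 2 * T -> clip u (t, p) = u (t, p).
Proof. by move=> tT; rewrite /clip/= indicE mem_set ?mul1r//= in_itv/=. Qed.

Lemma manifold_integral0 (F : M -> R) : (forall p, F p = 0) -> MI F = 0.
Proof.
move=> F0; rewrite /manifold_integral big1// => k _; rewrite /chart_integral /Rintegral.
by rewrite integral0_eq// => x _; rewrite F0 mulr0 mul0r mulr0.
Qed.

Lemma manifold_integral_ge0 (F : M -> R) : (forall p, 0 <= F p) -> 0 <= MI F.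
Proof.
move=> F0; apply: sumr_ge0 => k _; apply: Rintegral_ge0 => x _.
have w0 := ltW (w_pos (par (c k) x)).
by rewrite mulr_ge0// ?indicE ?ler0n// mulr_ge0// ?mulr_ge0// ?sqrtr_ge0.
Qed.

Lemma manifold_integral_time (F : X -> R) : bounded_measurable F ->
  (\int[tau]_t MI (fun p => F (t, p)))%R = MI (fun p => (\int[tau]_t F (t, p))%R).
Proof. exact: (manifold_integral_fubini A_manifold g_metric w_smooth chi_smooth K_chart chi_supp tau). Qed.

Lemma manifold_integral_bounded (F : X -> R) : bounded_measurable F ->
  bounded_measurable ((fun t => MI (fun p => F (t, p))) : measurableTypeR R -> R).
Proof. exact: (manifold_integral_fubini_bounded A_manifold g_metric w_smooth chi_smooth K_chart chi_supp). Qed.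

Lemma lateral_fubini (F : X -> R) : bounded_measurable F ->
  (\int[mu]_z F z = \int[tau]_t (\int[dS]_p F (t, p)))%R.
Proof.
move=> bF; have [mF [B FB]] := bF.
have iF : mu.-integrable setT (EFin \o F).
  have := L2_integrableM (L2_bounded mu_fin mF FB) (L2_cst mu_fin 1).
  by congr (_.-integrable _ _); apply/funext => z /=; rewrite mulr1.
rewrite (bounded_fubini tau dS bF).
rewrite [LHS]/Rintegral (integral_lateral T_gt0 iF) [RHS]/Rintegral; congr fine.
by apply: eq_integral => p _; exact: (bounded_Rintegral tau (bounded_section2 bF p)).
Qed.

Lemma eq_restr_leb (F G : R -> R) : bounded_measurable (F : measurableTypeR R -> R) ->
  bounded_measurable (G : measurableTypeR R -> R) ->
  (forall t, 0 < t < 2 * T -> F t = G t) -> (\int[tau]_t F t = \int[tau]_t G t)%R.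
Proof.
move=> [mF _] [mG _] FG; rewrite [LHS]/Rintegral [RHS]/Rintegral; congr fine.
rewrite (restr_leb_integral T mF) (restr_leb_integral T mG).
by apply: eq_integral => t /set_mem /=; rewrite in_itv/= => /FG ->.
Qed.

(** The two waves are taken at independent times, and the wave equation replaces the operator [a] by
    minus the second time derivative. *)
Lemma green_times f h u v t s : sol f u -> sol h v ->
  bounded_measurable (f : X -> R) -> bounded_measurable (h : X -> R) -> 0 < t -> 0 < s ->
  MI (fun p => v (s, p) * dt (dt u) (t, p) - u (t, p) * dt (dt v) (s, p)) =
  (\int[dS]_p (f (t, p) * v (s, p) - u (t, p) * h (s, p)))%R.
Proof.
move=> fu hv bf bh t0 s0.
have su := sol_smooth fu; have sv := sol_smooth hv.
have [mf [Bf fB]] := bounded_section1 bf t; have [mh [Bh hB]] := bounded_section1 bh s.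
have cdt (a : R * M -> R) r : smooth_time A a -> 0 < r -> continuous (fun p => - dt (dt a) (r, p)).
  move=> sa r0 p; apply: cvgN.
  exact: (smooth_function_continuous A_manifold (smooth_time_fixed (smooth_dt (smooth_dt sa)) (ltW r0))).
have aE (a e : R * M -> R) r : sol e a -> 0 < r -> forall i x, im i x ->
    a_op A g w i (fun p => a (r, p)) x = - dt (dt a) (r, par i x).
  move=> ea r0 i x ix; have := sol_wave ea r0 ix.
  by rewrite (dt2_derive A_manifold _ (sol_smooth ea) r0) addrC => /eqP; rewrite addr_eq0 => /eqP.
have E := green A_manifold M_compact g_metric w_smooth w_pos dS_volume chi_smooth chi_sum K_chart chi_supp
  (smooth_time_fixed su (ltW t0)) (smooth_time_fixed sv (ltW s0)) (cdt _ _ su t0) (cdt _ _ sv s0)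
  (aE _ _ _ fu t0) (aE _ _ _ hv s0)
  (Fu := fun p => f (t, p)) (Fv := fun p => h (s, p)) (B := Num.max Bf Bh).
rewrite -E//.
- by congr manifold_integral; apply/funext => p; ring.
- by move=> i x nu ix x0 e; exact: (sol_neumann fu t0 ix x0 e).
- by move=> i x nu ix x0 e; exact: (sol_neumann hv s0 ix x0 e).
- by move=> p; rewrite le_max fB.
- by move=> p; rewrite le_max hB orbT.
Qed.

Variables (f h : X -> R) (u v : R * M -> R).
Hypothesis f_source : sources A T f.
Hypothesis h_source : sources A T h.
Hypothesis fu : sol f u.
Hypothesis hv : sol h v.

Let bf : bounded_measurable f. Proof. by case: f_source. Qed.
Let bh : bounded_measurable h. Proof. by case: h_source. Qed.
Let su : smooth_time A u. Proof. exact: sol_smooth fu. Qed.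
Let sv : smooth_time A v. Proof. exact: sol_smooth hv. Qed.
Let bu := clip_bounded su.
Let bv := clip_bounded sv.
Let bu2 := clip_bounded (smooth_dt (smooth_dt su)).
Let bv2 := clip_bounded (smooth_dt (smooth_dt sv)).

Let L2b (F : X -> R) : bounded_measurable F -> L2 mu F.
Proof. by move=> [mF [B FB]]; exact: (L2_bounded mu_fin mF FB). Qed.

Let b_reflect (F : X -> R) : bounded_measurable F -> bounded_measurable (fun z : X => F (2 * T - z.1, z.2)).
Proof. exact: (bounded_measurable_comp (reflect_measurable T)). Qed.

Lemma reflected_symmetry : ip mu f (R_op T (clip v)) = ip mu (clip u) (R_op T h).
Proof.
have b1 := bounded_measurableM bf (b_reflect bv).
have b2 := bounded_measurableM bu (b_reflect bh).
have b3 := bounded_measurableM (b_reflect bv) bu2.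
have b4 := bounded_measurableM bu (b_reflect bv2).
have b12 := bounded_measurableB b1 b2; have b34 := bounded_measurableB b3 b4.
rewrite /ip; rewrite (lateral_fubini b1) (lateral_fubini b2).
apply/eqP; rewrite -subr_eq0 -RintegralB//; last 2 first.
- exact: (bounded_integrable tau (bounded_fubini_bounded dS b1)).
- exact: (bounded_integrable tau (bounded_fubini_bounded dS b2)).
(* Green's formula at the times [t] and [2 * T - t] turns the difference into an integral over time
   and manifold; with the order exchanged, every point of the manifold contributes 0 by
   [reflected_wronskian]. *)
apply/eqP; transitivity (\int[tau]_t MI (fun p => clip v (2 * T - t, p) * clip (dt (dt u)) (t, p)
    - clip u (t, p) * clip (dt (dt v)) (2 * T - t, p)))%R; last first.
  rewrite (manifold_integral_time b34); apply: manifold_integral0 => p.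
  have bp := bounded_section2 b34 p.
  rewrite /Rintegral (restr_leb_integral T (proj1 bp)).
  rewrite -[RHS]/(fine 0%E) -(reflected_wronskian A_manifold T_gt0 su sv (sol_init0 fu p) (sol_init0 hv p) (sol_init1 fu p) (sol_init1 hv p)).
  congr fine; apply: eq_integral => t /set_mem /=; rewrite in_itv/= => /andP[t0 tT].
  by rewrite !clipE ?t0//; apply/andP; split; lra.
pose G (t : R) := (\int[dS]_p (f (t, p) * clip v (2 * T - t, p)))%R - (\int[dS]_p (clip u (t, p) * h (2 * T - t, p)))%R.
have GE t : G t = (\int[dS]_p (f (t, p) * clip v (2 * T - t, p) - clip u (t, p) * h (2 * T - t, p)))%R.
  rewrite RintegralB//.
    exact: (bounded_integrable dS (bounded_section1 b1 t)).
  exact: (bounded_integrable dS (bounded_section1 b2 t)).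
have bG : bounded_measurable (G : measurableTypeR R -> R).
  by apply: bounded_measurableB; [exact: (bounded_fubini_bounded dS b1)|exact: (bounded_fubini_bounded dS b2)].
have bMI : bounded_measurable ((fun t => MI (fun p => clip v (2 * T - t, p) * clip (dt (dt u)) (t, p)
    - clip u (t, p) * clip (dt (dt v)) (2 * T - t, p))) : measurableTypeR R -> R).
  exact: (manifold_integral_bounded b34).
apply: (eq_restr_leb bG bMI) => t /andP[t0 tT].
have s0 : 0 < 2 * T - t by lra.
have sT : 0 < 2 * T - t < 2 * T by apply/andP; split; lra.
rewrite GE.
transitivity (\int[dS]_p (f (t, p) * v (2 * T - t, p) - u (t, p) * h (2 * T - t, p)))%R.
  by apply: eq_Rintegral => p _; rewrite !clipE ?t0.
rewrite -(green_times fu hv bf bh t0 s0).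
by congr manifold_integral; apply/funext => p; rewrite !clipE ?t0.
Qed.

(** A point is [((t, p), s)]: [t] is the time at which [J] is evaluated, [s] the time over which it
    integrates. *)
Let tri (y : X * measurableTypeR R) : R := \1_(triangle T) (y.1.1, y.2).

Let btri : bounded_measurable tri.
Proof.
split; last by exists 1 => y; rewrite /tri indicE; case: (_ \in _); rewrite ?normr1 ?normr0.
have ms : measurable_fun setT (fun y : X * measurableTypeR R => (y.2, y.1)).
  by apply: measurable_fun_pair; [exact: measurable_snd|exact: measurable_fst].
have := measurableT_comp (J_kernel_measurable T (f := cst 1) (measurable_cst _)) ms.
by congr measurable_fun; apply/funext => y; rewrite /= mulr1.
Qed.

Let mside : measurable_fun setT (fun y : X * measurableTypeR R => ((y.2, y.1.2) : X)).
Proof.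
apply: measurable_fun_pair; first exact: measurable_snd.
exact: (measurableT_comp measurable_snd measurable_fst).
Qed.

Let b_side (F : X -> R) : bounded_measurable F -> bounded_measurable (fun y : X * measurableTypeR R => F (y.2, y.1.2)).
Proof. exact: (bounded_measurable_comp mside). Qed.

Let b_main (F : X -> R) : bounded_measurable F -> bounded_measurable (fun y : X * measurableTypeR R => F y.1).
Proof. by apply: bounded_measurable_comp; exact: measurable_fst. Qed.

(** [E] is the integrand on the boundary, and [W] the one on the manifold that Green's formula puts
    in its place. *)
Let E (y : X * measurableTypeR R) : R := tri y * (clip u (y.2, y.1.2) * h y.1 - f (y.2, y.1.2) * clip v y.1).

Let W (y : X * measurableTypeR R) : R :=
  tri y * (clip u (y.2, y.1.2) * clip (dt (dt v)) y.1 - clip v y.1 * clip (dt (dt u)) (y.2, y.1.2)).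

Let bE : bounded_measurable E.
Proof.
by apply: bounded_measurableM => //; apply: bounded_measurableB; apply: bounded_measurableM;
  do ?[exact: b_side|exact: b_main].
Qed.

Let bW : bounded_measurable W.
Proof.
by apply: bounded_measurableM => //; apply: bounded_measurableB; apply: bounded_measurableM;
  do ?[exact: b_side|exact: b_main].
Qed.

Let mrow (t : R) : measurable_fun setT (fun z : X => (((t : measurableTypeR R), z.2), z.1) : X * measurableTypeR R).
Proof.
apply: measurable_fun_pair; last exact: measurable_fst.
by apply: measurable_fun_pair; [exact: measurable_cst|exact: measurable_snd].
Qed.

Let tri1 t s : 0 < t -> t < s -> s <= 2 * T - t -> \1_(triangle T) (t, s) = 1 :> R.
Proof.
move=> t0 ts st; rewrite indicE mem_set//; split => /=; first by lra.
by rewrite t0 ts.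
Qed.

Let tri0 t s : ~ (0 < t < s /\ s <= 2 * T - t) -> \1_(triangle T) (t, s) = 0 :> R.
Proof. by move=> H; rewrite indicE memNset//= => -[/= h1 h2]; apply: H; split => //; lra. Qed.

Let green_triangle t s : 0 < t < 2 * T -> 0 < s < 2 * T ->
  (\int[dS]_p E ((t, p), s))%R = MI (fun p => W ((t, p), s)).
Proof.
move=> tT sT; have /andP[t0 _] := tT; have /andP[s0 _] := sT.
rewrite /E /W /tri/=; rewrite indicE; case: (_ \in _); last first.
  rewrite manifold_integral0; last by move=> p; rewrite mul0r.
  by rewrite /Rintegral integral0_eq// => p _; rewrite mul0r.
transitivity (\int[dS]_p (h (t, p) * u (s, p) - v (t, p) * f (s, p)))%R.
  by apply: eq_Rintegral => p _; rewrite !clipE// mul1r; ring.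
rewrite -(green_times hv fu bh bf t0 s0).
by congr manifold_integral; apply/funext => p; rewrite !clipE// mul1r.
Qed.

Let V (z : X) : R := (\int[tau]_s W (z, s))%R.

Let bV : bounded_measurable V.
Proof. exact: (bounded_fubini_bounded tau bW). Qed.

(** The conditions [t + s <= 2 * T] and [t < s] force [t < T], so the integral over []0, 2 * T[] is
    the one computed by [triangle_wronskian]. *)
Let V_integral p : (\int[tau]_t V (t, p))%R = 2 * (u (T, p) * v (T, p)).
Proof.
have aux1 (a : R) : a < T -> a < 2 * T by move: T_gt0; lra.
have aux2 (a b : R) : a < b -> b <= 2 * T - a -> a < T by lra.
have aux3 (a b : R) : 0 < a -> a < b -> b <= 2 * T - a -> 0 < b < 2 * T by move=> h1 h2 h3; apply/andP; split; lra.
have bVp := bounded_section2 bV p.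
rewrite /Rintegral (restr_leb_integral T (proj1 bVp)).
rewrite -[RHS]/(fine (2 * (u (T, p) * v (T, p)))%:E).
rewrite -(triangle_wronskian A_manifold T_gt0 su sv (sol_init0 hv p) (sol_init1 hv p) (H := fun t => V (t, p))).
  congr fine; rewrite [LHS]integral_mkcond [RHS]integral_mkcond; apply: eq_integral => t _.
  rewrite !patchE; have [tD|ntD] := pselect (D t); last first.
    by rewrite memNset// memNset// => tT; apply: ntD; move: tT; rewrite /= !in_itv/= => /andP[-> h1] /=; exact: aux1.
  rewrite mem_set//; have [tT|ntT] := pselect ((`]0, T[%classic : set R) t); first by rewrite mem_set.
  rewrite memNset//; congr EFin; rewrite /V /Rintegral integral0_eq// => s _.
  rewrite /W /tri/= tri0 ?mul0r// => -[/andP[h1 h2] h3]; apply: ntT; rewrite /= in_itv/= h1/=; exact: aux2 h2 h3.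
move=> t /andP[t0 tT].
have bs : bounded_measurable ((fun s => W ((t, p), s)) : measurableTypeR R -> R) by exact: (bounded_section1 bW (t, p)).
rewrite -(bounded_Rintegral tau bs) (restr_leb_integral T (proj1 bs)).
rewrite [LHS]integral_mkcond [RHS]integral_mkcond; apply: eq_integral => s _.
rewrite !patchE; have [sI|nsI] := pselect ((`]t, (2 * T - t)%R]%classic : set R) s).
  have /andP[h1 h2] : t < s <= 2 * T - t by move: sI; rewrite /= in_itv.
  have sD : 0 < s < 2 * T by exact: aux3 t0 h1 h2.
  have tD : 0 < t < 2 * T by rewrite t0 aux1.
  rewrite mem_set// mem_set; last by rewrite /= in_itv.
  by congr EFin; rewrite /W /tri/= tri1// mul1r !clipE.
rewrite memNset//; case: ifPn => // _; congr EFin.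
rewrite /W /tri/= tri0 ?mul0r// => -[/andP[_ h1] h2]; by apply: nsI; rewrite /= in_itv/= h1.
Qed.

(** The factor 1/2 comes from [J] and the 2 from the time integral. They are left side by side
    because the symmetry and the sign of the right-hand side can be read off as it stands. *)
Lemma triangle_identity :
  ip mu (J_op T (clip u)) h - ip mu (J_op T f) (clip v) =
  2^-1 * MI (fun p => 2 * (u (T, p) * v (T, p))).
Proof.
have JE (F : X -> R) z : bounded_measurable F ->
    J_op T F z = 2^-1 * (\int[tau]_s (tri (z, s) * F (s, z.2)))%R.
  move=> bF; congr (_ * _); rewrite [LHS]/Rintegral [RHS]/Rintegral; congr fine.
  have bs := bounded_section1 (bounded_measurableM btri (b_side bF)) z.
  by rewrite (restr_leb_integral T (proj1 bs)).
have L2J (F : X -> R) : bounded_measurable F -> L2 mu (J_op T F).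
  by move=> /L2b F2; have [] := J_op_L2 T_gt0 F2.
pose Q (z : X) : R := (\int[tau]_s E (z, s))%R.
have bQ : bounded_measurable Q by exact: (bounded_fubini_bounded tau bE).
have QE z : J_op T (clip u) z * h z - J_op T f z * clip v z = 2^-1 * Q z.
  have b1 : bounded_measurable ((fun s => tri (z, s) * clip u (s, z.2)) : measurableTypeR R -> R).
    exact: (bounded_section1 (bounded_measurableM btri (b_side bu)) z).
  have b2 : bounded_measurable ((fun s => tri (z, s) * f (s, z.2)) : measurableTypeR R -> R).
    exact: (bounded_section1 (bounded_measurableM btri (b_side bf)) z).
  have ZB (F G : measurableTypeR R -> R) (r q : R) : bounded_measurable F -> bounded_measurable G ->
      (\int[tau]_s F s)%R * r - (\int[tau]_s G s)%R * q = (\int[tau]_s (F s * r - G s * q))%R.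
    move=> bF bG; have iF := bounded_integrable tau bF; have iG := bounded_integrable tau bG.
    have bFr : bounded_measurable (fun s => F s * r) by apply: bounded_measurableM => //; exact: bounded_measurable_cst.
    have bGq : bounded_measurable (fun s => G s * q) by apply: bounded_measurableM => //; exact: bounded_measurable_cst.
    have iFr := bounded_integrable tau bFr; have iGq := bounded_integrable tau bGq.
    rewrite RintegralB; [|exact: measurableT|exact: iFr|exact: iGq].
    rewrite RintegralZr; [|exact: measurableT|exact: iF].
    by rewrite RintegralZr; [|exact: measurableT|exact: iG].
  rewrite (JE _ _ bu) (JE _ _ bf) -!mulrA -mulrBr; congr (_ * _).
  rewrite (ZB _ _ (h z) (clip v z) b1 b2).
  by apply: eq_Rintegral => s _; rewrite /E/=; ring.
have iQ : mu.-integrable setT (EFin \o Q).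
  have := L2_integrableM (L2b bQ) (L2_cst mu_fin 1).
  by congr (_.-integrable _ _); apply/funext => z /=; rewrite mulr1.
rewrite /ip -RintegralB//; last 2 first.
- exact: (L2_integrableM (L2J _ bu) (L2b bh)).
- exact: (L2_integrableM (L2J _ bf) (L2b bv)).
transitivity (\int[mu]_z (2^-1 * Q z))%R; first by apply: eq_Rintegral => z _; exact: QE.
rewrite RintegralZl//; congr (_ * _); rewrite (lateral_fubini bQ).
transitivity (\int[tau]_t MI (fun p => V (t, p)))%R; last first.
  rewrite (manifold_integral_time bV); congr manifold_integral; apply/funext => p; exact: V_integral.
apply: (eq_restr_leb (bounded_fubini_bounded dS bQ) (manifold_integral_bounded bV)) => t tT.
have bEt := bounded_measurable_comp (mrow t) bE; have bWt := bounded_measurable_comp (mrow t) bW.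
transitivity (\int[tau]_s MI (fun p => W ((t, p), s)))%R; last exact: (manifold_integral_time bWt).
transitivity (\int[tau]_s (\int[dS]_p E ((t, p), s)))%R.
  by symmetry; exact: (bounded_fubini tau dS bEt).
apply: (eq_restr_leb (bounded_fubini_bounded dS bEt) (manifold_integral_bounded bWt)) => s sT.
exact: green_triangle.
Qed.

End identities.

(** * Symmetry and positivity of the connecting operator *)

Section connecting_operator.
Context {R : realType} {n : nat} {M : ptopologicalType} (I : Type).
Variable A : I -> chart R n M.
Hypothesis A_manifold : is_manifold A.
Hypothesis M_compact : compact [set: M].
Variable g : I -> 'rV[R]_n.+1 -> 'M[R]_n.+1.
Hypothesis g_metric : is_riemannian_metric A g.
Variable w : M -> R.
Hypothesis w_smooth : smooth_function A w.
Hypothesis w_pos : forall p, 0 < w p.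
Variable dS : {finite_measure set (borel M) -> \bar R}.
Hypothesis dS_volume : is_boundary_measure A g dS.
Variable T : R.
Hypothesis T_gt0 : 0 < T.
Variables (N : nat) (c : 'I_N -> I) (chi : 'I_N -> M -> R) (K : 'I_N -> set M).
Hypothesis chi_smooth : forall k, smooth_function A (chi k).
Hypothesis chi_ge0 : forall k p, 0 <= chi k p.
Hypothesis chi_sum : forall p, \sum_k chi k p = 1.
Hypothesis K_chart : forall k, compact (K k) /\ K k `<=` dom (A (c k)).
Hypothesis chi_supp : forall k q, chi k q != 0 -> K k q.
Local Notation X := (measurableTypeR R * borel M)%type.
Local Notation mu := (lateral_measure T dS).
Local Notation MI := (manifold_integral A g w c chi).
Variable Lam : (X -> R) -> (X -> R).
Hypothesis ND : is_ND_operator A g w mu Lam.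
Implicit Types f h : X -> R.

Let mu_fin : (mu setT < +oo)%E := lateral_finite T_gt0 dS.
Let bL : bounded_operator mu Lam := proj1 ND.
Let bR : bounded_operator mu (R_op T). Proof. exact: bounded_R_op. Qed.
Let bJ : bounded_operator mu (J_op T). Proof. exact: bounded_J_op. Qed.
Let bK : bounded_operator mu (K_op T Lam) := bounded_K_op T_gt0 bL.
Let srcL2 : sources A T `<=` L2 mu. Proof. exact: sources_L2. Qed.
Let dense f : L2 mu f -> L2_closure mu (sources A T) f.
Proof. exact: (sources_dense A_manifold M_compact g_metric dS_volume T_gt0). Qed.

Let clipL2 u : smooth_time A u -> L2 mu (clip T u).
Proof.
by move=> /(clip_bounded A_manifold M_compact T) [mF [B FB]]; exact: (L2_bounded mu_fin mF FB).
Qed.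

Lemma clip_ae u : clip T u = u %[ae mu].
Proof.
have := weight_ae A_manifold M_compact g_metric dS_volume T_gt0 (cst 1).
apply: filterS => z /= /(_ Logic.I); rewrite mul1r => H _.
suff E : \1_(`]0, (2 * T)%R[%classic : set R) z.1 = 1 :> R by rewrite /clip E mul1r.
move: H; rewrite /weight; rewrite indicE; case: (_ \in _) => //=; rewrite mul0r => /eqP.
by rewrite eq_sym oner_eq0.
Qed.

Lemma ND_source f : sources A T f -> exists2 u, is_solution A g w f u & Lam f = clip T u %[ae mu].
Proof.
move=> [sf _ _]; have [u fu Lu] := proj2 ND f sf; exists u => //.
exact: (ae_eq_trans Lu (ae_eq_sym (clip_ae u))).
Qed.

Lemma reflected_ND_symmetric f h : L2 mu f -> L2 mu h ->
  ip mu (R_op T (Lam f)) h = ip mu f (R_op T (Lam h)).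
Proof.
have bRL := bounded_operator_comp bR bL.
apply: (dense_adjoint srcL2 dense bRL bRL) => a b sa sb /=.
have a2 := srcL2 sa; have b2 := srcL2 sb.
have [u au Lu] := ND_source sa; have [v bv Lv] := ND_source sb.
have u2 := clipL2 (sol_smooth au); have v2 := clipL2 (sol_smooth bv).
have La2 := op_L2 bL a2; have Lb2 := op_L2 bL b2.
rewrite (R_op_adjoint T_gt0 dS (L2_measurable La2) (L2_measurable b2)).
rewrite (eq_ip2 La2 u2 (op_L2 bR b2) (op_L2 bR b2) Lu (aeq_refl _ _)).
rewrite (eq_ip2 a2 a2 (op_L2 bR Lb2) (op_L2 bR v2) (aeq_refl _ _) (bounded_operator_ae bR Lb2 v2 Lv)).
by rewrite (reflected_symmetry A_manifold M_compact g_metric w_smooth w_pos dS_volume T_gt0 chi_smooth chi_sum K_chart chi_supp sa sb au bv).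
Qed.

(** The symmetry of [R Lam] moves this operator to [h], after which two time reversals cancel: the
    resulting form contains [J] and [Lam] only. *)
Lemma connecting_form f h : L2 mu f -> L2 mu h ->
  ip mu (K_op T Lam f) h = ip mu (J_op T (Lam f)) h - ip mu (J_op T f) (Lam h).
Proof.
move=> f2 h2; have Jf2 := op_L2 bJ f2; have RJf2 := op_L2 bR Jf2.
have Lh2 := op_L2 bL h2; have RLh2 := op_L2 bR Lh2.
rewrite /K_op ipBl//; [|by apply: (op_L2 bJ); exact: op_L2|by apply: (op_L2 bR); exact: op_L2].
congr (_ - _); rewrite reflected_ND_symmetric//.
rewrite (R_op_adjoint T_gt0 dS (L2_measurable Jf2) (L2_measurable RLh2)); congr (ip mu _ _).
by apply/funext => -[t p]; rewrite /R_op/= subKr.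
Qed.

(* Blagovestchenskii's identity. *)
Lemma connecting_source f h u v : sources A T f -> sources A T h ->
  is_solution A g w f u -> is_solution A g w h v ->
  Lam f = clip T u %[ae mu] -> Lam h = clip T v %[ae mu] ->
  ip mu (K_op T Lam f) h = 2^-1 * MI (fun p => 2 * (u (T, p) * v (T, p))).
Proof.
move=> sf sh fu hv Lu Lv; have f2 := srcL2 sf; have h2 := srcL2 sh.
have u2 := clipL2 (sol_smooth fu); have v2 := clipL2 (sol_smooth hv).
have Lf2 := op_L2 bL f2; have Lh2 := op_L2 bL h2.
rewrite connecting_form//.
rewrite (eq_ip2 (op_L2 bJ Lf2) (op_L2 bJ u2) h2 h2 (bounded_operator_ae bJ Lf2 u2 Lu) (aeq_refl _ _)).
rewrite (eq_ip2 (op_L2 bJ f2) (op_L2 bJ f2) Lh2 v2 (aeq_refl _ _) Lv).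
exact: (triangle_identity A_manifold M_compact g_metric w_smooth w_pos dS_volume T_gt0 chi_smooth chi_sum K_chart chi_supp sf sh fu hv).
Qed.

Lemma connecting_symmetric f h : L2 mu f -> L2 mu h ->
  ip mu (K_op T Lam f) h = ip mu f (K_op T Lam h).
Proof.
apply: (dense_adjoint srcL2 dense bK bK) => a b sa sb.
have [u au Lu] := ND_source sa; have [v bv Lv] := ND_source sb.
rewrite (ipC mu a) (connecting_source sa sb au bv Lu Lv) (connecting_source sb sa bv au Lv Lu).
by congr (_ * manifold_integral _ _ _ _ _ _); apply/funext => p; rewrite mulrC [v _ * _]mulrC mulrC.
Qed.

Lemma connecting_ge0 f : L2 mu f -> 0 <= ip mu f (K_op T Lam f).
Proof.
apply: (dense_ge0 srcL2 dense bK) => a sa; have [u au Lu] := ND_source sa.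
rewrite ipC (connecting_source sa sa au au Lu Lu) mulr_ge0 ?invr_ge0//.
by apply: manifold_integral_ge0 => // p; rewrite mulr_ge0// -expr2 sqr_ge0.
Qed.

End connecting_operator.

Theorem theorem1 (R : realType) (n : nat) (n_ge2 : (2 <= n.+1)%N)
  (M : ptopologicalType) (I : Type) (A : I -> chart R n M)
  (A_manifold : is_manifold A)
  (M_compact : compact [set: M]) (M_connected : connected [set: M])
  (bd_nonempty : boundary A !=set0)
  (g : I -> 'rV[R]_n.+1 -> 'M[R]_n.+1) (g_metric : is_riemannian_metric A g)
  (w : M -> R) (w_smooth : smooth_function A w) (w_pos : forall p, 0 < w p)
  (dS : {finite_measure set (borel M) -> \bar R})
  (dS_volume : is_boundary_measure A g dS)
  (T : R) (T_pos : 0 < T) (alpha : R) (alpha_pos : 0 < alpha) :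
  let mu := lateral_measure T dS in
  forall Lam, is_ND_operator A g w mu Lam ->
  forall S, closed_subspace mu S ->
  forall P, orthogonal_projection mu S P ->
  forall I', adjoint_operator mu (I_op T) I' ->
  let K := K_op T Lam in
  let one := cst 1 in
  let energy f :=
    ip mu f (K f) - 2 * ip mu (I_op T f) one + alpha * L2norm mu f ^+ 2 in
  let minimizer f := S f /\ forall h, S h -> energy f <= energy h in
  let B f := P (K (P f)) + alpha *: f in
  [/\ exists f_alpha,
        [/\ minimizer f_alpha,
            forall f, minimizer f -> f = f_alpha %[ae mu],
            B f_alpha = P (I' one) %[ae mu] &
            forall f, S f -> B f = P (I' one) %[ae mu] ->
              f = f_alpha %[ae mu]] &
      positive_definite_on mu S B].
Proof.
move=> mu Lam ND S SC P PP I' IA K one energy minimizer B.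
have mu_fin := lateral_finite T_pos dS.
have [N [c [chi [Kc [chis chi0 chi1 KP chiK]]]]] := partition_of_unity A_manifold M_compact.
have [c2 cE] := IA one (L2_cst mu_fin 1).
have sym := @connecting_symmetric _ _ _ _ _ A_manifold M_compact _ g_metric _ w_smooth w_pos _ dS_volume
  _ T_pos _ _ _ _ chis chi1 KP chiK Lam ND.
have ge0 := @connecting_ge0 _ _ _ _ _ A_manifold M_compact _ g_metric _ w_smooth w_pos _ dS_volume
  _ T_pos _ _ _ _ chis chi0 chi1 KP chiK Lam ND.
exact: (regularized_minimizer mu_fin SC PP (bounded_K_op T_pos (proj1 ND)) sym ge0 c2 alpha_pos
  (ell := fun f => ip mu (I_op T f) one) cE).
Qed.
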